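(* Let $m\ge 2$ and let $N$ be an $(m+1)$-dimensional manifold. The assignment $$(p:\mathcal P\to N,\omega)\longmapsto (h^\omega,Z^\omega,\nabla^\omega,D^\omega)$$ induces a bijective correspondence between lightlike Cartan geometries on $N$ (up to isomorphism covering $\mathrm{id}_N$) and lightlike structures $(h,Z)$ on $N$ equipped with a lightlike-compatible structure $(\nabla,D)$.
   Context: Conventions. Manifolds are smooth, Hausdorff, connected, second countable. $\mathbb L^{m+2}$ is $\mathbb R^{m+2}$ with its Lorentzian inner product $\langle\,,\rangle$ of signature $(m+1,1)$ and a fixed basis $(\ell,e_1,\dots,e_m,n)$ with $\ell$ in the future lightlike cone, $\langle \ell,n\rangle=1$, $\langle e_i,e_j\rangle=\delta_{ij}$ and all other products of basis vectors zero. $G=O^+(m+1,1)$ is the group of linear isometries of $\mathbb L^{m+2}$ preserving the future lightlike cone, $H\subset G$ is the isotropy subgroup of $\ell$, with Lie algebras $\mathfrak h\subset\mathfrak g$. In the fixed basis $\mathfrak g$ consists of the matrices $\begin{pmatrix} a&\zeta&0\\ X&A&-\zeta^t\\0&-X^t&-a\end{pmatrix}$ with $a\in\mathbb R$, $X\in\mathbb R^m$, $\zeta\in(\mathbb R^m)^*$, $A\in\mathfrak o(m)$, and $\mathfrak h$ is given by $a=0,X=0$; so $\mathfrak g/\mathfrak h\cong\mathbb R\times\mathbb R^m$ via $(a,X)$. Lightlike Cartan geometry. A lightlike Cartan geometry on $N$ is a principal bundle $p:\mathcal P\to N$ with structure group $H$ and $\omega\in\Omega^1(\mathcal P,\mathfrak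 g)$ such that each $\omega(u):T_u\mathcal P\to\mathfrak g$ is a linear isomorphism, $(r^h)^*\omega=\mathrm{Ad}(h^{-1})\circ\omega$ for $h\in H$ ($r^h$ is right translation), and $\omega(\zeta_X)=X$ for the fundamental vector field $\zeta_X$ of each $X\in\mathfrak h$. An isomorphism of two such geometries is a principal bundle isomorphism $F$ pulling back one Cartan connection to the other. For $u\in\mathcal P$, $x=p(u)$, let $\phi_u:T_xN\to\mathfrak g/\mathfrak h$ be the isomorphism with $\phi_u(T_up\cdot\zeta)=\omega(u)(\zeta)+\mathfrak h$. With $q((a,X),(b,Y))=X^tY$ on $\mathbb R\times\mathbb R^m$, put $h^\omega(v,w)=q(\phi_u v,\phi_u w)$ and $Z^\omega_x=\phi_u^{-1}(1,0)$ (independent of $u$). Lightlike structure. A lightlike metric $h$ on $N$ is a symmetric $(0,2)$-tensor, positive semidefinite, whose radical $\mathrm{Rad}(h_x)=\{v\in T_xN:h(v,\cdot)=0\}$ is one-dimensional at each point; $(N,h,Z)$ is a lightlike manifold with $Z$ a vector field spanning the radical everywhere. $S(N,h,Z)=\{\tau\in\Omega^1(N,\mathbb R):\tau(Z)=1\}$, $\mathrm{An}(\tau)=\ker\tau\subset TN$ (on which $h$ is positive definite), $P^\tau(v)=v-\tau(v)Z$. For $\tau,\bar\tau\in S(N,h,Z)$, $L_{\tau,\bar\tau}=\sum_{i=1}^m\tau(E_i)E_i$ for any local $h$-orthonormal frame $(E_i)$ of $\mathrm{An}(\bar\tau)$. Lightlike-compatible structure. It is a pair $(\nabla,D)$ where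 $\nabla$ assigns to each $\tau\in S(N,h,Z)$ a metric linear connection $\nabla^\tau$ on $(\mathrm{An}(\tau)\to N,h)$ and $D$ assigns to each $\tau$ a vector bundle morphism $D^\tau:TN\to\mathrm{An}(\tau)$, such that for all $\tau,\bar\tau\in S(N,h,Z)$, $X\in\Gamma(\mathrm{An}(\tau))$, $W\in\mathfrak X(N)$: $$\nabla^{\bar\tau}_W(P^{\bar\tau}(X))=P^{\bar\tau}\big(\nabla^\tau_WX-\bar\tau(X)W\big)-h(X,W)L_{\tau,\bar\tau},$$ $$D^{\bar\tau}(W)=P^{\bar\tau}\Big(D^\tau(W)+\tfrac12h(L_{\tau,\bar\tau},L_{\tau,\bar\tau})W\Big)-\tau(W)L_{\tau,\bar\tau}-\nabla^{\bar\tau}_WL_{\tau,\bar\tau}.$$ The maps $\nabla^\omega,D^\omega$. The standard tractor bundle is $\mathcal T=\mathcal P\times_H\mathbb L^{m+2}$ with metric $\mathbf h([u,v_1],[u,v_2])=\langle v_1,v_2\rangle$ and the $\mathbf h$-metric connection $\nabla^{\mathcal T}$ induced by the unique principal connection on $\mathcal P\times_HG$ restricting to $\omega$ on $\mathcal P$; locally $\nabla^{\mathcal T}_W[s,f]=[s,W(f)+\omega(Ts\cdot W)f]$ for a local section $s$ of $\mathcal P$ and an $\mathbb L^{m+2}$-valued function $f$. Put $\xi_x=[u,\ell]$ ($p(u)=x$) and $\Phi(W)=\nabla^{\mathcal T}_W\xi$, a bundle monomorphism $TN\to\mathcal T$ with image $\xi^\perp$, isometric from $h^\omega$ to $\mathbf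 h$, with $\Phi(Z^\omega)=\xi$. For $\tau\in S(N,h^\omega,Z^\omega)$ let $\eta^\tau$ be the unique lightlike section of $\mathcal T$ with $\mathbf h(\xi,\eta^\tau)=1$, $\mathbf h(\Phi(\mathrm{An}(\tau)),\eta^\tau)=0$, so every section is uniquely $\alpha\xi+\Phi(X)+\beta\eta^\tau$ with $X\in\Gamma(\mathrm{An}(\tau))$. Then for $X\in\Gamma(\mathrm{An}(\tau))$, $\nabla^\tau_WX$ and $D^\tau(W)$ are the $\mathrm{An}(\tau)$-components of $\nabla^{\mathcal T}_W\Phi(X)$ and $\nabla^{\mathcal T}_W\eta^\tau$ respectively; $\nabla^\omega:\tau\mapsto\nabla^\tau$, $D^\omega:\tau\mapsto D^\tau$. *)

(* Defs.v *)
From HB Require Import structures.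
From mathcomp Require Import all_boot all_order all_algebra.
From mathcomp Require Import all_classical all_reals all_analysis.
Set Implicit Arguments.
Unset Strict Implicit.
Unset Printing Implicit Defensive.
Import Order.TTheory GRing.Theory Num.Theory.
Import numFieldNormedType.Exports.
Local Open Scope classical_set_scope.
Local Open Scope ring_scope.

(* Only used for finite-dimensional V and open A: there, existence and
   continuity of all iterated directional derivatives is C^infinity. *)
Section Smooth.
Context {R : realType} {V W : normedModType R}.

Fixpoint iter_derive (s : seq V) (f : V -> W) : V -> W :=
  if s is v :: s' then iter_derive s' (fun x => 'D_v f x) else f.

Definition Cinf_on (A : set V) (f : V -> W) : Prop :=
  forall (s : seq V) (x : V), A x ->
    {for x, continuous (iter_derive s f)} /\
    forall v, derivable (iter_derive s f) x v.

End Smooth.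

(* The smooth structure is given by an atlas indexed by the points: the chart
   [phi x], with domain [dom x] around x and inverse [psi x] (the values of
   [phi x] outside [dom x], and of [psi x] outside [phi x @` dom x], are
   meaningless).  The chart [phi x] identifies the tangent space at x with
   R^n, so a tangent vector at x is an element of 'rV[R]_n. *)
Record manifold (R : realType) (n : nat) := Manifold {
  carrier :> topologicalType;
  dom : carrier -> set carrier;
  phi : carrier -> carrier -> 'rV[R]_n;
  psi : carrier -> 'rV[R]_n -> carrier;
  manifold_hausdorff : hausdorff_space carrier;
  manifold_second_countable : @second_countable carrier;
  dom_self : forall x, dom x x;
  dom_open : forall x, open (dom x);
  phi_open : forall x, open (phi x @` dom x);
  phiK : forall x y, dom x y -> psi x (phi x y) = y;
  phi_continuous : forall x y, dom x y -> {for y, continuous (phi x)};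
  psi_continuous :
    forall x y, dom x y -> {for phi x y, continuous (psi x)};
  transition_smooth :
    forall x y, Cinf_on (phi x @` (dom x `&` dom y)) (phi y \o psi x)
}.
Arguments dom {R n} m.
Arguments phi {R n} m.
Arguments psi {R n} m.

Section Manifolds.
Context {R : realType}.

Definition smooth_plot k n (M : manifold R n) (V : set 'rV[R]_k)
    (a : 'rV[R]_k -> M) : Prop :=
  (forall y, V y -> {for y, continuous a}) /\
  forall c : M, Cinf_on (V `&` a @^-1` dom M c) (phi M c \o a).

Definition smooth_map n k (M : manifold R n) (M' : manifold R k)
    (O : set M) (f : M -> M') : Prop :=
  forall c : M, smooth_plot (phi M c @` (O `&` dom M c)) (f \o psi M c).

Definition smooth_fun n (M : manifold R n) (V : normedModType R)
    (O : set M) (f : M -> V) : Prop :=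
  forall c : M, Cinf_on (phi M c @` (O `&` dom M c)) (f \o psi M c).

Definition tmap n k (M : manifold R n) (M' : manifold R k) (f : M -> M')
    (x : M) (v : 'rV[R]_n) : 'rV[R]_k :=
  'd (phi M' (f x) \o f \o psi M x) (phi M x x) v.

Definition dfun n (M : manifold R n) (V : normedModType R) (f : M -> V)
    (x : M) (v : 'rV[R]_n) : V :=
  'd (f \o psi M x) (phi M x x) v.

(* components in the chart [phi c] of the tangent vector v at x *)
Definition tcoord n (M : manifold R n) (c x : M) (v : 'rV[R]_n) : 'rV[R]_n :=
  'd (phi M c \o psi M x) (phi M x x) v.

(* the tangent vector at x with components w in the chart [phi c] *)
Definition tvec n (M : manifold R n) (c x : M) (w : 'rV[R]_n) : 'rV[R]_n :=
  'd (phi M x \o psi M c) (phi M c x) w.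

Definition smooth_field n (M : manifold R n) (O : set M)
    (X : M -> 'rV[R]_n) : Prop :=
  forall c : M, smooth_fun (O `&` dom M c) (fun x => tcoord c x (X x)).

Definition one_form n (M : manifold R n) (V : normedModType R)
    (t : M -> 'rV[R]_n -> V) : Prop :=
  (forall x, linear (t x)) /\
  forall (c : M) (w : 'rV[R]_n),
    smooth_fun (dom M c) (fun x => t x (tvec c x w)).

End Manifolds.

(* L^{m+2} is the space of column vectors in the basis (l, e_1, ..., e_m, n),
   split in blocks of sizes 1, m, 1. *)
Section Lorentz.
Context {R : realType} {m : nat}.
Local Notation L := 'cV[R]_(1 + (m + 1)).
Local Notation mat := 'M[R]_(1 + (m + 1)).

Definition gram : mat :=
  block_mx 0 (row_mx 0 1%:M) (col_mx 0 1%:M) (block_mx 1%:M 0 0 0).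

Definition lprod (v w : L) : R := (v^T *m gram *m w) 0 0.

Definition ell : L := col_mx 1%:M 0.
Definition enn : L := col_mx 0 (col_mx 0 1%:M).

(* l - n is timelike and in the same time cone as l, since <l, l - n> < 0;
   note that n is a past vector. *)
Definition future_cone : set L :=
  [set v | lprod v v = 0 /\ lprod v (ell - enn) < 0].

Definition Ggroup : set mat :=
  [set g | (forall v w, lprod (g *m v) (g *m w) = lprod v w) /\
           (forall v, future_cone v -> future_cone (g *m v))].

Definition Hgroup : set mat := [set g | Ggroup g /\ g *m ell = ell].

Definition gmx (a : R) (X : 'cV[R]_m) (z : 'rV[R]_m) (A : 'M[R]_m) : mat :=
  block_mx a%:M (row_mx z 0) (col_mx X 0)
    (block_mx A (- z^T) (- X^T) (- a%:M)).

Definition galg : set mat :=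
  [set M | exists a X z A, A^T = - A /\ M = gmx a X z A].

Definition halg : set mat :=
  [set M | exists z A, A^T = - A /\ M = gmx 0 0 z A].

(* the projection of g onto g/h = R x R^m *)
Definition gproj (M : mat) : R * 'cV[R]_m :=
  (ulsubmx M 0 0, usubmx (dlsubmx M)).

Definition qform (y y' : R * 'cV[R]_m) : R := (y.2^T *m y'.2) 0 0.

Definition expmx (X : mat) : mat :=
  limn (series (fun k : nat => (k`!%:R : R)^-1 *: X ^+ k)).

End Lorentz.

(* H carries its structure of closed submanifold of the space of matrices, so
   that smooth maps into H are H-valued smooth maps into matrices, and a map on
   P x H is smooth iff it takes pairs of smooth maps (a, b) to smooth maps.
   The pair (s, g) in [pb_trivial] is the H-equivariant diffeomorphism
   (x, h) |-> s(x) h from U x H to p^-1(U), with inverse u |-> (p u, g u). *)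
Record principal_bundle (R : realType) (m n k : nat) (N : manifold R n)
    (P : manifold R k) (p : P -> N)
    (act : P -> 'M[R]_(1 + (m + 1)) -> P) : Prop := PrincipalBundle {
  pb_smooth : smooth_map setT p;
  pb_act1 : forall u, act u 1%:M = u;
  pb_actM : forall u g h, Hgroup g -> Hgroup h ->
    act (act u g) h = act u (g *m h);
  pb_fibre : forall u h, Hgroup h -> p (act u h) = p u;
  pb_act_smooth : forall (d : nat) (V : set 'rV[R]_d) (a : 'rV[R]_d -> P)
      (b : 'rV[R]_d -> 'M[R]_(1 + (m + 1))),
    open V -> smooth_plot V a -> Cinf_on V b -> (forall y, V y -> Hgroup (b y)) ->
    smooth_plot V (fun y => act (a y) (b y));
  pb_trivial : forall x0 : N, exists (U : set N) (s : N -> P)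
      (g : P -> 'M[R]_(1 + (m + 1))),
    [/\ open U, U x0, smooth_map U s, smooth_fun (p @^-1` U) g &
     [/\ forall x, U x -> p (s x) = x,
         forall u, U (p u) -> Hgroup (g u) /\ act (s (p u)) (g u) = u &
         forall x h, U x -> Hgroup h -> g (act (s x) h) = h]]
}.

Record cartan_connection (R : realType) (m k : nat) (P : manifold R k)
    (act : P -> 'M[R]_(1 + (m + 1)) -> P)
    (om : P -> 'rV[R]_k -> 'M[R]_(1 + (m + 1))) : Prop := CartanConnection {
  cc_form : one_form om;
  cc_iso : forall u, set_bij [set: 'rV[R]_k] galg (om u);
  cc_equivariant : forall h, Hgroup h -> forall u v,
    om (act u h) (tmap (act^~ h) u v) = invmx h *m om u v *m h;
  cc_fundamental : forall X, halg X -> forall u,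
    om u (derive1 (fun t : R => phi P u (act u (expmx (t *: X)))) 0) = X
}.

Record cartan_geometry (R : realType) (m : nat) (N : manifold R m.+1) :=
  CartanGeometry {
  cg_dim : nat;
  cg_tot : manifold R cg_dim;
  cg_proj : cg_tot -> N;
  cg_act : cg_tot -> 'M[R]_(1 + (m + 1)) -> cg_tot;
  cg_om : cg_tot -> 'rV[R]_cg_dim -> 'M[R]_(1 + (m + 1));
  cg_principal : principal_bundle cg_proj cg_act;
  cg_cartan : cartan_connection cg_act cg_om
}.
Arguments cg_dim {R m N} c.
Arguments cg_tot {R m N} c.
Arguments cg_proj {R m N} c.
Arguments cg_act {R m N} c.
Arguments cg_om {R m N} c.

(* isomorphism covering the identity of N *)
Definition cartan_iso (R : realType) (m : nat) (N : manifold R m.+1)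
    (C C' : cartan_geometry N) : Prop :=
  exists (F : cg_tot C -> cg_tot C') (F' : cg_tot C' -> cg_tot C),
    [/\ smooth_map setT F, smooth_map setT F', cancel F F' & cancel F' F] /\
    [/\ forall u, cg_proj C' (F u) = cg_proj C u,
        forall u h, Hgroup h -> F (cg_act C u h) = cg_act C' (F u) h &
        forall u v, cg_om C' (F u) (tmap F u v) = cg_om C u v].

Section LightlikeStructures.
Context {R : realType} {m : nat} {N : manifold R m.+1}.
Local Notation vec := 'rV[R]_m.+1.
Implicit Types (h : N -> vec -> vec -> R) (Z W X Y : N -> vec)
  (t : N -> vec -> R) (f : N -> R).

Definition sym_tensor h : Prop :=
  [/\ forall x v, linear (h x v : vec -> R^o),
      forall x v w, h x v w = h x w v &
      forall (c : N) v w,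
        smooth_fun (dom N c) (fun x => h x (tvec c x v) (tvec c x w))].

(* The last clause says that Rad(h_x) is the line spanned by Z_x. *)
Definition lightlike h Z : Prop :=
  [/\ sym_tensor h, forall x v, 0 <= h x v v, smooth_field setT Z &
      forall x, Z x != 0 /\
        forall v, (forall w, h x v w = 0) <-> exists a : R, v = a *: Z x].

Definition Sforms Z : set (N -> vec -> R) :=
  [set t | one_form (t : N -> vec -> R^o) /\ forall x, t x (Z x) = 1].

Definition An_section t : set (N -> vec) :=
  [set X | smooth_field setT X /\ forall x, t x (X x) = 0].

Definition Pr Z t (x : N) (v : vec) : vec := v - t x v *: Z x.

(* E is an h-orthonormal basis of An(t)_x, a space of dimension m. *)
Definition An_orthonormal h t (x : N) (E : 'I_m -> vec) : Prop :=
  (forall i, t x (E i) = 0) /\ forall i j, h x (E i) (E j) = (i == j)%:R.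

(* L_{t,t'}, computed from any orthonormal basis of An(t')_x *)
Definition Lfield h t t' (x : N) : vec :=
  xget 0 [set v | exists E, An_orthonormal h t' x E /\
                            v = \sum_(i < m) t x (E i) *: E i].

Definition metric_connection h t (nb : (N -> vec) -> (N -> vec) -> N -> vec) :
    Prop :=
  forall W W' X Y f,
    smooth_field setT W -> smooth_field setT W' ->
    An_section t X -> An_section t Y -> smooth_fun setT (f : N -> R^o) ->
    [/\ An_section t (nb W X),
        nb (fun y => f y *: W y + W' y) X =
          (fun x => f x *: nb W X x + nb W' X x),
        nb W (fun y => X y + Y y) = (fun x => nb W X x + nb W Y x),
        nb W (fun y => f y *: X y) =
          (fun x => dfun (f : N -> R^o) x (W x) *: X x + f x *: nb W X x) &
        forall x, dfun ((fun y => h y (X y) (Y y)) : N -> R^o) x (W x) =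
          h x (nb W X x) (Y x) + h x (X x) (nb W Y x)].

Definition bundle_morphism t (D : N -> vec -> vec) : Prop :=
  [/\ forall x, linear (D x), forall x v, t x (D x v) = 0 &
      forall (c : N) w, smooth_field (dom N c) (fun x => D x (tvec c x w))].

End LightlikeStructures.

(* The values of [ls_nabla] and [ls_D] are only meaningful for a one-form in
   S(N,h,Z), a smooth field W and a smooth section X of An(t); accordingly
   structures are compared by [lightlike_eq], not by Leibniz equality. *)
Record lightlike_data (R : realType) (m : nat) (N : manifold R m.+1) :=
  LightlikeData {
  ls_h : N -> 'rV[R]_m.+1 -> 'rV[R]_m.+1 -> R;
  ls_Z : N -> 'rV[R]_m.+1;
  ls_nabla : (N -> 'rV[R]_m.+1 -> R) ->
    (N -> 'rV[R]_m.+1) -> (N -> 'rV[R]_m.+1) -> N -> 'rV[R]_m.+1;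
  ls_D : (N -> 'rV[R]_m.+1 -> R) -> N -> 'rV[R]_m.+1 -> 'rV[R]_m.+1
}.

Section Compatible.
Context {R : realType} {m : nat} {N : manifold R m.+1}.
Implicit Type s : lightlike_data N.

Definition lightlike_compatible s : Prop :=
  let h := ls_h s in let Z := ls_Z s in
  let nb := ls_nabla s in let D := ls_D s in
  (forall t, Sforms Z t -> metric_connection h t (nb t)) /\
  (forall t, Sforms Z t -> bundle_morphism t (D t)) /\
  forall t t', Sforms Z t -> Sforms Z t' ->
    let L := Lfield h t t' in
    (forall X W, An_section t X -> smooth_field setT W -> forall x,
      nb t' W (fun y => Pr Z t' y (X y)) x =
        Pr Z t' x (nb t W X x - t' x (X x) *: W x) - h x (X x) (W x) *: L x) /\
    (forall W, smooth_field setT W -> forall x,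
      D t' x (W x) =
        Pr Z t' x (D t x (W x) + (2^-1 * h x (L x) (L x)) *: W x)
        - t x (W x) *: L x - nb t' W L x).

Definition lightlike_structure s : Prop :=
  lightlike (ls_h s) (ls_Z s) /\ lightlike_compatible s.

Definition lightlike_eq s s' : Prop :=
  [/\ ls_h s = ls_h s', ls_Z s = ls_Z s' &
   forall t, Sforms (ls_Z s) t ->
     (forall W X, smooth_field setT W -> An_section t X ->
        ls_nabla s t W X = ls_nabla s' t W X) /\
     ls_D s t = ls_D s' t].

End Compatible.

(* Sections of the tractor bundle T = P x_H L^{m+2} are represented by
   H-equivariant maps f : P -> L^{m+2}, the section being p(u) |-> [u, f(u)];
   the local expression of that section along a local section s of P is
   [s, f o s].  The metric is pointwise [lprod], and xi is the constant map
   [ell]. *)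
Section Tractors.
Context {R : realType} {m : nat} {N : manifold R m.+1}.
Variable C : cartan_geometry N.
Local Notation vec := 'rV[R]_m.+1.
Local Notation P := (cg_tot C).
Local Notation p := (cg_proj C).
Local Notation om := (cg_om C).
Local Notation L := 'cV[R]_(1 + (m + 1)).

Definition local_section (U : set N) (s : N -> P) : Prop :=
  [/\ open U, smooth_map U s & forall x, U x -> p (s x) = x].

(* phi_u : T_xN -> g/h, where x = p u *)
Definition phi_iso (u : P) (v : vec) : R * 'cV[R]_m :=
  xget 0 [set y | exists z, tmap p u z = v /\ y = gproj (om u z)].

Definition tractor_section (f : P -> L) : Prop :=
  smooth_fun setT f /\
  forall u g, Hgroup g -> f (cg_act C u g) = invmx g *m f u.

(* nabla^T_W [s, f o s] = [s, W(f o s) + omega(Ts.W) (f o s)], for any local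
   section s of P through u *)
Definition nablaT (W : N -> vec) (f : P -> L) (u : P) : L :=
  xget 0 [set y | exists (U : set N) (s : N -> P),
    [/\ local_section U s, U (p u), s (p u) = u &
        y = dfun (f \o s) (p u) (W (p u))
            + om u (tmap s (p u) (W (p u))) *m f u]].

Definition xi : P -> L := fun=> ell.

Definition Phi (W : N -> vec) : P -> L := nablaT W xi.

Definition is_eta (t : N -> vec -> R) (eta : P -> L) : Prop :=
  [/\ tractor_section eta, forall u, lprod (eta u) (eta u) = 0,
      forall u, lprod (xi u) (eta u) = 1 &
      forall X, An_section t X -> forall u, lprod (Phi X u) (eta u) = 0].

(* Y is the An(t)-component of f = alpha xi + Phi(Y) + beta eta *)
Definition An_component (t : N -> vec -> R) (eta f : P -> L) (Y : N -> vec) :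
    Prop :=
  An_section t Y /\
  exists alpha beta : N -> R, forall u,
    f u = alpha (p u) *: xi u + Phi Y u + beta (p u) *: eta u.

(* s is (h^omega, Z^omega, nabla^omega, D^omega) *)
Definition induces (s : lightlike_data N) : Prop :=
  [/\ forall u v w,
        ls_h s (p u) v w = qform (phi_iso u v) (phi_iso u w),
      forall u, phi_iso u (ls_Z s (p u)) = (1, 0) &
      forall t, Sforms (ls_Z s) t -> exists eta, is_eta t eta /\
        forall W, smooth_field setT W ->
          (forall X, An_section t X ->
             An_component t eta (nablaT W (Phi X)) (ls_nabla s t W X)) /\
          An_component t eta (nablaT W eta) (fun x => ls_D s t x (W x))].

End Tractors.

(* Main.v *)
(* A lightlike Cartan geometry is equivalent to its tractor bundle
   [(T, <,>, nabla^T, xi)]: [Phih u v] is the value at [u] of [Phi v = nabla_v xi],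
   it determines [h] and [Z], and a one-form [t] with [t(Z) = 1] gives the null
   complement [eta t] of [xi + Phi (An t)].  Skewness of [nabla^T] makes [nabla^t]
   metric, and comparing [eta t] with [eta t'] gives the two transformation rules.

   Conversely [nabla^T] is determined by [h], [Z], [nabla^t] and [D^t] for one
   [t]: its form [omega] in a frame [(xi, Phi E_i, eta t)], [(E_i)] orthonormal in
   [An t], is the matrix with entries [t(W)], [h(W, E_i)], [h(D^t W, E_i)],
   [h(nabla^t_W E_j, E_i)].  For two geometries inducing the same structure, this
   makes the bijection matching points with equal [Phih] an isomorphism.  To
   realise a given structure, glue these local forms along the O(m)-valued changes
   of orthonormal frames; the transformation rules then force agreement for all
   other one-forms. *)
Require Import Defs.
From HB Require Import structures.
From mathcomp Require Import all_boot all_order all_algebra.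
From mathcomp Require Import all_classical all_reals all_analysis.
From mathcomp Require Import ring lra.
Set Implicit Arguments.
Unset Strict Implicit.
Unset Printing Implicit Defensive.
Import Order.TTheory GRing.Theory Num.Theory.
Import numFieldNormedType.Exports.
Local Open Scope classical_set_scope.
Local Open Scope ring_scope.

(** * Smooth functions of several variables *)

(** [Cinf_on] speaks only of iterated directional derivatives, and a tangent vector at [x] is
    written in the chart chosen at [x]. Full differentiability therefore has to be recovered, and
    tangent maps are handled through velocities of parametrized pieces, where the chosen charts
    cancel. Compatible structures act on global fields, sections and one-forms, while every
    verification is pointwise: bump functions supply global objects with prescribed local behaviour,
    and a global form with [t(Z) = 1] needs an averaging valid on noncompact [N]. On the group side
    the axioms give [omega] on velocities of exponential curves only. Arbitrary smooth curves in [H]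
    are compared with them in the rational coordinates of the Cayley transform, which also serve as
    fibre charts of the bundle to be built. Keeping one form [t] fixed while gluing is what reduces
    the cocycle to O(m): all frames share the null vectors [xi] and [eta^t], so neither [D] nor the
    unipotent part of [H] enters it. *)

Section Differentiability.
Context {R : realType}.

(** The differentiability hypothesis is symmetric about 0, so that one statement covers both signs
    of [a]; it is applied to coordinate increments of unknown sign. *)
Lemma MVT_centered (g dg : R -> R) (a : R) :
  (forall t : R, `|t| <= `|a| -> is_derive t 1 g (dg t)) ->
  exists2 c, `|c| <= `|a| & g a - g 0 = dg c * a.
Proof.
move=> gd.
have cg t : `|t| <= `|a| -> {for t, continuous g}.
  by move=> /gd [dt _]; apply: differentiable_continuous; exact/derivable1_diffP.
have [a0|a0] := leP 0 a.
  have [c||c ca ->] := @MVT_segment R g dg 0 a a0.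
  - rewrite in_itv/= => /andP[c0 ca]; apply: gd.
    by rewrite (ger0_norm (ltW c0)) (ger0_norm a0) ltW.
  - apply: continuous_in_subspaceT => t.
    rewrite inE/= in_itv/= => /andP[t0 ta]; apply: cg.
    by rewrite !ger0_norm.
  - exists c; last by rewrite subr0.
    by move: ca; rewrite in_itv/= => /andP[c0 ca]; rewrite !ger0_norm.
have [c||c ca] := @MVT_segment R g dg a 0 (ltW a0).
- rewrite in_itv/= => /andP[ac c0]; apply: gd.
  by rewrite !ltr0_norm// lerNl opprK ltW.
- apply: continuous_in_subspaceT => t.
  rewrite inE/= in_itv/= => /andP[at0 t0]; apply: cg.
  by rewrite (ltr0_norm a0) (ler0_norm t0) lerNl opprK.
- rewrite sub0r => /(congr1 -%R); rewrite opprB mulrN opprK => ->.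
  exists c => //.
  move: ca; rewrite in_itv/= => /andP[ac c0].
  by rewrite (ltr0_norm a0) (ler0_norm c0) lerNl opprK.
Qed.

Lemma is_derive_line (V W : normedModType R) (f : V -> W) (y e : V) (t : R) :
  derivable f (y + t *: e) e ->
  is_derive t 1 (fun s : R => f (y + s *: e)) ('D_e f (y + t *: e)).
Proof.
move=> fd.
have E : (fun h : R => h^-1 *: (((fun s : R => f (y + s *: e)) \o shift t) (h *: 1) - f (y + t *: e))) = (fun h => h^-1 *: ((f \o shift (y + t *: e)) (h *: e) - f (y + t *: e))).
  apply/funext => h /=; congr (_ *: (f _ - _)).
  by rewrite [h *: 1]mulr1 scalerDl addrCA.
split; first by rewrite /derivable E.
by rewrite /derive E.
Qed.

Lemma differentiable_approx (V W : normedModType R) (f : V -> W) (df : {linear V -> W}) x :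
  continuous df ->
  (forall e, 0 < e -> \forall h \near 0, `|f (h + x) - f x - df h| <= e * `|h|) ->
  differentiable f x.
Proof.
move=> cdf H.
have E : f \o shift x = cst (f x) + df +o_ 0 id.
  apply/eqaddoP => e e0.
  near=> h.
  have -> : (f \o shift x - (cst (f x) + df)) h = f (h + x) - f x - df h.
    by rewrite -addrA -opprD.
  near: h; exact: H.
by apply/diff_locallyP; rewrite (diff_unique cdf E).
Unshelve. all: by end_near. Qed.

Lemma mx_norm_entry m n (M : 'M[R]_(m, n)) i j : `|M i j| <= `|M|.
Proof.
rewrite [leRHS]/Num.Def.normr/= mx_normrE.
exact: (le_bigmax _ (fun k : 'I_m * 'I_n => `|M k.1 k.2|) (i, j)).
Qed.

Lemma mx_norm_le m n (M : 'M[R]_(m, n)) e :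
  0 <= e -> (forall i j, `|M i j| <= e) -> `|M| <= e.
Proof.
move=> e0 H; rewrite [leLHS]/Num.Def.normr/= mx_normrE.
by apply: bigmax_le => // -[i j] _ /=.
Qed.

Lemma linear_mx_continuous p q (W : normedModType R) (f : {linear 'M[R]_(p, q) -> W}) :
  continuous f.
Proof.
have -> : (f : _ -> W) = (fun v => \sum_(k : 'I_p * 'I_q) v k.1 k.2 *: f (delta_mx k.1 k.2)).
  apply/funext => v; rewrite {1}[v]matrix_sum_delta pair_bigA linear_sum.
  by apply: eq_bigr => k _; rewrite linearZ.
move=> v.
have H k : {for v, continuous (fun x : 'M[R]_(p, q) => x k.1 k.2 *: f (delta_mx k.1 k.2))}.
  apply: differentiable_continuous; apply: differentiableZl.
  exact: differentiable_coord.
apply: cvg_big; [exact: add_continuous|exact: nbhs_filter|].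
by move=> k _; exact: H.
Qed.

(* Telescoping along the coordinates: each step is controlled by the mean value
   theorem and the continuity at x of one partial derivative. *)
Lemma differentiable_partial n (f : 'rV[R]_n -> R^o) (A : set 'rV[R]_n) x :
  open A -> A x ->
  (forall y v, A y -> derivable f y v) ->
  (forall v, {for x, continuous ('D_v f)}) ->
  differentiable f x.
Proof.
move=> oA Ax fd cd.
pose e_ i : 'rV[R]_n := delta_mx 0 i.
pose dfm : 'M[R]_(n, 1) := \col_i 'D_(e_ i) f x.
pose df (v : 'rV[R]_n) := (v *m dfm) 0 0.
have dfl : linear (df : 'rV[R]_n -> R^o).
  by move=> k u v; rewrite /df mulmxDl -scalemxAl !mxE.
pose dfL : {linear 'rV[R]_n -> R^o} := HB.pack df (GRing.isLinear.Build _ _ _ _ df dfl).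
apply: (@differentiable_approx _ _ f dfL); first exact: linear_mx_continuous.
move=> e e0.
(* Each of the [n] telescoping steps may cost [e / n.+1] times the norm of [h]; the successor avoids
   a division by zero when [n = 0]. *)
have e'0 : 0 < e / n.+1%:R by rewrite divr_gt0.
have sc : (fun h : 'rV[R]_n => h + x) @ (0 : 'rV[R]_n) --> x.
  by rewrite -[X in _ --> X]add0r; exact: (@cvgD R _ _ (nbhs (0 : 'rV[R]_n)) _ id (cst x) 0 x cvg_id (cvg_cst x)).
have H : \forall h \near (0 : 'rV[R]_n), A (h + x) /\ forall i, `|'D_(e_ i) f (h + x) - 'D_(e_ i) f x| <= e / n.+1%:R.
  near=> h; split.
    near: h; apply: sc; exact: open_nbhs_nbhs.
  near: h; apply: filter_forall => i.
  have /cvgrPdist_le /(_ _ e'0) /sc H := cd (e_ i).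
  have {}H : \forall h \near (0 : 'rV[R]_n), `|'D_(e_ i) f x - 'D_(e_ i) f (h + x)| <= e / n.+1%:R by exact: H.
  by near=> h; rewrite distrC; near: h.
have /nbhs_ballP [d /= d0 Hd] := H.
have Hd' h : `|h| < d -> A (h + x) /\ forall i, `|'D_(e_ i) f (h + x) - 'D_(e_ i) f x| <= e / n.+1%:R.
  by move=> hd; apply: Hd; rewrite /= -ball_normE /= sub0r normrN.
near=> h.
have hd : `|h| < d.
  near: h; apply/nbhs_ballP; exists d => // y; by rewrite -ball_normE /= sub0r normrN.
(* [tr j] keeps the first [j] coordinates of [h]. The points [tr j + x] are the corners of a path
   along the axes from [x] to [h + x]; no coordinate exceeds that of [h] in absolute value, so the
   path stays in the ball. *)
pose tr j : 'rV[R]_n := \row_i (if (i < j)%N then h 0 i else 0).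
have key j : (j <= n)%N -> `|f (tr j + x) - f x - \sum_(i < n | (i < j)%N) h 0 i * 'D_(e_ i) f x| <= j%:R * (e / n.+1%:R) * `|h|.
  elim: j => [_|j IH jn].
    have -> : tr 0%N = 0 by apply/rowP => i; rewrite !mxE.
    by rewrite add0r subrr big_pred0// subr0 normr0 !mul0r.
  pose J := Ordinal jn.
  have trS : tr j.+1 = tr j + h 0 J *: e_ J.
    apply/rowP => i; rewrite !mxE eqxx/= ltnS.
    have [->|ne] := eqVneq i J; first by rewrite /= leqnn ltnn add0r mulr1.
    rewrite mulr0 addr0 leq_eqVlt.
    by have -> : (nat_of_ord i == j) = false by apply/negbTE/eqP => E; case/eqP: ne; exact/val_inj.
  pose g (t : R) := f (tr j + x + t *: e_ J).
  have trn t : `|t| <= `|h 0 J| -> `|tr j + t *: e_ J| < d.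
    move=> th; apply: le_lt_trans hd; apply: mx_norm_le => // a i.
    rewrite ord1 !mxE eqxx /=.
    have [->|ne] := eqVneq i J.
      by rewrite /= ltnn add0r mulr1 (le_trans th)// mx_norm_entry.
    rewrite mulr0 addr0; case: ifP => _; last by rewrite normr0.
    exact: mx_norm_entry.
  have [t ht|c hc gE] := @MVT_centered g (fun t => 'D_(e_ J) f (tr j + x + t *: e_ J)) (h 0 J).
    apply: is_derive_line; apply: fd.
    rewrite addrAC; by have [] := Hd' _ (trn t ht).
  have -> : \sum_(i < n | (i < j.+1)%N) h 0 i * 'D_(e_ i) f x = h 0 J * 'D_(e_ J) f x + \sum_(i < n | (i < j)%N) h 0 i * 'D_(e_ i) f x.
    rewrite (bigD1 J) ?ltnSn//=; congr (_ + _); apply: eq_bigl => i.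
    rewrite ltnS leq_eqVlt -(inj_eq val_inj) /=.
    by have [->|] := eqVneq (nat_of_ord i) j; rewrite ?ltnn ?andbT ?andbF.
  have fS : f (tr j.+1 + x) = f (tr j + x) + 'D_(e_ J) f (tr j + x + c *: e_ J) * h 0 J.
    by rewrite -gE /g scale0r addr0 trS addrAC [RHS]addrC subrK.
  rewrite fS.
  have -> : f (tr j + x) + 'D_(e_ J) f (tr j + x + c *: e_ J) * h 0 J - f x -
     (h 0 J * 'D_(e_ J) f x + \sum_(i < n | (i < j)%N) h 0 i * 'D_(e_ i) f x) =
     (f (tr j + x) - f x - \sum_(i < n | (i < j)%N) h 0 i * 'D_(e_ i) f x) + h 0 J * ('D_(e_ J) f (tr j + x + c *: e_ J) - 'D_(e_ J) f x) by ring.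
  apply: (le_trans (ler_normD _ _)).
  rewrite -natr1 mulrDl mulrDl mul1r; apply: lerD; first exact: IH (ltnW jn).
  rewrite normrM mulrC; apply: ler_pM => //; last exact: mx_norm_entry.
  rewrite addrAC; have [_] := Hd' _ (trn c hc); exact.
have := key n (leqnn n).
have -> : tr n = h by apply/rowP => i; rewrite !mxE ltn_ord.
have -> : \sum_(i < n | (i < n)%N) h 0 i * 'D_(e_ i) f x = df h.
  by rewrite /df !mxE; apply: eq_big => [i|i _]; rewrite ?ltn_ord ?mxE.
move/le_trans; apply; apply: ler_wpM2r => //.
rewrite mulrCA; apply: ler_piMr; first exact: ltW.
by rewrite ler_pdivrMr// mul1r ler_nat.
Unshelve. all: by end_near. Qed.

End Differentiability.

(** * Calculus of functions of finite differentiability order *)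

Section FiniteOrder.
Context {R : realType}.

(** Derivatives of products and composites along a whole list of directions have no manageable
    formula. With an order counter each rule is an induction on [k]: one derivative of the result is
    a combination of functions of the same kind, of order [k]. *)
Fixpoint Ck (V W : normedModType R) (k : nat) (A : set V) (f : V -> W) : Prop :=
  (forall x, A x -> {for x, continuous f} /\ forall v, derivable f x v) /\
  if k is k'.+1 then forall v, Ck k' A ('D_v f) else True.

Lemma CkP (V W : normedModType R) (A : set V) (f : V -> W) :
  Cinf_on A f <-> forall k, Ck k A f.
Proof.
split=> [fA k|].
  elim: k f fA => [|k IH] f fA; split=> //; try by move=> x /(fA [::]).
  by move=> v; apply: IH => s x /(fA (v :: s)).
move=> H s; elim: s f H => [|v s IH] f H x Ax.
  by have [/(_ _ Ax)] := H 0%N.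
apply: IH => // k; by have [_ /(_ v)] := H k.+1.
Qed.

Lemma Ck_base (V W : normedModType R) k (A : set V) (f : V -> W) : Ck k A f ->
  forall x, A x -> {for x, continuous f} /\ forall v, derivable f x v.
Proof. by case: k => [|k] []. Qed.

Lemma eq_Ck (V W : normedModType R) k (A : set V) (f g : V -> W) :
  open A -> (forall x, A x -> f x = g x) -> Ck k A f -> Ck k A g.
Proof.
move=> oA; elim: k f g => [|k IH] f g fg fC.
all: have near_fg x : A x -> \forall y \near x, f y = g y
  by move=> Ax; near=> y; apply: fg; near: y; exact: open_nbhs_nbhs.
all: have base : forall x, A x -> {for x, continuous g} /\ forall v, derivable g x v.
1,3: move=> x Ax; have [cf df] := Ck_base fC Ax; split=> [|v];
  [|exact: near_eq_derivable (near_fg _ Ax) (df v)];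
  by rewrite /prop_for /continuous_at -(fg _ Ax); apply: cvg_trans cf;
   apply: near_eq_cvg; apply: filterS (near_fg _ Ax) => y ->.
  by split.
split=> // v; apply: (IH ('D_v f)); last exact: fC.2.
by move=> x Ax; apply: near_eq_derive; exact: near_fg.
Unshelve. all: by end_near. Qed.

Lemma CkW (V W : normedModType R) k (A : set V) (f : V -> W) : Ck k.+1 A f -> Ck k A f.
Proof.
elim: k f => [|k IH] f [bf df]; split=> // v; apply: IH; exact: df.
Qed.

Lemma Ck_cst (V W : normedModType R) k (A : set V) (c : W) : open A -> Ck k A (fun _ : V => c).
Proof.
move=> oA; elim: k c => [|k IH] c; split=> //.
1,2: by move=> x _; split=> [|v]; [exact: cst_continuous|exact: derivable_cst].
move=> v; apply: eq_Ck (IH 0) => // x Ax; by rewrite derive_cst.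
Qed.

Lemma Ck_add (V W : normedModType R) k (A : set V) (f g : V -> W) : open A ->
  Ck k A f -> Ck k A g -> Ck k A (fun x => f x + g x).
Proof.
move=> oA; elim: k f g => [|k IH] f g fC gC; split=> //.
1,2: by move=> x Ax; have [? ?] := Ck_base fC Ax; have [? ?] := Ck_base gC Ax;
  split=> [|v]; [exact: continuousD|exact: derivableD].
move=> v; apply: (@eq_Ck _ _ _ _ (fun x => 'D_v f x + 'D_v g x)) => //.
  move=> x Ax; have [_ fd] := Ck_base fC Ax; have [_ gd] := Ck_base gC Ax.
  by rewrite -deriveD.
by apply: IH; [exact: fC.2|exact: gC.2].
Qed.

Lemma is_derive_scale (V W : normedModType R) (k : V -> R^o) (f : V -> W) x v :
  {for x, continuous f} -> derivable k x v -> derivable f x v ->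
  is_derive x v (fun y => k y *: f y) ('D_v k x *: f x + k x *: 'D_v f x).
Proof.
move=> cf dk df.
have cv : (fun h : R => h *: v + x) @ 0^' --> x.
  rewrite -[X in _ --> X]add0r -[X in _ --> X + _](scale0r v).
  apply: cvgD; last exact: cvg_cst.
  apply: cvgZr_tmp; apply: cvg_within_filter; exact: cvg_id.
have lim : h^-1 *: (((fun y => k y *: f y) \o shift x) (h *: v) - k x *: f x) @[h --> 0^']
    --> 'D_v k x *: f x + k x *: 'D_v f x.
  have -> : (fun h => h^-1 *: (((fun y => k y *: f y) \o shift x) (h *: v) - k x *: f x)) =
     (fun h => (h^-1 *: ((k \o shift x) (h *: v) - k x) : R^o) *: f (h *: v + x) +
               k x *: (h^-1 *: ((f \o shift x) (h *: v) - f x))).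
    apply/funext => h /=.
    have E (d : R^o) (w : W) : (h^-1 *: d) *: w = h^-1 *: (d *: w) by rewrite scalerA.
    rewrite E [k x *: (_ *: _)]scalerA mulrC -scalerA -scalerDr; congr (_ *: _).
    by rewrite scalerBl scalerBr addrA subrK.
  apply: cvgD.
    by apply: cvgZ; [exact: dk|exact: (cvg_comp _ _ cv cf)].
  by apply: cvgZ; [exact: cvg_cst|exact: df].
by split; [apply/cvg_ex; exists ('D_v k x *: f x + k x *: 'D_v f x)|exact: cvg_lim lim].
Qed.

Lemma Ck_scale (V W : normedModType R) i (A : set V) (k : V -> R^o) (f : V -> W) :
  open A -> Ck i A k -> Ck i A f -> Ck i A (fun x => k x *: f x).
Proof.
move=> oA; elim: i k f => [|i IH] k f kC fC.
all: have D x v : A x -> is_derive x v (fun y => k y *: f y) ('D_v k x *: f x + k x *: 'D_v f x)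
  by move=> Ax; apply: is_derive_scale; [exact: (Ck_base fC Ax).1|
    exact: (Ck_base kC Ax).2|exact: (Ck_base fC Ax).2].
all: split=> //.
1,2: by move=> x Ax; split=> [|v]; [apply: continuousZ;
  [exact: (Ck_base kC Ax).1|exact: (Ck_base fC Ax).1]|have [] := D x v Ax].
move=> v; apply: (eq_Ck (f := fun x => 'D_v k x *: f x + k x *: 'D_v f x) oA).
  by move=> x Ax; have [_ ->] := D x v Ax.
by apply: Ck_add => //; apply: IH; first [exact: CkW|exact: kC.2|exact: fC.2].
Qed.

Lemma mx_regular (V : normedModType R) p q (f : V -> 'M[R]_(p, q)) x :
  ({for x, continuous f} /\ forall v, derivable f x v) <->
  forall i j, {for x, continuous (fun x => f x i j : R^o)} /\
              forall v, derivable (fun x => f x i j : R^o) x v.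
Proof.
split=> [[cf df] i j|H].
  split=> [|v]; last by move/derivable_mxP: (df v).
  apply: (@continuous_comp _ _ _ f (fun M : 'M[R]_(p, q) => M i j : R^o) x) => //.
  by apply: differentiable_continuous; exact: differentiable_coord.
split=> [|v]; last by apply/derivable_mxP => i j; exact: (H i j).2.
apply/cvgrPdist_le => e e0; near=> y; apply: mx_norm_le; rewrite ?ltW// => i j.
rewrite !mxE; move: i j; near: y; apply: filter_forall => i.
apply: filter_forall => j; have [/cvgrPdist_le cf _] := H i j; exact: cf.
Unshelve. all: by end_near. Qed.

Lemma Ck_mx (V : normedModType R) k (A : set V) p q (f : V -> 'M[R]_(p, q)) :
  open A -> Ck k A f <-> forall i j, Ck k A (fun x => f x i j : R^o).
Proof.
move=> oA; elim: k f => [|k IH] f.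
  split=> [[H _] i j|H].
    by split=> // x /H/mx_regular.
  by split=> // x Ax; apply/mx_regular => i j; have [/(_ _ Ax)] := H i j.
have dE v x i j : derivable f x v ->
    ('D_v f x) i j = 'D_v (fun x => f x i j : R^o) x.
  by move=> df; rewrite derive_mx// mxE.
split=> [fC i j|H].
  split=> [x /(Ck_base fC)/mx_regular //|v].
  apply: (@eq_Ck _ _ _ _ (fun x => ('D_v f x) i j : R^o)) => //.
    by move=> x Ax; apply: dE => //; exact: (Ck_base fC Ax).2.
  by move: i j; apply/IH; exact: fC.2.
have bf : forall x, A x -> {for x, continuous f} /\ forall v, derivable f x v.
  by move=> x Ax; apply/mx_regular => i j; exact: Ck_base (H i j) _ Ax.
split=> // v; apply/IH => i j.
apply: (@eq_Ck _ _ _ _ ('D_v (fun x => f x i j : R^o))) => //; last exact: (H i j).2.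
by move=> x Ax; rewrite dE//; exact: (bf x Ax).2.
Qed.

(* The targets for which smoothness in the sense of directional derivatives
   implies differentiability. *)
Class smooth_target (W : normedModType R) : Prop :=
  Cinf_differentiable : forall n (A : set 'rV[R]_n) (f : 'rV[R]_n -> W) x,
    open A -> Cinf_on A f -> A x -> differentiable f x.

(* [Ck 1] asks for continuous directional derivatives, which is what
   [differentiable_partial] needs. *)
#[global] Instance regular_smooth_target : smooth_target R^o.
Proof.
move=> n A f x oA /CkP fC Ax.
apply: (differentiable_partial oA Ax).
  by move=> y v Ay; exact: (Ck_base (fC 0%N) Ay).2.
by move=> v; have [_ /(_ v) [/(_ _ Ax)[]]] := fC 1%N.
Qed.

#[global] Instance mx_smooth_target p q : smooth_target 'M[R]_(p, q).
Proof.
move=> n A f x oA /CkP fC Ax.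
have fd i j : differentiable (fun x => f x i j : R^o) x.
  apply: (regular_smooth_target oA) => //; apply/CkP => k.
  by move: i j; apply/(Ck_mx _ _ oA).
have -> : f = \sum_(i < p) \sum_(j < q) (fun x => f x i j *: delta_mx i j).
  apply/funext => y; rewrite {1}[f y]matrix_sum_delta fct_sumE.
  by apply: eq_bigr => i _; rewrite fct_sumE.
apply: differentiable_sum => i; apply: differentiable_sum => j.
exact: differentiableZl.
Qed.

Lemma derive_sum_delta n (W : normedModType R) (f : 'rV[R]_n -> W) x v :
  differentiable f x -> 'D_v f x = \sum_(i < n) v 0 i *: 'D_(delta_mx 0 i) f x.
Proof.
move=> fd; rewrite deriveE// {1}[v]row_sum_delta linear_sum.
by apply: eq_bigr => i _; rewrite linearZ deriveE.
Qed.

Lemma Ck_sum (V W : normedModType R) k (A : set V) (I : Type) (r : seq I) (F : I -> V -> W) :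
  open A -> (forall i, Ck k A (F i)) -> Ck k A (fun x => \sum_(i <- r) F i x).
Proof.
move=> oA H; elim: r => [|i r IH].
  by apply: eq_Ck (Ck_cst k 0 oA) => // x _; rewrite big_nil.
by apply: eq_Ck (Ck_add oA (H i) IH) => // x _; rewrite big_cons.
Qed.

Lemma derive_comp n m (g : 'rV[R]_n -> 'rV[R]_m)
    (W : normedModType R) (f : 'rV[R]_m -> W) x v :
  differentiable g x -> differentiable f (g x) ->
  'D_v (f \o g) x = 'D_('D_v g x) f (g x).
Proof.
move=> gd fd; rewrite !deriveE//; last exact: differentiable_comp.
by rewrite diff_comp.
Qed.

(** A derivative of [f \o g] is the sum over [i] of the [i]-th component of ['D_v g] times
    ['D_i f \o g]. The first factor is smooth and the second is a composite of lower order, which is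
    why the induction runs over all smooth [f] with [g] fixed. *)
Lemma Ck_comp n m k (W : normedModType R) {tW : smooth_target W}
    (A : set 'rV[R]_n) (B : set 'rV[R]_m)
    (g : 'rV[R]_n -> 'rV[R]_m) (f : 'rV[R]_m -> W) :
  open A -> open B -> (forall x, A x -> B (g x)) ->
  Cinf_on A g -> Cinf_on B f -> Ck k A (f \o g).
Proof.
move=> oA oB AB gC; have gd x : A x -> differentiable g x by exact: Cinf_differentiable gC.
elim: k f => [|k IH] f fC.
all: have fd x : B x -> differentiable f x by exact: Cinf_differentiable fC.
all: split=> //.
1,2: move=> x Ax; have fgd : differentiable (f \o g) x
  by apply: differentiable_comp; [exact: gd|exact: fd (AB _ Ax)].
1,2: by split=> [|v]; [exact: differentiable_continuous|exact: diff_derivable].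
move=> v; apply: (eq_Ck (f :=
  (fun x => \sum_(i < m) ('D_v g x 0 i : R^o) *: ('D_(delta_mx 0 i) f \o g) x)) oA).
  move=> x Ax; have gdx := gd _ Ax; have fdx := fd _ (AB _ Ax).
  by rewrite (derive_comp _ gdx fdx) (derive_sum_delta _ fdx).
apply: (Ck_sum _ oA) => i; apply: (Ck_scale oA).
  have [_ /(_ v)] := (CkP _ _).1 gC k.+1.
  by move/(Ck_mx _ _ oA); exact.
by apply: IH => s x Bx; exact: (fC (delta_mx 0 i :: s)).
Qed.

End FiniteOrder.

(** * Closure properties of smooth functions and rules for differentials *)

Section SmoothCalculus.
Context {R : realType}.

Lemma eq_Cinf (V W : normedModType R) (A : set V) (f g : V -> W) :
  open A -> (forall x, A x -> f x = g x) -> Cinf_on A f -> Cinf_on A g.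
Proof. by move=> oA fg /CkP fC; apply/CkP => k; exact: eq_Ck (fC k). Qed.

Lemma Cinf_sub (V W : normedModType R) (A B : set V) (f : V -> W) :
  B `<=` A -> Cinf_on A f -> Cinf_on B f.
Proof. by move=> BA fC s x /BA; exact: fC. Qed.

Lemma Cinf_local (V W : normedModType R) (A : set V) (f : V -> W) :
  (forall x, A x -> exists B : set V, B x /\ Cinf_on B f) -> Cinf_on A f.
Proof. by move=> H s x /H [B [Bx fC]]; exact: fC. Qed.

Lemma Cinf_D (V W : normedModType R) (A : set V) (f : V -> W) v :
  Cinf_on A f -> Cinf_on A ('D_v f).
Proof. by move=> fC s; exact: fC (v :: s). Qed.

Lemma Cinf_cst (V W : normedModType R) (A : set V) (c : W) :
  open A -> Cinf_on A (fun _ : V => c).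
Proof. by move=> oA; apply/CkP => k; exact: Ck_cst. Qed.

Lemma Cinf_add (V W : normedModType R) (A : set V) (f g : V -> W) : open A ->
  Cinf_on A f -> Cinf_on A g -> Cinf_on A (fun x => f x + g x).
Proof. by move=> oA /CkP fC /CkP gC; apply/CkP => k; exact: Ck_add. Qed.

Lemma Cinf_scale (V W : normedModType R) (A : set V) (k : V -> R^o) (f : V -> W) :
  open A -> Cinf_on A k -> Cinf_on A f -> Cinf_on A (fun x => k x *: f x).
Proof. by move=> oA /CkP kC /CkP fC; apply/CkP => i; exact: Ck_scale. Qed.

Lemma Cinf_mul (V : normedModType R) (A : set V) (f g : V -> R^o) : open A ->
  Cinf_on A f -> Cinf_on A g -> Cinf_on A (fun x => f x * g x : R^o).
Proof. exact: Cinf_scale. Qed.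

Lemma Cinf_opp (V W : normedModType R) (A : set V) (f : V -> W) : open A ->
  Cinf_on A f -> Cinf_on A (fun x => - f x).
Proof.
move=> oA fC; apply: (eq_Cinf oA _ (Cinf_scale oA (Cinf_cst (-1 : R^o) oA) fC)) => x _.
by rewrite scaleN1r.
Qed.

Lemma Cinf_sub_fun (V W : normedModType R) (A : set V) (f g : V -> W) : open A ->
  Cinf_on A f -> Cinf_on A g -> Cinf_on A (fun x => f x - g x).
Proof. by move=> oA fC gC; apply: (Cinf_add oA fC); exact: Cinf_opp. Qed.

Lemma Cinf_mx (V : normedModType R) (A : set V) p q (f : V -> 'M[R]_(p, q)) :
  open A -> Cinf_on A f <-> forall i j, Cinf_on A (fun x => f x i j : R^o).
Proof.
move=> oA; split=> [/CkP fC i j|fC]; apply/CkP => k.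
  by move: i j; apply/(Ck_mx _ _ oA).
by apply/Ck_mx => // i j; have /CkP := fC i j.
Qed.

Lemma Cinf_sum (V W : normedModType R) (A : set V) (I : Type) (r : seq I)
    (P : pred I) (F : I -> V -> W) : open A -> (forall i, P i -> Cinf_on A (F i)) ->
  Cinf_on A (fun x => \sum_(i <- r | P i) F i x).
Proof.
move=> oA H; elim: r => [|i r IH].
  by apply: eq_Cinf (Cinf_cst (0 : W) oA) => // x _; rewrite big_nil.
have [Pi|Pi] := boolP (P i).
  by apply: eq_Cinf (Cinf_add oA (H i Pi) IH) => // x _; rewrite big_cons Pi.
by apply: eq_Cinf IH => // x _; rewrite big_cons (negbTE Pi).
Qed.

Lemma Cinf_prod (V : normedModType R) (A : set V) (I : Type) (r : seq I)
    (F : I -> V -> R^o) : open A -> (forall i, Cinf_on A (F i)) ->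
  Cinf_on A (fun x => \prod_(i <- r) F i x : R^o).
Proof.
move=> oA H; elim: r => [|i r IH].
  by apply: eq_Cinf (Cinf_cst (1 : R^o) oA) => // x _; rewrite big_nil.
by apply: eq_Cinf (Cinf_mul oA (H i) IH) => // x _; rewrite big_cons.
Qed.

Lemma Cinf_comp n m (W : normedModType R) {tW : smooth_target W}
    (A : set 'rV[R]_n) (B : set 'rV[R]_m)
    (g : 'rV[R]_n -> 'rV[R]_m) (f : 'rV[R]_m -> W) :
  open A -> open B -> (forall x, A x -> B (g x)) ->
  Cinf_on A g -> Cinf_on B f -> Cinf_on A (f \o g).
Proof. by move=> oA oB AB gC fC; apply/CkP => k; exact: (Ck_comp _ oA oB AB gC fC). Qed.

(** If a family of functions of one real variable is closed under differentiation, every member is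
    smooth, and no formula for higher derivatives is ever needed. Inverse, square root, the flat
    function and the matrix exponential are all treated by exhibiting such a family. *)
Lemma Cinf_family n (A : set 'rV[R]_n) (B : set R) (Fam : set (R -> R))
    (g : 'rV[R]_n -> R^o) :
  open A -> (forall x, A x -> B (g x)) -> Cinf_on A g ->
  (forall F, Fam F -> exists2 G, Fam G & forall t : R, B t -> is_derive t 1 F (G t)) ->
  forall F, Fam F -> Cinf_on A (fun x => F (g x) : R^o).
Proof.
move=> oA AB gC FamD F FF; apply/CkP => k.
elim: k F FF => [|k IH] F FF; have [G FG FGd] := FamD F FF.
all: have Fd x : A x -> differentiable (F : R -> R^o) (g x).
1,3: by move=> Ax; apply/derivable1_diffP; have [] := FGd _ (AB _ Ax).
all: have gd x : A x -> differentiable g x by exact: Cinf_differentiable gC.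
all: have Fgd x : A x -> differentiable ((F : R -> R^o) \o g) x
  by move=> Ax; apply: differentiable_comp; [exact: gd|exact: Fd].
all: split=> //.
1,2: by move=> x Ax; split=> [|v];
  [exact: differentiable_continuous (Fgd _ Ax)|exact: diff_derivable (Fgd _ Ax)].
move=> v; apply: (@eq_Ck _ _ _ _ _ (fun x => 'D_v g x * G (g x) : R^o)) => //.
  move=> x Ax; rewrite (deriveE _ (Fgd _ Ax)) diff_comp; [|exact: gd|exact: Fd].
  rewrite /= -(deriveE _ (gd _ Ax)) diff1E; last exact: Fd.
  by rewrite derive1E; have [_ ->] := FGd _ (AB _ Ax).
by apply: (Ck_scale oA); [have [_] := (CkP _ _).1 gC k.+1; exact|exact: IH].
Qed.

Lemma scale_regE (a b : R) : a *: (b : R^o) = a * b.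
Proof. by []. Qed.

Lemma Cinf_inv n (A : set 'rV[R]_n) (g : 'rV[R]_n -> R^o) :
  open A -> (forall x, A x -> g x != 0) -> Cinf_on A g ->
  Cinf_on A (fun x => (g x)^-1 : R^o).
Proof.
move=> oA g0 gC.
(* The functions [c * t^-k] contain the inverse and are closed under differentiation. *)
pose Fam : set (R -> R) := [set F | exists c k, F = fun t => c * (t^-1) ^+ k].
have FF : Fam (fun t => t^-1).
  by exists 1, 1%N; apply/funext => t; rewrite mul1r expr1.
apply: (Cinf_family (B := [set t | t != 0]) oA g0 gC _ FF).
move=> _ [c [k ->]]; exists (fun t => (- (c * k%:R)) * t^-1 ^+ k.+1).
  by exists (- (c * k%:R)), k.+1.
move=> t t0; have id_inv : is_derive t 1 (fun t : R => t^-1) (- t^-2 *: 1).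
  split; first by apply: derivableV => //; exact: derivable_id.
  by rewrite deriveV// ?derive_id//; exact: derivable_id.
have -> : (fun t => c * t^-1 ^+ k) = cst c * (fun t : R => t^-1) ^+ k.
  by apply/funext => s; rewrite fctE exprfctE.
apply: (is_derive_eq (is_deriveM (is_derive_cst c t 1) (is_deriveX k id_inv))).
rewrite scaler0 addr0 /cst !scale_regE.
case: k => [|k]; first by rewrite !(mulr0, mul0r, oppr0).
rewrite /= -natr1 !exprVn !exprS.
by field; rewrite t0 /= expf_neq0.
Qed.

Lemma Cinf_sqrt n (A : set 'rV[R]_n) (g : 'rV[R]_n -> R^o) :
  open A -> (forall x, A x -> 0 < g x) -> Cinf_on A g ->
  Cinf_on A (fun x => Num.sqrt (g x) : R^o).
Proof.
move=> oA g0 gC.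
(* Since the derivative of the square root is [sqrt t / (2 t)], the functions [c * sqrt t * t^-k]
   are closed under differentiation, with new constant [c / 2 - c * k]. *)
pose Fam : set (R -> R) := [set F | exists c k, F = fun t => c * Num.sqrt t * (t^-1) ^+ k].
have FF : Fam (fun t => Num.sqrt t).
  by exists 1, 0%N; apply/funext => t; rewrite mul1r expr0 mulr1.
apply: (Cinf_family (B := [set t | 0 < t]) oA g0 gC _ FF).
move=> _ [c [k ->]]; exists (fun t => (c / 2 - c * k%:R) * Num.sqrt t * t^-1 ^+ k.+1).
  by exists (c / 2 - c * k%:R), k.+1.
move=> t /= t_gt0; have t0 : t != 0 by rewrite gt_eqF.
have id_inv : is_derive t 1 (fun t : R => t^-1) (- t^-2 *: 1).
  split; first by apply: derivableV => //; exact: derivable_id.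
  by rewrite deriveV// ?derive_id//; exact: derivable_id.
have sq := is_derive1_sqrt t_gt0.
have -> : (fun t => c * Num.sqrt t * t^-1 ^+ k) = cst c * Num.sqrt * (fun t : R => t^-1) ^+ k.
  by apply/funext => s; rewrite fctE exprfctE.
apply: (is_derive_eq (is_deriveM (is_deriveM (is_derive_cst c t 1) sq) (is_deriveX k id_inv))).
rewrite scaler0 addr0 /cst !scale_regE.
have s0 : Num.sqrt t != 0 by rewrite sqrtr_eq0 -ltNge.
have tE : t^-1 = (Num.sqrt t)^-1 ^+ 2 by rewrite exprVn sqr_sqrtr// ltW.
rewrite exprfctE mulrfctE -exprVn.
case: k => [|k]; first by rewrite !expr0 expr1 tE; field.
rewrite [k.+1.-1]/= (exprS _ k.+1) !(exprS _ k); move: (t^-1 ^+ k) => p.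
by rewrite -natr1 tE; field.
Qed.

Lemma Cinf_entry (V : normedModType R) (A : set V) p q (f : V -> 'M[R]_(p, q)) i j :
  open A -> Cinf_on A f -> Cinf_on A (fun x => f x i j : R^o).
Proof. by move=> oA /(Cinf_mx _ oA). Qed.

Lemma Cinf_entries (V : normedModType R) (A : set V) p q (f : V -> 'M[R]_(p, q)) :
  open A -> (forall i j, Cinf_on A (fun x => f x i j : R^o)) -> Cinf_on A f.
Proof. by move=> oA /(Cinf_mx _ oA). Qed.

Lemma Cinf_id n (A : set 'rV[R]_n) : open A -> Cinf_on A (fun x : 'rV[R]_n => x).
Proof.
move=> oA; apply/CkP => -[|k]; split=> //.
1,2: by move=> x _; split=> [|v]; [exact: cvg_id|exact: derivable_id].
by move=> v; apply: eq_Ck (Ck_cst k v oA) => // x _; rewrite derive_id.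
Qed.

Lemma Cinf_mulmx n (A : set 'rV[R]_n) p q r (f : 'rV[R]_n -> 'M[R]_(p, q))
    (g : 'rV[R]_n -> 'M[R]_(q, r)) : open A ->
  Cinf_on A f -> Cinf_on A g -> Cinf_on A (fun x => f x *m g x).
Proof.
move=> oA fC gC; apply: (Cinf_entries oA) => i j.
apply: (eq_Cinf (f := fun x => \sum_k (f x i k * g x k j : R^o)) oA) => [x _|].
  by rewrite mxE.
apply: (Cinf_sum _ oA) => k _.
exact: (Cinf_mul oA (Cinf_entry i k oA fC) (Cinf_entry k j oA gC)).
Qed.

Lemma Cinf_mxsub n (A : set 'rV[R]_n) p q p' q' (s : 'I_p' -> 'I_p) (t : 'I_q' -> 'I_q)
    (f : 'rV[R]_n -> 'M[R]_(p, q)) : open A ->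
  Cinf_on A f -> Cinf_on A (fun x => mxsub s t (f x)).
Proof.
move=> oA fC; apply: (Cinf_entries oA) => i j.
by apply: (eq_Cinf oA _ (Cinf_entry (s i) (t j) oA fC)) => x _; rewrite mxE.
Qed.

Lemma Cinf_trmx n (A : set 'rV[R]_n) p q (f : 'rV[R]_n -> 'M[R]_(p, q)) : open A ->
  Cinf_on A f -> Cinf_on A (fun x => (f x)^T).
Proof.
move=> oA fC; apply: (Cinf_entries oA) => i j.
by apply: (eq_Cinf oA _ (Cinf_entry j i oA fC)) => x _; rewrite mxE.
Qed.

Lemma Cinf_det n (A : set 'rV[R]_n) p (f : 'rV[R]_n -> 'M[R]_p) : open A ->
  Cinf_on A f -> Cinf_on A (fun x => \det (f x) : R^o).
Proof.
move=> oA fC; rewrite /determinant.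
apply: (Cinf_sum _ oA) => s _; apply: (Cinf_mul oA); first exact: (Cinf_cst _ oA).
by apply: (Cinf_prod _ oA) => i; exact: (Cinf_entry _ _ oA fC).
Qed.

Lemma Cinf_adj n (A : set 'rV[R]_n) p (f : 'rV[R]_n -> 'M[R]_p) : open A ->
  Cinf_on A f -> Cinf_on A (fun x => \adj (f x)).
Proof.
move=> oA fC; apply: (Cinf_entries oA) => i j.
apply: (eq_Cinf (f := fun x => (-1) ^+ (j + i) * \det (row' j (col' i (f x))) : R^o) oA) => [x _|].
  by rewrite mxE.
apply: (Cinf_mul oA); first exact: (Cinf_cst _ oA).
apply: (Cinf_det oA).
apply: (eq_Cinf oA _ (Cinf_mxsub (lift j) (lift i) oA fC)) => x _.
by apply/matrixP => k l; rewrite !mxE.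
Qed.

Lemma Cinf_invmx n (A : set 'rV[R]_n) p (f : 'rV[R]_n -> 'M[R]_p) : open A ->
  (forall x, A x -> f x \in unitmx) ->
  Cinf_on A f -> Cinf_on A (fun x => invmx (f x)).
Proof.
move=> oA fu fC.
apply: (eq_Cinf (f := fun x => (\det (f x))^-1 *: \adj (f x)) oA) => [x Ax|].
  by rewrite /invmx fu.
apply: (Cinf_scale oA); last exact: (Cinf_adj oA fC).
apply: (Cinf_inv oA); last exact: (Cinf_det oA fC).
by move=> x /fu; rewrite unitmxE unitfE.
Qed.

Lemma Cinf_row_mx n (A : set 'rV[R]_n) p q r (f : 'rV[R]_n -> 'M[R]_(p, q))
    (g : 'rV[R]_n -> 'M[R]_(p, r)) : open A ->
  Cinf_on A f -> Cinf_on A g -> Cinf_on A (fun x => row_mx (f x) (g x)).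
Proof.
move=> oA fC gC; apply: (Cinf_entries oA) => i j.
case: (split_ordP j) => k ->.
  by apply: (eq_Cinf oA _ (Cinf_entry i k oA fC)) => x _; rewrite row_mxEl.
by apply: (eq_Cinf oA _ (Cinf_entry i k oA gC)) => x _; rewrite row_mxEr.
Qed.

Lemma Cinf_col_mx n (A : set 'rV[R]_n) p q r (f : 'rV[R]_n -> 'M[R]_(p, r))
    (g : 'rV[R]_n -> 'M[R]_(q, r)) : open A ->
  Cinf_on A f -> Cinf_on A g -> Cinf_on A (fun x => col_mx (f x) (g x)).
Proof.
move=> oA fC gC; apply: (Cinf_entries oA) => i j.
case: (split_ordP i) => k ->.
  by apply: (eq_Cinf oA _ (Cinf_entry k j oA fC)) => x _; rewrite col_mxEu.
by apply: (eq_Cinf oA _ (Cinf_entry k j oA gC)) => x _; rewrite col_mxEd.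
Qed.

Lemma Cinf_linear n (A : set 'rV[R]_n) p q r s (f : 'M[R]_(p, q) -> 'M[R]_(r, s))
    (g : 'rV[R]_n -> 'M[R]_(p, q)) : linear f -> open A ->
  Cinf_on A g -> Cinf_on A (fun x => f (g x)).
Proof.
move=> fl oA gC.
pose fL : {linear 'M[R]_(p, q) -> 'M[R]_(r, s)} := HB.pack f (GRing.isLinear.Build _ _ _ _ f fl).
apply: (eq_Cinf (f := fun x => \sum_(k : 'I_p * 'I_q) (g x k.1 k.2 : R^o) *: f (delta_mx k.1 k.2)) oA).
  move=> x _; rewrite -[f]/(fL : _ -> _) {2}[g x]matrix_sum_delta pair_bigA linear_sum.
  by apply: eq_bigr => k _; rewrite linearZ.
apply: (Cinf_sum _ oA) => k _; apply: (Cinf_scale oA); last exact: (Cinf_cst _ oA).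
exact: (Cinf_entry _ _ oA gC).
Qed.

Lemma diff_linear n p q (W : normedModType R) (f : 'M[R]_(p, q) -> W)
    (g : 'rV[R]_n -> 'M[R]_(p, q)) x v : linear f -> differentiable g x ->
  'd (fun y => f (g y)) x v = f ('d g x v).
Proof.
move=> fl gd.
pose fL : {linear 'M[R]_(p, q) -> W} := HB.pack f (GRing.isLinear.Build _ _ _ _ f fl).
have cf : continuous fL by exact: linear_mx_continuous.
have fd : differentiable fL (g x) by exact: linear_differentiable.
apply: (etrans (congr1 (fun F => F v) (diff_comp gd fd))).
exact: (congr1 (fun F : _ -> W => F ('d g x v)) (diff_lin (g x) cf)).
Qed.

Lemma Cinf_diff n (W : normedModType R) {tW : smooth_target W} (A : set 'rV[R]_n)
    (f : 'rV[R]_n -> W) v :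
  open A -> Cinf_on A f -> Cinf_on A (fun x => 'd f x v).
Proof.
move=> oA fC; apply: (eq_Cinf oA _ (Cinf_D v fC)) => x Ax.
exact: deriveE (Cinf_differentiable oA fC Ax).
Qed.

Lemma diff_entry (V : normedModType R) p q (f : V -> 'M[R]_(p, q)) x v i j :
  differentiable f x -> differentiable (fun y => f y i j : R^o) x ->
  ('d f x v) i j = 'd (fun y => f y i j : R^o) x v.
Proof.
by move=> df dfij; rewrite -!deriveE// derive_mx ?mxE//; exact: diff_derivable.
Qed.

Lemma diff_scale n (W : normedModType R) {tW : smooth_target W} (A : set 'rV[R]_n)
    (k : 'rV[R]_n -> R^o) (f : 'rV[R]_n -> W) x v :
  open A -> A x -> Cinf_on A k -> Cinf_on A f ->
  'd (fun y => k y *: f y) x v = 'd k x v *: f x + k x *: 'd f x v.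
Proof.
move=> oA Ax kC fC.
have kd : differentiable k x by exact: (Cinf_differentiable oA kC Ax).
have fd : differentiable f x by exact: (Cinf_differentiable oA fC Ax).
have kfd : differentiable (fun y => k y *: f y) x by exact: (Cinf_differentiable oA (Cinf_scale oA kC fC) Ax).
have [_ D] := is_derive_scale (differentiable_continuous fd)
  (diff_derivable (v := v) kd) (diff_derivable (v := v) fd).
apply: etrans (esym (deriveE v kfd)) (etrans D _).
by congr (_ *: _ + _ *: _); exact: deriveE.
Qed.

Lemma diff_mulmx n (A : set 'rV[R]_n) p q r (f : 'rV[R]_n -> 'M[R]_(p, q))
    (g : 'rV[R]_n -> 'M[R]_(q, r)) x v :
  open A -> A x -> Cinf_on A f -> Cinf_on A g ->
  'd (fun y => f y *m g y) x v = 'd f x v *m g x + f x *m 'd g x v.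
Proof.
move=> oA Ax fC gC.
have fd : differentiable f x by exact: (Cinf_differentiable oA fC Ax).
have gd : differentiable g x by exact: (Cinf_differentiable oA gC Ax).
have fgd : differentiable (fun y => f y *m g y) x by exact: (Cinf_differentiable oA (Cinf_mulmx oA fC gC) Ax).
have fe i k := Cinf_entry i k oA fC; have ge k j := Cinf_entry k j oA gC.
have fed i k : differentiable (fun y => f y i k : R^o) x by exact: (Cinf_differentiable oA (fe i k) Ax).
have ged k j : differentiable (fun y => g y k j : R^o) x by exact: (Cinf_differentiable oA (ge k j) Ax).
have fge i j : differentiable (fun y => (f y *m g y) i j : R^o) x by exact: (Cinf_differentiable oA (Cinf_entry i j oA (Cinf_mulmx oA fC gC)) Ax).
apply/matrixP => i j; rewrite (diff_entry v fgd (fge i j)) !mxE -big_split /=.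
have -> : (fun y => (f y *m g y) i j : R^o) =
    \sum_(k < q) (fun y => (f y i k : R^o) *: (g y k j : R^o)).
  by apply/funext => y; rewrite mxE fct_sumE.
rewrite -deriveE; last first.
  apply: differentiable_sum => k.
  by apply: (Cinf_differentiable oA _ Ax); exact: (Cinf_scale oA (fe i k) (ge k j)).
rewrite derive_sum; last first.
  move=> k; apply: diff_derivable.
  by apply: (Cinf_differentiable oA _ Ax); exact: (Cinf_scale oA (fe i k) (ge k j)).
apply: eq_bigr => k _; rewrite (diff_entry v fd (fed i k)) (diff_entry v gd (ged k j)).
rewrite deriveE; last first.
  by apply: (Cinf_differentiable oA _ Ax); exact: (Cinf_scale oA (fe i k) (ge k j)).
exact: (diff_scale v oA Ax (fe i k) (ge k j)).
Qed.

Lemma diff_trmx n (A : set 'rV[R]_n) p q (f : 'rV[R]_n -> 'M[R]_(p, q)) x v :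
  open A -> A x -> Cinf_on A f -> 'd (fun y => (f y)^T) x v = ('d f x v)^T.
Proof.
move=> oA Ax fC; have fTC := Cinf_trmx oA fC.
have fd : differentiable f x by exact: (Cinf_differentiable oA fC).
have fTd : differentiable (fun y => (f y)^T) x by exact: (Cinf_differentiable oA fTC).
apply/matrixP => k l; rewrite mxE.
have fij : differentiable (fun y => f y l k : R^o) x.
  exact: (Cinf_differentiable oA (Cinf_entry l k oA fC)).
rewrite (diff_entry v fd fij).
have fE : (fun y => f y l k : R^o) = (fun y => (f y)^T k l) by apply/funext => z; rewrite mxE.
by rewrite fE in fij *; exact: (diff_entry v fTd fij).
Qed.

Lemma eq_diff (V W : normedModType R) (A : set V) (f g : V -> W) x v :
  open A -> A x -> (forall y, A y -> f y = g y) -> differentiable f x ->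
  differentiable g x -> 'd f x v = 'd g x v.
Proof.
move=> oA Ax fg fd gd; rewrite -!deriveE//; apply: near_eq_derive.
near=> y; apply: fg; near: y; exact: open_nbhs_nbhs.
Unshelve. all: by end_near. Qed.

End SmoothCalculus.

(** * The flat function [exp(-1/t)] and its derivatives *)

Section FlatFunction.
Context {R : realType}.

(** The polynomial parameter makes the family closed under differentiation, as [Cinf_family]
    requires; only [p = 1] is used afterwards. *)
Definition flat_exp (p : {poly R}) (t : R) : R :=
  if 0 < t then p.[t^-1] * expR (- t^-1) else 0.

(** With [n] two more than the size of [p], [exp(s/n) >= s/n] gives [exp(-s) <= (n/s)^n]. For
    [s >= 1] the polynomial absorbs [size p] powers of [s], and [s^-2] remains: at [s = 1/t] this is
    quadratic flatness at 0. *)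
Lemma poly_expR_bound (p : {poly R}) :
  exists2 C, 0 <= C & forall s, 1 <= s -> `|p.[s]| * expR (- s) <= C * s^-1 ^+ 2.
Proof.
pose n := (size p).+2; pose C := \sum_(i < size p) `|p`_i|.
exists (C * n%:R ^+ n); first by rewrite mulr_ge0// ?exprn_ge0// sumr_ge0.
move=> s s1; have s0 : 0 < s by exact: lt_le_trans s1.
have pC : `|p.[s]| <= C * s ^+ size p.
  rewrite horner_coef /C mulr_suml; apply: le_trans (ler_norm_sum _ _ _) _.
  apply: ler_sum => i _; rewrite normrM normrX (gtr0_norm s0).
  by apply: ler_wpM2l => //; rewrite ler_weXn2l// ltnW.
have eC : expR (- s) <= n%:R ^+ n * s^-1 ^+ n.
  have n0 : n%:R != 0 :> R by rewrite pnatr_eq0.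
  have w0 : 0 < s / n%:R by rewrite divr_gt0.
  rewrite -[in leLHS](divfK n0 s) -mulNr expRM_natr -exprMn -[_ * s^-1]invrK invfM invrK mulrC.
  apply: lerXn2r; rewrite ?nnegrE ?invr_ge0 ?expR_ge0 ?mulr_ge0 ?invr_ge0 ?ler0n ?(ltW s0)//.
  rewrite mulrC.
  rewrite expRN lef_pV2 ?posrE ?expR_gt0//.
  by apply: le_trans (expR_ge1Dx _); rewrite lerDr.
apply: le_trans (ler_pM _ _ pC eC) _; rewrite ?expR_ge0//.
rewrite mulrACA; apply: ler_wpM2l; first by rewrite mulr_ge0// ?exprn_ge0// sumr_ge0.
rewrite /n -2!addn1 -addnA exprD mulrA -exprMn divff ?gt_eqF// expr1n mul1r.
by [].
Qed.

(** For [t > 0] the derivative of [p(1/t) exp(-1/t)] is [t^-2 (p - p')(1/t) exp(-1/t)], and [t^-2]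
    is the value of ['X^2] at [1/t]. At 0 the quadratic bound sends the difference quotient to 0. *)
Lemma is_derive_flat_exp (p : {poly R}) (t : R) :
  is_derive t 1 (flat_exp p) (flat_exp ('X^2 * (p - p^`())) t).
Proof.
have [t0|t0|->] := ltgtP t 0.
- have E : \forall s \near t, cst 0 s = flat_exp p s.
    near=> s; rewrite /flat_exp ltNge ltW//; near: s; exact: lt_nbhsl.
  rewrite /flat_exp ltNge ltW//=.
  exact: near_eq_is_derive E _.
- have E : \forall s \near t, ((horner p \o GRing.inv) * (expR \o (fun s => - s^-1))) s = flat_exp p s.
    near=> s; rewrite /flat_exp ifT//; near: s; exact: lt_nbhsr.
  apply: near_eq_is_derive E _.
  have tn0 : t != 0 by rewrite gt_eqF.
  have id_inv : is_derive t 1 (fun t : R => t^-1) (- t^-2 *: 1).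
    split; first by apply: derivableV => //; exact: derivable_id.
    by rewrite deriveV// ?derive_id//; exact: derivable_id.
  have Nid_inv : is_derive t 1 (fun t : R => - t^-1) (t^-2).
    by apply: (is_derive_eq (is_deriveN id_inv)); rewrite scaleNr opprK [LHS]mulr1.
  have d1 : is_derive t 1 (horner p \o GRing.inv) (- t^-2 * p^`().[t^-1]).
    apply: (is_derive_eq (is_derive1_comp (is_derive_poly p t^-1) id_inv)).
    by rewrite scale_regE mulr1 mulrC.
  have d2 : is_derive t 1 (expR \o (fun s => - s^-1)) (t^-2 * expR (- t^-1)).
    have H : is_derive ((fun s : R => - s^-1) t) 1 expR (expR (- t^-1)) by exact: is_derive_expR.
    by apply: (is_derive_eq (@is_derive1_comp _ expR (fun s => - s^-1) t _ _ H Nid_inv)); rewrite mulrC.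
  apply: (is_derive_eq (is_deriveM d1 d2)).
  rewrite /flat_exp t0 !hornerE !scale_regE /= exprVn; ring.
- have [C C0 HC] := poly_expR_bound p.
  have F0 q : flat_exp q 0 = 0 by rewrite /flat_exp ltxx.
  have bd h : `|h| <= 1 -> `|flat_exp p h| <= C * h ^+ 2.
    move=> h1; rewrite /flat_exp; case: ifPn => [h0|_]; last first.
      by rewrite normr0 mulr_ge0// sqr_ge0.
    rewrite normrM (ger0_norm (expR_ge0 _)); apply: le_trans (HC _ _) _; last by rewrite invrK.
    by rewrite -[leLHS]invr1 lef_pV2 ?posrE// -(gtr0_norm h0).
  have lim : h^-1 *: ((flat_exp p \o shift (0 : R)) (h *: (1 : R)) - flat_exp p 0) @[h --> 0^'] --> (0 : R).
    apply/cvgrPdist_le => e e0; near=> h.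
    have hn0 : h != 0 by near: h; exact: nbhs_dnbhs_neq.
    have -> : h^-1 *: ((flat_exp p \o shift (0 : R)) (h *: (1 : R)) - flat_exp p 0) = h^-1 * flat_exp p h.
      by rewrite F0 subr0 /= addr0 [h%:A]mulr1.
    rewrite sub0r normrN normrM normfV.
    rewrite mulrC ler_pdivrMr ?normr_gt0//; apply: le_trans (bd _ _) _.
      by near: h; apply: dnbhs0_le.
    rewrite -real_normK ?num_real// expr2 mulrA ler_wpM2r//.
    (* The constant [C] may vanish, hence the radius [e / (C + 1)]. *)
    have : `|h| <= e / (C + 1) by near: h; apply: dnbhs0_le; rewrite divr_gt0// ltr_wpDl.
    rewrite ler_pdivlMr ?ltr_wpDl// mulrC; apply: le_trans.
    by rewrite ler_wpM2r// lerDl.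
  rewrite F0; split; first by apply/cvg_ex; exists 0.
  exact: cvg_lim lim.
Unshelve. all: by end_near. Qed.

Lemma Cinf_flat_exp n (A : set 'rV[R]_n) (g : 'rV[R]_n -> R^o) (p : {poly R}) :
  open A -> Cinf_on A g -> Cinf_on A (fun x => flat_exp p (g x) : R^o).
Proof.
move=> oA gC.
apply: (Cinf_family (B := setT) (Fam := range flat_exp) oA _ gC) => //.
move=> _ [q _ <-]; exists (flat_exp ('X^2 * (q - q^`()))) => //.
by move=> t _; exact: is_derive_flat_exp.
Qed.

Lemma flat_exp1_gt0 t : 0 < t -> 0 < flat_exp 1 t.
Proof. by move=> t0; rewrite /flat_exp t0 hornerC mul1r expR_gt0. Qed.

Lemma flat_exp_le0 p t : t <= 0 -> flat_exp p t = 0.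
Proof. by move=> t0; rewrite /flat_exp ltNge t0. Qed.

Lemma flat_exp1_ge0 t : 0 <= flat_exp 1 t.
Proof.
by have [/flat_exp_le0 ->|/flat_exp1_gt0/ltW] := leP t 0.
Qed.

End FlatFunction.

(** * Smooth maps between manifolds *)

Section Plots.
Context {R : realType} {n : nat} {M : manifold R n}.
Implicit Types (c d x : M) (O : set M).
Local Notation im c O := (phi M c @` (O `&` dom M c)).

Lemma chart_imageP c O y : im c O y ->
  [/\ O (psi M c y), dom M c (psi M c y) & phi M c (psi M c y) = y].
Proof. by move=> [x [Ox cx] <-]; rewrite phiK. Qed.

Lemma chart_image_open c O : open O -> open (im c O).
Proof.
move=> oO; rewrite openE => _ [x [Ox cx] <-]; rewrite /interior.
have pc := psi_continuous cx; rewrite /prop_for /continuous_at phiK// in pc.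
have H1 : \forall y \near phi M c x, (O `&` dom M c) (psi M c y).
  apply: pc; apply: open_nbhs_nbhs; split=> //.
  by apply: openI => //; exact: dom_open.
have H2 : \forall y \near phi M c x, (phi M c @` dom M c) y.
  by apply: open_nbhs_nbhs; split; [exact: phi_open|exists x].
near=> y.
have [z cz zy] : (phi M c @` dom M c) y by near: y.
exists z => //; rewrite -(phiK cz) zy; by near: y.
Unshelve. all: by end_near. Qed.

Arguments chart_image_open c {O}.

Lemma phi_image c O x : O x -> dom M c x -> im c O (phi M c x).
Proof. by exists x. Qed.

Lemma plot_preim_open k (V : set 'rV[R]_k) (a : 'rV[R]_k -> M) O : open V ->
  (forall y, V y -> {for y, continuous a}) -> open O -> open (V `&` a @^-1` O).
Proof.
move=> oV ca oO; rewrite openE => y [Vy Oy]; rewrite /interior.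
have H1 : \forall z \near y, V z by exact: open_nbhs_nbhs.
have H2 : \forall z \near y, O (a z) by apply: (ca _ Vy); exact: open_nbhs_nbhs.
by near=> z; split; near: z.
Unshelve. all: by end_near. Qed.

(** [smooth_plot] quantifies over all charts; one chart around each point is enough because the
    transition maps are smooth. *)
Lemma smooth_plotI k (V : set 'rV[R]_k) (a : 'rV[R]_k -> M) : open V ->
  (forall y, V y -> exists c B, [/\ open B, B y, forall z, B z -> dom M c (a z) &
     Cinf_on B (phi M c \o a)]) -> smooth_plot V a.
Proof.
move=> oV H.
have ca y : V y -> {for y, continuous a}.
  move=> /H[c [B [oB By Bc aC]]].
  have [c1 _] := aC [::] y By.
  have c2 : {for y, continuous (psi M c \o (phi M c \o a))}.
    by apply: continuous_comp => //; exact: psi_continuous (Bc _ By).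
  have E : \forall z \near y, (psi M c \o (phi M c \o a)) z = a z.
    by near=> z; rewrite /= phiK//; apply: Bc; near: z; exact: open_nbhs_nbhs.
  move: c2; rewrite /prop_for /continuous_at /= phiK; last exact: Bc.
  move=> c2; apply: cvg_trans c2; exact: (near_eq_cvg E).
split=> // d; apply: Cinf_local => y [Vy dy].
have [c [B [oB By Bc aC]]] := H y Vy.
have oBd : open (B `&` (V `&` a @^-1` dom M d)).
  by apply: openI => //; apply: plot_preim_open => //; exact: dom_open.
exists (B `&` (V `&` a @^-1` dom M d)); split=> //.
apply: (eq_Cinf (f := (phi M d \o psi M c) \o (phi M c \o a)) oBd) => [z [Bz _]|].
  by rewrite /= phiK//; exact: Bc.
apply: (Cinf_comp (B := im c (dom M d)) oBd) => [|z [Bz [_ dz]]||].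
- by apply: chart_image_open; exact: dom_open.
- by apply: phi_image => //; exact: Bc.
- by apply: Cinf_sub aC => z [].
- by rewrite setIC; exact: transition_smooth.
Unshelve. all: by end_near. Qed.

Lemma smooth_plot_sub k (V V' : set 'rV[R]_k) (a : 'rV[R]_k -> M) :
  V' `<=` V -> smooth_plot V a -> smooth_plot V' a.
Proof.
move=> V'V [ca aC]; split=> [y /V'V /ca //|c]; apply: Cinf_sub (aC c) => y [].
by move=> /V'V.
Qed.

Lemma smooth_plot_local k (V : set 'rV[R]_k) (a : 'rV[R]_k -> M) :
  (forall y, V y -> exists B : set 'rV[R]_k, B y /\ smooth_plot B a) -> smooth_plot V a.
Proof.
move=> H; split=> [y /H[B [By [ca _]]]|c]; first exact: ca.
by apply: Cinf_local => y [/H[B [By [_ aC]]] cy]; exists (B `&` a @^-1` dom M c).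
Qed.

Lemma eq_smooth_plot k (V : set 'rV[R]_k) (a b : 'rV[R]_k -> M) : open V ->
  (forall y, V y -> a y = b y) -> smooth_plot V a -> smooth_plot V b.
Proof.
move=> oV ab [ca aC]; apply: smooth_plotI => // y Vy.
have oB : open (V `&` a @^-1` dom M (b y)) by apply: plot_preim_open => //; exact: dom_open.
exists (b y), (V `&` a @^-1` dom M (b y)); split=> //.
- by split=> //=; rewrite ab//; exact: dom_self.
- by move=> z [Vz]; rewrite /= ab.
- by apply: (eq_Cinf oB _ (aC (b y))) => z [Vz _]; rewrite /= ab.
Qed.

Lemma smooth_plot_comp k l (V : set 'rV[R]_k) (V' : set 'rV[R]_l) (a : 'rV[R]_k -> M)
    (g : 'rV[R]_l -> 'rV[R]_k) : open V -> open V' -> Cinf_on V' g ->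
  (forall z, V' z -> V (g z)) -> smooth_plot V a -> smooth_plot V' (a \o g).
Proof.
move=> oV oV' gC V'V [ca aC].
have cag y : V' y -> {for y, continuous (a \o g)}.
  move=> V'y; apply: continuous_comp; first exact: (gC [::] y V'y).1.
  exact: ca (V'V _ V'y).
split=> // c.
apply: (Cinf_comp (f := phi M c \o a) (g := g) (B := V `&` a @^-1` dom M c)) => //.
- by apply: plot_preim_open => //; exact: dom_open.
- by apply: plot_preim_open => //; exact: dom_open.
- by move=> y [V'y cy]; split=> //; exact: V'V.
- by apply: Cinf_sub gC => y [].
Qed.

Lemma smooth_plot_psi c : smooth_plot (im c setT) (psi M c).
Proof.
apply: smooth_plotI => [|y yc]; first by apply: chart_image_open; exact: openT.
exists c, (im c setT); split=> //.
- by apply: chart_image_open; exact: openT.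
- by move=> z /chart_imageP[].
- apply: (@eq_Cinf _ _ _ _ id); first by apply: chart_image_open; exact: openT.
    by move=> z /chart_imageP[].
  by apply: Cinf_id; apply: chart_image_open; exact: openT.
Qed.

Lemma smooth_plot_psi_sub c O : smooth_plot (im c O) (psi M c).
Proof. by apply: smooth_plot_sub (smooth_plot_psi c) => _ [x [_ cx] <-]; exists x. Qed.

Lemma plot_fun k (W : normedModType R) {tW : smooth_target W} (V : set 'rV[R]_k)
    (a : 'rV[R]_k -> M) O (f : M -> W) : open V -> open O -> smooth_plot V a ->
  (forall y, V y -> O (a y)) -> smooth_fun O f -> Cinf_on V (f \o a).
Proof.
move=> oV oO [ca aC] VO fC; apply: Cinf_local => y Vy.
pose B := V `&` a @^-1` dom M (a y).
have oB : open B by apply: plot_preim_open => //; exact: dom_open.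
exists B; split; first by split=> //; exact: dom_self.
apply: (eq_Cinf (f := (f \o psi M (a y)) \o (phi M (a y) \o a)) oB) => [z [_ zc]|].
  by rewrite /= phiK.
apply: (Cinf_comp (B := im (a y) O) oB _ _ (aC (a y)) (fC (a y))).
  exact: chart_image_open.
by move=> z [Vz zc]; apply: phi_image => //; exact: VO.
Qed.

End Plots.
Arguments chart_image_open {R n M} c {O}.

Section Maps.
Context {R : realType}.

Lemma plot_map k n n' (M : manifold R n) (M' : manifold R n') (V : set 'rV[R]_k)
    (a : 'rV[R]_k -> M) (O : set M) (f : M -> M') : open V -> open O -> smooth_plot V a ->
  (forall y, V y -> O (a y)) -> smooth_map O f -> smooth_plot V (f \o a).
Proof.
move=> oV oO [ca aC] VO fC; apply: smooth_plot_local => y Vy.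
pose B := V `&` a @^-1` dom M (a y).
have oB : open B by apply: plot_preim_open => //; exact: dom_open.
exists B; split; first by split=> //; exact: dom_self.
apply: (eq_smooth_plot (a := (f \o psi M (a y)) \o (phi M (a y) \o a)) oB) => [z [_ zc]|].
  by rewrite /= phiK.
apply: (smooth_plot_comp _ oB (aC (a y)) _ (fC (a y))).
  exact: chart_image_open.
by move=> z [Vz zc]; apply: phi_image => //; exact: VO.
Qed.

Lemma smooth_map_comp n n' n'' (M : manifold R n) (M' : manifold R n')
    (M'' : manifold R n'') (O : set M) (O' : set M') (f : M -> M') (g : M' -> M'') :
  open O -> open O' -> (forall x, O x -> O' (f x)) ->
  smooth_map O f -> smooth_map O' g -> smooth_map O (g \o f).
Proof.
move=> oO oO' OO' fC gC c.
apply: (plot_map (a := f \o psi M c) _ oO' (fC c) _ gC).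
  exact: chart_image_open.
by move=> y /chart_imageP[Oy _ _]; exact: OO'.
Qed.

Lemma smooth_fun_comp n n' (M : manifold R n) (M' : manifold R n')
    (W : normedModType R) {tW : smooth_target W} (O : set M) (O' : set M')
    (f : M -> M') (g : M' -> W) :
  open O -> open O' -> (forall x, O x -> O' (f x)) ->
  smooth_map O f -> smooth_fun O' g -> smooth_fun O (g \o f).
Proof.
move=> oO oO' OO' fC gC c.
apply: (plot_fun (a := f \o psi M c) _ oO' (fC c) _ gC).
  exact: chart_image_open.
by move=> y /chart_imageP[Oy _ _]; exact: OO'.
Qed.

Lemma smooth_map_id n (M : manifold R n) (O : set M) : smooth_map O id.
Proof. by move=> c; exact: smooth_plot_psi_sub. Qed.

Lemma smooth_map_sub n n' (M : manifold R n) (M' : manifold R n') (O O' : set M)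
    (f : M -> M') : O' `<=` O -> smooth_map O f -> smooth_map O' f.
Proof.
move=> O'O fC c; apply: smooth_plot_sub (fC c) => _ [x [Ox cx] <-].
by exists x => //; split=> //; exact: O'O.
Qed.

Lemma smooth_map_local n n' (M : manifold R n) (M' : manifold R n') (O : set M)
    (f : M -> M') :
  (forall x, O x -> exists O' : set M, O' x /\ smooth_map O' f) -> smooth_map O f.
Proof.
move=> H c; apply: smooth_plot_local => _ [x [/H[ U [ Ux fC]] cx] <-].
by exists (phi M c @` (U `&` dom M c)); split; [exists x|exact: fC].
Qed.

Lemma eq_smooth_map n n' (M : manifold R n) (M' : manifold R n') (O : set M)
    (f g : M -> M') : open O -> (forall x, O x -> f x = g x) ->
  smooth_map O f -> smooth_map O g.
Proof.
move=> oO fg fC c; apply: (eq_smooth_plot _ _ (fC c)); first exact: chart_image_open.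
by move=> y /chart_imageP[Oy _ _]; exact: fg.
Qed.

End Maps.

Section Functions.
Context {R : realType} {n : nat} {M : manifold R n}.
Implicit Types (O : set M).

Section General.
Context {W : normedModType R}.

Lemma smooth_fun_sub O O' (f : M -> W) : O' `<=` O -> smooth_fun O f -> smooth_fun O' f.
Proof.
move=> O'O fC c; apply: Cinf_sub (fC c) => _ [x [Ox cx] <-].
by exists x => //; split=> //; exact: O'O.
Qed.

Lemma smooth_fun_local O (f : M -> W) :
  (forall x, O x -> exists O' : set M, O' x /\ smooth_fun O' f) -> smooth_fun O f.
Proof.
move=> H c; apply: Cinf_local => _ [x [/H[ U [ Ux fC]] cx] <-].
by exists (phi M c @` (U `&` dom M c)); split; [exists x|exact: fC].
Qed.

Lemma eq_smooth_fun O (f g : M -> W) : open O -> (forall x, O x -> f x = g x) ->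
  smooth_fun O f -> smooth_fun O g.
Proof.
move=> oO fg fC c; apply: (eq_Cinf _ _ (fC c)); first exact: chart_image_open.
by move=> y /chart_imageP[Oy _ _]; exact: fg.
Qed.

Lemma smooth_fun_cst O (w : W) : open O -> smooth_fun O (fun _ : M => w).
Proof. by move=> oO c; exact: (Cinf_cst (V := 'rV[R]_n) w (chart_image_open c oO)). Qed.

Lemma smooth_fun_add O (f g : M -> W) : open O -> smooth_fun O f -> smooth_fun O g ->
  smooth_fun O (fun x => f x + g x).
Proof. by move=> oO fC gC c; exact: (Cinf_add (V := 'rV[R]_n) (chart_image_open c oO) (fC c) (gC c)). Qed.

Lemma smooth_fun_opp O (f : M -> W) : open O -> smooth_fun O f ->
  smooth_fun O (fun x => - f x).
Proof. by move=> oO fC c; exact: (Cinf_opp (V := 'rV[R]_n) (chart_image_open c oO) (fC c)). Qed.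

Lemma smooth_fun_subr O (f g : M -> W) : open O -> smooth_fun O f -> smooth_fun O g ->
  smooth_fun O (fun x => f x - g x).
Proof. by move=> oO fC gC; apply: smooth_fun_add => //; exact: smooth_fun_opp. Qed.

Lemma smooth_fun_scale O (k : M -> R^o) (f : M -> W) : open O ->
  smooth_fun O k -> smooth_fun O f -> smooth_fun O (fun x => k x *: f x).
Proof. by move=> oO kC fC c; exact: (Cinf_scale (V := 'rV[R]_n) (chart_image_open c oO) (kC c) (fC c)). Qed.

Lemma smooth_fun_sum O (I : Type) (r : seq I) (P : pred I) (F : I -> M -> W) : open O ->
  (forall i, P i -> smooth_fun O (F i)) -> smooth_fun O (fun x => \sum_(i <- r | P i) F i x).
Proof.
move=> oO FC c.
by apply: (Cinf_sum (V := 'rV[R]_n) r (P := P) (F := fun i => F i \o psi M c) (chart_image_open c oO)) => i /FC.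
Qed.

Lemma smooth_funI {tW : smooth_target W} O (c : M) (f : M -> W) : open O -> O `<=` dom M c ->
  Cinf_on (phi M c @` O) (f \o psi M c) -> smooth_fun O f.
Proof.
move=> oO Oc fC d; have oi := chart_image_open d oO.
apply: (eq_Cinf (f := (f \o psi M c) \o (phi M c \o psi M d)) oi).
  by move=> y /chart_imageP[/Oc yc _ _]; rewrite /= phiK.
have E : phi M c @` O = phi M c @` (O `&` dom M c).
  by congr (_ @` _); apply/seteqP; split=> [x Ox|x []//]; split=> //; exact: Oc.
apply: (Cinf_comp (B := phi M c @` O) oi) => //.
- by rewrite E; exact: chart_image_open.
- by move=> y /chart_imageP[Oy _ _]; exists (psi M d y).
- apply: Cinf_sub (@transition_smooth _ _ M d c) => _ [x [Ox dx] <-].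
  by exists x => //; split=> //; exact: Oc.
Qed.

End General.

Lemma smooth_fun_mul O (f g : M -> R^o) : open O -> smooth_fun O f -> smooth_fun O g ->
  smooth_fun O (fun x => f x * g x : R^o).
Proof. exact: smooth_fun_scale. Qed.

Lemma smooth_fun_inv O (f : M -> R^o) : open O -> (forall x, O x -> f x != 0) ->
  smooth_fun O f -> smooth_fun O (fun x => (f x)^-1 : R^o).
Proof.
move=> oO f0 fC c; apply: (Cinf_inv (chart_image_open c oO) _ (fC c)).
by move=> y /chart_imageP[Oy _ _]; exact: f0.
Qed.

Lemma smooth_fun_sqrt O (f : M -> R^o) : open O -> (forall x, O x -> 0 < f x) ->
  smooth_fun O f -> smooth_fun O (fun x => Num.sqrt (f x) : R^o).
Proof.
move=> oO f0 fC c; apply: (Cinf_sqrt (chart_image_open c oO) _ (fC c)).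
by move=> y /chart_imageP[Oy _ _]; exact: f0.
Qed.

Lemma smooth_fun_flat O (f : M -> R^o) : open O ->
  smooth_fun O f -> smooth_fun O (fun x => flat_exp 1 (f x) : R^o).
Proof. by move=> oO fC c; exact: (Cinf_flat_exp _ (chart_image_open c oO) (fC c)). Qed.

Lemma smooth_fun_entry O p q (f : M -> 'M[R]_(p, q)) i j : open O ->
  smooth_fun O f -> smooth_fun O (fun x => f x i j : R^o).
Proof. by move=> oO fC c; exact: (Cinf_entry i j (chart_image_open c oO) (fC c)). Qed.

Lemma smooth_fun_entries O p q (f : M -> 'M[R]_(p, q)) : open O ->
  (forall i j, smooth_fun O (fun x => f x i j : R^o)) -> smooth_fun O f.
Proof.
move=> oO fC c; apply: (Cinf_entries (chart_image_open c oO)) => i j; exact: fC.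
Qed.

Lemma smooth_fun_mulmx O p q r (f : M -> 'M[R]_(p, q)) (g : M -> 'M[R]_(q, r)) : open O ->
  smooth_fun O f -> smooth_fun O g -> smooth_fun O (fun x => f x *m g x).
Proof. by move=> oO fC gC c; exact: (Cinf_mulmx (chart_image_open c oO) (fC c) (gC c)). Qed.

Lemma smooth_fun_trmx O p q (f : M -> 'M[R]_(p, q)) : open O ->
  smooth_fun O f -> smooth_fun O (fun x => (f x)^T).
Proof. by move=> oO fC c; exact: (Cinf_trmx (chart_image_open c oO) (fC c)). Qed.

Lemma smooth_fun_invmx O p (f : M -> 'M[R]_p) : open O ->
  (forall x, O x -> f x \in unitmx) -> smooth_fun O f -> smooth_fun O (fun x => invmx (f x)).
Proof.
move=> oO fu fC c; apply: (Cinf_invmx (chart_image_open c oO) _ (fC c)).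
by move=> y /chart_imageP[Oy _ _]; exact: fu.
Qed.

Lemma smooth_fun_row_mx O p q r (f : M -> 'M[R]_(p, q)) (g : M -> 'M[R]_(p, r)) : open O ->
  smooth_fun O f -> smooth_fun O g -> smooth_fun O (fun x => row_mx (f x) (g x)).
Proof. by move=> oO fC gC c; exact: (Cinf_row_mx (chart_image_open c oO) (fC c) (gC c)). Qed.

Lemma smooth_fun_col_mx O p q r (f : M -> 'M[R]_(p, r)) (g : M -> 'M[R]_(q, r)) : open O ->
  smooth_fun O f -> smooth_fun O g -> smooth_fun O (fun x => col_mx (f x) (g x)).
Proof. by move=> oO fC gC c; exact: (Cinf_col_mx (chart_image_open c oO) (fC c) (gC c)). Qed.

Lemma smooth_fun_phi (c : M) : smooth_fun (dom M c) (phi M c).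
Proof.
have oc := @dom_open _ _ M c.
apply: (smooth_funI (c := c)) => //.
have E : phi M c @` dom M c = phi M c @` (setT `&` dom M c) by rewrite setTI.
have oi : open (phi M c @` dom M c) by rewrite E; apply: chart_image_open; exact: openT.
apply: (@eq_Cinf _ _ _ _ id) => //; last exact: Cinf_id.
by move=> _ [x cx <-]; rewrite /= phiK.
Qed.

Lemma smooth_fun_post (W : normedModType R) {tW : smooth_target W} k O
    (B : set 'rV[R]_k) (f : M -> 'rV[R]_k) (g : 'rV[R]_k -> W) :
  open O -> open B -> (forall x, O x -> B (f x)) ->
  smooth_fun O f -> Cinf_on B g -> smooth_fun O (g \o f).
Proof.
move=> oO oB OB fC gC c.
apply: (Cinf_comp (chart_image_open c oO) oB _ (fC c) gC).
by move=> y /chart_imageP[Oy _ _]; exact: OB.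
Qed.

Lemma smooth_fun_continuous (W : normedModType R) O (f : M -> W) x : O x ->
  smooth_fun O f -> {for x, continuous f}.
Proof.
move=> Ox fC.
have [cf _] := fC x [::] _ (phi_image Ox (@dom_self _ _ M x)).
have cfp : {for x, continuous ((f \o psi M x) \o phi M x)}.
  by apply: continuous_comp => //; apply: phi_continuous; exact: dom_self.
have E : \forall z \near x, ((f \o psi M x) \o phi M x) z = f z.
  near=> z; rewrite /= phiK//; near: z; apply: open_nbhs_nbhs.
  by split; [exact: dom_open|exact: dom_self].
move: cfp; rewrite /prop_for /continuous_at /= phiK; last exact: dom_self.
by move=> cfp; apply: cvg_trans cfp; exact: (near_eq_cvg E).
Unshelve. all: by end_near. Qed.

Lemma smooth_fun_preim_open (W : normedModType R) O (f : M -> W) (B : set W) : open O ->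
  smooth_fun O f -> open B -> open (O `&` f @^-1` B).
Proof.
move=> oO fC oB; rewrite openE => x [Ox Bx]; rewrite /interior.
have H1 : \forall z \near x, O z by exact: open_nbhs_nbhs.
have H2 : \forall z \near x, B (f z).
  by apply: (smooth_fun_continuous Ox fC); exact: open_nbhs_nbhs.
by near=> z; split; near: z.
Unshelve. all: by end_near. Qed.

Lemma smooth_map_continuous n' (M' : manifold R n') O (f : M -> M') x : O x ->
  smooth_map O f -> {for x, continuous f}.
Proof.
move=> Ox fC.
have [/(_ _ (phi_image Ox (@dom_self _ _ M x))) cf _] := fC x.
have cfp : {for x, continuous ((f \o psi M x) \o phi M x)}.
  by apply: continuous_comp => //; apply: phi_continuous; exact: dom_self.
have E : \forall z \near x, ((f \o psi M x) \o phi M x) z = f z.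
  near=> z; rewrite /= phiK//; near: z; apply: open_nbhs_nbhs.
  by split; [exact: dom_open|exact: dom_self].
move: cfp; rewrite /prop_for /continuous_at /= phiK; last exact: dom_self.
by move=> cfp; apply: cvg_trans cfp; exact: (near_eq_cvg E).
Unshelve. all: by end_near. Qed.

Lemma smooth_map_preim_open n' (M' : manifold R n') O (f : M -> M') (B : set M') : open O ->
  smooth_map O f -> open B -> open (O `&` f @^-1` B).
Proof.
move=> oO fC oB; rewrite openE => x [Ox Bx]; rewrite /interior.
have H1 : \forall z \near x, O z by exact: open_nbhs_nbhs.
have H2 : \forall z \near x, B (f z).
  by apply: (smooth_map_continuous Ox fC); exact: open_nbhs_nbhs.
by near=> z; split; near: z.
Unshelve. all: by end_near. Qed.

End Functions.

(** * Tangent maps *)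

Section Tangent.
Context {R : realType}.

(* The velocity at y in direction w of a parametrized piece of M, as a tangent
   vector at a y. *)
Definition tplot k n (M : manifold R n) (a : 'rV[R]_k -> M) (y w : 'rV[R]_k) : 'rV[R]_n :=
  'd (phi M (a y) \o a) y w.

Lemma plot_differentiable k n (M : manifold R n) (V : set 'rV[R]_k) (a : 'rV[R]_k -> M) c y :
  open V -> smooth_plot V a -> V y -> dom M c (a y) -> differentiable (phi M c \o a) y.
Proof.
move=> oV [ca aC] Vy cy.
apply: (Cinf_differentiable (A := V `&` a @^-1` dom M c) _ (aC c)) => //.
by apply: plot_preim_open => //; exact: dom_open.
Qed.

Section Functions.
Context {n : nat} {M : manifold R n} {W : normedModType R} {tW : smooth_target W}.
Implicit Types (O : set M) (f g : M -> W).
Local Notation im c O := (phi M c @` (O `&` dom M c)).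

Lemma smooth_fun_differentiable O f c x : open O -> smooth_fun O f -> O x -> dom M c x ->
  differentiable (f \o psi M c) (phi M c x).
Proof.
move=> oO fC Ox cx.
exact: (Cinf_differentiable (chart_image_open c oO) (fC c) (phi_image Ox cx)).
Qed.

(** The chart at [a y] occurs in [dfun] and its inverse in [tplot]; they cancel near [y], leaving
    the ordinary chain rule. The other chain rules for tangent maps reduce to this one. *)
Lemma dfun_tplot k O f (V : set 'rV[R]_k) (a : 'rV[R]_k -> M) y w :
  open O -> open V -> smooth_fun O f -> smooth_plot V a -> V y -> O (a y) ->
  'd (f \o a) y w = dfun f (a y) (tplot a y w).
Proof.
move=> oO oV fC aC Vy Oy; rewrite /dfun /tplot.
have ya := @dom_self _ _ M (a y).
have d1 : differentiable (phi M (a y) \o a) y by exact: plot_differentiable aC Vy ya.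
have d2 : differentiable (f \o psi M (a y)) ((phi M (a y) \o a) y).
  exact: (smooth_fun_differentiable oO fC Oy ya).
rewrite -[RHS]/(('d (f \o psi M (a y)) (phi M (a y) (a y)) \o 'd (phi M (a y) \o a) y) w).
rewrite -(diff_comp d1 d2).
have oB : open (V `&` a @^-1` (O `&` dom M (a y))).
  by apply: (plot_preim_open oV aC.1); apply: openI => //; exact: dom_open.
have By : (V `&` a @^-1` (O `&` dom M (a y))) y by [].
have E z : (V `&` a @^-1` (O `&` dom M (a y))) z ->
    ((f \o psi M (a y)) \o (phi M (a y) \o a)) z = (f \o a) z.
  by move=> [_ [_ cz]]; rewrite /= phiK.
have d3 := differentiable_comp d1 d2.
apply/esym/(eq_diff w oB By E d3).
apply: (Cinf_differentiable (A := V `&` a @^-1` O)) => //.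
  exact: (plot_preim_open oV aC.1 oO).
apply: (plot_fun (V := V `&` a @^-1` O) (O := O)) => //.
- exact: (plot_preim_open oV aC.1 oO).
- by apply: smooth_plot_sub aC => z [].
- by move=> z [].
Qed.

End Functions.

(** Composing [f] with the chart of [M'] at [f (a y)] gives a vector-valued function, to which
    [dfun_tplot] applies. *)
Lemma tplot_map k n n' (M : manifold R n) (M' : manifold R n') (O : set M) (f : M -> M')
    (V : set 'rV[R]_k) (a : 'rV[R]_k -> M) y w :
  open O -> open V -> smooth_map O f -> smooth_plot V a -> V y -> O (a y) ->
  tplot (f \o a) y w = tmap f (a y) (tplot a y w).
Proof.
move=> oO oV fC aC Vy Oy.
have oO' : open (O `&` f @^-1` dom M' (f (a y))).
  by apply: (smooth_map_preim_open oO fC); exact: dom_open.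
apply: (dfun_tplot (f := phi M' (f (a y)) \o f) w oO' oV _ aC Vy).
- apply: (smooth_fun_comp (O' := dom M' (f (a y))) oO').
  + exact: dom_open.
  + by move=> x [].
  + by apply: smooth_map_sub fC => x [].
  + exact: smooth_fun_phi.
- by split => //; exact: dom_self.
Qed.

Lemma tplot_comp k l n (M : manifold R n) (V : set 'rV[R]_k) (a : 'rV[R]_k -> M)
    (g : 'rV[R]_l -> 'rV[R]_k) z w :
  open V -> smooth_plot V a -> V (g z) -> differentiable g z ->
  tplot (a \o g) z w = tplot a (g z) ('d g z w).
Proof.
move=> oV aC Vz gd; rewrite /tplot.
have d1 : differentiable (phi M (a (g z)) \o a) (g z).
  by apply: (plot_differentiable oV aC) => //; exact: dom_self.
by rewrite -[_ \o (a \o g)]/((phi M (a (g z)) \o a) \o g) (diff_comp gd d1).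
Qed.

Lemma eq_tplot k n (M : manifold R n) (V : set 'rV[R]_k) (a b : 'rV[R]_k -> M) y w :
  open V -> (forall z, V z -> a z = b z) -> smooth_plot V a -> V y ->
  tplot a y w = tplot b y w.
Proof.
move=> oV ab aC Vy; rewrite /tplot -(ab _ Vy).
have bC : smooth_plot V b by exact: (eq_smooth_plot oV ab aC).
apply: (eq_diff _ oV Vy) => [z Vz||]; first by rewrite /= (ab _ Vz).
  by apply: (plot_differentiable oV aC) => //; exact: dom_self.
by apply: (plot_differentiable oV bC) => //; rewrite -ab//; exact: dom_self.
Qed.

Section Charts.
Context {n : nat} {M : manifold R n}.
Implicit Types (O : set M) (c x : M).
Local Notation im c O := (phi M c @` (O `&` dom M c)).

Lemma imT_open c : open (im c setT).
Proof. by apply: chart_image_open; exact: openT. Qed.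

Arguments imT_open : clear implicits.

Lemma imTx c x : dom M c x -> im c setT (phi M c x).
Proof. by move=> cx; exists x. Qed.

Lemma tvecE c x w : dom M c x -> tvec c x w = tplot (psi M c) (phi M c x) w.
Proof. by move=> cx; rewrite /tvec /tplot phiK. Qed.

Lemma tvec_self x w : tvec x x w = w.
Proof.
rewrite /tvec.
transitivity ('d (@id 'rV[R]_n) (phi M x x) w); last first.
  by rewrite -deriveE ?derive_id.
apply: (eq_diff (V := 'rV[R]_n) _ (imT_open x) (imTx (@dom_self _ _ M x))) => //.
  by move=> y /chart_imageP[].
apply: (plot_differentiable (imT_open x) (smooth_plot_psi x) (imTx (@dom_self _ _ M x))).
by rewrite phiK; exact: dom_self.
Qed.

Lemma tplot_psi_self x w : tplot (psi M x) (phi M x x) w = w.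
Proof. by rewrite -tvecE ?tvec_self//; exact: dom_self. Qed.

Lemma tcoordK c x v : dom M c x -> tvec c x (tcoord c x v) = v.
Proof.
move=> cx; have xx := @dom_self _ _ M x; have e := phiK xx.
have d1 : differentiable (phi M c \o psi M x) (phi M x x).
  by apply: (plot_differentiable (imT_open x) (smooth_plot_psi x) (imTx xx)); rewrite e.
have d2 : differentiable (phi M x \o psi M c) ((phi M c \o psi M x) (phi M x x)).
  rewrite /= e.
  by apply: (plot_differentiable (imT_open c) (smooth_plot_psi c) (imTx cx)); rewrite phiK.
have D : 'd ((phi M x \o psi M c) \o (phi M c \o psi M x)) (phi M x x) v =
    tvec c x (tcoord c x v).
  by apply: etrans (congr1 (fun F => F v) (diff_comp d1 d2)) _; rewrite /= e.
rewrite -D; transitivity ('d (@id 'rV[R]_n) (phi M x x) v); last by rewrite -deriveE ?derive_id.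
have oB := chart_image_open x (@dom_open _ _ M c).
have bx := phi_image cx xx.
apply: (eq_diff (V := 'rV[R]_n) _ oB bx) => [y /chart_imageP[cy xy yE]||].
- by rewrite /= phiK.
- exact: (differentiable_comp d1 d2).
- by [].
Qed.

Lemma tvecK c x w : dom M c x -> tcoord c x (tvec c x w) = w.
Proof.
move=> cx; rewrite tvecE// -[tcoord c x]/(dfun (phi M c) x).
have := dfun_tplot (f := phi M c) (a := psi M c) (y := phi M c x) w (@dom_open _ _ M c)
  (imT_open c) (@smooth_fun_phi _ _ M c) (smooth_plot_psi c) (imTx cx).
rewrite phiK// => /(_ (@mx_smooth_target _ _ _) cx) <-.
transitivity ('d (@id 'rV[R]_n) (phi M c x) w); last by rewrite -deriveE ?derive_id.
apply: (eq_diff (V := 'rV[R]_n) _ (imT_open c) (imTx cx)) => //; first by move=> y /chart_imageP[].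
by apply: (plot_differentiable (imT_open c) (smooth_plot_psi c) (imTx cx)); rewrite phiK.
Qed.

Lemma tmap_id x v : tmap (@id M) x v = v.
Proof.
rewrite -[RHS](tplot_psi_self x) -[v in LHS](tplot_psi_self x).
have := tplot_map (f := @id M) (a := psi M x) (y := phi M x x) v openT (imT_open x)
  (smooth_map_id setT) (smooth_plot_psi x) (imTx (@dom_self _ _ M x)).
by rewrite phiK ?tplot_psi_self; [move=> <-|exact: dom_self].
Qed.

Lemma dfun_tvec (W : normedModType R) {tW : smooth_target W} O (f : M -> W) c x w :
  open O -> smooth_fun O f -> O x -> dom M c x ->
  dfun f x (tvec c x w) = 'd (f \o psi M c) (phi M c x) w.
Proof.
move=> oO fC Ox cx; rewrite tvecE//.
have := dfun_tplot (a := psi M c) (y := phi M c x) w oO (imT_open c) fC (smooth_plot_psi c) (imTx cx).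
by rewrite phiK// => /(_ tW) ->.
Qed.

Lemma tmap_tvec n' (M' : manifold R n') O (f : M -> M') c x w :
  open O -> smooth_map O f -> O x -> dom M c x ->
  tmap f x (tvec c x w) = tplot (f \o psi M c) (phi M c x) w.
Proof.
move=> oO fC Ox cx; rewrite tvecE//.
have := tplot_map (a := psi M c) (y := phi M c x) w oO (imT_open c) fC (smooth_plot_psi c) (imTx cx).
by rewrite phiK// => ->.
Qed.

Lemma eq_dfun (W : normedModType R) {tW : smooth_target W} O (f g : M -> W) x v :
  open O -> (forall y, O y -> f y = g y) -> smooth_fun O f -> O x -> dfun f x v = dfun g x v.
Proof.
move=> oO fg fC Ox; have xx := @dom_self _ _ M x.
apply: (eq_diff (V := 'rV[R]_n) _ (chart_image_open x oO) (phi_image Ox xx)).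
- by move=> y /chart_imageP[Oy _ _] /=; exact: fg.
- exact: (smooth_fun_differentiable oO fC).
- by apply: (smooth_fun_differentiable oO _ Ox xx); exact: (eq_smooth_fun oO fg fC).
Qed.

Lemma dfun_comp n' (M' : manifold R n') (W : normedModType R) {tW : smooth_target W} O
    (O' : set M') (f : M -> M') (g : M' -> W) x v :
  open O -> open O' -> smooth_map O f -> smooth_fun O' g -> O x -> O' (f x) ->
  dfun (g \o f) x v = dfun g (f x) (tmap f x v).
Proof.
move=> oO oO' fC gC Ox Ofx; have xx := @dom_self _ _ M x.
have oi : open (im x O) by exact: chart_image_open.
have xi := phi_image Ox xx.
have e := phiK xx.
have Ofx' : O' ((f \o psi M x) (phi M x x)) by rewrite /= e.
apply: (etrans (dfun_tplot (a := f \o psi M x) (y := phi M x x) v oO' oi gC (fC x) xi Ofx')).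
have E : tplot (f \o psi M x) (phi M x x) v = tmap f x v by rewrite /tplot /= e.
by rewrite E /= e.
Qed.

Lemma tmap_comp n' n'' (M' : manifold R n') (M'' : manifold R n'') O
    (O' : set M') (f : M -> M') (g : M' -> M'') x v :
  open O -> open O' -> smooth_map O f -> smooth_map O' g -> O x -> O' (f x) ->
  tmap (g \o f) x v = tmap g (f x) (tmap f x v).
Proof.
move=> oO oO' fC gC Ox Ofx; have xx := @dom_self _ _ M x.
have oi : open (im x O) by exact: chart_image_open.
have xi := phi_image Ox xx.
have := tplot_map (a := f \o psi M x) (y := phi M x x) v oO' oi gC (fC x) xi.
rewrite /= phiK// => /(_ Ofx).
rewrite -(tmap_tvec v oO fC Ox xx) tvec_self => <-.
by rewrite /tmap /tplot /= phiK.
Qed.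

Lemma eq_tmap n' (M' : manifold R n') O (f g : M -> M') x v :
  open O -> (forall y, O y -> f y = g y) -> smooth_map O f -> O x -> tmap f x v = tmap g x v.
Proof.
move=> oO fg fC Ox; have xx := @dom_self _ _ M x.
have gC : smooth_map O g by exact: (eq_smooth_map oO fg fC).
rewrite -[v](tvec_self x) (tmap_tvec _ oO fC Ox xx) (tmap_tvec _ oO gC Ox xx).
apply: (eq_tplot _ (chart_image_open x oO) _ (fC x) (phi_image Ox xx)).
by move=> y /chart_imageP[Oy _ _] /=; exact: fg.
Qed.

Lemma dfun_ext (W : normedModType R) (f g : M -> W) x v : f =1 g ->
  dfun f x v = dfun g x v.
Proof. by move=> /funext ->. Qed.

Section Rules.
Context {W : normedModType R} {tW : smooth_target W}.

Lemma dfun_cst (w : W) x v : dfun (fun _ : M => w) x v = 0.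
Proof. by rewrite /dfun -[_ \o _]/(cst w) diff_cst. Qed.

Lemma dfun_add O (f g : M -> W) x v : open O -> smooth_fun O f -> smooth_fun O g -> O x ->
  dfun (fun y => f y + g y) x v = dfun f x v + dfun g x v.
Proof.
move=> oO fC gC Ox; have xx := @dom_self _ _ M x.
have d1 : differentiable (f \o psi M x) (phi M x x) by exact: smooth_fun_differentiable fC Ox xx.
have d2 : differentiable (g \o psi M x) (phi M x x) by exact: smooth_fun_differentiable gC Ox xx.
exact: (congr1 (fun F => F v) (diffD d1 d2)).
Qed.

Lemma dfun_scale O (k : M -> R^o) (f : M -> W) x v :
  open O -> smooth_fun O k -> smooth_fun O f -> O x ->
  dfun (fun y => k y *: f y) x v = dfun k x v *: f x + k x *: dfun f x v.
Proof.
move=> oO kC fC Ox; have xx := @dom_self _ _ M x; rewrite /dfun.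
apply: (etrans (diff_scale v (chart_image_open x oO) (phi_image Ox xx) (kC x) (fC x))).
by rewrite /= phiK.
Qed.

End Rules.

Lemma dfun_mulmx O p q r (f : M -> 'M[R]_(p, q)) (g : M -> 'M[R]_(q, r)) x v :
  open O -> smooth_fun O f -> smooth_fun O g -> O x ->
  dfun (fun y => f y *m g y) x v = dfun f x v *m g x + f x *m dfun g x v.
Proof.
move=> oO fC gC Ox; have xx := @dom_self _ _ M x; rewrite /dfun.
apply: (etrans (diff_mulmx v (chart_image_open x oO) (phi_image Ox xx) (fC x) (gC x))).
by rewrite /= phiK.
Qed.

Lemma dfun_entry O p q (f : M -> 'M[R]_(p, q)) x v i j : open O -> smooth_fun O f -> O x ->
  (dfun f x v) i j = dfun (fun y => f y i j : R^o) x v.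
Proof.
move=> oO fC Ox; have xx := @dom_self _ _ M x; rewrite /dfun.
have d1 : differentiable (f \o psi M x) (phi M x x) by exact: smooth_fun_differentiable fC Ox xx.
have fijC := smooth_fun_entry i j oO fC.
have d2 : differentiable ((fun y => f y i j : R^o) \o psi M x) (phi M x x).
  exact: smooth_fun_differentiable fijC Ox xx.
exact: diff_entry.
Qed.

Lemma dfun_trmx O p q (f : M -> 'M[R]_(p, q)) x v : open O -> smooth_fun O f -> O x ->
  dfun (fun y => (f y)^T) x v = (dfun f x v)^T.
Proof.
move=> oO fC Ox; have xx := @dom_self _ _ M x.
exact: (diff_trmx v (chart_image_open x oO) (phi_image Ox xx) (fC x)).
Qed.

End Charts.

End Tangent.

Section LinearForms.
Context {R : realType}.

Lemma linear_sum_delta n (W : lmodType R) (f : 'rV[R]_n -> W) v : linear f ->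
  f v = \sum_(i < n) v 0 i *: f (delta_mx 0 i).
Proof.
move=> fl.
pose fL : {linear 'rV[R]_n -> W} := HB.pack f (GRing.isLinear.Build _ _ _ _ f fl).
rewrite -[f]/(fL : _ -> W) {1}[v]row_sum_delta linear_sum.
by apply: eq_bigr => i _; rewrite linearZ.
Qed.

Lemma linearP_add (V W : lmodType R) (f : V -> W) u v : linear f -> f (u + v) = f u + f v.
Proof. by move=> fl; have := fl 1 u v; rewrite !scale1r. Qed.

Lemma linearP_0 (V W : lmodType R) (f : V -> W) : linear f -> f 0 = 0.
Proof. by move=> fl; have := fl (-1) 0 0; rewrite scaler0 addr0 scaleN1r addNr. Qed.

Lemma linearP_scale (V W : lmodType R) (f : V -> W) k v : linear f -> f (k *: v) = k *: f v.
Proof. by move=> fl; have := fl k v 0; rewrite addr0 linearP_0// addr0. Qed.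

Lemma linearP_opp (V W : lmodType R) (f : V -> W) v : linear f -> f (- v) = - f v.
Proof. by move=> fl; rewrite -scaleN1r linearP_scale// scaleN1r. Qed.

Lemma linearP_sub (V W : lmodType R) (f : V -> W) u v : linear f -> f (u - v) = f u - f v.
Proof. by move=> fl; rewrite linearP_add// linearP_opp. Qed.

Lemma linearP_sum (V W : lmodType R) (f : V -> W) (I : Type) (r : seq I) (P : pred I)
    (F : I -> V) : linear f -> f (\sum_(i <- r | P i) F i) = \sum_(i <- r | P i) f (F i).
Proof.
move=> fl; elim: r => [|i r IH]; first by rewrite !big_nil linearP_0.
by rewrite !big_cons; case: ifP => _ //; rewrite linearP_add// IH.
Qed.

End LinearForms.

(** * Vector fields and one-forms *)

Section Fields.
Context {R : realType} {n : nat} {M : manifold R n}.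
Implicit Types (O U : set M) (c x : M) (X Y : M -> 'rV[R]_n).
Local Notation im c O := (phi M c @` (O `&` dom M c)).

Lemma tcoord_linear c x : linear (tcoord c x).
Proof. by move=> k u v; rewrite /tcoord linearP. Qed.

Lemma tvec_linear c x : linear (tvec c x).
Proof. by move=> k u v; rewrite /tvec linearP. Qed.

Lemma tmap_linear n' (M' : manifold R n') (f : M -> M') x : linear (tmap f x).
Proof. by move=> k u v; rewrite /tmap linearP. Qed.

Lemma dfun_linear (W : normedModType R) (f : M -> W) x : linear (dfun f x).
Proof. by move=> k u v; rewrite /dfun linearP. Qed.

Definition form_on (W : normedModType R) O (t : M -> 'rV[R]_n -> W) : Prop :=
  (forall x, O x -> linear (t x)) /\
  forall c w, smooth_fun (O `&` dom M c) (fun x => t x (tvec c x w)).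

Lemma one_form_on (W : normedModType R) (t : M -> 'rV[R]_n -> W) :
  one_form t -> form_on setT t.
Proof. by move=> [tl tC]; split=> [x _|c w]; rewrite ?setTI. Qed.

Lemma form_on_sub (W : normedModType R) O U (t : M -> 'rV[R]_n -> W) :
  U `<=` O -> form_on O t -> form_on U t.
Proof.
move=> UO [tl tC]; split=> [x /UO|c w]; first exact: tl.
by apply: smooth_fun_sub (tC c w) => x [/UO].
Qed.

Lemma openId O c : open O -> open (O `&` dom M c).
Proof. by move=> oO; apply: openI => //; exact: dom_open. Qed.

Lemma self_Id O x : O x -> (O `&` dom M x) x.
Proof. by move=> Ox; split=> //; exact: dom_self. Qed.

Lemma smooth_field_sub O U X : U `<=` O -> smooth_field O X -> smooth_field U X.
Proof. by move=> UO XC c; apply: smooth_fun_sub (XC c) => x [/UO]. Qed.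

Lemma smooth_field_local O X :
  (forall x, O x -> exists U : set M, U x /\ smooth_field U X) -> smooth_field O X.
Proof.
move=> H c; apply: smooth_fun_local => x [/H[U [Ux XC]] cx].
by exists (U `&` dom M c).
Qed.

Lemma eq_smooth_field O X Y : open O -> (forall x, O x -> X x = Y x) ->
  smooth_field O X -> smooth_field O Y.
Proof.
move=> oO XY XC c; apply: (eq_smooth_fun (openId c oO) _ (XC c)) => x [Ox _].
by rewrite XY.
Qed.

Lemma smooth_field_add O X Y : open O -> smooth_field O X -> smooth_field O Y ->
  smooth_field O (fun x => X x + Y x).
Proof.
move=> oO XC YC c; apply: (eq_smooth_fun (openId c oO) _ (smooth_fun_add (openId c oO) (XC c) (YC c))).
by move=> x _; rewrite (linearP_add _ _ (tcoord_linear c x)).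
Qed.

Lemma smooth_field_scale O (k : M -> R^o) X : open O -> smooth_fun O k -> smooth_field O X ->
  smooth_field O (fun x => k x *: X x).
Proof.
move=> oO kC XC c; have kC' : smooth_fun (O `&` dom M c) k by apply: smooth_fun_sub kC => x [].
apply: (eq_smooth_fun (openId c oO) _ (smooth_fun_scale (openId c oO) kC' (XC c))).
by move=> x _; rewrite (linearP_scale _ _ (tcoord_linear c x)).
Qed.

Lemma smooth_field_opp O X : open O -> smooth_field O X -> smooth_field O (fun x => - X x).
Proof.
move=> oO XC.
apply: (eq_smooth_field oO _ (smooth_field_scale oO (smooth_fun_cst (-1 : R^o) oO) XC)) => x _.
by rewrite scaleN1r.
Qed.

Lemma smooth_field_subr O X Y : open O -> smooth_field O X -> smooth_field O Y ->
  smooth_field O (fun x => X x - Y x).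
Proof. by move=> oO XC YC; apply: (smooth_field_add oO XC); exact: smooth_field_opp. Qed.

Lemma smooth_field_cst0 O : open O -> smooth_field O (fun=> 0).
Proof.
move=> oO c; apply: (eq_smooth_fun (openId c oO) _ (smooth_fun_cst (0 : 'rV[R]_n) (openId c oO))).
by move=> x _; rewrite (linearP_0 (tcoord_linear c x)).
Qed.

Lemma smooth_field_sum O (I : Type) (r : seq I) (F : I -> M -> 'rV[R]_n) : open O ->
  (forall i, smooth_field O (F i)) -> smooth_field O (fun x => \sum_(i <- r) F i x).
Proof.
move=> oO FC; elim: r => [|i r IH].
  by apply: (eq_smooth_field oO _ (smooth_field_cst0 oO)) => x _; rewrite big_nil.
apply: (eq_smooth_field oO _ (smooth_field_add oO (FC i) IH)) => x _.
by rewrite big_cons.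
Qed.

Lemma dfun_form (W : normedModType R) {tW : smooth_target W} O (f : M -> W) :
  open O -> smooth_fun O f -> form_on O (dfun f).
Proof.
move=> oO fC; split=> [x _|c w]; first exact: dfun_linear.
have oOc := openId c oO; have oi : open (im c O) by exact: chart_image_open.
apply: (eq_smooth_fun (f := (fun y => 'd (f \o psi M c) y w) \o phi M c) oOc) => [x [Ox cx]|].
  exact: esym (dfun_tvec w oO fC Ox cx).
apply: (smooth_fun_post oOc oi) => [x [Ox cx]||].
- exact: phi_image.
- by apply: smooth_fun_sub (@smooth_fun_phi _ _ M c) => x [].
- exact: (Cinf_diff w oi (fC c)).
Qed.

Lemma smooth_field_chart c w : smooth_field (dom M c) (fun x => tvec c x w).
Proof.
move=> d; have [_ H] := dfun_form (@dom_open _ _ M d) (@smooth_fun_phi _ _ M d).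
by rewrite setIC; exact: H.
Qed.

Lemma field_tvec_sum c x (v : 'rV[R]_n) : dom M c x ->
  v = \sum_(i < n) (tcoord c x v) 0 i *: tvec c x (delta_mx 0 i).
Proof.
by move=> cx; rewrite -linear_sum_delta ?tcoordK//; exact: tvec_linear.
Qed.

Lemma smooth_fieldI O c X : open O -> O `<=` dom M c ->
  smooth_fun O (fun x => tcoord c x (X x)) -> smooth_field O X.
Proof.
move=> oO Oc XC.
apply: (eq_smooth_field (X := fun x => \sum_(i < n) (tcoord c x (X x)) 0 i *: tvec c x (delta_mx 0 i)) oO).
  by move=> x /Oc cx; rewrite -field_tvec_sum.
apply: smooth_field_sum => // i; apply: smooth_field_scale => //.
  exact: smooth_fun_entry.
by apply: smooth_field_sub Oc _; exact: smooth_field_chart.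
Qed.

Lemma smooth_fun_tcoord O c X : open O -> smooth_field O X -> O `<=` dom M c ->
  smooth_fun O (fun x => tcoord c x (X x)).
Proof.
by move=> oO XC Oc; apply: smooth_fun_sub (XC c) => x Ox; split=> //; exact: Oc.
Qed.

Lemma form_field (W : normedModType R) {tW : smooth_target W} O (t : M -> 'rV[R]_n -> W) X :
  open O -> form_on O t -> smooth_field O X -> smooth_fun O (fun x => t x (X x)).
Proof.
move=> oO [tl tC] XC; apply: smooth_fun_local => x Ox.
exists (O `&` dom M x); split; first exact: self_Id.
have oOx := openId x oO.
apply: (eq_smooth_fun (f := fun y => \sum_(i < n) ((tcoord x y (X y)) 0 i : R^o) *: t y (tvec x y (delta_mx 0 i))) oOx).
  move=> y [Oy xy]; rewrite [in RHS](field_tvec_sum (X y) xy) (linearP_sum _ _ _ (tl _ Oy)).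
  by apply: eq_bigr => i _; rewrite (linearP_scale _ _ (tl _ Oy)).
apply: (smooth_fun_sum _ oOx) => i _; apply: (smooth_fun_scale oOx); last exact: tC.
exact: (smooth_fun_entry _ _ oOx (XC x)).
Qed.

Lemma dfun_field (W : normedModType R) {tW : smooth_target W} O (f : M -> W) X :
  open O -> smooth_fun O f -> smooth_field O X -> smooth_fun O (fun x => dfun f x (X x)).
Proof. by move=> oO fC XC; apply: (form_field oO _ XC); exact: dfun_form. Qed.

(** In a coordinate frame an injective form has an invertible matrix [Am], so the components of [X]
    are those of [t(X)] times the inverse matrix, which is smooth. This is how fields defined only
    through their images are shown to be smooth. *)
Lemma smooth_field_coframe O (t : M -> 'rV[R]_n -> 'rV[R]_n) X :
  open O -> form_on O t -> (forall x v, O x -> t x v = 0 -> v = 0) ->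
  smooth_fun O (fun x => t x (X x)) -> smooth_field O X.
Proof.
move=> oO [tl tC] tinj tX; apply: smooth_field_local => x Ox.
exists (O `&` dom M x); split; first exact: self_Id.
have oOx := openId x oO.
pose Am (y : M) : 'M[R]_n := \matrix_i t y (tvec x y (delta_mx 0 i)).
have AmE y w : O y -> t y (tvec x y w) = w *m Am y.
  move=> Oy; rewrite (linear_sum_delta (f := fun v => t y (tvec x y v))); last first.
    by move=> k u v; rewrite (tvec_linear x y k u v) tl.
  rewrite mulmx_sum_row; apply: eq_bigr => i _; by rewrite rowK.
have AmC : smooth_fun (O `&` dom M x) Am.
  apply: (smooth_fun_entries oOx) => i j.
  apply: (eq_smooth_fun oOx _ (smooth_fun_entry 0 j oOx (tC x (delta_mx 0 i)))) => y _.
  by rewrite mxE.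
have Amu y : (O `&` dom M x) y -> Am y \in unitmx.
  move=> [Oy xy]; rewrite -row_free_unit; apply/inj_row_free => w.
  rewrite -AmE// => /(tinj _ _ Oy) /(congr1 (tcoord x y)).
  by rewrite tvecK// (linearP_0 (tcoord_linear x y)).
apply: (smooth_fieldI (c := x) oOx) => [y []//|].
apply: (eq_smooth_fun (f := fun y => t y (X y) *m invmx (Am y)) oOx) => [y [Oy xy]|].
  by rewrite -{1}[X y](tcoordK _ xy) AmE// mulmxK//; exact: Amu.
apply: (smooth_fun_mulmx oOx); last exact: smooth_fun_invmx.
by apply: smooth_fun_sub tX => y [].
Qed.

End Fields.

Section Pullback.
Context {R : realType} {n n' : nat} {M : manifold R n} {M' : manifold R n'}.

(** In a chart [d] of the target, [t (T s v)] is a sum of derivatives of the coordinate functions of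
    [s] times the values of [t] on the coordinate fields along [s]. *)
Lemma pullback_form (W : normedModType R) {tW : smooth_target W}
    (O : set M) (s : M -> M') (t : M' -> 'rV[R]_n' -> W) :
  open O -> smooth_map O s -> one_form t -> form_on O (fun x v => t (s x) (tmap s x v)).
Proof.
move=> oO sC [tl tC]; split=> [x _ k u v|c w].
  by rewrite (tmap_linear s x k u v) tl.
have oOc := openId c oO.
apply: smooth_fun_local => x [Ox cx].
pose d := s x; pose B := (O `&` dom M c) `&` (O `&` s @^-1` dom M' d).
have oB : open B by apply: openI => //; apply: (smooth_map_preim_open oO sC); exact: dom_open.
exists B; split; first by do !split=> //; exact: dom_self.
pose f := phi M' d \o s.
have fC : smooth_fun (O `&` s @^-1` dom M' d) f.
  apply: (smooth_fun_comp (O' := dom M' d)); last exact: smooth_fun_phi.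
  - by apply: (smooth_map_preim_open oO sC); exact: dom_open.
  - exact: dom_open.
  - by move=> y [].
  - by apply: smooth_map_sub sC => y [].
have oOs : open (O `&` s @^-1` dom M' d) by apply: (smooth_map_preim_open oO sC); exact: dom_open.
have fl y v : B y -> t (s y) (tmap s y v) =
    \sum_(i < n') (dfun f y v) 0 i *: t (s y) (tvec d (s y) (delta_mx 0 i)).
  move=> [_ [Oy sy]].
  rewrite {1}(field_tvec_sum (tmap s y v) sy) (linearP_sum _ _ _ (tl _)).
  apply: eq_bigr => i _; rewrite (linearP_scale _ _ (tl _)); congr (_ 0 i *: _).
  by rewrite (dfun_comp v oO (@dom_open _ _ M' d) sC (@smooth_fun_phi _ _ M' d) Oy sy).
apply: (eq_smooth_fun (f := fun y => \sum_(i < n') ((dfun f y (tvec c y w)) 0 i : R^o)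
    *: t (s y) (tvec d (s y) (delta_mx 0 i))) oB) => [y By|].
  by rewrite fl.
apply: (smooth_fun_sum _ oB) => i _; apply: (smooth_fun_scale oB).
  apply: (smooth_fun_entry _ _ oB).
  have [_ H] := dfun_form oOs fC.
  by apply: smooth_fun_sub (H c w) => y [[_ ?] ?].
apply: (smooth_fun_comp (f := s) (g := fun u => t u (tvec d u (delta_mx 0 i))) oB (@dom_open _ _ M' d)) => //.
- by move=> y [_ []].
- by apply: smooth_map_sub sC => y [[]].
Qed.

End Pullback.

(** * Symmetric two-tensors *)

Section Tensors.
Context {R : realType} {m : nat} {N : manifold R m.+1}.
Implicit Types (O : set N) (X Y : N -> 'rV[R]_m.+1).

Section Algebra.
Variable h : N -> 'rV[R]_m.+1 -> 'rV[R]_m.+1 -> R.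
Hypothesis hT : sym_tensor h.

Lemma tensor_linear x v : linear (h x v : 'rV[R]_m.+1 -> R^o).
Proof. by case: hT. Qed.

Lemma tensorC x v w : h x v w = h x w v.
Proof. by case: hT. Qed.

Lemma tensorDr x v w w' : h x v (w + w') = h x v w + h x v w'.
Proof. exact: (linearP_add _ _ (tensor_linear x v)). Qed.

Lemma tensorZr x v k w : h x v (k *: w) = k * h x v w.
Proof. exact: (linearP_scale _ _ (tensor_linear x v)). Qed.

Lemma tensor0r x v : h x v 0 = 0.
Proof. exact: (linearP_0 (tensor_linear x v)). Qed.

Lemma tensorBr x v w w' : h x v (w - w') = h x v w - h x v w'.
Proof. exact: (linearP_sub _ _ (tensor_linear x v)). Qed.

Lemma tensor_sumr x v (I : Type) (r : seq I) (F : I -> 'rV[R]_m.+1) :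
  h x v (\sum_(i <- r) F i) = \sum_(i <- r) h x v (F i).
Proof. exact: (linearP_sum r predT F (tensor_linear x v)). Qed.

Lemma tensorDl x v w w' : h x (w + w') v = h x w v + h x w' v.
Proof. by rewrite tensorC tensorDr !(tensorC x v). Qed.

Lemma tensorZl x v k w : h x (k *: w) v = k * h x w v.
Proof. by rewrite tensorC tensorZr tensorC. Qed.

Lemma tensor0l x v : h x 0 v = 0.
Proof. by rewrite tensorC tensor0r. Qed.

Lemma tensorBl x v w w' : h x (w - w') v = h x w v - h x w' v.
Proof. by rewrite tensorC tensorBr !(tensorC x v). Qed.

Lemma tensor_suml x v (I : Type) (r : seq I) (F : I -> 'rV[R]_m.+1) :
  h x (\sum_(i <- r) F i) v = \sum_(i <- r) h x (F i) v.
Proof. by rewrite tensorC tensor_sumr; apply: eq_bigr => i _; exact: tensorC. Qed.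

Lemma tensor_field O X Y : open O -> smooth_field O X -> smooth_field O Y ->
  smooth_fun O (fun x => h x (X x) (Y x) : R^o).
Proof.
move=> oO XC YC; apply: smooth_fun_local => x Ox.
exists (O `&` dom N x); split; first exact: self_Id.
have oOx := openId x oO.
apply: (eq_smooth_fun (f := fun y => \sum_(i < m.+1) ((tcoord x y (X y)) 0 i : R^o) *:
  \sum_(j < m.+1) ((tcoord x y (Y y)) 0 j : R^o) *:
    (h y (tvec x y (delta_mx 0 i)) (tvec x y (delta_mx 0 j)) : R^o)) oOx).
  move=> y [Oy xy]; rewrite [in RHS](field_tvec_sum (X y) xy) tensor_suml.
  apply: eq_bigr => i _; rewrite tensorZl; congr (_ * _).
  rewrite [in RHS](field_tvec_sum (Y y) xy) tensor_sumr.
  by apply: eq_bigr => j _; rewrite tensorZr.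
apply: (smooth_fun_sum _ oOx) => i _; apply: (smooth_fun_scale oOx).
  exact: (smooth_fun_entry _ _ oOx (XC x)).
apply: (smooth_fun_sum _ oOx) => j _; apply: (smooth_fun_scale oOx).
  exact: (smooth_fun_entry _ _ oOx (YC x)).
by case: hT => _ _ hC; apply: smooth_fun_sub (hC x _ _) => y [].
Qed.

End Algebra.

End Tensors.

(** * Bump functions and global one-forms *)

Section Bump.
Context {R : realType}.

Definition cutoff (e t : R) : R :=
  flat_exp 1 (2 * e - t) / (flat_exp 1 (2 * e - t) + flat_exp 1 (t - e)).

Lemma cutoff_denom_gt0 (e t : R) : 0 < e ->
  0 < flat_exp 1 (2 * e - t) + flat_exp 1 (t - e).
Proof.
move=> e0; have [te|te] := ltP t (2 * e).
  by apply: ltr_wpDr; [exact: flat_exp1_ge0|apply: flat_exp1_gt0; rewrite subr_gt0].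
apply: ltr_wpDl; [exact: flat_exp1_ge0|apply: flat_exp1_gt0].
by rewrite subr_gt0; apply: lt_le_trans te; rewrite mulr_natl mulr2n ltrDl.
Qed.

Lemma cutoff_ge0 (e t : R) : 0 < e -> 0 <= cutoff e t.
Proof.
by move=> e0; rewrite divr_ge0 ?flat_exp1_ge0 ?ltW// cutoff_denom_gt0.
Qed.

Lemma cutoff1 (e t : R) : 0 < e -> t <= e -> cutoff e t = 1.
Proof.
move=> e0 te; rewrite /cutoff [flat_exp 1 (t - e)]flat_exp_le0 ?subr_le0// addr0 divff//.
rewrite gt_eqF// flat_exp1_gt0// subr_gt0 (le_lt_trans te)//.
by rewrite mulr_natl mulr2n ltrDl.
Qed.

Lemma cutoff0 (e t : R) : 2 * e <= t -> cutoff e t = 0.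
Proof. by move=> te; rewrite /cutoff flat_exp_le0 ?mul0r// subr_le0. Qed.

Context {n : nat} {M : manifold R n}.
Implicit Types (O U : set M) (x c : M).

(** The support is encoded by an open set [O2] on which [chi] vanishes and which covers the manifold
    together with [O]. A product [chi * f] with [f] smooth on [O] is then smooth on each of two open
    sets covering the manifold. *)
Lemma bump_function O x : open O -> O x ->
  exists (chi : M -> R^o) (O1 O2 : set M),
    [/\ smooth_fun setT chi, forall y, 0 <= chi y,
        [/\ open O1, O1 x, O1 `<=` O & forall y, O1 y -> chi y = 1] &
        [/\ open O2, forall y, O y \/ O2 y & forall y, O2 y -> chi y = 0]].
Proof.
move=> oO Ox; have xx := @dom_self _ _ M x.
pose U := O `&` dom M x; pose y0 := phi M x x.
have oU : open U by exact: openId.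
have oB : open (phi M x @` U) by exact: chart_image_open.
have By0 : (phi M x @` U) y0 by exists x.
have /nbhs_ballP [r /= r0 rB] : nbhs y0 (phi M x @` U) by exact: open_nbhs_nbhs.
(* The squared Euclidean distance, since the norm of ['rV[R]_n] is the sup norm and is not
   smooth. *)
pose q (y : 'rV[R]_n) : R^o := \sum_(i < n) (y 0 i - y0 0 i) ^+ 2.
have qC (A : set 'rV[R]_n) : open A -> Cinf_on A q.
  move=> oA; apply: (Cinf_sum _ oA) => i _.
  have H : Cinf_on A (fun y : 'rV[R]_n => y 0 i - y0 0 i : R^o).
    apply: (Cinf_sub_fun oA); last exact: Cinf_cst.
    exact: (Cinf_entry 0 i oA (Cinf_id oA)).
  by apply: (eq_Cinf oA _ (Cinf_mul oA H H)) => y _; rewrite expr2.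
(* The cutoff vanishes for [q >= 2 * e = r^2 / 2], so its support lies within distance
   [r * sqrt (1/2) < r * (3/4)] of [y0], well inside the ball of radius [r]. *)
pose e := r ^+ 2 / 4.
have e0 : 0 < e by rewrite divr_gt0// exprn_gt0.
pose K := [set y | q y <= 2 * e].
have Kr y : K y -> ball y0 (r * (3 / 4)) y.
  move=> Ky; rewrite -ball_normE /=; apply: (@le_lt_trans _ _ (r * Num.sqrt (1 / 2))).
    apply: mx_norm_le; first by rewrite mulr_ge0// ?sqrtr_ge0// ltW.
    move=> i j; rewrite !mxE ord1 -ler_sqr ?nnegrE ?mulr_ge0 ?sqrtr_ge0 ?(ltW r0)//.
    rewrite real_normK ?num_real// exprMn sqr_sqrtr//.
    apply: (@le_trans _ _ (2 * e)); last by rewrite /e; lra.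
    apply: le_trans Ky; rewrite /q (bigD1 j)//= -[leLHS]addr0 -sqrrN opprB lerD2l.
    by apply: sumr_ge0 => k _; exact: sqr_ge0.
  rewrite ltr_pM2l// -ltr_sqr ?nnegrE ?sqrtr_ge0 ?divr_ge0// sqr_sqrtr// expr2; lra.
have KB : K `<=` phi M x @` U.
  move=> y /Kr H; apply: rB; apply: le_ball H.
  by rewrite ler_piMr ?ltW//; lra.
have cq : continuous q.
  by move=> y; exact: (qC setT openT [::] y I).1.
have cK : compact K.
  apply: bounded_closed_compact.
    exists (`|y0| + r); split; first exact: num_real.
    move=> M0 hM0 y /Kr; rewrite -ball_normE /= => H; apply: ltW.
    apply: le_lt_trans hM0; rewrite -[y](subrK y0) (le_trans (ler_normD _ _))//.
    rewrite addrC lerD2l distrC; apply: le_trans (ltW H) _.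
    by rewrite ler_piMr ?ltW//; lra.
  apply: (closed_comp (f := q) (D := [set t | t <= 2 * e])); last exact: closed_le.
  by move=> y _; exact: cq.
pose C := psi M x @` K.
(* Compactness of [K] and the Hausdorff property make its image closed in the whole manifold and not
   merely in the chart; the extension by zero is smooth for this reason. *)
have cC : closed C.
  apply: compact_closed; first exact: manifold_hausdorff.
  apply: continuous_compact => //; apply: continuous_in_subspaceT => y; rewrite inE => /KB.
  by case=> z [_ xz] <-; exact: psi_continuous.
have CU : C `<=` U.
  by move=> _ [y /KB [z Uz <-] <-]; rewrite phiK//; case: Uz.
pose chi z : R^o := if `[< U z >] then cutoff e (q (phi M x z)) else 0.
pose O2 := ~` C.
have oO2 : open O2 by exact: closed_openC.
have chi0 y : O2 y -> chi y = 0.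
  move=> nCy; rewrite /chi; case: asboolP => // -[Oy xy].
  apply: cutoff0; rewrite leNgt; apply/negP => /ltW qy; apply: nCy.
  by exists (phi M x y) => //; rewrite phiK.
have qphiC : smooth_fun U (q \o phi M x).
  apply: (smooth_fun_post oU openT) => //; last exact: qC openT.
  by apply: smooth_fun_sub (@smooth_fun_phi _ _ M x) => y [].
pose O1 := U `&` (q \o phi M x) @^-1` [set t | t < e].
exists chi, O1, O2; split.
- apply: smooth_fun_local => y _; have [Uy|nUy] := pselect (U y).
    exists U; split; first exact: Uy.
    have c1 : smooth_fun U (fun z => 2 * e - (q \o phi M x) z : R^o).
      exact: (smooth_fun_subr oU (smooth_fun_cst (2 * e : R^o) oU) qphiC).
    have c2 : smooth_fun U (fun z => (q \o phi M x) z - e : R^o).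
      exact: (smooth_fun_subr oU qphiC (smooth_fun_cst (e : R^o) oU)).
    have f1 := smooth_fun_flat oU c1; have f2 := smooth_fun_flat oU c2.
    apply: (eq_smooth_fun oU _ (smooth_fun_mul oU f1 (smooth_fun_inv oU _ (smooth_fun_add oU f1 f2)))).
      by move=> z Uz; rewrite /chi asboolT.
    by move=> z Uz; rewrite gt_eqF// cutoff_denom_gt0.
  exists O2; split; first by move=> /CU.
  by apply: (eq_smooth_fun oO2 _ (smooth_fun_cst 0 oO2)) => z O2z; rewrite chi0.
- by move=> y; rewrite /chi; case: ifP => // _; exact: cutoff_ge0.
- split.
  + by apply: (smooth_fun_preim_open oU qphiC); exact: open_lt.
  + split => //=; rewrite /q big1// => i _; by rewrite subrr expr0n.
  + by move=> y [[]].
  + by move=> y [Uy /ltW qy]; rewrite /chi asboolT//; exact: cutoff1.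
- split=> // y; have [Oy|nOy] := pselect (O y); [by left|right].
  by move=> /CU [].
Qed.

Lemma smooth_fun_glue (W : normedModType R) O (O2 : set M) (f : M -> W) :
  (forall y, O y \/ O2 y) -> smooth_fun O f -> smooth_fun O2 f -> smooth_fun setT f.
Proof.
move=> OO2 fO fO2; apply: smooth_fun_local => y _.
by have [?|?] := OO2 y; [exists O|exists O2].
Qed.

Lemma smooth_fun_extend (W : normedModType R) O (O2 : set M) (chi : M -> R^o) (f : M -> W) :
  open O -> open O2 -> (forall y, O y \/ O2 y) -> (forall y, O2 y -> chi y = 0) ->
  smooth_fun setT chi -> smooth_fun O f -> smooth_fun setT (fun y => chi y *: f y).
Proof.
move=> oO oO2 OO2 chi0 chiC fC; apply: (smooth_fun_glue OO2).
  by apply: smooth_fun_scale => //; apply: smooth_fun_sub chiC.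
by apply: (eq_smooth_fun oO2 _ (smooth_fun_cst 0 oO2)) => y /chi0 ->; rewrite scale0r.
Qed.

Lemma smooth_field_extend O (O2 : set M) (chi : M -> R^o) (X : M -> 'rV[R]_n) :
  open O -> open O2 -> (forall y, O y \/ O2 y) -> (forall y, O2 y -> chi y = 0) ->
  smooth_fun setT chi -> smooth_field O X -> smooth_field setT (fun y => chi y *: X y).
Proof.
move=> oO oO2 OO2 chi0 chiC XC; apply: smooth_field_local => y _.
have [Oy|O2y] := OO2 y.
  exists O; split; [exact: Oy|apply: (smooth_field_scale oO _ XC)].
  by apply: smooth_fun_sub chiC.
exists O2; split; [exact: O2y|apply: (eq_smooth_field oO2 _ (smooth_field_cst0 oO2)) => z /chi0 ->].
by rewrite scale0r.
Qed.

(** Turns statements about global smooth fields into statements about single tangent vectors. *)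
Lemma field_through x (v : 'rV[R]_n) :
  exists2 X : M -> 'rV[R]_n, smooth_field setT X & X x = v.
Proof.
have [chi [ O1 [ O2 [chiC _ [_ o1x _ chi1] [oO2 OO2 chi0]]]]] :=
  bump_function (@dom_open _ _ M x) (@dom_self _ _ M x).
exists (fun y => chi y *: tvec x y v).
  apply: (smooth_field_extend _ oO2 OO2 chi0 chiC); first exact: dom_open.
  exact: smooth_field_chart.
by rewrite chi1// scale1r tvec_self.
Qed.

(** Every [y] lies in a basic set contained in [U y]. For each code of a basic set one centre [x] is
    chosen with that basic set inside [U x]; [x0] fills in the numbers that code nothing. *)
Lemma second_countable_subcover (U : M -> set M) (x0 : M) :
  (forall x, open (U x)) -> (forall x, U x x) ->
  exists c : nat -> M, forall x, exists i, U (c i) x.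
Proof.
move=> oU Ux; have [B /countable_injP [f finj] [Bo Bb]] := @manifold_second_countable _ _ M.
pose c i := xget x0 [set x | exists b, [/\ B b, f b = i & b `<=` U x]].
exists c => y.
have /(_ (U y)) [] := Bb y; first by apply: open_nbhs_nbhs; split.
move=> b [Bb1 by_] bU; exists (f b).
have : [set x | exists b', [/\ B b', f b' = f b & b' `<=` U x]] (c (f b)).
  by apply: (@xgetI _ _ _ y); exists b.
move=> [b' [Bb' fb' b'U]]; apply: b'U.
by rewrite (finj b' b) ?inE.
Qed.

End Bump.

Section GlobalForm.
Context {R : realType} {m : nat} {N : manifold R m.+1}.
Implicit Types (O : set N) (Z : N -> 'rV[R]_m.+1).

Lemma one_form_scale (chi : N -> R^o) (t : N -> 'rV[R]_m.+1 -> R^o) O (O2 : set N) :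
  open O -> open O2 -> (forall y, O y \/ O2 y) -> (forall y, O2 y -> chi y = 0) ->
  (forall y, linear (t y)) ->
  smooth_fun setT chi -> form_on O t -> one_form (fun y v => chi y *: t y v).
Proof.
move=> oO oO2 OO2 chi0 tl chiC [_ tC]; split=> [y k u v|c w].
  by rewrite tl scalerDr !scalerA mulrC.
apply: smooth_fun_local => y cy; have [Oy|O2y] := OO2 y.
  exists (O `&` dom N c); split; first by [].
  apply: (smooth_fun_scale (openId c oO) _ (tC c w)).
  by apply: smooth_fun_sub chiC.
exists O2; split; first exact: O2y.
by apply: (eq_smooth_fun oO2 _ (smooth_fun_cst 0 oO2)) => z /chi0 ->; rewrite scale0r.
Qed.

(** Some coordinate of [Z x] is nonzero; the corresponding coordinate form, normalised at [x], is
    positive on [Z] near [x], and a bump function supported there keeps it nonnegative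
    everywhere. *)
Lemma local_form Z x : smooth_field setT Z -> Z x != 0 ->
  exists t : N -> 'rV[R]_m.+1 -> R^o,
    [/\ one_form t, forall y, 0 <= t y (Z y) & t x (Z x) = 1].
Proof.
move=> ZC Zx0; have xx := @dom_self _ _ N x; have ox := @dom_open _ _ N x.
have /existsP [k Zk] : [exists k, Z x 0 k != 0].
  apply/contraT; rewrite negb_exists => /forallP H.
  by case/eqP: Zx0; apply/rowP => k; rewrite mxE; apply/eqP; move: (H k); rewrite negbK.
pose l (y : N) v : R^o := (tcoord x y v) 0 k / Z x 0 k.
have ll y : linear (l y).
  by move=> a u v; rewrite /l (tcoord_linear x y a u v) !mxE mulrDl -mulrA.
have lF : form_on (dom N x) l.
  split=> // c w.
  have [_ /(_ c w) H] := dfun_form ox (@smooth_fun_phi _ _ N x).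
  have oxc := openId c ox.
  apply: (eq_smooth_fun oxc _ (smooth_fun_mul oxc (smooth_fun_entry 0 k oxc H)
    (smooth_fun_cst ((Z x 0 k)^-1 : R^o) oxc))) => y _; by [].
have lZC : smooth_fun (dom N x) (fun y => l y (Z y)).
  by apply: (form_field ox lF); apply: smooth_field_sub ZC.
pose O := dom N x `&` (fun y => l y (Z y)) @^-1` [set t | 0 < t].
have oO : open O by apply: (smooth_fun_preim_open ox lZC); exact: open_gt.
have lx : l x (Z x) = 1.
  by rewrite /l -[tcoord x x]/(tvec x x) tvec_self divff.
have Ox : O x by split => //=; rewrite lx.
have [chi [ O1 [ O2 [chiC chi_ge0 [_ o1x _ chi1] [oO2 OO2 chi0]]]]] := bump_function oO Ox.
exists (fun y v => chi y *: l y v); split.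
- apply: (one_form_scale oO oO2 OO2 chi0 ll chiC).
  by apply: form_on_sub lF => y [].
- move=> y; have [[_ /= ly]|/chi0 ->] := OO2 y; last by rewrite scale0r.
  by rewrite mulr_ge0// ltW.
- by rewrite chi1// scale1r lx.
Qed.

(* With f i := t_i(Z), the weights w i := prod_(j < i) rho (f j), where rho is
   smooth, positive on t < 1/2 and zero on t >= 1/2, form a locally finite
   family: on {f j > 1/2} all w i with i > j vanish. The form is
   sum_i w i * t_i / sum_i w i * f i. *)
Lemma Sforms_nonempty Z : smooth_field setT Z -> (forall x, Z x != 0) ->
  exists t, Sforms Z t.
Proof.
move=> ZC Z0.
(* [x0] is needed as a default centre of the countable cover; on an empty manifold all conditions
   are vacuous. *)
have [[x0 _]|N0] := pselect (exists x : N, True); last first.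
  exists (fun _ _ => 0); split=> [|x]; last by exfalso; apply: N0; exists x.
  by split=> [x|c w]; exfalso; apply: N0; [exists x|exists c].
have /choice [al alP] : forall x, exists t : N -> 'rV[R]_m.+1 -> R^o,
    [/\ one_form t, forall y, 0 <= t y (Z y) & t x (Z x) = 1].
  by move=> x; apply: local_form.
pose F x y : R^o := al x y (Z y).
have FC x : smooth_fun setT (F x).
  by apply: (form_field openT _ ZC); apply: one_form_on; case: (alP x).
pose U x := [set y | 2^-1 < F x y].
have oU x : open (U x).
  have := smooth_fun_preim_open openT (FC x) (open_gt (y := 2^-1)).
  by rewrite setTI.
have Ux x : U x x by rewrite /U /= /F; have [_ _ ->] := alP x; lra.
have [c cU] := second_countable_subcover x0 oU Ux.
pose f i : N -> R^o := F (c i).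
pose w i y : R^o := \prod_(j < i) flat_exp 1 (2^-1 - f j y).
have wC i : smooth_fun setT (w i).
  elim: i => [|i IH].
    apply: (eq_smooth_fun openT _ (smooth_fun_cst (1 : R^o) openT)) => y _.
    by rewrite /w big_ord0.
  have fi : smooth_fun setT (fun y => 2^-1 - f i y : R^o).
    exact: (smooth_fun_subr openT (smooth_fun_cst (2^-1 : R^o) openT) (FC (c i))).
  apply: (eq_smooth_fun openT _ (smooth_fun_mul openT IH (smooth_fun_flat openT fi))) => y _.
  by rewrite /w big_ord_recr.
have w_ge0 i y : 0 <= w i y by apply: prodr_ge0 => j _; exact: flat_exp1_ge0.
have w0 i j y : (j < i)%N -> U (c j) y -> w i y = 0.
  move=> ji; rewrite /U /= => H; rewrite /w (bigD1 (Ordinal ji))//= flat_exp_le0 ?mul0r//.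
  by rewrite subr_le0 ltW.
pose G k y : R^o := \sum_(i < k) w i y * f i y.
pose T k y v : R^o := \sum_(i < k) w i y * al (c i) y v.
have GC k : smooth_fun setT (G k).
  apply: (smooth_fun_sum _ openT) => i _; apply: (smooth_fun_mul openT (wC i)); exact: FC.
have stable (E : nat -> R) j k y : (j < k)%N -> U (c j) y ->
    \sum_(i < k) w i y * E i = \sum_(i < j.+1) w i y * E i.
  move=> jk Uj; rewrite -!(big_mkord xpredT (fun i => w i y * E i)).
  rewrite (@big_cat_nat _ _ _ j.+1)//= -[RHS]addr0; congr (_ + _).
  rewrite big_nat_cond; apply: big1 => i /andP[/andP[ji _] _].
  by rewrite (w0 i j)// mul0r.
(* The least [i] with [f i y >= 1/2] has positive weight, because every earlier [f] is below [1/2]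
   at [y], and it occurs among the first [j.+1] terms. *)
have G_gt0 j y : U (c j) y -> 0 < G j.+1 y.
  move=> Uj; have ex : exists i, 2^-1 <= f i y by exists j; exact: ltW.
  have [i fi imin] := ex_minnP ex.
  have ij : (i <= j)%N by apply: imin; exact: ltW.
  rewrite /G (bigD1 (Ordinal (ij : (i < j.+1)%N)))//=.
  apply: ltr_wpDr.
    by apply: sumr_ge0 => k _; rewrite mulr_ge0//; have [_ + _] := alP (c k); exact.
  apply: mulr_gt0; last by apply: lt_le_trans fi.
  apply: prodr_gt0 => k _; apply: flat_exp1_gt0; rewrite subr_gt0 ltNge.
  by apply/negP => /imin; rewrite leqNgt ltn_ord.
have ex y : exists i, `[< U (c i) y >] by have [i Ui] := cU y; exists i; apply/asboolP.
(* The index at which the sums are cut at [y]. Any other [j] with [U (c j) y] gives the same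
   quotient, so near a given point a constant [j] can be used, which makes smoothness visible. *)
pose j0 y := ex_minn (ex y).
have j0P y : U (c (j0 y)) y by rewrite /j0; case: ex_minnP => i /asboolP.
have j0_le y j : U (c j) y -> (j0 y <= j)%N.
  by move=> Uj; rewrite /j0; case: ex_minnP => i _; apply; exact/asboolP.
pose tau (y : N) (v : 'rV[R]_m.+1) : R^o := T (j0 y).+1 y v / G (j0 y).+1 y.
have tauE j y v : U (c j) y -> tau y v = T j.+1 y v / G j.+1 y.
  move=> Uj; rewrite /tau /T /G.
  by rewrite (stable (fun i => al (c i) y v) (j0 y) j.+1) ?ltnS ?j0_le// (stable (f^~ y) (j0 y) j.+1) ?ltnS ?j0_le.
exists tau; split; last first.
  move=> y; rewrite (tauE _ _ _ (j0P y)).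
  have -> : T (j0 y).+1 y (Z y) = G (j0 y).+1 y by [].
  by rewrite divff// gt_eqF//; exact: G_gt0.
split=> [y a u v|d e].
  have TL k : T k y (a *: u + v) = a * T k y u + T k y v.
    rewrite /T mulr_sumr -big_split /=; apply: eq_bigr => i _.
    have [[al_l _] _ _] := alP (c i).
    by rewrite (al_l y a u v) mulrDr scale_regE mulrCA.
  by rewrite /tau TL mulrDl -mulrA.
apply: smooth_fun_local => y dy; have Uj := j0P y; set j := j0 y in Uj.
pose B := U (c j) `&` dom N d; have oB : open B by exact: openId.
exists B; split; first by [].
have TC : smooth_fun B (fun y => T j.+1 y (tvec d y e)).
  apply: (smooth_fun_sum _ oB) => i _; apply: (smooth_fun_mul oB).
    by apply: smooth_fun_sub (wC i).
  have [[_ /(_ d e) H] _ _] := alP (c i).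
  by apply: smooth_fun_sub H => z [].
have GB : smooth_fun B (G j.+1) by apply: smooth_fun_sub (GC _).
have GI : smooth_fun B (fun y => (G j.+1 y)^-1 : R^o).
  by apply: (smooth_fun_inv oB _ GB) => z [Uz _]; rewrite gt_eqF//; exact: G_gt0.
apply: (eq_smooth_fun oB _ (smooth_fun_mul oB TC GI)) => z [Uz _].
by rewrite (tauE j).
Qed.

End GlobalForm.

(** * The Lorentz group and its Lie algebra *)

Section LorentzAlgebra.
Context {R : realType} {m : nat}.
Local Notation L := 'cV[R]_(1 + (m + 1)).
Local Notation mat := 'M[R]_(1 + (m + 1)).
Local Notation J := (@gram R m).
Local Notation l0 := (@ell R m).

Definition dot (y y' : 'cV[R]_m) : R := (y^T *m y') 0 0.

Lemma dotE y y' : dot y y' = \sum_i y i 0 * y' i 0.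
Proof. by rewrite /dot mxE; apply: eq_bigr => i _; rewrite mxE. Qed.

Lemma dotC y y' : dot y y' = dot y' y.
Proof. by rewrite !dotE; apply: eq_bigr => i _; rewrite mulrC. Qed.

Lemma dotDl y y' y'' : dot (y + y') y'' = dot y y'' + dot y' y''.
Proof. by rewrite /dot linearD mulmxDl mxE. Qed.

Lemma dotDr y y' y'' : dot y'' (y + y') = dot y'' y + dot y'' y'.
Proof. by rewrite dotC dotDl !(dotC y''). Qed.

Lemma dotZl k y y' : dot (k *: y) y' = k * dot y y'.
Proof. by rewrite /dot linearZ -scalemxAl mxE. Qed.

Lemma dotZr k y y' : dot y (k *: y') = k * dot y y'.
Proof. by rewrite dotC dotZl dotC. Qed.

Lemma dotNl y y' : dot (- y) y' = - dot y y'.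
Proof. by rewrite -scaleN1r dotZl mulN1r. Qed.

Lemma dotNr y y' : dot y (- y') = - dot y y'.
Proof. by rewrite dotC dotNl dotC. Qed.

Lemma dot0l y : dot 0 y = 0.
Proof. by rewrite -(scale0r 0) dotZl mul0r. Qed.

Lemma dot0r y : dot y 0 = 0.
Proof. by rewrite dotC dot0l. Qed.

Lemma dot_ge0 y : 0 <= dot y y.
Proof. by rewrite dotE sumr_ge0// => i _; rewrite -expr2 sqr_ge0. Qed.

Lemma dot_eq0 y : dot y y = 0 -> y = 0.
Proof.
rewrite dotE => /eqP; rewrite psumr_eq0 => [/allP H|i _]; last by rewrite -expr2 sqr_ge0.
apply/colP => i; rewrite mxE; apply/eqP; have := H i (mem_index_enum i).
by rewrite /= mulf_eq0 orbb.
Qed.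

Lemma dot_delta y i : dot y (delta_mx i 0) = y i 0.
Proof.
rewrite dotE (bigD1 i)//= mxE !eqxx mulr1 big1 ?addr0// => j ji.
by rewrite mxE (negbTE ji) mulr0.
Qed.

Lemma dot_skew (A : 'M[R]_m) y y' : A^T = - A -> dot (A *m y) y' = - dot y (A *m y').
Proof. by move=> AT; rewrite /dot trmx_mul AT mulmxN mulNmx mulmxA mxE. Qed.

Definition lvec (a : R) (y : 'cV[R]_m) (b : R) : L := col_mx a%:M (col_mx y b%:M).
Definition ltop (v : L) : R := usubmx v 0 0.
Definition lmid (v : L) : 'cV[R]_m := usubmx (dsubmx v).
Definition lbot (v : L) : R := dsubmx (dsubmx v) 0 0.

Lemma lvecK v : v = lvec (ltop v) (lmid v) (lbot v).
Proof. by rewrite /lvec /ltop /lmid /lbot -!mx11_scalar !vsubmxK. Qed.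

Lemma ltop_lvec a y b : ltop (lvec a y b) = a.
Proof. by rewrite /ltop /lvec col_mxKu mxE eqxx mulr1n. Qed.

Lemma lmid_lvec a y b : lmid (lvec a y b) = y.
Proof. by rewrite /lmid /lvec col_mxKd col_mxKu. Qed.

Lemma lbot_lvec a y b : lbot (lvec a y b) = b.
Proof. by rewrite /lbot /lvec !col_mxKd mxE eqxx mulr1n. Qed.

Lemma lvecD a y b a' y' b' : lvec a y b + lvec a' y' b' = lvec (a + a') (y + y') (b + b').
Proof. by rewrite /lvec !add_col_mx !raddfD. Qed.

Lemma lvecZ k a y b : k *: lvec a y b = lvec (k * a) (k *: y) (k * b).
Proof. by rewrite /lvec !scale_col_mx !scale_scalar_mx. Qed.

Lemma lvec_inj a y b a' y' b' : lvec a y b = lvec a' y' b' -> [/\ a = a', y = y' & b = b'].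
Proof.
move=> E; split; first by rewrite -(ltop_lvec a y b) E ltop_lvec.
  by rewrite -(lmid_lvec a y b) E lmid_lvec.
by rewrite -(lbot_lvec a y b) E lbot_lvec.
Qed.

Lemma lvec_sum (y : 'cV[R]_m) : \sum_i y i 0 *: lvec 0 (delta_mx i 0) 0 = lvec 0 y 0.
Proof.
have yE : y = \sum_i y i 0 *: delta_mx i 0.
  by rewrite {1}[y]matrix_sum_delta; apply: eq_bigr => i _; rewrite big_ord1.
rewrite [in RHS]yE; elim/big_rec2 : _ => [|i v w _ ->].
  by rewrite /lvec !raddf0 !col_mx0.
by rewrite lvecZ lvecD !mulr0 !addr0.
Qed.

Lemma ellE : l0 = lvec 1 0 0.
Proof. by rewrite /ell /lvec; congr col_mx; rewrite raddf0 col_mx0. Qed.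

Lemma ennE : @enn R m = lvec 0 0 1.
Proof. by rewrite /enn /lvec raddf0. Qed.

Lemma gram_lvec a y b : J *m lvec a y b = lvec b y a.
Proof.
rewrite /gram /lvec mul_block_col mul_row_col !(mul0mx, add0r, mul1mx).
by rewrite mul_col_mx mul_block_col !(mul0mx, addr0, mul1mx) add_col_mx add0r addr0.
Qed.

Lemma lprod_lvec a y b a' y' b' :
  lprod (lvec a y b) (lvec a' y' b') = a * b' + dot y y' + b * a'.
Proof.
rewrite /lprod -mulmxA gram_lvec /lvec !tr_col_mx !mul_row_col !tr_scalar_mx.
by rewrite -!scalar_mxM /dot !mxE eqxx !mulr1n addrA.
Qed.

Lemma gmx_lvec a X z A al y be :
  gmx a X z A *m lvec al y be =
  lvec (a * al + (z *m y) 0 0) (al *: X + A *m y - be *: z^T) (- dot X y - a * be).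
Proof.
rewrite /gmx /lvec mul_block_col mul_row_col mul0mx addr0 mul_col_mx mul_block_col.
rewrite mul0mx add_col_mx add0r -!scalar_mxM; congr col_mx.
  by apply/matrixP => i j; rewrite !ord1 !mxE eqxx !mulr1n.
congr col_mx.
  rewrite mul_mx_scalar; apply/colP => i; rewrite !mxE.
  by rewrite [X in _ + (_ + X)]big_ord1 !mxE eqxx mulr1n addrA mulNr [z 0 i * _]mulrC.
apply/matrixP => i j; rewrite !ord1 mxE mulNmx mulNmx -scalar_mxM /dot !mxE eqxx !mulr1n.
by [].
Qed.

Lemma gramK : J *m J = 1%:M.
Proof.
apply/matrixP => i j; have : J *m (J *m (delta_mx j 0 : L)) = delta_mx j 0.
  by rewrite [delta_mx j 0 : L]lvecK !gram_lvec.
rewrite mulmxA -colE => /colP/(_ i) H; rewrite [RHS]mxE; move: H.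
by rewrite mxE [delta_mx _ _ _ _]mxE eqxx andbT.
Qed.

Lemma lprodC (v w : L) : lprod v w = lprod w v.
Proof. by rewrite (lvecK v) (lvecK w) !lprod_lvec dotC; ring. Qed.

Lemma lprodDr (v w w' : L) : lprod v (w + w') = lprod v w + lprod v w'.
Proof. by rewrite /lprod mulmxDr mxE. Qed.

Lemma lprodZr k (v w : L) : lprod v (k *: w) = k * lprod v w.
Proof. by rewrite /lprod -scalemxAr mxE. Qed.

Lemma lprodBr (v w w' : L) : lprod v (w - w') = lprod v w - lprod v w'.
Proof. by rewrite lprodDr -scaleN1r lprodZr mulN1r. Qed.

Lemma lprod_ell (v : L) : lprod v l0 = lbot v.
Proof. by rewrite {1}(lvecK v) ellE lprod_lvec dot0r; ring. Qed.

Lemma lprod_enn (v : L) : lprod v enn = ltop v.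
Proof. by rewrite {1}(lvecK v) ennE lprod_lvec dot0r; ring. Qed.

Lemma lprod_self (v : L) : lprod v v = 2 * ltop v * lbot v + dot (lmid v) (lmid v).
Proof. by rewrite {1 2}(lvecK v) lprod_lvec; ring. Qed.

Lemma mx_eq_form (B C : mat) :
  (forall v w : L, (v^T *m B *m w) 0 0 = (v^T *m C *m w) 0 0) -> B = C.
Proof.
move=> H; apply/matrixP => i j; have := H (delta_mx i 0) (delta_mx j 0).
by rewrite !trmx_delta -!mulmxA -!colE -!rowE !mxE.
Qed.

Lemma lprod_isoP (g : mat) :
  (forall v w, lprod (g *m v) (g *m w) = lprod v w) <-> g^T *m J *m g = J.
Proof.
split=> [H|H v w]; last by rewrite /lprod trmx_mul !mulmxA -(mulmxA _ _ J) -(mulmxA _ _ g) H.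
by apply: mx_eq_form => v w; rewrite -[RHS]H /lprod trmx_mul !mulmxA.
Qed.

(** An isometry fixing [ell] preserves the future cone automatically. For a future null vector with
    components [(a, y, b)] one has [b < a] and [b <= 0], and [b] is unchanged since it is the
    product with [ell]. If [b < 0], nullity makes the new [a] nonnegative; if [b = 0], then [y = 0]
    and the vector is a multiple of [ell], hence fixed. *)
Lemma HgroupP (g : mat) : Hgroup g <-> g^T *m J *m g = J /\ g *m l0 = l0.
Proof.
split=> [[[/lprod_isoP gJ _] gl]//|[gJ gl]]; have gi := (lprod_isoP g).2 gJ.
split=> //; split=> // v [v0 vf]; split; first by rewrite gi.
have vb : lprod (g *m v) l0 = lprod v l0 by rewrite -{1}gl gi.
have gv0 : lprod (g *m v) (g *m v) = 0 by rewrite gi.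
rewrite !lprod_ell in vb; rewrite lprod_self in gv0; rewrite lprod_self in v0.
move: vf; rewrite !lprodBr !lprod_ell !lprod_enn vb; rewrite vb in gv0 => ba.
have y0 := dot_ge0 (lmid v); have y'0 := dot_ge0 (lmid (g *m v)).
have b_le0 : lbot v <= 0 by nra.
have [b0|b0] := ltP (lbot v) 0; first by nra.
have {}b0 : lbot v = 0 by lra.
have yE : lmid v = 0 by apply: dot_eq0; rewrite b0 in v0; lra.
have vE : v = ltop v *: l0 by rewrite ellE lvecZ mulr0 mulr1 scaler0 {1}(lvecK v) b0 yE.
have : g *m v = ltop v *: l0 by rewrite {1}vE -scalemxAr gl.
by move=> /(congr1 ltop); rewrite ellE lvecZ ltop_lvec mulr1 => ->.
Qed.

Lemma Hgroup1 : Hgroup (1%:M : mat).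
Proof. by apply/HgroupP; rewrite trmx1 mul1mx mulmx1 mul1mx. Qed.

Lemma HgroupM (g h : mat) : Hgroup g -> Hgroup h -> Hgroup (g *m h).
Proof.
move=> /HgroupP[gJ gl] /HgroupP[hJ hl]; apply/HgroupP; split.
  by rewrite trmx_mul !mulmxA -(mulmxA _ _ J) -(mulmxA _ _ g) gJ.
by rewrite -mulmxA hl.
Qed.

Lemma Hgroup_unit (g : mat) : Hgroup g -> g \in unitmx.
Proof.
move=> /HgroupP[gJ _]; have : (J *m g^T *m J) *m g = 1%:M.
  by rewrite -!mulmxA (mulmxA g^T) gJ gramK.
by case/mulmx1_unit.
Qed.

Lemma HgroupV (g : mat) : Hgroup g -> Hgroup (invmx g).
Proof.
move=> gH; have gu := Hgroup_unit gH; move/HgroupP: gH => [gJ gl]; apply/HgroupP; split.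
  rewrite -{1}gJ trmx_inv !mulmxA mulVmx ?unitmx_tr// mul1mx.
  by rewrite -mulmxA mulmxV// mulmx1.
by rewrite -{1}gl mulKmx.
Qed.

Lemma Hgroup_preserves (g : mat) (v w : L) : Hgroup g -> lprod (g *m v) (g *m w) = lprod v w.
Proof. by move=> /HgroupP[gJ _]; exact: (lprod_isoP g).2 gJ v w. Qed.

Lemma Hgroup_lbot (g : mat) (v : L) : Hgroup g -> lbot (g *m v) = lbot v.
Proof.
move=> gH; have /HgroupP[_ gl] := gH; rewrite -!lprod_ell -{1}gl.
exact: Hgroup_preserves.
Qed.

Lemma galg_gmx a X z (A : 'M[R]_m) : A^T = - A -> galg (gmx a X z A).
Proof. by move=> AT; exists a, X, z, A. Qed.

Lemma gmx_skew a X z (A : 'M[R]_m) : A^T = - A ->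
  (gmx a X z A)^T *m J + J *m gmx a X z A = 0.
Proof.
move=> AT; apply: mx_eq_form => v w.
rewrite mulmxDr mulmxDl mulmx0 mul0mx [LHS]mxE [RHS]mxE.
have -> : (v^T *m ((gmx a X z A)^T *m J) *m w) 0 0 = lprod (gmx a X z A *m v) w.
  by rewrite /lprod trmx_mul !mulmxA.
have -> : (v^T *m (J *m gmx a X z A) *m w) 0 0 = lprod v (gmx a X z A *m w).
  by rewrite /lprod !mulmxA.
rewrite (lvecK v) (lvecK w) !gmx_lvec !lprod_lvec !dotDl !dotDr !dotNl !dotNr !dotZl !dotZr.
rewrite (dot_skew _ _ AT) (dotC (lmid v) X).
have E y : (z *m y) 0 0 = dot z^T y by rewrite /dot trmxK.
by rewrite !E (dotC (lmid v) z^T); ring.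
Qed.

(** The matrices of [galg] are the skew endomorphisms of the Lorentz product. Conversely the blocks
    are read off the images of [ell] and of the [e i], and skewness forces all other entries. The
    linear equation makes stability under sums, multiples and [Ad] immediate. *)
Lemma galgP (M : mat) : galg M <-> M^T *m J + J *m M = 0.
Proof.
split=> [[a [X [z [A [AT ->]]]]]|MJ]; first exact: gmx_skew.
have MS (v w : L) : lprod (M *m v) w = - lprod v (M *m w).
  have := congr1 (fun B : mat => (v^T *m B *m w) 0 0) MJ.
  rewrite mulmxDr mulmxDl mulmx0 mul0mx [LHS]mxE [RHS]mxE => /eqP; rewrite addr_eq0 => /eqP H.
  by rewrite /lprod trmx_mul !mulmxA in H *.
pose e i : L := lvec 0 (delta_mx i 0) 0.
have simp := (mulr0, scale0r, mulmx0, dot0r, oppr0, add0r, addr0, subr0, mulr1, scale1r, sub0r).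
pose a := ltop (M *m l0); pose X := lmid (M *m l0).
pose z : 'rV[R]_m := \row_j ltop (M *m e j).
pose A : 'M[R]_m := \matrix_(i, j) lmid (M *m e j) i 0.
have lpe (v : L) i : lprod v (e i) = lmid v i 0.
  by rewrite {1}(lvecK v) lprod_lvec dot_delta; ring.
have AT : A^T = - A.
  by apply/matrixP => i j; rewrite [LHS]mxE [LHS]mxE [RHS]mxE [A i j]mxE -!lpe MS lprodC.
exists a, X, z, A; split => //.
have El : M *m l0 = gmx a X z A *m l0.
  rewrite ellE gmx_lvec !mulmx0 !mulr0 subr0 scale1r scale0r subr0 mxE dot0r oppr0 addr0 mulr1 -ellE.
  rewrite (lvecK (M *m l0)) -/a -/X; congr lvec; first by rewrite addr0.
  rewrite -lprod_ell; have := MS l0 l0; rewrite lprodC => H; lra.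
have Ee j : M *m e j = gmx a X z A *m e j.
  rewrite /e gmx_lvec !simp dot_delta.
  rewrite (lvecK (M *m _)); congr lvec.
  - by rewrite -colE mxE [z 0 j]mxE.
  - by apply/colP => i; rewrite -colE [RHS]mxE [RHS]mxE.
  - by rewrite -lprod_ell MS lprodC lpe.
have En : M *m enn = gmx a X z A *m enn.
  rewrite ennE gmx_lvec !simp mxE.
  rewrite (lvecK (M *m _)) -ennE; congr lvec.
  - rewrite -lprod_enn; have := MS enn enn; rewrite lprodC => H; lra.
  - by apply/colP => i; rewrite -lpe MS [RHS]mxE [(z^T) i 0]mxE [z 0 i]mxE lprodC lprod_enn.
  - by rewrite -lprod_ell MS lprodC lprod_enn.
have Ev (v : L) : M *m v = gmx a X z A *m v.
  have -> : v = ltop v *: l0 + \sum_i lmid v i 0 *: e i + lbot v *: enn.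
    rewrite lvec_sum.
    rewrite {1}(lvecK v) ellE ennE !lvecZ !lvecD !mulr0 !scaler0 !mulr1.
    by rewrite !addr0 !add0r.
  rewrite !mulmxDr -!scalemxAr El En; congr (_ + _ + _).
  rewrite !mulmx_sumr; apply: eq_bigr => i _; by rewrite -!scalemxAr Ee.
apply/matrixP => i j; have := congr1 (fun v : L => v i 0) (Ev (delta_mx j 0)).
by rewrite -!colE !mxE.
Qed.

Lemma gmx_ell a X z (A : 'M[R]_m) : gmx a X z A *m l0 = lvec a X 0.
Proof.
rewrite ellE gmx_lvec !mulmx0 !mulr0 subr0 scale1r scale0r subr0 mxE dot0r oppr0 addr0 mulr1.
by rewrite addr0.
Qed.

Lemma halgP (M : mat) : halg M <-> M^T *m J + J *m M = 0 /\ M *m l0 = 0.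
Proof.
split=> [[z [A [AT ->]]]|[/galgP [a [X [z [A [AT ->]]]]]]].
  by rewrite gmx_skew// gmx_ell /lvec !raddf0 !col_mx0.
rewrite gmx_ell => H; exists z, A; split => //.
have /lvec_inj [-> ->] // : lvec a X 0 = lvec 0 0 0.
by rewrite H /lvec !raddf0 !col_mx0.
Qed.

Lemma halg_galg (M : mat) : halg M -> galg M.
Proof. by move=> /halgP[H _]; apply/galgP. Qed.

Lemma galg_halg (M : mat) : galg M -> M *m l0 = 0 -> halg M.
Proof. by move=> /galgP H Ml; apply/halgP. Qed.

Lemma galg_Ad (g M : mat) : Hgroup g -> galg M -> galg (invmx g *m M *m g).
Proof.
move=> gH; have gu := Hgroup_unit gH; have /HgroupP[gJ _] := gH.
move=> /galgP MJ; apply/galgP.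
have gJ' : J *m invmx g = g^T *m J by rewrite -{1}gJ -mulmxA mulmxV// mulmx1.
have gJ'' : (invmx g)^T *m J = J *m g.
  by rewrite -{1}gJ trmx_inv !mulmxA mulVmx ?unitmx_tr// mul1mx.
have := congr1 (fun B => g^T *m B *m g) MJ.
rewrite mulmxDr mulmxDl mulmx0 mul0mx => H; rewrite -[RHS]H !trmx_mul; congr (_ + _).
  by rewrite -!mulmxA gJ''.
by rewrite !mulmxA gJ'.
Qed.

Lemma galgD (M M' : mat) : galg M -> galg M' -> galg (M + M').
Proof.
move=> /galgP MJ /galgP MJ'; apply/galgP.
by rewrite raddfD /= mulmxDl mulmxDr addrACA MJ MJ' addr0.
Qed.

Lemma galgZ k (M : mat) : galg M -> galg (k *: M).
Proof.
by move=> /galgP MJ; apply/galgP; rewrite linearZ /= -scalemxAl -scalemxAr -scalerDr MJ scaler0.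
Qed.

Lemma galgB (M M' : mat) : galg M -> galg M' -> galg (M - M').
Proof. by move=> MG MG'; apply: galgD => //; rewrite -scaleN1r; exact: galgZ. Qed.

Lemma gproj_gmx a X z (A : 'M[R]_m) : gproj (gmx a X z A) = (a, X).
Proof.
by rewrite /gproj /gmx block_mxKul block_mxKdl col_mxKu mxE eqxx mulr1n.
Qed.

End LorentzAlgebra.

(** * Exponential and Cayley transform *)

Section MatrixExponential.
Context {R : realType} {m : nat}.
Local Notation q := (1 + (m + 1))%N.
Local Notation mat := 'M[R]_(1 + (m + 1)).
Implicit Types X Y : mat.

Lemma mulmx_norm X Y : `|X *m Y| <= q%:R * `|X| * `|Y|.
Proof.
apply: mx_norm_le => [|i j]; first by rewrite !mulr_ge0.
rewrite mxE; apply: le_trans (ler_norm_sum _ _ _) _.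
apply: (@le_trans _ _ (\sum_(k < q) `|X| * `|Y|)); last first.
  by rewrite sumr_const card_ord -[leLHS]mulr_natl mulrA.
by apply: ler_sum => k _; rewrite normrM; apply: ler_pM => //; exact: mx_norm_entry.
Qed.

Lemma mx1_norm : `|1%:M : mat| <= 1.
Proof.
apply: mx_norm_le => // i j; rewrite mxE; case: eqP => _.
  by rewrite mulr1n normr1.
by rewrite mulr0n normr0.
Qed.

Lemma mx_exp_norm X k : `|X ^+ k| <= (q%:R * `|X|) ^+ k.
Proof.
elim: k => [|k IH]; first by rewrite !expr0 mx1_norm.
rewrite !exprS; apply: le_trans (mulmx_norm _ _) _.
by apply: ler_wpM2l => //; rewrite mulr_ge0.
Qed.

(** The left factor [Y] is there for differentiation: the derivative in [t] of an entry of
    [Y exp(tX)] is the same entry of [Y X exp(tX)], so the entries with varying [Y] form a family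
    closed under differentiation. *)
Definition exp_entry_coeff X Y i j (k : nat) : R := (Y *m X ^+ k) i j / k`!%:R.

Lemma exp_entry_cvg X Y i j t : cvgn (pseries (exp_entry_coeff X Y i j) t).
Proof.
apply: normed_cvg; pose C := q%:R * `|Y|; pose x := q%:R * `|X| * `|t|.
have C0 : 0 <= C by rewrite mulr_ge0.
have x0 : 0 <= x by rewrite !mulr_ge0.
apply: (@series_le_cvg _ _ (fun k => C * exp_coeff x k)) => [k|k|k|].
- exact: normr_ge0.
- by rewrite mulr_ge0// exp_coeff_ge0.
- rewrite /exp_entry_coeff /exp_coeff /= !normrM normfV normr_nat normrX mulrAC mulrA.
  apply: ler_wpM2r; first by rewrite invr_ge0.
  rewrite /x exprMn [leRHS]mulrA; apply: ler_wpM2r; first by rewrite exprn_ge0.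
  apply: le_trans (mx_norm_entry _ i j) _; apply: le_trans (mulmx_norm _ _) _.
  by apply: ler_wpM2l => //; exact: mx_exp_norm.
- have -> : series (fun k => C * exp_coeff x k) = fun n => C *: (series (exp_coeff x) n : R^o).
    by apply/funext => n; rewrite /series /= -mulr_sumr.
  by apply: is_cvgZl_tmp; exact: is_cvg_series_exp_coeff.
Qed.

Definition exp_entry X Y i j (t : R) : R := limn (pseries (exp_entry_coeff X Y i j) t).

Lemma is_derive_exp_entry X Y i j (t : R) :
  is_derive t 1 (exp_entry X Y i j) (exp_entry X (Y *m X) i j t).
Proof.
have D Z : pseries_diffs (exp_entry_coeff X Z i j) = exp_entry_coeff X (Z *m X) i j.
  apply/funext => k; rewrite /pseries_diffs /exp_entry_coeff exprS mulmxA.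
  rewrite factS natrM; field.
  by rewrite nat1r !pnatr_eq0 -lt0n fact_gt0.
rewrite /exp_entry -D; apply: (@pseries_snd_diffs _ _ (`|t| + 1)); rewrite ?D; try exact: exp_entry_cvg.
by rewrite [ltRHS]ger0_norm ?addr_ge0// ltrDl.
Qed.

Lemma cvg_mx_entries p r (u : nat -> 'M[R]_(p, r)) (l : 'M[R]_(p, r)) :
  (forall i j, u n i j @[n --> \oo] --> l i j) -> u n @[n --> \oo] --> l.
Proof.
move=> H; apply/cvgrPdist_le => e e0; near=> n; apply: mx_norm_le; rewrite ?(ltW e0)// => i j.
rewrite !mxE; move: i j; near: n; apply: filter_forall => i; apply: filter_forall => j.
by have /cvgrPdist_le := H i j; exact.
Unshelve. all: by end_near. Qed.

Lemma expmx_entry X t i j : expmx (t *: X) i j = exp_entry X 1%:M i j t.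
Proof.
pose l : mat := \matrix_(i, j) exp_entry X 1%:M i j t.
have H : series (fun k : nat => (k`!%:R : R)^-1 *: (t *: X) ^+ k) n @[n --> \oo] --> l.
  apply: cvg_mx_entries => {}i {}j; rewrite mxE.
  have : pseries (exp_entry_coeff X 1%:M i j) t n @[n --> \oo] --> exp_entry X 1%:M i j t.
    exact: exp_entry_cvg.
  have -> // : pseries (exp_entry_coeff X 1%:M i j) t =
      fun n => series (fun k : nat => (k`!%:R : R)^-1 *: (t *: X) ^+ k) n i j.
  apply/funext => n; rewrite /pseries /series /= summxE.
  apply: eq_bigr => k _; rewrite exprZn 2!mxE /exp_entry_coeff mul1mx.
  by rewrite [RHS]mulrC -[RHS]mulrA [LHS]mulrC.
by rewrite /expmx (cvg_lim _ H) ?mxE//; exact: norm_hausdorff.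
Qed.

Lemma exp_entry_mul X Y i j t : exp_entry X Y i j t = (Y *m expmx (t *: X)) i j.
Proof.
rewrite mxE; under eq_bigr do rewrite expmx_entry.
apply: cvg_lim => //.
have -> : pseries (exp_entry_coeff X Y i j) t =
    fun n => \sum_(k < q) Y i k * pseries (exp_entry_coeff X 1%:M k j) t n.
  apply/funext => n; rewrite /pseries /series /=.
  under [RHS]eq_bigr do rewrite mulr_sumr.
  rewrite exchange_big /=; apply: eq_bigr => l _.
  rewrite /exp_entry_coeff mxE !mulr_suml; apply: eq_bigr => k _.
  by rewrite mul1mx !mulrA.
apply: cvg_big; first exact: add_continuous.
by move=> k _; apply: cvgZl_tmp; exact: exp_entry_cvg.
Qed.

Lemma lim_series_head (f : nat -> R) : (forall k, f k.+1 = 0) -> limn (series f) = f 0%N.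
Proof.
move=> f0; apply: lim_near_cst => //; near=> n.
have n0 : (0 < n)%N by near: n; exists 1%N.
by rewrite /series /= -(prednK n0) big_nat_recl// big1 ?addr0.
Unshelve. all: by end_near. Qed.

Lemma expmx0 X : expmx ((0 : R) *: X) = 1%:M.
Proof.
apply/matrixP => i j; rewrite expmx_entry /exp_entry /pseries lim_series_head.
  by rewrite /= /exp_entry_coeff !expr0 mulmx1 fact0 divr1 mulr1.
by move=> k; rewrite /= exprS mul0r mulr0.
Qed.

Lemma ell_delta : @ell R m = delta_mx 0 0.
Proof.
apply/colP => i; rewrite /ell; case: (split_ordP i) => k ->.
  by rewrite col_mxEu [RHS]mxE ord1 mxE.
by rewrite col_mxEd [RHS]mxE mxE.
Qed.

Lemma expmx_ell X t : X *m ell = 0 -> expmx (t *: X) *m ell = (ell : 'cV[R]_(1 + (m + 1))).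
Proof.
move=> Xl; apply/colP => i; rewrite ell_delta -colE mxE expmx_entry /exp_entry /pseries.
rewrite lim_series_head.
  by rewrite /= /exp_entry_coeff !expr0 mulmx1 fact0 divr1 mulr1 !mxE andbT.
move=> k; rewrite /= /exp_entry_coeff mul1mx exprSr.
have -> : (X ^+ k * X) i 0 = (X ^+ k *m (X *m ell)) i 0.
  by rewrite mulmxA ell_delta -colE [RHS]mxE.
by rewrite Xl mulmx0 mxE !mul0r.
Qed.

(** A one-parameter group as a function on ['rV[R]_1], the form in which the calculus of plots
    applies to it. *)
Definition exp_line X (y : 'rV[R]_1) : mat := expmx (y 0 0 *: X).

Lemma exp_line_smooth X : Cinf_on setT (exp_line X).
Proof.
apply: (Cinf_entries openT) => i j.
pose Fam : set (R -> R) := [set F | exists Y, F = exp_entry X Y i j].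
apply: (eq_Cinf (f := fun y : 'rV[R]_1 => exp_entry X 1%:M i j (y 0 0) : R^o) openT).
  by move=> y _; rewrite /exp_line expmx_entry.
have FF : Fam (exp_entry X 1%:M i j) by exists 1%:M.
apply: (Cinf_family (B := setT) openT _ (Cinf_entry 0 0 openT (Cinf_id openT)) _ FF) => //.
move=> _ [Y ->]; exists (exp_entry X (Y *m X) i j); first by exists (Y *m X).
by move=> t _; exact: is_derive_exp_entry.
Qed.

Lemma diff_exp_line X (y v : 'rV[R]_1) :
  'd (exp_line X) y v = v 0 0 *: (X *m exp_line X y).
Proof.
have bd : differentiable (exp_line X) y.
  exact: (Cinf_differentiable openT (exp_line_smooth X)).
apply/matrixP => i j.
have gd : differentiable (fun y : 'rV[R]_1 => y 0 0 : R^o) y by exact: differentiable_coord.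
have Fd : differentiable (exp_entry X 1%:M i j : R -> R^o) (y 0 0).
  by apply/derivable1_diffP; have [] := is_derive_exp_entry X 1%:M i j (y 0 0).
have E : (fun y => exp_line X y i j : R^o) = (exp_entry X 1%:M i j : R -> R^o) \o (fun y => y 0 0 : R^o).
  by apply/funext => z; rewrite /= /exp_line expmx_entry.
have bijd : differentiable (fun y => exp_line X y i j : R^o) y.
  by rewrite E; exact: (differentiable_comp gd Fd).
rewrite (diff_entry v bd bijd) E; apply: (etrans (congr1 (fun F => F v) (diff_comp gd Fd))).
rewrite /= diff1E// derive1E; have [_ ->] := is_derive_exp_entry X 1%:M i j (y 0 0).
rewrite mul1mx exp_entry_mul [RHS]mxE -deriveE//; congr (_ * _).
rewrite /derive; apply: cvg_lim => //; apply: cvg_near_cst; near=> h => /=.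
rewrite mxE mxE addrK scale_regE mulrA mulVf ?mul1r//.
by near: h; exact: nbhs_dnbhs_neq.
Unshelve. all: by end_near. Qed.

Lemma line_constant (f : 'rV[R]_1 -> R^o) y : Cinf_on setT f ->
  (forall y v, 'd f y v = 0) -> f y = f 0.
Proof.
move=> fC f0; pose e : 'rV[R]_1 := delta_mx 0 0.
have fd z : differentiable f z by exact: (Cinf_differentiable openT fC).
have yE (z : 'rV[R]_1) : z = 0 + z 0 0 *: e.
  by apply/rowP => i; rewrite !ord1 !mxE eqxx mulr1 add0r.
have -> : f 0 = f (0 + 0 *: e) by rewrite scale0r addr0.
rewrite (yE y).
apply: (@is_derive_0_is_cst _ (fun s => f (0 + s *: e))) => s.
have fds : derivable f (0 + s *: e) e by apply: diff_derivable.
by apply: (is_derive_eq (is_derive_line fds)); rewrite deriveE.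
Qed.

(** With [b] the one-parameter group, the derivative of [b^T J b] is a multiple of
    [b^T (X^T J + J X) b = 0], so [b^T J b] keeps its value [J] at 0. *)
Lemma expmx_Hgroup X t : halg X -> Hgroup (expmx (t *: X)).
Proof.
move=> /halgP[XJ Xl]; apply/HgroupP; split; last exact: expmx_ell.
pose J := @gram R m; pose b := exp_line X.
have bC := exp_line_smooth X; have bTC := Cinf_trmx openT bC.
have bJC := Cinf_mulmx openT bTC (Cinf_cst J openT).
have FC := Cinf_mulmx openT bJC bC.
apply/matrixP => i j; pose y : 'rV[R]_1 := t%:M.
have := @line_constant (fun y => ((b y)^T *m J *m b y) i j) y (Cinf_entry i j openT FC).
have -> : b y = expmx (t *: X) by rewrite /b /exp_line mxE eqxx mulr1n.
have -> : b 0 = 1%:M by rewrite /b /exp_line mxE expmx0.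
rewrite trmx1 mul1mx mulmx1; apply => {}y v.
have Fd : differentiable (fun y => (b y)^T *m J *m b y) y by exact: (Cinf_differentiable openT FC).
have Fijd : differentiable (fun y => ((b y)^T *m J *m b y) i j : R^o) y.
  exact: (Cinf_differentiable openT (Cinf_entry i j openT FC)).
rewrite -(diff_entry v Fd Fijd).
have -> : 'd (fun y => (b y)^T *m J *m b y) y v = 0; last by rewrite mxE.
apply: (etrans (diff_mulmx v openT I bJC bC)).
have E1 : 'd (fun y => (b y)^T *m J) y v = ('d b y v)^T *m J.
  apply: (etrans (diff_mulmx v openT I bTC (Cinf_cst J openT))).
  apply: (etrans (congr2 (fun Z Z' => Z *m J + (b y)^T *m Z') (diff_trmx v openT I bC)
    (congr1 (fun F => F v) (diff_cst J y)))).
  by rewrite mulmx0 addr0.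
apply: (etrans (congr1 (fun Z => Z *m b y + (b y)^T *m J *m 'd b y v) E1)).
rewrite diff_exp_line linearZ /= -!scalemxAl -scalemxAr -scalerDr trmx_mul.
rewrite -!mulmxA -mulmxDr !mulmxA -mulmxDl XJ.
by rewrite mul0mx mulmx0 scaler0.
Qed.

End MatrixExponential.

Section Cayley.
Context {R : realType} {m : nat}.
Local Notation mat := 'M[R]_(1 + (m + 1)).
Local Notation J := (@gram R m).
Local Notation l0 := (@ell R m).

(* The Cayley transform identifies [halg] near 0 with H near 1, and unlike the
   exponential it is rational. *)
Definition cay (X : mat) : mat := (1%:M + 2^-1 *: X) *m invmx (1%:M - 2^-1 *: X).
Definition cayV (g : mat) : mat := 2 *: ((g - 1%:M) *m invmx (g + 1%:M)).

Lemma cayD1 X : 1%:M - 2^-1 *: X \in unitmx -> cay X + 1%:M = 2 *: invmx (1%:M - 2^-1 *: X).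
Proof.
move=> u; rewrite /cay -{3}(mulmxV u) -mulmxDl addrACA subrr addr0 -mulr2n -scaler_nat.
by rewrite -scalemxAl mul1mx.
Qed.

Lemma cayB1 X : 1%:M - 2^-1 *: X \in unitmx -> cay X - 1%:M = X *m invmx (1%:M - 2^-1 *: X).
Proof.
move=> u; rewrite /cay -{3}(mulmxV u) -mulmxBl; congr (_ *m _).
by apply/matrixP => i j; rewrite !mxE; field.
Qed.

Lemma cay_unit X : 1%:M - 2^-1 *: X \in unitmx -> cay X + 1%:M \in unitmx.
Proof.
move=> u; rewrite cayD1// unitmxZ ?unitmx_inv//.
by rewrite unitfE pnatr_eq0.
Qed.

Lemma cayK X : 1%:M - 2^-1 *: X \in unitmx -> cayV (cay X) = X.
Proof.
move=> u; rewrite /cayV cayB1// cayD1// invmxZ ?unitmx_inv//; last first.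
  by rewrite -cayD1// cay_unit.
rewrite invmxK -scalemxAr -mulmxA mulVmx// mulmx1 scalerA divff ?scale1r//.
Qed.

Lemma cayV_half g : g + 1%:M \in unitmx ->
  1%:M - 2^-1 *: cayV g = 2 *: invmx (g + 1%:M) /\
  1%:M + 2^-1 *: cayV g = 2 *: (g *m invmx (g + 1%:M)).
Proof.
move=> u; rewrite /cayV scalerA mulVf ?pnatr_eq0// scale1r.
set k := invmx _; have k1 : (g + 1%:M) *m k = 1%:M by exact: mulmxV.
rewrite -{1 3}k1 -mulmxBl -mulmxDl; split; first rewrite -[in RHS](mul1mx k);
  rewrite [RHS]scalemxAl; congr (_ *m _); apply/matrixP => i j; rewrite !mxE; ring.
Qed.

Lemma cayV_unit g : g + 1%:M \in unitmx -> 1%:M - 2^-1 *: cayV g \in unitmx.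
Proof.
move=> u; rewrite (cayV_half u).1 unitmxZ ?unitmx_inv//.
by rewrite unitfE pnatr_eq0.
Qed.

Lemma cayVK g : g + 1%:M \in unitmx -> cay (cayV g) = g.
Proof.
move=> u; have [h1 h2] := cayV_half u; rewrite /cay h2 h1.
rewrite invmxZ ?unitmx_inv//; last by rewrite -h1; exact: cayV_unit.
rewrite invmxK -scalemxAl -scalemxAr scalerA divff ?pnatr_eq0// scale1r.
by rewrite mulmxKV.
Qed.

Lemma invmx_ell (B : mat) (k : R) : B \in unitmx -> k != 0 -> B *m l0 = k *: l0 ->
  invmx B *m l0 = k^-1 *: l0.
Proof.
move=> u k0 H; have := mulKmx u l0; rewrite H -scalemxAr => E.
by rewrite -[in RHS]E scalerA mulVf// scale1r.
Qed.

(** Put [B = 1 - X/2] and [C = 1 + X/2]. Skewness gives [B^T J = J C] and [C^T J = J B], and [B]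
    commutes with [C]; hence [C B^-1] preserves [J]. Both [B] and [C] fix [ell]. *)
Lemma cay_Hgroup X : halg X -> 1%:M - 2^-1 *: X \in unitmx -> Hgroup (cay X).
Proof.
move=> /halgP[XJ Xl] u; apply/HgroupP; split.
  set B := 1%:M - _ in u; pose C : mat := 1%:M + 2^-1 *: X.
  have XJ' : X^T *m J = - (J *m X) by apply/eqP; rewrite -addr_eq0 XJ.
  have BJ : B^T *m J = J *m C.
    rewrite /B /C linearB /= trmx1 linearZ /= mulmxBl mulmxDr mul1mx mulmx1.
    by rewrite -scalemxAl XJ' scalerN opprK -scalemxAr.
  have CJ : C^T *m J = J *m B.
    rewrite /B /C linearD /= trmx1 linearZ /= mulmxBr mulmxDl mul1mx mulmx1.
    by rewrite -scalemxAl XJ' scalerN -scalemxAr.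
  have BC : B *m C = C *m B.
    rewrite /B /C mulmxBl mulmxDl !mul1mx mulmxDr mulmxBr !mulmx1.
    by apply/matrixP => i j; rewrite !mxE; ring.
  rewrite /cay -/B -/C trmx_mul -!mulmxA (mulmxA C^T) CJ (mulmxA _ C) -(mulmxA J) BC.
  rewrite -!mulmxA mulmxV// mulmx1 -BJ mulmxA trmx_inv mulVmx ?mul1mx//.
  by rewrite unitmx_tr.
rewrite /cay -mulmxA (@invmx_ell _ 1) ?oner_eq0//; last first.
  by rewrite mulmxBl -scalemxAl Xl mul1mx scaler0 subr0 scale1r.
by rewrite invr1 scale1r mulmxDl -scalemxAl Xl mul1mx scaler0 addr0.
Qed.

(** Up to the invertible factors [g + 1], skewness of [cayV g] is the identity [(g - 1)^T J (g + 1)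
    + (g + 1)^T J (g - 1) = 2 (g^T J g - J) = 0]. *)
Lemma cayV_halg g : Hgroup g -> g + 1%:M \in unitmx -> halg (cayV g).
Proof.
move=> /HgroupP[gJ gl] u; apply/halgP; split.
  have uT : (g + 1%:M)^T \in unitmx by rewrite unitmx_tr.
  rewrite /cayV linearZ /= -scalemxAl -scalemxAr -scalerDr trmx_mul trmx_inv.
  set p := g + 1%:M in u uT *; set p' := g - 1%:M.
  suff E : p'^T *m J *m p + p^T *m J *m p' = 0.
    have -> : invmx p^T *m p'^T *m J + J *m (p' *m invmx p) =
        invmx p^T *m (p'^T *m J *m p + p^T *m J *m p') *m invmx p.
      rewrite mulmxDr mulmxDl; congr (_ + _); first by rewrite !mulmxA mulmxK.
      by rewrite !mulmxA mulVmx// mul1mx.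
    by rewrite E mulmx0 mul0mx scaler0.
  rewrite /p /p' !linearD /= linearN /= trmx1.
  rewrite !mulmxDl ?mulmxDr !mulNmx !mulmxN !mul1mx !mulmx1 gJ.
  by apply/matrixP => i j; rewrite !mxE; ring.
rewrite /cayV -scalemxAl -mulmxA (@invmx_ell _ 2) ?pnatr_eq0//; last first.
  by rewrite mulmxDl gl mul1mx scaler_nat.
by rewrite -scalemxAr mulmxBl gl mul1mx subrr !scaler0.
Qed.

Lemma cayV1 : cayV 1%:M = 0.
Proof. by rewrite /cayV subrr mul0mx scaler0. Qed.

Lemma unit2 : 1%:M + 1%:M \in @unitmx R (1 + (m + 1)).
Proof. by rewrite -mulr2n -scaler_nat unitmxZ ?unitmx1// unitfE pnatr_eq0. Qed.

Lemma Cinf_cay n (A : set 'rV[R]_n) (X : 'rV[R]_n -> mat) : open A ->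
  (forall y, A y -> 1%:M - 2^-1 *: X y \in unitmx) ->
  Cinf_on A X -> Cinf_on A (fun y => cay (X y)).
Proof.
move=> oA u XC; have c1 := Cinf_cst (1%:M : mat) oA.
have XC2 := Cinf_scale oA (Cinf_cst (2^-1 : R^o) oA) XC.
apply: (Cinf_mulmx oA); first exact: (Cinf_add oA c1 XC2).
by apply: (Cinf_invmx oA u); exact: (Cinf_sub_fun oA c1 XC2).
Qed.

Lemma Cinf_cayV n (A : set 'rV[R]_n) (g : 'rV[R]_n -> mat) : open A ->
  (forall y, A y -> g y + 1%:M \in unitmx) ->
  Cinf_on A g -> Cinf_on A (fun y => cayV (g y)).
Proof.
move=> oA u gC; have c1 := Cinf_cst (1%:M : mat) oA.
apply: (Cinf_scale oA (Cinf_cst (2 : R^o) oA)); apply: (Cinf_mulmx oA).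
  exact: (Cinf_sub_fun oA gC c1).
by apply: (Cinf_invmx oA u); exact: (Cinf_add oA gC c1).
Qed.

(* Differentiate [cayV g (g + 1) = 2 (g - 1)]. *)
Lemma diff_cayV n (A : set 'rV[R]_n) (g : 'rV[R]_n -> mat) y v : open A -> A y ->
  (forall y, A y -> g y + 1%:M \in unitmx) -> Cinf_on A g -> g y = 1%:M ->
  'd (fun y => cayV (g y)) y v = 'd g y v.
Proof.
move=> oA Ay u gC gy; have c1 := Cinf_cst (1%:M : mat) oA.
have kC := Cinf_cayV oA u gC; have g1C := Cinf_add oA gC c1; have g2C := Cinf_sub_fun oA gC c1.
have gd : differentiable g y by exact: (Cinf_differentiable oA gC).
have g1d : differentiable (fun y => g y + 1%:M) y by exact: (Cinf_differentiable oA g1C).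
have g2d : differentiable (fun y => 2 *: (g y - 1%:M)) y.
  exact: (Cinf_differentiable oA (Cinf_scale oA (Cinf_cst (2 : R^o) oA) g2C)).
have kgd : differentiable (fun y => cayV (g y) *m (g y + 1%:M)) y.
  exact: (Cinf_differentiable oA (Cinf_mulmx oA kC g1C)).
have E z : A z -> cayV (g z) *m (g z + 1%:M) = 2 *: (g z - 1%:M).
  by move=> Az; rewrite /cayV -scalemxAl mulmxKV//; exact: u.
have c1d : differentiable (cst (1%:M : mat)) y by exact: differentiable_cst.
have dc : 'd (cst (1%:M : mat)) y v = 0 by rewrite (congr1 (fun F => F v) (diff_cst (1%:M : mat) y)).
have dg1 : 'd (fun y => g y + 1%:M) y v = 'd g y v.
  apply: (etrans (congr1 (fun F => F v) (diffD gd c1d))).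
  by apply: (etrans (congr1 (fun Z => 'd g y v + Z) dc)); rewrite addr0.
have dg2 : 'd (fun y => 2 *: (g y - 1%:M)) y v = 2 *: 'd g y v.
  apply: (etrans (congr1 (fun F => F v) (diffZ 2 (differentiableB gd c1d)))).
  apply: (etrans (congr1 (fun F => 2 *: F v) (diffB gd c1d))).
  by apply: (etrans (congr1 (fun Z => 2 *: ('d g y v - Z)) dc)); rewrite subr0.
have H := etrans (eq_diff v oA Ay E kgd g2d) dg2.
have : 2 *: 'd (fun y => cayV (g y)) y v = 2 *: 'd g y v.
  apply: etrans H; apply/esym; apply: (etrans (diff_mulmx v oA Ay kC g1C)).
  have alg (a b g1 k : mat) : g1 = 1%:M -> k = 0 -> a *m (g1 + 1%:M) + k *m b = 2 *: a.
    by move=> -> ->; rewrite mul0mx addr0 mulmxDr mulmx1 -mulr2n -scaler_nat.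
  by apply: (alg _ _ _ _ gy); rewrite gy; exact: cayV1.
have n2 : (2 : R) != 0 by rewrite pnatr_eq0.
exact: (scalerI n2).
Qed.

End Cayley.

(** * Linear coordinates on the Lie algebra of [H] *)

Section HalgCoordinates.
Context {R : realType} {m : nat}.
Local Notation mat := 'M[R]_(1 + (m + 1)).
Local Notation J := (@gram R m).
Local Notation l0 := (@ell R m).

(** [halg] is the kernel of this linear map, so a basis comes from the row space of a kernel matrix
    and no explicit dimension formula enters. *)
Definition halg_defect (X : mat) : 'M[R]_(1 + (m + 1), 1 + (m + 1) + 1) :=
  row_mx (X^T *m J + J *m X) (X *m l0).

Fact halg_defect_linear : linear halg_defect.
Proof.
move=> k X Y; rewrite /halg_defect scale_row_mx add_row_mx linearP /= mulmxDl mulmxDr.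
by rewrite mulmxDl -!scalemxAl -scalemxAr scalerDr addrACA.
Qed.
HB.instance Definition _ := GRing.isLinear.Build R mat
  'M[R]_(1 + (m + 1), 1 + (m + 1) + 1) _ halg_defect halg_defect_linear.

Definition halg_basis := row_base (kermx (lin_mx halg_defect)).
Definition halg_dim := \rank (kermx (lin_mx halg_defect)).
Definition iota (y : 'rV[R]_halg_dim) : mat := vec_mx (y *m halg_basis).
Definition iotaV (X : mat) : 'rV[R]_halg_dim := mxvec X *m pinvmx halg_basis.

Lemma halg_mxvec X : halg X <-> (mxvec X <= halg_basis)%MS.
Proof.
rewrite /halg_basis eq_row_base; have -> : (mxvec X <= kermx (lin_mx halg_defect))%MS = (halg_defect X == 0).
  by rewrite sub_kermx mul_vec_lin mxvec_eq0.
split; first by move=> /halgP[e1 e2]; rewrite /halg_defect e1 e2 row_mx0.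
move=> /eqP E; apply/halgP; split.
  by have := congr1 lsubmx E; rewrite row_mxKl linear0.
by have := congr1 rsubmx E; rewrite row_mxKr linear0.
Qed.

Lemma iota_halg y : halg (iota y).
Proof. by apply/halg_mxvec; rewrite vec_mxK submxMl. Qed.

Lemma iotaVK X : halg X -> iota (iotaV X) = X.
Proof. by move=> /halg_mxvec X0; rewrite /iota /iotaV mulmxKpV// mxvecK. Qed.

Lemma iotaK y : iotaV (iota y) = y.
Proof.
rewrite /iota /iotaV vec_mxK; apply: (@row_free_inj _ _ _ _ halg_basis).
  exact: row_base_free.
by rewrite mulmxKpV ?submxMl.
Qed.

Lemma iota_linear : linear iota.
Proof. by move=> k y z; rewrite /iota mulmxDl -scalemxAl linearP. Qed.

Lemma iotaV_linear : linear iotaV.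
Proof. by move=> k X Y; rewrite /iotaV linearP /= mulmxDl -scalemxAl. Qed.

End HalgCoordinates.

Section MatrixOpenness.
Context {R : realType}.

Lemma Cinf_continuous n (W : normedModType R) (A : set 'rV[R]_n) (f : 'rV[R]_n -> W) y :
  Cinf_on A f -> A y -> {for y, continuous f}.
Proof. by move=> fC Ay; have [] := fC [::] y Ay. Qed.

Lemma Cinf_preim_open n (W : normedModType R) (A : set 'rV[R]_n) (f : 'rV[R]_n -> W)
    (B : set W) : open A -> Cinf_on A f -> open B -> open (A `&` f @^-1` B).
Proof.
move=> oA fC oB; rewrite openE => y [Ay By].
apply: filterI; first exact: open_nbhs_nbhs.
by apply: (Cinf_continuous fC Ay); exact: open_nbhs_nbhs.
Qed.

Lemma neq0_open : open [set r : R^o | r != 0].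
Proof.
rewrite (_ : [set r : R^o | r != 0] = ~` [set 0]); first exact/closed_openC/closed_eq.
by apply/seteqP; split => r /= => [/eqP|]; last move/eqP.
Qed.

Lemma Cinf_unit_open n p (A : set 'rV[R]_n) (f : 'rV[R]_n -> 'M[R]_p) :
  open A -> Cinf_on A f -> open (A `&` [set y | f y \in unitmx]).
Proof.
move=> oA fC.
rewrite (_ : [set y | f y \in unitmx] = (fun y => \det (f y) : R^o) @^-1` [set r | r != 0]).
  by apply: (Cinf_preim_open oA _ neq0_open); exact: Cinf_det.
by apply/seteqP; split => y /=; rewrite unitmxE unitfE.
Qed.

Lemma lsubmx_linear p q r : linear (@lsubmx R p q r).
Proof. by move=> k A B; rewrite linearP. Qed.

Lemma rsubmx_linear p q r : linear (@rsubmx R p q r).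
Proof. by move=> k A B; rewrite linearP. Qed.

Lemma Cinf_lsub n (A : set 'rV[R]_n) p q r (f : 'rV[R]_n -> 'M[R]_(p, q + r)) : open A ->
  Cinf_on A f -> Cinf_on A (fun y => lsubmx (f y)).
Proof. by move=> oA; exact: (Cinf_linear (@lsubmx_linear p q r) oA). Qed.

Lemma Cinf_rsub n (A : set 'rV[R]_n) p q r (f : 'rV[R]_n -> 'M[R]_(p, q + r)) : open A ->
  Cinf_on A f -> Cinf_on A (fun y => rsubmx (f y)).
Proof. by move=> oA; exact: (Cinf_linear (@rsubmx_linear p q r) oA). Qed.

Lemma diff_row_mx n (A : set 'rV[R]_n) p q r (f : 'rV[R]_n -> 'M[R]_(p, q))
    (g : 'rV[R]_n -> 'M[R]_(p, r)) y w : open A -> A y -> Cinf_on A f -> Cinf_on A g ->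
  'd (fun z => row_mx (f z) (g z)) y w = row_mx ('d f y w) ('d g y w).
Proof.
move=> oA Ay fC gC.
have d : differentiable (fun z => row_mx (f z) (g z)) y.
  exact: (Cinf_differentiable oA (Cinf_row_mx oA fC gC) Ay).
rewrite -[LHS]hsubmxK; congr row_mx.
  apply: (etrans (esym (diff_linear w (@lsubmx_linear p q r) d))).
  by congr ('d _ y w); apply/funext => z; rewrite row_mxKl.
apply: (etrans (esym (diff_linear w (@rsubmx_linear p q r) d))).
by congr ('d _ y w); apply/funext => z; rewrite row_mxKr.
Qed.

Lemma diff_idE n (y w : 'rV[R]_n) : 'd (fun z : 'rV[R]_n => z) y w = w.
Proof. by apply: (congr1 (fun F => F w) (@diff_lin _ _ _ idfun y _)) => ? ?. Qed.

Lemma diff_cstE n (W : normedModType R) (c : W) (y w : 'rV[R]_n) : 'd (fun=> c) y w = 0.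
Proof. exact: (congr1 (fun F => F w) (diff_cst c y)). Qed.

Lemma tplot_linear n d (M : manifold R n) (a : 'rV[R]_d -> M) y : linear (tplot a y).
Proof. by move=> k v w; rewrite /tplot linearP. Qed.

End MatrixOpenness.

(** * Cartan geometries *)

Section PrincipalBundle.
Context {R : realType} {m : nat} {N : manifold R m.+1}.
Variable C : cartan_geometry N.
Local Notation q := (1 + (m + 1))%N.
Local Notation mat := 'M[R]_(1 + (m + 1)).
Local Notation l0 := (@ell R m).
Local Notation P := (cg_tot C).
Local Notation p := (@cg_proj R m N C).
Local Notation act := (@cg_act R m N C).
Local Notation om := (@cg_om R m N C).
Local Notation k := (cg_dim C).
Implicit Types (u : P) (x : N) (h g : mat).

Let pb : principal_bundle p act := cg_principal C.
Let cc : cartan_connection act om := cg_cartan C.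

Lemma act_plot d (V : set 'rV[R]_d) (a : 'rV[R]_d -> P) (b : 'rV[R]_d -> mat) :
    open V -> smooth_plot V a -> Cinf_on V b -> (forall y, V y -> Hgroup (b y)) ->
  smooth_plot V (fun y => act (a y) (b y)).
Proof. exact: (pb_act_smooth pb). Qed.

Lemma om_linear u : linear (om u).
Proof. exact: (cc_form cc).1. Qed.

Lemma om_galg u v : galg (om u v).
Proof. by have [+ _ _] := cc_iso cc u; apply. Qed.

Lemma om_inj u v w : om u v = om u w -> v = w.
Proof. by move=> H; have [_ + _] := cc_iso cc u; apply; rewrite ?inE. Qed.

Lemma om_surj u X : galg X -> exists v, om u v = X.
Proof. by move=> H; have [_ _ /(_ X H)[v _ <-]] := cc_iso cc u; exists v. Qed.

Lemma cst_plot d (V : set 'rV[R]_d) u : open V -> smooth_plot V (fun=> u).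
Proof.
move=> oV; apply: (smooth_plotI oV) => y Vy; exists u, V; split => //.
  by move=> z _; exact: dom_self.
exact: (Cinf_cst _ oV).
Qed.

Lemma act_smooth h : Hgroup h -> smooth_map setT (act^~ h).
Proof.
move=> Hh c; have oV : open (phi P c @` (setT `&` dom P c)) by exact: (chart_image_open c openT).
apply: (act_plot oV (smooth_plot_psi c) (Cinf_cst _ oV)) => y _ //.
Qed.

Definition cay_dom : set 'rV[R]_(@halg_dim R m) := [set y | 1%:M - 2^-1 *: iota y \in unitmx].

Lemma iota_smooth : Cinf_on setT (@iota R m).
Proof. exact: (Cinf_linear (@iota_linear R m) openT (Cinf_id openT)). Qed.

Lemma cay_dom_open : open cay_dom.
Proof.
have HC : Cinf_on setT (fun y : 'rV[R]_(@halg_dim R m) => 1%:M - 2^-1 *: iota y).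
  apply: (Cinf_sub_fun openT (Cinf_cst _ openT)).
  exact: (Cinf_scale openT (Cinf_cst (2^-1 : R^o) openT) iota_smooth).
by have := Cinf_unit_open openT HC; rewrite setTI.
Qed.

Definition cay_chart u (y : 'rV[R]_(@halg_dim R m)) : P := act u (cay (iota y)).

Lemma cay_chart_plot u : smooth_plot cay_dom (cay_chart u).
Proof.
apply: (act_plot cay_dom_open (cst_plot u cay_dom_open)).
  apply: (Cinf_cay cay_dom_open); first by [].
  exact: (Cinf_sub (@subsetT _ _) iota_smooth).
by move=> y Vy; apply: cay_Hgroup => //; exact: iota_halg.
Qed.

Section FibreCurve.
Variables (d : nat) (V : set 'rV[R]_d) (b : 'rV[R]_d -> mat) (y0 : 'rV[R]_d).
Hypotheses (oV : open V) (bC : Cinf_on V b) (bH : forall y, V y -> Hgroup (b y)).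
Hypotheses (Vy0 : V y0) (b0 : b y0 = 1%:M).

Let B := V `&` [set y | b y + 1%:M \in unitmx].

Let oB : open B.
Proof. exact: (Cinf_unit_open oV (Cinf_add oV bC (Cinf_cst _ oV))). Qed.

Let By0 : B y0.
Proof. by split=> //=; rewrite b0; exact: unit2. Qed.

Let ka y := iotaV (cayV (b y)).

Let bCB : Cinf_on B b.
Proof. by apply: (Cinf_sub _ bC) => y []. Qed.

Let cC : Cinf_on B (fun y => cayV (b y)).
Proof. by apply: (Cinf_cayV oB _ bCB) => y []. Qed.

Let kaC : Cinf_on B ka.
Proof. exact: (Cinf_linear (@iotaV_linear R m) oB cC). Qed.

Let kaK y : B y -> iota (ka y) = cayV (b y).
Proof. by move=> [Vy uy]; rewrite /ka iotaVK//; apply: cayV_halg => //; exact: bH. Qed.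

Let ka0 : ka y0 = 0.
Proof. by rewrite /ka b0 cayV1; exact: (linearP_0 (@iotaV_linear R m)). Qed.

Let diff_b w : 'd b y0 w = iota ('d ka y0 w).
Proof.
have kad : differentiable ka y0 by exact: (Cinf_differentiable oB kaC By0).
have cd : differentiable (fun y => cayV (b y)) y0 by exact: (Cinf_differentiable oB cC By0).
apply: (etrans (esym (diff_cayV w oB By0 (fun y By => By.2) bCB b0))).
apply: (etrans _ (diff_linear w (@iota_linear R m) kad)).
apply: (eq_diff w oB By0 _ cd); first by move=> y By; rewrite kaK.
apply: (Cinf_differentiable oB _ By0).
exact: (Cinf_linear (@iota_linear R m) oB kaC).
Qed.

Lemma diff_Hgroup1_halg w : halg ('d b y0 w).
Proof. by rewrite diff_b; exact: iota_halg. Qed.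

(** Near [y0] the curve [b] is the Cayley transform of a smooth curve in [halg] through 0, so
    [u . b] factors through [cay_chart u] and its velocity depends only on the derivative of [b].
    Two curves in [H] with the same derivative at 1 thus give the same vertical vector. *)
Lemma tplot_fibre u w :
  tplot (fun y => act u (b y)) y0 w = tplot (cay_chart u) 0 (iotaV ('d b y0 w)).
Proof.
have kad : differentiable ka y0 by exact: (Cinf_differentiable oB kaC By0).
have aP : smooth_plot B (fun y => act u (b y)).
  apply: (act_plot oB (cst_plot u oB) bCB) => y [Vy _]; exact: bH.
have kV z : B z -> cay_dom (ka z).
  by move=> Bz; rewrite /cay_dom /= kaK//; exact: (cayV_unit Bz.2).
have E : tplot (fun y => act u (b y)) y0 w = tplot (cay_chart u \o ka) y0 w.
  apply: (eq_tplot w oB _ aP By0) => z Bz.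
  by rewrite /= /cay_chart kaK// cayVK//; exact: Bz.2.
rewrite E (tplot_comp w cay_dom_open (cay_chart_plot u) (kV _ By0) kad) ka0.
by rewrite diff_b iotaK.
Qed.

End FibreCurve.

(** The axiom on fundamental fields uses a derivative in a real parameter; here it is identified
    with the velocity of a plot. *)
Lemma tplot_exp_line u X : halg X ->
  tplot (fun y : 'rV[R]_1 => act u (exp_line X y)) 0 (delta_mx 0 0) =
  derive1 (fun t : R => phi P u (act u (expmx (t *: X)))) 0.
Proof.
move=> HX.
have aP : smooth_plot setT (fun y : 'rV[R]_1 => act u (exp_line X y)).
  apply: (act_plot openT (cst_plot u openT) (exp_line_smooth X)) => y _.
  exact: expmx_Hgroup.
have a0 : act u (exp_line X 0) = u by rewrite /exp_line mxE expmx0 (pb_act1 pb).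
pose g y := phi P u (act u (exp_line X y)).
have gd : differentiable g 0.
  by apply: (plot_differentiable openT aP I); rewrite a0; exact: dom_self.
pose e : 'rV[R]_1 := delta_mx 0 0.
have e0 : (0 : 'rV[R]_1) + (0 : R) *: e = 0 by rewrite scale0r addr0.
have gd' : derivable g ((0 : 'rV[R]_1) + (0 : R) *: e) e.
  by rewrite e0; exact: diff_derivable.
rewrite /tplot a0 -/e -[LHS](deriveE e gd) derive1E.
have -> : (fun t : R => phi P u (act u (expmx (t *: X)))) =
    fun s : R => g ((0 : 'rV[R]_1) + s *: e).
  by apply/funext => t; rewrite /g /exp_line /e !mxE add0r !eqxx mulr1.
by have [_ ->] := is_derive_line gd'; rewrite e0.
Qed.

(** The exponential line of [iota y] has the same velocity as the Cayley chart in direction [y], and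
    on exponential lines the value of [omega] is given by the axiom. *)
Lemma om_cay_chart u y : om u (tplot (cay_chart u) 0 y) = iota y.
Proof.
have HX := iota_halg y; pose X : mat := iota y.
have e0 : exp_line X 0 = 1%:M by rewrite /exp_line mxE expmx0.
have := tplot_fibre openT (exp_line_smooth X) (fun y _ => expmx_Hgroup (y 0 0) HX) I e0 u (delta_mx 0 0).
rewrite tplot_exp_line// diff_exp_line e0 mulmx1 mxE !eqxx scale1r iotaK => <-.
exact: (cc_fundamental cc).
Qed.

Lemma om_fibre d (V : set 'rV[R]_d) (b : 'rV[R]_d -> mat) y0 u w :
  open V -> Cinf_on V b -> (forall y, V y -> Hgroup (b y)) -> V y0 -> b y0 = 1%:M ->
  om u (tplot (fun y => act u (b y)) y0 w) = 'd b y0 w.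
Proof.
move=> oV bC bH Vy0 b0; rewrite (tplot_fibre oV bC bH Vy0 b0) om_cay_chart.
exact/iotaVK/(diff_Hgroup1_halg oV bC bH Vy0 b0).
Qed.

Lemma Hgroup_mulVmx h : Hgroup h -> invmx h *m h = 1%:M :> mat.
Proof. by move=> /Hgroup_unit/mulVmx. Qed.

Lemma Hgroup_mulmxV h : Hgroup h -> h *m invmx h = 1%:M :> mat.
Proof. by move=> /Hgroup_unit/mulmxV. Qed.

Lemma actM u g h : Hgroup g -> Hgroup h -> act (act u g) h = act u (g *m h).
Proof. exact: (pb_actM pb). Qed.

Lemma act1 u : act u 1%:M = u.
Proof. exact: (pb_act1 pb). Qed.

Lemma om_act h u v : Hgroup h -> om (act u h) (tmap (act^~ h) u v) = invmx h *m om u v *m h.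
Proof. by move=> Hh; exact: (cc_equivariant cc). Qed.

(* The two terms come from the restrictions of [(y, z) |-> a y . b z] to the
   two factors, the diagonal being [y |-> (y, y)]. *)
Lemma om_act_plot d (V : set 'rV[R]_d) (a : 'rV[R]_d -> P) (b : 'rV[R]_d -> mat) y w :
  open V -> smooth_plot V a -> Cinf_on V b -> (forall y, V y -> Hgroup (b y)) -> V y ->
  om (act (a y) (b y)) (tplot (fun y => act (a y) (b y)) y w) =
    invmx (b y) *m om (a y) (tplot a y w) *m b y + invmx (b y) *m 'd b y w.
Proof.
move=> oV aP bC bH Vy.
pose l (z : 'rV[R]_(d + d)) := lsubmx z; pose r (z : 'rV[R]_(d + d)) := rsubmx z.
have lC A : open A -> Cinf_on A l by move=> oA; exact: (Cinf_lsub oA (Cinf_id oA)).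
have rC A : open A -> Cinf_on A r by move=> oA; exact: (Cinf_rsub oA (Cinf_id oA)).
pose VV := (setT `&` l @^-1` V) `&` r @^-1` V.
have oVl : open (setT `&` l @^-1` V) := Cinf_preim_open openT (lC _ openT) oV.
have oVV : open VV := Cinf_preim_open oVl (rC _ oVl) oV.
pose F z := act (a (l z)) (b (r z)).
have FP : smooth_plot VV F.
  apply: (act_plot oVV).
  - by apply: (smooth_plot_comp oV oVV (lC _ oVV) _ aP) => z [[_ ?] _].
  - by apply: (Cinf_comp oVV oV _ (rC _ oVV) bC) => z [_ ?].
  - by move=> z [_ Vz]; exact: bH.
have idC := Cinf_id oV.
have DC : Cinf_on V (fun z => row_mx z z) := Cinf_row_mx oV idC idC.
have D1C : Cinf_on V (fun z => row_mx z y) := Cinf_row_mx oV idC (Cinf_cst y oV).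
have D2C : Cinf_on V (fun z => row_mx y z) := Cinf_row_mx oV (Cinf_cst y oV) idC.
have VVy : VV (row_mx y y) by split; [split => //|]; rewrite /= /l /r ?row_mxKl ?row_mxKr.
have DD : differentiable (fun z => row_mx z z) y by exact: (Cinf_differentiable oV DC Vy).
have D1 : differentiable (fun z => row_mx z y) y by exact: (Cinf_differentiable oV D1C Vy).
have D2 : differentiable (fun z => row_mx y z) y by exact: (Cinf_differentiable oV D2C Vy).
have DDE : 'd (fun z => row_mx z z) y w = row_mx w w.
  by apply: (etrans (diff_row_mx w oV Vy idC idC)); rewrite diff_idE.
have D1E : 'd (fun z => row_mx z y) y w = row_mx w 0.
  apply: (etrans (diff_row_mx w oV Vy idC (Cinf_cst y oV))).
  exact: (congr2 row_mx (diff_idE _ _) (diff_cstE _ _ _)).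
have D2E : 'd (fun z => row_mx y z) y w = row_mx 0 w.
  apply: (etrans (diff_row_mx w oV Vy (Cinf_cst y oV) idC)).
  exact: (congr2 row_mx (diff_cstE _ _ _) (diff_idE _ _)).
have T : tplot (fun y => act (a y) (b y)) y w = tplot F (row_mx y y) (row_mx w w).
  have := tplot_comp (g := fun z => row_mx z z) w oVV FP VVy DD.
  rewrite DDE => <-.
  apply: (congr1 (fun a => tplot a y w)); apply/funext => z.
  by rewrite /F /= /l /r row_mxKl row_mxKr.
have T1 : tplot F (row_mx y y) (row_mx w 0) = tmap (act^~ (b y)) (a y) (tplot a y w).
  have := tplot_comp (g := fun z => row_mx z y) w oVV FP VVy D1.
  rewrite D1E => <-.
  have -> : F \o (fun z => row_mx z y) = (act^~ (b y)) \o a.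
    by apply/funext => z; rewrite /F /= /l /r row_mxKl row_mxKr.
  by apply: (tplot_map w openT oV (act_smooth (bH _ Vy)) aP Vy).
have Hb := bH _ Vy; have HbV := HgroupV Hb.
(* With the first factor frozen, [a y . b z] equals [(a y . b y) . (b y)^-1 b z]: a curve in the
   fibre through the identity of [H], to which [om_fibre] applies. *)
have T2 : om (act (a y) (b y)) (tplot F (row_mx y y) (row_mx 0 w)) = invmx (b y) *m 'd b y w.
  have := tplot_comp (g := fun z => row_mx y z) w oVV FP VVy D2.
  rewrite D2E => <-.
  have bVC : Cinf_on V (fun z => invmx (b y) *m b z) := Cinf_mulmx oV (Cinf_cst _ oV) bC.
  have bVH z : V z -> Hgroup (invmx (b y) *m b z) by move=> Vz; apply: HgroupM => //; exact: bH.
  have bVE : 'd (fun z => invmx (b y) *m b z) y w = invmx (b y) *m 'd b y w.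
    apply: (etrans (diff_mulmx w oV Vy (Cinf_cst _ oV) bC)).
    by apply: (etrans (congr1 (fun Z => Z *m b y + _) (diff_cstE _ _ _))); rewrite mul0mx add0r.
  have fib := @om_fibre d V (fun z => invmx (b y) *m b z) y (act (a y) (b y)) w oV bVC bVH Vy
    (Hgroup_mulVmx Hb).
  apply: (etrans _ (etrans fib bVE)).
  apply: (congr1 (om _)); apply: (eq_tplot w oV _ _ Vy) => [z Vz|].
    rewrite actM//; last exact: bVH.
    by rewrite mulmxA Hgroup_mulmxV// mul1mx /F /= /l /r row_mxKl row_mxKr.
  apply: (eq_smooth_plot (a := fun z => act (a y) (b z)) oV).
    by move=> z Vz; rewrite /F /= /l /r row_mxKl row_mxKr.
  exact: (act_plot oV (cst_plot _ oV) bC bH).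
have -> : tplot (fun y => act (a y) (b y)) y w =
    tplot F (row_mx y y) (row_mx w 0) + tplot F (row_mx y y) (row_mx 0 w).
  by rewrite T -(linearP_add _ _ (tplot_linear _ _)) add_row_mx addr0 add0r.
by rewrite (linearP_add _ _ (om_linear _)) T1 om_act// T2.
Qed.

End PrincipalBundle.

(** * Local sections, and [phi_u] as an isomorphism onto the orthogonal of [ell] *)

Section LocalSections.
Context {R : realType} {m : nat} {N : manifold R m.+1}.
Variable C : cartan_geometry N.
Local Notation q := (1 + (m + 1))%N.
Local Notation mat := 'M[R]_(1 + (m + 1)).
Local Notation L := 'cV[R]_(1 + (m + 1)).
Local Notation l0 := (@ell R m).
Local Notation vec := 'rV[R]_m.+1.
Local Notation P := (cg_tot C).
Local Notation p := (@cg_proj R m N C).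
Local Notation act := (@cg_act R m N C).
Local Notation om := (@cg_om R m N C).
Implicit Types (u : P) (x : N) (h g : mat) (U : set N) (s : N -> P).

Let pb : principal_bundle p act := cg_principal C.

Lemma proj_act u h : Hgroup h -> p (act u h) = p u.
Proof. exact: (pb_fibre pb). Qed.

Lemma proj_smooth : smooth_map setT p.
Proof. exact: (pb_smooth pb). Qed.

Lemma proj_continuous : continuous p.
Proof. by move=> u; exact: (smooth_map_continuous (O := setT) I proj_smooth). Qed.

Lemma proj_preim_open U : open U -> open (p @^-1` U).
Proof. by move=> oU; apply: open_comp => // u _; exact: proj_continuous. Qed.

Lemma local_section_at u : exists U s, [/\ local_section U s, U (p u) & s (p u) = u].
Proof.
have [U [s [g [oU Ux sC gC [ps gs sg]]]]] := pb_trivial pb (p u).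
have [Hg gE] := gs u Ux.
exists U, (fun x => act (s x) (g u)); split => //.
split => //; last by move=> x Ux'; rewrite proj_act// ps.
exact: (smooth_map_comp oU openT (fun _ _ => I) sC (act_smooth Hg)).
Qed.

Lemma local_section_through x : exists U s, local_section U s /\ U x.
Proof. by have [U [s [g [oU Ux sC _ [ps _ _]]]]] := pb_trivial pb x; exists U, s. Qed.

Lemma proj_surj x : exists u, p u = x.
Proof. by have [U [s [[_ _ ps] Ux]]] := local_section_through x; exists (s x); exact: ps. Qed.

Lemma fibre_ex u u' : p u = p u' -> exists2 h, Hgroup h & u' = act u h.
Proof.
have [U [s [g [oU Ux sC gC [ps gs sg]]]]] := pb_trivial pb (p u) => pE.
have [Hg gE] := gs u Ux; have [|Hg' gE'] := gs u'; first by rewrite -pE.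
have HV := HgroupV Hg; exists (invmx (g u) *m g u'); first exact: HgroupM.
rewrite -[X in act X _]gE actM//; last exact: HgroupM.
by rewrite mulmxA Hgroup_mulmxV// mul1mx pE.
Qed.

Lemma act_free u h h' : Hgroup h -> Hgroup h' -> act u h = act u h' -> h = h'.
Proof.
have [U [s [g [oU Ux sC gC [ps gs sg]]]]] := pb_trivial pb (p u) => Hh Hh'.
have [Hg gE] := gs u Ux; rewrite -gE !actM// => E.
have := congr1 g E; rewrite !sg//; try exact: HgroupM.
by move/(congr1 (mulmx (invmx (g u)))); rewrite !mulmxA Hgroup_mulVmx// !mul1mx.
Qed.

(** The element of [H] is pointwise unique; in a local trivialisation with coordinate [ga] it is
    [ga(f)^-1 ga(f')], which is smooth. *)
Lemma fibre_difference n (M : manifold R n) (O : set M) (f f' : M -> P) :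
  open O -> smooth_map O f -> smooth_map O f' -> (forall y, O y -> p (f y) = p (f' y)) ->
  exists2 g : M -> mat, smooth_fun O g & forall y, O y -> Hgroup (g y) /\ f' y = act (f y) (g y).
Proof.
move=> oO fC fC' pE.
pose g y := xget 0 [set h | Hgroup h /\ f' y = act (f y) h].
have gP y : O y -> Hgroup (g y) /\ f' y = act (f y) (g y).
  move=> Oy; have [h Hh E] := fibre_ex (pE y Oy).
  by rewrite /g; case: xgetP => [k _ //|/(_ h) []].
exists g => //; apply: smooth_fun_local => y Oy.
have [U [s [ga [oU Ux sC gC [ps gs sg]]]]] := pb_trivial pb (p (f y)).
have opU := proj_preim_open oU.
pose O' := O `&` f @^-1` (p @^-1` U).
have oO' : open O' := smooth_map_preim_open oO fC opU.
exists O'; split => //.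
have gfC : smooth_fun O' (ga \o f).
  by apply: (smooth_fun_comp oO' opU) => // [z []//|]; apply: smooth_map_sub fC => z [].
have gfC' : smooth_fun O' (ga \o f').
  apply: (smooth_fun_comp oO' opU) => // [z [Oz]|]; first by rewrite /= pE.
  by apply: smooth_map_sub fC' => z [].
apply: (eq_smooth_fun (f := fun z => invmx (ga (f z)) *m ga (f' z)) oO'); last first.
  apply: (smooth_fun_mulmx oO' _ gfC'); apply: (smooth_fun_invmx oO' _ gfC) => z [_ Uz].
  exact/Hgroup_unit/(gs _ Uz).1.
move=> z [Oz Uz]; have [Hg E] := gP z Oz; have [Hh Eh] := gs _ Uz.
have -> : ga (f' z) = ga (f z) *m g z.
  by rewrite E -{1}Eh actM// sg//; exact: HgroupM.
by rewrite mulmxA Hgroup_mulVmx// mul1mx.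
Qed.

Section Maps.
Context {n : nat} {M : manifold R n}.
Variables (O : set M) (f : M -> P) (g : M -> mat).
Hypotheses (oO : open O) (fC : smooth_map O f) (gC : smooth_fun O g).
Hypothesis gH : forall y, O y -> Hgroup (g y).

Lemma act_map_smooth : smooth_map O (fun y => act (f y) (g y)).
Proof.
move=> c; have oV := chart_image_open c oO.
apply: (act_plot oV (fC c) (@gC c)) => y Vy.
by have [Oy _ _] := chart_imageP Vy; exact: gH.
Qed.

Lemma om_act_map y v : O y ->
  om (act (f y) (g y)) (tmap (fun y => act (f y) (g y)) y v) =
    invmx (g y) *m om (f y) (tmap f y v) *m g y + invmx (g y) *m dfun g y v.
Proof.
move=> Oy; have dy := @dom_self _ _ M y.
have oV := chart_image_open y oO; have Vy := phi_image Oy dy.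
have bH z : (phi M y @` (O `&` dom M y)) z -> Hgroup (g (psi M y z)).
  by move=> /chart_imageP[Oz _ _]; exact: gH.
have E := om_act_plot v oV (fC y) (@gC y) bH Vy.
have K := phiK dy.
have tE (F : M -> P) : smooth_map O F -> tmap F y v = tplot (F \o psi M y) (phi M y y) v.
  by move=> FC; rewrite -(tmap_tvec v oO FC Oy dy) tvec_self.
rewrite (tE _ act_map_smooth) (tE _ fC) -[in act (f y) _]K.
by apply: (etrans E); rewrite /dfun /= K.
Qed.

End Maps.

Definition theta s x (v : vec) : mat := om (s x) (tmap s x v).

Lemma theta_form U s : local_section U s -> form_on U (theta s).
Proof. by move=> [oU sC _]; exact: (pullback_form oU sC (cc_form (cg_cartan C))). Qed.

Lemma theta_linear s x : linear (theta s x).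
Proof. by move=> k v w; rewrite /theta (tmap_linear s x) om_linear. Qed.

Lemma tmap_section U s x v : local_section U s -> U x ->
  tmap p (s x) (tmap s x v) = v.
Proof.
move=> [oU sC ps] Ux; rewrite -(tmap_comp v oU openT sC proj_smooth Ux I).
rewrite -[RHS](tmap_id (M := N) x); apply: (eq_tmap v oU _ _ Ux) => //.
exact: (smooth_map_comp oU openT (fun _ _ => I) sC proj_smooth).
Qed.

(** Over [U] every point is [s (p u') . g u'] with [g] smooth, and the product rule for [omega]
    applied to the identity map written in this way expresses [omega] through its pullback [theta]
    and [g^-1 dg]. *)
Lemma om_section_vertical U s u : local_section U s -> U (p u) -> exists2 g,
  smooth_fun (p @^-1` U) g & (forall u', U (p u') -> Hgroup (g u') /\ u' = act (s (p u')) (g u')) /\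
  forall z, om u z = invmx (g u) *m theta s (p u) (tmap p u z) *m g u + invmx (g u) *m dfun g u z.
Proof.
move=> [oU sC ps] Uu; have oO := proj_preim_open oU.
have pC : smooth_map (p @^-1` U) p by exact: (smooth_map_sub _ proj_smooth).
have spC : smooth_map (p @^-1` U) (s \o p) := smooth_map_comp oO oU (fun _ Uz => Uz) pC sC.
have [|g gC gE] := fibre_difference oO spC (@smooth_map_id _ _ P _).
  by move=> u' Uu'; rewrite /= ps.
exists g => //; split => // z.
have := om_act_map oO spC gC (fun y Uy => (gE y Uy).1) z Uu.
rewrite -(gE u Uu).2 (tmap_comp z oO oU pC sC Uu Uu) => <-.
rewrite -[z in LHS](tmap_id u); apply: (congr1 (om u)).
apply: (eq_tmap z oO _ _ Uu) => [y Uy|]; first exact: (gE y Uy).2.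
exact: smooth_map_id.
Qed.

(** For vertical [z] only [g^-1 dg(z)] survives in the local formula, and [dg(z)] kills [ell]
    because [g] takes values in the stabiliser of [ell]. Consequently [omega] modulo [halg] depends
    only on the projection of its argument. *)
Lemma om_vertical u z : tmap p u z = 0 -> om u z *m l0 = 0.
Proof.
move=> z0; have [U [s [ls Uu _]]] := local_section_at u.
have [oU _ _] := ls; have oO := proj_preim_open oU.
have [g gC [gE ->]] := om_section_vertical ls Uu.
rewrite z0 (linearP_0 (theta_linear s (p u))) mulmx0 mul0mx add0r -mulmxA.
have -> : dfun g u z *m l0 = 0; last by rewrite mulmx0.
have lC : smooth_fun (p @^-1` U) (fun=> l0) := smooth_fun_cst l0 oO.
have := dfun_mulmx z oO gC lC Uu; rewrite dfun_cst mulmx0 addr0 => <-.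
rewrite -[RHS](dfun_cst (M := P) l0 u z); apply: (eq_dfun z oO _ _ Uu).
  by move=> y Uy; have /HgroupP[_ ->] := (gE y Uy).1.
exact: (smooth_fun_mulmx oO gC lC).
Qed.

(* The class of [phi_u v] in g/h as the vector of [ell^perp] it acts by on [ell]. *)
Definition Phih u (v : vec) : L := lvec (phi_iso u v).1 (phi_iso u v).2 0.

Lemma galg_ell X : galg X -> X *m l0 = lvec (gproj X).1 (gproj X).2 0.
Proof. by move=> [a [y [z [A [sA ->]]]]]; rewrite gmx_ell gproj_gmx. Qed.

Lemma PhihE u v z : tmap p u z = v -> Phih u v = om u z *m l0.
Proof.
move=> zv; rewrite /Phih /phi_iso.
case: xgetP => [y -> [z' [z'v ->]]|/(_ (gproj (om u z))) []]; last by exists z.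
rewrite -galg_ell; last exact: om_galg.
apply/eqP; rewrite -subr_eq0 -mulmxBl -(linearP_sub _ _ (om_linear u)) om_vertical//.
by rewrite (linearP_sub _ _ (tmap_linear _ _)) zv z'v subrr.
Qed.

Lemma Phih_section U s x v : local_section U s -> U x -> Phih (s x) v = theta s x v *m l0.
Proof. by move=> ls Ux; apply: PhihE; have [_ _ ps] := ls; exact: (tmap_section v ls Ux). Qed.

Lemma proj_submersive u v : exists z, tmap p u z = v.
Proof.
have [U [s [ls Uu su]]] := local_section_at u.
exists (tmap s (p u) v); have := tmap_section v ls Uu.
by rewrite su.
Qed.

Lemma Phih_linear u : linear (Phih u).
Proof.
move=> k v w; have [z zv] := proj_submersive u v; have [z' zw] := proj_submersive u w.
rewrite (PhihE zv) (PhihE zw) (@PhihE _ _ (k *: z + z')); last first.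
  by rewrite (tmap_linear _ _) zv zw.
by rewrite (om_linear u) mulmxDl scalemxAl.
Qed.

Lemma lbot_Phih u v : lbot (Phih u v) = 0.
Proof. exact: lbot_lvec. Qed.

Lemma phi_isoE u v : phi_iso u v = (ltop (Phih u v), lmid (Phih u v)).
Proof. by rewrite /Phih ltop_lvec lmid_lvec; case: phi_iso. Qed.

Lemma Phih_act u h v : Hgroup h -> Phih (act u h) v = invmx h *m Phih u v.
Proof.
move=> Hh; have [z zv] := proj_submersive u v.
have aC := @act_smooth _ _ _ C h Hh.
rewrite (PhihE zv) (@PhihE _ _ (tmap (act^~ h) u z)).
  by rewrite om_act// -!mulmxA; have /HgroupP[_ ->] := Hh.
rewrite -(tmap_comp z openT openT aC proj_smooth I I) -zv.
apply: (eq_tmap z openT _ _ I) => [y _|]; first exact: proj_act.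
exact: (smooth_map_comp openT openT (fun _ _ => I) aC proj_smooth).
Qed.

(** If [Phih u] kills [v] and [z] lifts [v], then [omega(z)] lies in [halg]. By injectivity of
    [omega], [z] is the velocity of [u . exp(t omega(z))], a curve in a fibre, so its projection [v]
    is zero. *)
Lemma Phih_inj u v w : Phih u v = Phih u w -> v = w.
Proof.
move=> E; apply/eqP; rewrite -subr_eq0; apply/eqP.
have : Phih u (v - w) = 0 by rewrite (linearP_sub _ _ (Phih_linear u)) E subrr.
have [z zv] := proj_submersive u (v - w); rewrite (PhihE zv) => z0.
have HX := galg_halg (om_galg u z) z0.
have e0 : exp_line (om u z) 0 = 1%:M by rewrite /exp_line mxE expmx0.
have eH y : setT y -> Hgroup (exp_line (om u z) y) by move=> _; exact: expmx_Hgroup.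
have aP : smooth_plot setT (fun y : 'rV[R]_1 => act u (exp_line (om u z) y)).
  exact: (act_plot openT (cst_plot u openT) (exp_line_smooth _) eH).
have := om_fibre (C := C) u (delta_mx 0 0) openT (exp_line_smooth (om u z)) eH I e0.
rewrite diff_exp_line e0 mulmx1 mxE !eqxx scale1r => /(om_inj (C := C)) zE.
rewrite -zv -zE; have a0 : act u (exp_line (om u z) 0) = u by rewrite e0 act1.
rewrite -{1}a0 -(tplot_map (delta_mx 0 0) openT openT proj_smooth aP I I).
rewrite (_ : p \o _ = fun=> p u).
  exact: (diff_cstE (phi N (p u) (p u)) 0).
by apply/funext => y /=; rewrite proj_act//; exact: eH.
Qed.

Lemma Phih_surj u (e : L) : lbot e = 0 -> exists v, Phih u v = e.
Proof.
move=> e0; have Hg : galg (gmx (ltop e) (lmid e) 0 0 : mat) by apply: galg_gmx; rewrite trmx0 oppr0.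
have [z zE] := om_surj u Hg; exists (tmap p u z).
by rewrite (PhihE erefl) zE gmx_ell [RHS]lvecK e0.
Qed.

Lemma Phih_form U s : local_section U s -> form_on U (fun x v => Phih (s x) v).
Proof.
move=> ls; have [oU _ _] := ls; have [tl tC] := theta_form ls.
split => [x Ux|c w]; first exact: Phih_linear.
have oUc := openId c oU.
apply: (eq_smooth_fun (f := fun x => theta s x (tvec c x w) *m l0) oUc).
  by move=> x [Ux _]; rewrite (Phih_section _ ls Ux).
exact: (smooth_fun_mulmx oUc (tC c w) (smooth_fun_cst l0 oUc)).
Qed.

End LocalSections.

Lemma smooth_fun_linear (R : realType) n (M : manifold R n) (O : set M) p q r s
    (l : 'M[R]_(p, q) -> 'M[R]_(r, s)) (f : M -> 'M[R]_(p, q)) :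
  linear l -> open O -> smooth_fun O f -> smooth_fun O (fun x => l (f x)).
Proof. by move=> ll oO fC c; exact: (Cinf_linear ll (chart_image_open c oO) (@fC c)). Qed.

(** * Tractor calculus *)

Section TractorCalculus.
Context {R : realType} {m : nat} {N : manifold R m.+1}.
Variable C : cartan_geometry N.
Local Notation q := (1 + (m + 1))%N.
Local Notation mat := 'M[R]_(1 + (m + 1)).
Local Notation L := 'cV[R]_(1 + (m + 1)).
Local Notation J := (@gram R m).
Local Notation l0 := (@ell R m).
Local Notation vec := 'rV[R]_m.+1.
Local Notation P := (cg_tot C).
Local Notation p := (@cg_proj R m N C).
Local Notation act := (@cg_act R m N C).
Implicit Types (u : P) (x : N) (g : mat) (U : set N) (s : N -> P) (f : P -> L)
  (W X : N -> vec).

Definition nabla_along s W f x : L := dfun (f \o s) x (W x) + theta s x (W x) *m f (s x).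

Lemma tractor_along U s f : tractor_section f -> local_section U s -> smooth_fun U (f \o s).
Proof.
by move=> [fC _] [oU sC _]; exact: (smooth_fun_comp oU openT (fun _ _ => I) sC fC).
Qed.

Lemma tractor_act f u g : tractor_section f -> Hgroup g -> f (act u g) = invmx g *m f u.
Proof. by move=> [_ fE]; exact: fE. Qed.

Lemma tractor_actK f u g : tractor_section f -> Hgroup g -> f u = g *m f (act u g).
Proof. by move=> tf Hg; rewrite (tractor_act _ tf Hg) mulmxA Hgroup_mulmxV// mul1mx. Qed.

(** With [s' = s . G], the derivative of [f \o s = G (f \o s')] produces a term in [dG], which
    cancels the inhomogeneous term of [theta] for the two sections. *)
Lemma nabla_along_change U s U' s' W f x g : local_section U s -> local_section U' s' ->
  U x -> U' x -> tractor_section f -> Hgroup g -> s' x = act (s x) g ->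
  nabla_along s W f x = g *m nabla_along s' W f x.
Proof.
move=> ls ls' Ux Ux' tf Hg sx; have [oU sC ps] := ls; have [oU' sC' ps'] := ls'.
pose O := U `&` U'; have oO : open O := openI oU oU'.
have Ox : O x by [].
have [OU OU'] : O `<=` U /\ O `<=` U' by split => y [].
have sCO := smooth_map_sub OU sC; have sCO' := smooth_map_sub OU' sC'.
have [|G GC GE] := fibre_difference oO sCO sCO'.
  by move=> y [Uy Uy']; rewrite ps ?ps'.
have [HGx sGx] := GE x Ox.
have Gx : G x = g by apply: (@act_free _ _ _ C (s x) _ _ HGx Hg); rewrite -sGx.
have th : theta s' x (W x) = invmx g *m theta s x (W x) *m g + invmx g *m dfun G x (W x).
  rewrite -Gx -(om_act_map oO sCO GC (fun y Oy => (GE y Oy).1) (W x) Ox) -sGx /theta.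
  apply: (congr1 (cg_om C (s' x))); apply: (eq_tmap (W x) oO _ sCO' Ox) => y Oy.
  exact: (GE y Oy).2.
have fC' : smooth_fun O (f \o s') := smooth_fun_sub OU' (tractor_along tf ls').
have d : dfun (f \o s) x (W x) = dfun G x (W x) *m f (s' x) + g *m dfun (f \o s') x (W x).
  rewrite -Gx -(dfun_mulmx (W x) oO GC fC' Ox).
  apply: (eq_dfun (W x) oO _ (smooth_fun_sub OU (tractor_along tf ls)) Ox) => y Oy /=.
  by have [HGy ->] := GE y Oy; exact: tractor_actK.
rewrite /nabla_along d th [X in theta s x (W x) *m X](tractor_actK _ tf Hg) -sx.
rewrite mulmxDr mulmxDl mulmxDr !mulmxA Hgroup_mulmxV// !mul1mx.
by rewrite addrAC addrC; congr (_ + _); rewrite addrC.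
Qed.

(** [nablaT] picks an arbitrary value computed from some section through the point; two sections
    agreeing at the point are related there by the identity of [H], so all candidates coincide. *)
Lemma nablaTE U s W f x : local_section U s -> U x -> tractor_section f ->
  nablaT W f (s x) = nabla_along s W f x.
Proof.
move=> ls Ux tf; have [oU sC ps] := ls; rewrite /nablaT ps//.
case: xgetP => [y -> [U' [s' [ls' Ux' sx ->]]]|/(_ (nabla_along s W f x)) []]; last first.
  by exists U, s.
apply/esym; have E : s' x = act (s x) 1%:M by rewrite act1.
have := nabla_along_change W ls ls' Ux Ux' tf (@Hgroup1 R m) E.
by rewrite mul1mx /nabla_along /theta sx.
Qed.

Lemma nablaT_at U s W f u : local_section U s -> U (p u) -> s (p u) = u ->
  tractor_section f -> nablaT W f u = nabla_along s W f (p u).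
Proof. by move=> ls Uu su tf; rewrite -[X in nablaT W f X]su; exact: (nablaTE W ls Uu tf). Qed.

Lemma nablaT_act W f u g : tractor_section f -> Hgroup g ->
  nablaT W f (act u g) = invmx g *m nablaT W f u.
Proof.
move=> tf Hg; have [U [s [ls Uu su]]] := local_section_at u.
have [U' [s' [ls' Uu' su']]] := local_section_at (act u g).
rewrite proj_act// in Uu' su'.
rewrite -su' -[in RHS]su (nablaTE W ls Uu tf) (nablaTE W ls' Uu' tf).
rewrite (@nabla_along_change U s U' s' W f (p u) g) ?su//.
by rewrite mulmxA Hgroup_mulVmx// mul1mx.
Qed.

(** Equivariance gives [f u = (g u)^-1 f (s (p u))] over a local section [s], so smoothness upstairs
    follows from smoothness along sections. *)
Lemma tractorI f : (forall u g, Hgroup g -> f (act u g) = invmx g *m f u) ->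
  (forall x, exists U s, [/\ local_section U s, U x & smooth_fun U (f \o s)]) ->
  tractor_section f.
Proof.
move=> fE fC; split => //; apply: smooth_fun_local => u _.
have [U [s [ls Uu fsC]]] := fC (p u); have [oU sC ps] := ls.
have oO := proj_preim_open C oU; exists (p @^-1` U); split => //.
have [g gC [gE _]] := om_section_vertical ls Uu.
apply: (eq_smooth_fun (f := fun u' => invmx (g u') *m f (s (p u'))) oO).
  by move=> u' Uu'; have [Hg E] := gE u' Uu'; rewrite [in RHS]E fE.
apply: (smooth_fun_mulmx oO).
  by apply: (smooth_fun_invmx oO _ gC) => u' Uu'; exact: (Hgroup_unit (gE u' Uu').1).
have pC : smooth_map (p @^-1` U) p by exact: (smooth_map_sub _ (proj_smooth (C := C))).
exact: (smooth_fun_comp oO oU (fun _ Uz => Uz) pC fsC).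
Qed.

Lemma nablaT_tractor W f : smooth_field setT W -> tractor_section f ->
  tractor_section (nablaT W f).
Proof.
move=> WC tf; apply: tractorI => [u g Hg|x]; first exact: nablaT_act.
have [U [s [ls Ux]]] := local_section_through C x; have [oU sC ps] := ls.
exists U, s; split => //; have WCU := smooth_field_sub (@subsetT _ U) WC.
apply: (eq_smooth_fun (f := nabla_along s W f) oU).
  by move=> y Uy; rewrite /= (nablaTE W ls Uy tf).
have fC := tractor_along tf ls.
apply: (smooth_fun_add oU (dfun_field oU fC WCU)).
exact: (smooth_fun_mulmx oU (form_field oU (theta_form ls) WCU) fC).
Qed.

Lemma nablaT_ext W X f u : W (p u) = X (p u) -> nablaT W f u = nablaT X f u.
Proof. by move=> WX; rewrite /nablaT WX. Qed.

Section Rules.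
Variables (f f' : P -> L) (tf : tractor_section f) (tf' : tractor_section f').

Lemma tractor_add : tractor_section (fun u => f u + f' u).
Proof.
split=> [|u g Hg]; first exact: (smooth_fun_add openT tf.1 tf'.1).
by rewrite !(tractor_act _ _ Hg)// mulmxDr.
Qed.

Lemma tractor_scale (k : N -> R^o) : smooth_fun setT k ->
  tractor_section (fun u => k (p u) *: f u).
Proof.
move=> kC; split=> [|u g Hg].
  apply: (smooth_fun_scale openT _ tf.1).
  exact: (smooth_fun_comp openT openT (fun _ _ => I) (@proj_smooth _ _ _ C) kC).
by rewrite (tractor_act _ tf Hg) proj_act// scalemxAr.
Qed.

Lemma nablaT_add W u : nablaT W (fun u => f u + f' u) u = nablaT W f u + nablaT W f' u.
Proof.
have [U [s [ls Uu su]]] := local_section_at u; have [oU sC ps] := ls.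
rewrite !(nablaT_at W ls Uu su)//; last exact: tractor_add.
have E : dfun ((fun u0 => f u0 + f' u0) \o s) (p u) (W (p u)) =
    dfun (f \o s) (p u) (W (p u)) + dfun (f' \o s) (p u) (W (p u)).
  by exact: (dfun_add (W (p u)) oU (tractor_along tf ls) (tractor_along tf' ls) Uu).
by rewrite /nabla_along E mulmxDr addrACA.
Qed.

Lemma nablaT_scale (k : N -> R^o) W u : smooth_fun setT k ->
  nablaT W (fun u => k (p u) *: f u) u =
    dfun k (p u) (W (p u)) *: f u + k (p u) *: nablaT W f u.
Proof.
move=> kC; have [U [s [ls Uu su]]] := local_section_at u; have [oU sC ps] := ls.
have kU : smooth_fun U k by exact: (smooth_fun_sub _ kC).
have tkf := tractor_scale kC.
have E : dfun (fun y => k y *: (f \o s) y) (p u) (W (p u)) =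
    dfun k (p u) (W (p u)) *: f u + k (p u) *: dfun (f \o s) (p u) (W (p u)).
  by rewrite -[X in _ *: f X]su; exact: (dfun_scale (W (p u)) oU kU (tractor_along tf ls) Uu).
have E' : dfun ((fun u => k (p u) *: f u) \o s) (p u) (W (p u)) =
    dfun (fun y => k y *: (f \o s) y) (p u) (W (p u)).
  apply: (eq_dfun _ oU _ (tractor_along tkf ls) Uu) => y Uy /=.
  by rewrite ps.
rewrite (nablaT_at W ls Uu su tkf) (nablaT_at W ls Uu su tf) /nabla_along E' E su.
by rewrite scalerDr -scalemxAr addrA.
Qed.

Lemma nablaT_linear (k : N -> R) W W' u :
  nablaT (fun x => k x *: W x + W' x) f u = k (p u) *: nablaT W f u + nablaT W' f u.
Proof.
have [U [s [ls Uu su]]] := local_section_at u.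
rewrite !(nablaT_at _ ls Uu su tf) /nabla_along.
rewrite (dfun_linear (f \o s) (p u)) (theta_linear s (p u)) mulmxDl -scalemxAl.
by rewrite scalerDr addrACA.
Qed.

Lemma theta_skew s x v (e e' : L) :
  lprod (theta s x v *m e) e' + lprod e (theta s x v *m e') = 0.
Proof.
have /galgP := om_galg (s x) (tmap s x v); rewrite -/(theta s x v) => H.
have -> : lprod (theta s x v *m e) e' = (e^T *m ((theta s x v)^T *m J) *m e') 0 0.
  by rewrite /lprod trmx_mul !mulmxA.
have -> : lprod e (theta s x v *m e') = (e^T *m (J *m theta s x v) *m e') 0 0.
  by rewrite /lprod !mulmxA.
have -> (k k' : 'M[R]_1) : k 0 0 + k' 0 0 = (k + k') 0 0 by rewrite mxE.
by rewrite -mulmxDl -mulmxDr H mulmx0 mul0mx mxE.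
Qed.

(** Along a section the product is the matrix product of [f^T], [J] and [f']; the connection terms
    in the two covariant derivatives cancel because [theta] is skew. *)
Lemma dfun_lprod (F : N -> R^o) W u : (forall u, F (p u) = lprod (f u) (f' u)) ->
  dfun F (p u) (W (p u)) = lprod (nablaT W f u) (f' u) + lprod (f u) (nablaT W f' u).
Proof.
move=> FE; have [U [s [ls Uu su]]] := local_section_at u; have [oU sC ps] := ls.
pose w := W (p u); have fC := tractor_along tf ls; have fC' := tractor_along tf' ls.
have fTC := smooth_fun_trmx oU fC.
have fJC := smooth_fun_mulmx oU fTC (smooth_fun_cst J oU).
have prC := smooth_fun_mulmx oU fJC fC'.
have E1 : dfun F (p u) w = dfun (fun y => ((f (s y))^T *m J *m f' (s y)) 0 0 : R^o) (p u) w.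
  have H : smooth_fun U F.
    apply: (eq_smooth_fun oU _ (smooth_fun_entry 0 0 oU prC)) => y Uy.
    by rewrite /= -/(lprod _ _) -FE ps.
  apply: (eq_dfun w oU _ H Uu) => y Uy.
  by rewrite -/(lprod _ _) -FE ps.
have E2 : dfun (fun y => (f (s y))^T *m J *m f' (s y)) (p u) w =
    (dfun (f \o s) (p u) w)^T *m J *m f' u + (f u)^T *m J *m dfun (f' \o s) (p u) w.
  apply: (etrans (dfun_mulmx w oU fJC fC' Uu)).
  rewrite (dfun_mulmx w oU fTC (smooth_fun_cst J oU) Uu) dfun_cst mulmx0 addr0.
  by rewrite (dfun_trmx w oU fC Uu) /= su.
rewrite E1 -(dfun_entry w 0 0 oU prC Uu) E2 mxE.
have -> : nablaT W f u = dfun (f \o s) (p u) w + theta s (p u) w *m f u.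
  by rewrite -{1}su (nablaTE W ls Uu tf) /nabla_along su.
have -> : nablaT W f' u = dfun (f' \o s) (p u) w + theta s (p u) w *m f' u.
  by rewrite -{1}su (nablaTE W ls Uu tf') /nabla_along su.
rewrite lprodDr lprodC lprodDr addrACA.
rewrite [X in _ = _ + (X + _)]lprodC theta_skew addr0.
by congr (_ + _); rewrite lprodC.
Qed.

End Rules.

Lemma tractor_xi : tractor_section (@xi R m N C).
Proof.
split=> [|u g /HgroupV/HgroupP[_ ->]//]; exact: (smooth_fun_cst l0 openT).
Qed.

Lemma PhiE W : Phi W = fun u : P => Phih u (W (p u)).
Proof.
apply/funext => u; have [U [s [ls Uu su]]] := local_section_at u.
rewrite /Phi -{1}su (nablaTE W ls Uu tractor_xi) /nabla_along.
have -> : dfun (@xi R m N C \o s) (p u) (W (p u)) = 0 by exact: (dfun_cst l0 (p u)).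
by rewrite add0r -[in RHS]su (Phih_section _ ls Uu) su.
Qed.

Lemma tractor_Phi X : smooth_field setT X -> tractor_section (fun u => Phih u (X (p u))).
Proof. by move=> XC; rewrite -PhiE; exact: (nablaT_tractor XC tractor_xi). Qed.

(** The last component of [Phih] is always 0, so its first [1 + m] components form an injective form
    with values in a space of dimension [m.+1], and [smooth_field_coframe] applies. *)
Lemma smooth_field_Phih U s X : local_section U s ->
  smooth_fun U (fun x => Phih (s x) (X x)) -> smooth_field U X.
Proof.
move=> ls XC; have [oU _ _] := ls; have [tl tC] := Phih_form ls.
pose row (e : L) : 'rV[R]_(1 + m) := row_mx (usubmx e)^T (usubmx (dsubmx e))^T.
have row_lin : linear row by move=> k e e'; rewrite /row !linearP /= scale_row_mx add_row_mx.
have row_smooth O (F : N -> L) : open O -> smooth_fun O F -> smooth_fun O (fun x => row (F x)).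
  by move=> oO; exact: (smooth_fun_linear row_lin oO).
apply: (@smooth_field_coframe R m.+1 N U (fun x v => row (Phih (s x) v)) X oU).
- split=> [x Ux k v w|c w]; first by rewrite (tl x Ux) row_lin.
  exact: (row_smooth _ _ (openId c oU) (tC c w)).
- move=> x v Ux row0; apply: (@Phih_inj R m N C (s x)); rewrite (linearP_0 (tl x Ux)).
  have e1 : usubmx (Phih (s x) v) = 0.
    have := congr1 (@lsubmx R 1 1 m) row0; rewrite linear0 [LHS]row_mxKl => e.
    by apply: trmx_inj; rewrite e trmx0.
  have e2 : usubmx (dsubmx (Phih (s x) v)) = 0.
    have := congr1 (@rsubmx R 1 1 m) row0; rewrite linear0 [LHS]row_mxKr => e.
    by apply: trmx_inj; rewrite e trmx0.
  rewrite [LHS]lvecK lbot_Phih /ltop /lmid e1 e2 /lvec !mxE.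
  by rewrite -scalemx1 scale0r !col_mx0.
- exact: (row_smooth _ _ oU XC).
Qed.

End TractorCalculus.

(** * The splitting of tractors determined by a one-form *)

Section Decomposition.
Context {R : realType} {m : nat} {N : manifold R m.+1}.
Variable C : cartan_geometry N.
Local Notation q := (1 + (m + 1))%N.
Local Notation mat := 'M[R]_(1 + (m + 1)).
Local Notation L := 'cV[R]_(1 + (m + 1)).
Local Notation l0 := (@ell R m).
Local Notation vec := 'rV[R]_m.+1.
Local Notation P := (cg_tot C).
Local Notation p := (@cg_proj R m N C).
Local Notation act := (@cg_act R m N C).
Implicit Types (u : P) (x : N) (g : mat) (U : set N) (s : N -> P) (f : P -> L)
  (W X Y : N -> vec) (v w : vec) (e : L).

Definition Phinv u e : vec := xget 0 [set v | Phih u v = e].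

Lemma PhinvK u e : lbot e = 0 -> Phih u (Phinv u e) = e.
Proof.
by move=> e0; have [v vE] := Phih_surj u e0; rewrite /Phinv; case: xgetP => [w -> ->|/(_ v) []].
Qed.

Lemma PhihK u v : Phinv u (Phih u v) = v.
Proof. by apply: (@Phih_inj R m N C u); rewrite PhinvK ?lbot_Phih. Qed.

Lemma PhihD u v w : Phih u (v + w) = Phih u v + Phih u w.
Proof. exact: (linearP_add _ _ (Phih_linear u)). Qed.

Lemma PhihZ u (k : R) v : Phih u (k *: v) = k *: Phih u v.
Proof. exact: (linearP_scale _ _ (Phih_linear u)). Qed.

Lemma PhihB u v w : Phih u (v - w) = Phih u v - Phih u w.
Proof. exact: (linearP_sub _ _ (Phih_linear u)). Qed.

Lemma Phih0 u : Phih u 0 = 0.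
Proof. exact: (linearP_0 (Phih_linear u)). Qed.

Lemma lprod_Phih_xi u v : lprod (Phih u v) l0 = 0.
Proof. by rewrite lprod_ell lbot_Phih. Qed.

Lemma lbotD e e' : lbot (e + e') = lbot e + lbot e'.
Proof. by rewrite /lbot !linearD /= mxE. Qed.

Lemma lbotZ (k : R) e : lbot (k *: e) = k * lbot e.
Proof. by rewrite /lbot !linearZ /= mxE. Qed.

Definition tractor_metric (h : N -> vec -> vec -> R) : Prop :=
  forall u v w, h (p u) v w = lprod (Phih u v) (Phih u w).

Definition tractor_radical (Z : N -> vec) : Prop := forall u, Phih u (Z (p u)) = l0.

Lemma qform_phi_iso u v w : qform (phi_iso u v) (phi_iso u w) = lprod (Phih u v) (Phih u w).
Proof.
by rewrite /Phih lprod_lvec /qform /dot mulr0 mul0r add0r addr0.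
Qed.

Lemma phi_iso_radical u v : phi_iso u v = (1, 0) <-> Phih u v = l0.
Proof.
rewrite phi_isoE ellE; split => [[e1 e2]|->]; last by rewrite ltop_lvec lmid_lvec.
by rewrite [LHS]lvecK e1 e2 lbot_Phih.
Qed.

(** An arbitrary, not necessarily continuous, choice of a point in each fibre, used to evaluate
    quantities that do not depend on the point. *)
Definition point x : P := sval (cid (proj_surj C x)).

Lemma pointK x : p (point x) = x.
Proof. exact: (svalP (cid (proj_surj C x))). Qed.

Lemma point_act u : exists2 g, Hgroup g & u = act (point (p u)) g.
Proof. by apply: fibre_ex; rewrite pointK. Qed.

Variable Z : N -> vec.
Hypothesis ZE : tractor_radical Z.

Section OneForm.
Variable t : N -> vec -> R.
Hypothesis tS : Sforms Z t.

Lemma form_linear x : linear (t x : vec -> R^o).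
Proof. exact: tS.1.1. Qed.

Lemma formD x v w : t x (v + w) = t x v + t x w.
Proof. exact: (linearP_add _ _ (form_linear x)). Qed.

Lemma formZ x (k : R) v : t x (k *: v) = k * t x v.
Proof. exact: (linearP_scale _ _ (form_linear x)). Qed.

Lemma formB x v w : t x (v - w) = t x v - t x w.
Proof. exact: (linearP_sub _ _ (form_linear x)). Qed.

Lemma form0 x : t x 0 = 0.
Proof. exact: (linearP_0 (form_linear x)). Qed.

Lemma form_rad x : t x (Z x) = 1.
Proof. exact: tS.2. Qed.

Lemma form_Pr x v : t x (Pr Z t x v) = 0.
Proof. by rewrite /Pr formB formZ form_rad mulr1 subrr. Qed.

Lemma Pr_id x v : t x v = 0 -> Pr Z t x v = v.
Proof. by move=> tv; rewrite /Pr tv scale0r subr0. Qed.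

Lemma Pr_linear x : linear (Pr Z t x).
Proof.
move=> k v w; rewrite /Pr formD formZ scalerDl -scalerA scalerBr opprD.
by rewrite addrACA.
Qed.

(** In the coordinates at [u], the product with [ell] forces the last component of [eta] to be 1;
    its middle part is found from the requirement that [Phih u v] pair with it to [t(v)], tested
    where [Phih u v] is a basis vector; nullity then fixes the top component. *)
Definition eta_mid u : 'cV[R]_m := \col_i t (p u) (Phinv u (lvec 0 (delta_mx i 0) 0)).

Definition eta u : L := lvec (- (2^-1 * dot (eta_mid u) (eta_mid u))) (eta_mid u) 1.

Lemma lbot_eta u : lbot (eta u) = 1.
Proof. exact: lbot_lvec. Qed.

Lemma eta_null u : lprod (eta u) (eta u) = 0.
Proof. by rewrite /eta lprod_lvec; field. Qed.

Lemma Phih_eta u v : lprod (Phih u v) (eta u) = t (p u) v.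
Proof.
set a := ltop (Phih u v); set y := lmid (Phih u v).
have E : v = a *: Z (p u) + \sum_i y i 0 *: Phinv u (lvec 0 (delta_mx i 0) 0).
  apply: (@Phih_inj R m N C u); rewrite PhihD PhihZ ZE (linearP_sum _ _ _ (Phih_linear u)).
  under eq_bigr do rewrite PhihZ PhinvK ?lbot_lvec//.
  by rewrite lvec_sum ellE lvecZ lvecD mulr1 mulr0 !addr0 scaler0 add0r [LHS]lvecK lbot_Phih.
rewrite [in RHS]E formD formZ form_rad mulr1 (linearP_sum _ _ _ (form_linear (p u))).
rewrite [Phih u v]lvecK lprod_lvec -/a -/y lbot_Phih mul0r addr0 mulr1 dotE.
by congr (_ + _); apply: eq_bigr => i _; rewrite [eta_mid u i 0]mxE formZ.
Qed.

Lemma eta_unique u e : lprod e e = 0 -> lbot e = 1 ->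
  (forall v, lprod (Phih u v) e = t (p u) v) -> e = eta u.
Proof.
move=> e0 e1 eP; have mE : lmid e = eta_mid u.
  apply/colP => i; rewrite [RHS]mxE -eP PhinvK ?lbot_lvec// [in RHS](lvecK e) lprod_lvec.
  by rewrite !mul0r add0r addr0 dotC dot_delta.
rewrite [LHS]lvecK /eta e1 mE; congr (lvec _ _ _).
move: e0; rewrite lprod_self e1 mE mulr1 => /eqP; rewrite addrC addr_eq0 => /eqP ->.
by rewrite mulrN opprK mulKf// pnatr_eq0.
Qed.

Lemma eta_act u g : Hgroup g -> eta (act u g) = invmx g *m eta u.
Proof.
move=> Hg; have HgV := HgroupV Hg; apply/esym/eta_unique.
- by rewrite Hgroup_preserves// eta_null.
- by rewrite Hgroup_lbot// lbot_eta.
- by move=> v; rewrite Phih_act// Hgroup_preserves// proj_act// Phih_eta.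
Qed.

Lemma tractor_eta : tractor_section eta.
Proof.
apply: tractorI => [u g|x]; first exact: eta_act.
have [U [s [ls Ux]]] := local_section_through C x; have [oU _ ps] := ls.
exists U, s; split => //.
have midC : smooth_fun U (fun y => eta_mid (s y)).
  apply: (smooth_fun_entries oU) => i j; rewrite (ord1 j) {j}.
  pose X y := Phinv (s y) (lvec 0 (delta_mx i 0) 0).
  have XC : smooth_field U X.
    apply: (smooth_field_Phih ls).
    apply: (eq_smooth_fun (f := fun=> lvec 0 (delta_mx i 0) 0) oU).
      by move=> y _; rewrite PhinvK ?lbot_lvec.
    exact: (smooth_fun_cst _ oU).
  have tC : form_on U (t : N -> vec -> R^o) by apply: (form_on_sub _ (one_form_on tS.1)).
  apply: (eq_smooth_fun oU _ (form_field oU tC XC)) => y Uy.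
  by rewrite mxE ps.
have dotC : smooth_fun U (fun y => (- (2^-1 * dot (eta_mid (s y)) (eta_mid (s y)))) : R^o).
  apply: (smooth_fun_opp oU); apply: (smooth_fun_mul oU (smooth_fun_cst (2^-1 : R^o) oU)).
  exact: (smooth_fun_entry 0 0 oU (smooth_fun_mulmx oU (smooth_fun_trmx oU midC) midC)).
apply: (smooth_fun_col_mx oU).
  apply: (smooth_fun_entries oU) => i j.
  by apply: (eq_smooth_fun oU _ dotC) => y _; rewrite !ord1 mxE eqxx mulr1n.
exact: (smooth_fun_col_mx oU midC (smooth_fun_cst _ oU)).
Qed.

(** Removing the [eta] component leaves a vector orthogonal to [ell], hence in the image of
    [Phih u]; projecting its preimage along [Z] removes the [xi] component. This is the pointwise
    form of [An_component]. *)
Definition An_part u e : vec := Pr Z t (p u) (Phinv u (e - lbot e *: eta u)).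

Lemma lbotB_eta u e : lbot (e - lbot e *: eta u) = 0.
Proof.
by rewrite -scaleNr lbotD lbotZ lbot_eta mulr1 subrr.
Qed.

Lemma An_part_form u e : t (p u) (An_part u e) = 0.
Proof. exact: form_Pr. Qed.

Lemma An_part_decomp u e :
  e = lprod e (eta u) *: l0 + Phih u (An_part u e) + lbot e *: eta u.
Proof.
set v := Phinv u (e - lbot e *: eta u).
have E : e = Phih u v + lbot e *: eta u by rewrite PhinvK ?lbotB_eta// subrK.
have -> : lprod e (eta u) = t (p u) v.
  by rewrite {1}E lprodC lprodDr lprodZr eta_null mulr0 addr0 lprodC Phih_eta.
by rewrite /An_part -/v /Pr PhihB PhihZ ZE addrCA subrr addr0.
Qed.

Lemma An_part_unique u e v (a b : R) : t (p u) v = 0 ->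
  e = a *: l0 + Phih u v + b *: eta u -> v = An_part u e.
Proof.
move=> tv E; have bE : lbot e = b.
  by rewrite E !lbotD !lbotZ lbot_Phih lbot_eta ellE lbot_lvec mulr0 !add0r mulr1.
rewrite /An_part bE E addrK -(ZE u) -PhihZ -PhihD PhihK.
by rewrite /Pr formD formZ form_rad tv mulr1 addr0 addrC addKr.
Qed.

Lemma An_part_linear u : linear (An_part u).
Proof.
move=> k e e'; apply/esym.
apply: (@An_part_unique u _ _ (k * lprod e (eta u) + lprod e' (eta u)) (k * lbot e + lbot e')).
  by rewrite formD formZ !An_part_form mulr0 addr0.
rewrite (PhihD u (k *: An_part u e)) (PhihZ u k (An_part u e)).
rewrite [X in k *: X + _](An_part_decomp u e) [X in _ + X = _](An_part_decomp u e').
set a := l0; set b := Phih _ _; set b' := Phih _ _; set c := eta u.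
move: (lprod e c) (lprod e' c) (lbot e) (lbot e') => x1 x2 x3 x4.
clearbody a b b' c; by apply/matrixP => i j; rewrite !mxE; ring.
Qed.

Lemma An_part_Phih u v : An_part u (Phih u v) = Pr Z t (p u) v.
Proof. by rewrite /An_part lbot_Phih scale0r subr0 PhihK. Qed.

Lemma An_part_xi u : An_part u l0 = 0.
Proof.
apply/esym/(@An_part_unique u _ _ 1 0); first exact: form0.
by rewrite scale1r Phih0 scale0r !addr0.
Qed.

Lemma An_part_act u g e : Hgroup g -> An_part (act u g) (invmx g *m e) = An_part u e.
Proof.
move=> Hg; have HgV := HgroupV Hg.
apply/esym/(@An_part_unique (act u g) _ _ (lprod e (eta u)) (lbot e)).
  by rewrite proj_act// An_part_form.
rewrite Phih_act// eta_act// [X in invmx g *m X](An_part_decomp u e) !mulmxDr -!scalemxAr.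
by have /HgroupP[_ ->] := HgV.
Qed.

Lemma An_part_smooth f : tractor_section f -> forall X,
  (forall u, X (p u) = An_part u (f u)) -> An_section t X.
Proof.
move=> tf X XE; split; last by move=> x; rewrite -(pointK x) XE An_part_form.
apply: smooth_field_local => x _.
have [U [s [ls Ux]]] := local_section_through C x; have [oU _ ps] := ls.
exists U; split => //; apply: (smooth_field_Phih ls).
have fC := tractor_along tf ls; have eC := tractor_along tractor_eta ls.
have botC (F : N -> L) : smooth_fun U F -> smooth_fun U (fun y => lbot (F y) : R^o).
  move=> FC; have lC := smooth_fun_cst l0 oU.
  have FTC := smooth_fun_trmx oU FC.
  apply: (eq_smooth_fun oU _ (smooth_fun_entry 0 0 oU (smooth_fun_mulmx oU
    (smooth_fun_mulmx oU FTC (smooth_fun_cst (@gram R m) oU)) lC))).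
  by move=> y _; rewrite -lprod_ell.
have prC : smooth_fun U (fun y => lprod (f (s y)) (eta (s y)) : R^o).
  exact: (smooth_fun_entry 0 0 oU (smooth_fun_mulmx oU
    (smooth_fun_mulmx oU (smooth_fun_trmx oU fC) (smooth_fun_cst (@gram R m) oU)) eC)).
apply: (eq_smooth_fun (f := fun y => f (s y) - lprod (f (s y)) (eta (s y)) *: l0
    - lbot (f (s y)) *: eta (s y)) oU).
  move=> y Uy; have := XE (s y); rewrite ps// => ->.
  rewrite [X in X - _ - _](An_part_decomp (s y) (f (s y))).
  by rewrite addrAC addrK addrAC subrr add0r.
apply: (smooth_fun_subr oU _ (smooth_fun_scale oU (botC _ fC) eC)).
exact: (smooth_fun_subr oU fC (smooth_fun_scale oU prC (smooth_fun_cst l0 oU))).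
Qed.

Definition An_field f x : vec := An_part (point x) (f (point x)).

Lemma An_fieldE f u : tractor_section f -> An_field f (p u) = An_part u (f u).
Proof.
move=> tf; have [g Hg {2 3}->] := point_act u.
by rewrite (tractor_act _ tf Hg) An_part_act.
Qed.

Lemma An_field_section f : tractor_section f -> An_section t (An_field f).
Proof. by move=> tf; apply: (An_part_smooth tf) => u; rewrite An_fieldE. Qed.

Lemma An_through x v : t x v = 0 -> exists2 X, An_section t X & X x = v.
Proof.
move=> tv; have [Y YC Yx] := field_through x v.
have tf := tractor_Phi C YC; exists (An_field (fun u => Phih u (Y (p u)))).
  exact: An_field_section.
by rewrite -{1}(pointK x) An_fieldE// An_part_Phih pointK Yx Pr_id.
Qed.

Lemma is_etaP f : is_eta t f <-> f = eta.
Proof.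
split=> [[tf f0 fxi fAn]|->].
  apply/funext => u; have f1 : lbot (f u) = 1 by rewrite -lprod_ell lprodC fxi.
  apply: eta_unique => // v.
  have [X XA Xv] := An_through (form_Pr (p u) v).
  have := fAn X XA u; rewrite PhiE Xv /Pr PhihB PhihZ ZE lprodC lprodBr lprodZr.
  rewrite lprod_ell f1 mulr1 => /eqP; rewrite subr_eq0 => /eqP <-.
  exact: lprodC.
split; [exact: tractor_eta|exact: eta_null| |].
  by move=> u; rewrite /xi lprodC lprod_ell lbot_eta.
by move=> X [_ tX] u; rewrite PhiE Phih_eta.
Qed.

Lemma An_componentP f Y : tractor_section f ->
  An_component t eta f Y <-> forall u, Y (p u) = An_part u (f u).
Proof.
move=> tf; split=> [[[_ tY] [a [b E]]] u|YE].
  by apply: (An_part_unique (tY _) (a := a (p u)) (b := b (p u))); rewrite E PhiE.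
split; first exact: (An_part_smooth tf).
exists (fun x => lprod (f (point x)) (eta (point x))), (fun x => lbot (f (point x))) => u.
rewrite PhiE YE {1}(An_part_decomp u (f u)).
have [g Hg E] := point_act u; have HgV := HgroupV Hg.
have -> : lprod (f u) (eta u) = lprod (f (point (p u))) (eta (point (p u))).
  by rewrite [in LHS]E (tractor_act _ tf Hg) eta_act// Hgroup_preserves.
have -> // : lbot (f u) = lbot (f (point (p u))).
by rewrite [in LHS]E (tractor_act _ tf Hg) Hgroup_lbot.
Qed.

End OneForm.
End Decomposition.

Section Induced.
Context {R : realType} {m : nat} {N : manifold R m.+1}.
Variables (C : cartan_geometry N) (s : lightlike_data N).
Local Notation p := (@cg_proj R m N C).
Local Notation Z := (ls_Z s).

(** Since [eta] is the only section satisfying [is_eta] and the [An(t)]-component is unique, the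
    existential clauses become explicit pointwise formulas. *)
Lemma inducesP : induces C s <->
  [/\ tractor_metric C (ls_h s), tractor_radical C Z &
   forall t, Sforms Z t -> forall W, smooth_field setT W ->
     (forall X, An_section t X -> forall u, ls_nabla s t W X (p u) =
        An_part Z t u (nablaT W (fun u => Phih u (X (p u))) u)) /\
     (forall u, ls_D s t (p u) (W (p u)) = An_part Z t u (nablaT W (eta t) u))].
Proof.
split=> [[hE ZE cE]|[hE ZE' cE]].
  have ZE' : tractor_radical C Z by move=> u; apply/phi_iso_radical; exact: ZE.
  split=> [u v w||t tS W WC] //; first by rewrite hE qform_phi_iso.
  have [e [/(is_etaP ZE' tS) -> /(_ W WC)[nE DE]]] := cE t tS; split.
    move=> X XA u; have [XC _] := XA; have := nE X XA; rewrite PhiE.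
    by move/(An_componentP ZE' tS _ (nablaT_tractor WC (tractor_Phi C XC))) => ->.
  by move=> u; move/(An_componentP ZE' tS _ (nablaT_tractor WC (tractor_eta ZE' tS))): DE => ->.
split=> [u v w|u|t tS]; first by rewrite hE qform_phi_iso.
  exact/phi_iso_radical.
exists (eta t); split; first exact/is_etaP.
move=> W WC; have [nE DE] := cE t tS W WC; split=> [X XA|].
  rewrite PhiE; have tX := nablaT_tractor WC (tractor_Phi C XA.1).
  exact: ((An_componentP ZE' tS _ tX).2 (nE X XA)).
exact: ((An_componentP ZE' tS _ (nablaT_tractor WC (tractor_eta ZE' tS))).2 DE).
Qed.

End Induced.

Section OrthonormalExpansion.
Context {R : realType} {m : nat} {N : manifold R m.+1}.
Local Notation vec := 'rV[R]_m.+1.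
Variables (h : N -> vec -> vec -> R) (Z : N -> vec) (t : N -> vec -> R).
Hypotheses (hT : sym_tensor h) (tS : Sforms Z t).
Hypothesis hZ : forall x v, h x (Z x) v = 0.

(** Pairing with [t] and with the [E j] recovers the coefficients of any combination of [Z x] and
    the [E i]. These [m.+1] vectors are therefore independent, hence a basis. *)
Lemma orthonormal_expand x (E : 'I_m -> vec) v : An_orthonormal h t x E ->
  v = t x v *: Z x + \sum_i h x v (E i) *: E i.
Proof.
move=> [tE hE]; pose M : 'M[R]_(1 + m, m.+1) := col_mx (Z x) (\matrix_i E i).
have ME (r : 'rV[R]_(1 + m)) : r *m M = lsubmx r 0 0 *: Z x + \sum_i rsubmx r 0 i *: E i.
  rewrite -{1}[r]hsubmxK mul_row_col; congr (_ + _).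
    by rewrite [lsubmx r in LHS]mx11_scalar mul_scalar_mx.
  by rewrite mulmx_sum_row; apply: eq_bigr => i _; rewrite rowK.
have tM r : t x (r *m M) = lsubmx r 0 0.
  rewrite ME (formD tS) (formZ tS) (form_rad tS) mulr1 (linearP_sum _ _ _ (form_linear tS x)).
  by rewrite big1 ?addr0// => i _; rewrite (formZ tS) tE mulr0.
have hM r j : h x (r *m M) (E j) = rsubmx r 0 j.
  rewrite ME (tensorDl hT) (tensorZl hT) hZ mulr0 add0r (tensor_suml hT).
  rewrite (bigD1 j)//= big1 => [|i ij]; rewrite (tensorZl hT) hE ?eqxx ?mulr1 ?addr0//.
  by rewrite (negbTE ij) mulr0.
have Mu : M \in unitmx.
  rewrite -row_free_unit; apply: inj_row_free => r r0.
  rewrite -[r]hsubmxK; have -> : lsubmx r = 0.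
    by apply/rowP => i; rewrite !ord1 -tM r0 (form0 tS) mxE.
  have -> : rsubmx r = 0 by apply/rowP => i; rewrite -hM r0 (tensor0l hT) mxE.
  exact: row_mx0.
have -> : v = (v *m invmx M) *m M by rewrite mulmxKV.
rewrite tM [LHS]ME; congr (_ + _).
by apply: eq_bigr => i _; rewrite hM.
Qed.

End OrthonormalExpansion.

(** * The induced lightlike structure *)

Section InducedStructure.
Context {R : realType} {m : nat} {N : manifold R m.+1}.
Variable C : cartan_geometry N.
Local Notation mat := 'M[R]_(1 + (m + 1)).
Local Notation L := 'cV[R]_(1 + (m + 1)).
Local Notation l0 := (@ell R m).
Local Notation vec := 'rV[R]_m.+1.
Local Notation P := (cg_tot C).
Local Notation p := (@cg_proj R m N C).
Local Notation act := (@cg_act R m N C).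
Implicit Types (u : P) (x : N) (W X Y : N -> vec) (v w : vec) (e : L).

Section MetricAndRadical.
Variables (h : N -> vec -> vec -> R) (Z : N -> vec).
Hypotheses (hE : tractor_metric C h) (ZE : tractor_radical C Z).

Lemma metricE x v w : h x v w = lprod (Phih (point C x) v) (Phih (point C x) w).
Proof. by rewrite -hE pointK. Qed.

Lemma tractor_sym_tensor : sym_tensor h.
Proof.
split=> [x v k w w'|x v w|c v w]; rewrite ?metricE; last 1 first.
- apply: smooth_fun_local => x cx.
  have [U [s [ls Ux]]] := local_section_through C x; have [oU _ ps] := ls.
  have oUc := openId c oU; exists (U `&` dom N c); split => //.
  have [_ PC] := Phih_form ls.
  have PTC := smooth_fun_trmx oUc (PC c v).
  apply: (eq_smooth_fun oUc _ (smooth_fun_entry 0 0 oUc (smooth_fun_mulmx oUc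
    (smooth_fun_mulmx oUc PTC (smooth_fun_cst (@gram R m) oUc)) (PC c w)))).
  by move=> y [Uy _]; rewrite -/(lprod _ _) -hE ps.
- by rewrite (Phih_linear _) lprodDr lprodZr.
- exact: lprodC.
Qed.

Lemma metric_radl x v : h x (Z x) v = 0.
Proof. by rewrite -(pointK C x) hE ZE lprodC lprod_Phih_xi. Qed.

Lemma Phih_radical u x : p u = x -> Phih u (Z x) = l0.
Proof. by move=> <-; exact: ZE. Qed.

Lemma radical_smooth : smooth_field setT Z.
Proof.
apply: smooth_field_local => x _.
have [U [s [ls Ux]]] := local_section_through C x; have [oU _ ps] := ls.
exists U; split => //; apply: (smooth_field_Phih ls).
apply: (eq_smooth_fun oU _ (smooth_fun_cst l0 oU)) => y Uy.
by rewrite (Phih_radical (ps y Uy)).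
Qed.

Lemma tractor_lightlike : lightlike h Z.
Proof.
have PZ x : Phih (point C x) (Z x) = l0 by exact: (Phih_radical (pointK C x)).
split; [exact: tractor_sym_tensor| |exact: radical_smooth|].
  by move=> x v; rewrite metricE lprod_self lbot_Phih mulr0 add0r dot_ge0.
move=> x; split.
  apply/eqP => Z0; have := PZ x; rewrite Z0 Phih0 => /(congr1 (@ltop R m)).
  rewrite ellE ltop_lvec /ltop !mxE => /eqP.
  by rewrite eq_sym oner_eq0.
move=> v; split=> [/(_ v)|[a ->] w]; last first.
  by rewrite (tensorZl tractor_sym_tensor) metric_radl mulr0.
rewrite metricE lprod_self lbot_Phih mulr0 add0r => /dot_eq0 y0.
exists (ltop (Phih (point C x) v)); apply: (@Phih_inj R m N C (point C x)).
rewrite (PhihZ (point C x)) PZ ellE lvecZ mulr1 mulr0 scaler0.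
by rewrite [LHS]lvecK y0 lbot_Phih.
Qed.

Section OneForm.
Variable t : N -> vec -> R.
Hypothesis tS : Sforms Z t.

(** [Phih u v] is orthogonal to [ell], and its product with [eta] is [t(v) = 0]; only the
    [An(t)]-component of [e] contributes. *)
Lemma lprod_An_part u e v : t (p u) v = 0 -> lprod e (Phih u v) = h (p u) (An_part Z t u e) v.
Proof.
move=> tv; rewrite hE [in LHS](An_part_decomp ZE tS u e) lprodC !lprodDr !lprodZr.
by rewrite lprod_Phih_xi (Phih_eta ZE tS) tv !mulr0 add0r addr0 lprodC.
Qed.

(** [Lfield] falls back on 0 in the absence of an orthonormal basis, so existence has to be shown.
    The basis comes from the standard vectors; projecting along [Z] leaves [h] unchanged. *)
Lemma An_orthonormal_ex x : exists E, An_orthonormal h t x E.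
Proof.
exists (fun i => Pr Z t x (Phinv (point C x) (lvec 0 (delta_mx i 0) 0))).
split=> [i|i j]; first exact: (form_Pr tS).
have hP v w : h x (Pr Z t x v) (Pr Z t x w) = h x v w.
  rewrite /Pr (tensorBl tractor_sym_tensor) !(tensorBr tractor_sym_tensor).
  rewrite !(tensorZl tractor_sym_tensor) !metric_radl mulr0.
  rewrite (tensorZr tractor_sym_tensor) [h x v (Z x)](tensorC tractor_sym_tensor) metric_radl.
  by rewrite mulr0 !subr0.
rewrite hP metricE !PhinvK ?lbot_lvec// lprod_lvec dot_delta mxE !mul0r add0r addr0.
by rewrite eqxx andbT eq_sym.
Qed.

Definition tractor_nabla W X : N -> vec :=
  An_field (C := C) Z t (nablaT W (fun u => Phih u (X (p u)))).

Lemma tractor_nablaE W X u : smooth_field setT W -> An_section t X ->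
  tractor_nabla W X (p u) = An_part Z t u (nablaT W (fun u => Phih u (X (p u))) u).
Proof.
move=> WC XA; apply: (An_fieldE ZE tS).
exact: (nablaT_tractor WC (tractor_Phi C XA.1)).
Qed.

Lemma tractor_metric_connection : metric_connection h t tractor_nabla.
Proof.
move=> W W' X Y f WC WC' XA YA fC.
have tX := tractor_Phi C XA.1; have tY := tractor_Phi C YA.1.
have lin := An_part_linear ZE tS.
split.
- exact: (An_field_section ZE tS (nablaT_tractor WC tX)).
- apply/funext => x; rewrite /tractor_nabla /An_field.
  by rewrite (nablaT_linear tX) lin pointK.
- apply/funext => x; rewrite /tractor_nabla /An_field.
  rewrite (_ : (fun u => Phih u (X (p u) + Y (p u))) = fun u => Phih u (X (p u)) + Phih u (Y (p u))).
    by rewrite (nablaT_add tX tY) (linearP_add _ _ (lin _)).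
  by apply/funext => u; rewrite PhihD.
- apply/funext => x; rewrite /tractor_nabla /An_field.
  rewrite (_ : (fun u => Phih u (f (p u) *: X (p u))) = fun u => f (p u) *: Phih u (X (p u))).
    rewrite (nablaT_scale tX W _ fC) lin (linearP_scale _ _ (lin _)) (An_part_Phih Z) !pointK.
    by rewrite Pr_id//; exact: XA.2.
  by apply/funext => u; rewrite PhihZ.
- move=> x; have FE u : h (p u) (X (p u)) (Y (p u)) = lprod (Phih u (X (p u))) (Phih u (Y (p u))).
    exact: hE.
  have := dfun_lprod tX tY (F := fun y => h y (X y) (Y y) : R^o) W (point C x) FE.
  rewrite pointK => ->.
  have := lprod_An_part (u := point C x); rewrite pointK => lA.
  rewrite (lA _ _ (YA.2 x)) [X in _ + X]lprodC (lA _ _ (XA.2 x)).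
  by rewrite [X in _ + X](tensorC tractor_sym_tensor).
Qed.

(** The field [fun=> v] is not smooth in general, its values being read in different charts, but
    [nablaT] only uses its value at the base point. *)
Definition tractor_D x v : vec :=
  An_part Z t (point C x) (nablaT (fun=> v) (eta (C := C) t) (point C x)).

Lemma tractor_DE W u : smooth_field setT W ->
  tractor_D (p u) (W (p u)) = An_part Z t u (nablaT W (eta t) u).
Proof.
move=> WC; have te := tractor_eta ZE tS.
rewrite -(An_fieldE ZE tS u (nablaT_tractor WC te)) /tractor_D /An_field.
by rewrite (@nablaT_ext R m N C _ W)// pointK.
Qed.

Lemma tractor_bundle_morphism : bundle_morphism t tractor_D.
Proof.
have te := tractor_eta ZE tS; have lin := An_part_linear ZE tS.
split=> [x k v w|x v|c w].
- by rewrite /tractor_D (nablaT_linear te (fun=> k) (fun=> v) (fun=> w)) lin.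
- by rewrite -{1}(pointK C x) (An_part_form tS).
- apply: smooth_field_local => x cx.
  have [chi [ O1 [ O2 [chiC _ [oO1 O1x O1c chi1] [oO2 cO2 chi0]]]]] := bump_function (dom_open c) cx.
  pose W y := (chi y : R) *: tvec c y w.
  have WC : smooth_field setT W.
    exact: (smooth_field_extend (dom_open c) oO2 cO2 chi0 chiC (smooth_field_chart w)).
  have [DC _] := An_field_section ZE tS (nablaT_tractor WC te).
  exists O1; split; first exact: O1x.
  apply: (eq_smooth_field oO1 _ (smooth_field_sub (@subsetT _ O1) DC)) => y O1y.
  rewrite -[in LHS](pointK C y) (An_fieldE ZE tS _ (nablaT_tractor WC te)) -tractor_DE// pointK.
  apply: (congr1 (tractor_D y)); apply: (etrans (congr1 (fun k : R => k *: tvec c y w) (chi1 y O1y))).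
  exact: scale1r.
Qed.

End OneForm.

Section TwoForms.
Variables t t' : N -> vec -> R.
Hypotheses (tS : Sforms Z t) (tS' : Sforms Z t').

(** The coefficient of the [An(t')]-part of [eta t] on [E_i] is its product with [Phi E_i], that is
    [t(E_i)]. This identifies [L] intrinsically and gives its smoothness. *)
Lemma LfieldE u : Lfield h t t' (p u) = An_part Z t' u (eta t u).
Proof.
rewrite /Lfield; case: xgetP => [w -> [E [Eo ->]]|H]; last first.
  by have [E Eo] := An_orthonormal_ex tS' (p u); case: (H _ (ex_intro _ E (conj Eo erefl))).
rewrite [RHS](orthonormal_expand tractor_sym_tensor tS' metric_radl _ Eo).
rewrite (An_part_form tS') scale0r add0r; apply: eq_bigr => i _.
by rewrite -(lprod_An_part tS') ?Eo.1// lprodC (Phih_eta ZE tS).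
Qed.

Lemma Lfield_field : Lfield h t t' = An_field (C := C) Z t' (eta t).
Proof. by apply/funext => x; rewrite -(pointK C x) LfieldE (An_fieldE ZE tS' _ (tractor_eta ZE tS)). Qed.

Lemma Lfield_section : An_section t' (Lfield h t t').
Proof. by rewrite Lfield_field; exact: (An_field_section ZE tS' (tractor_eta ZE tS)). Qed.

(** The decomposition of [eta t] with respect to [t'] is [eta t' + Phi L] plus a multiple of [xi],
    and the multiple is forced by nullity of [eta t]. Written with sums only, both sides can be
    differentiated term by term. *)
Lemma eta_change u : eta t' u + Phih u (Lfield h t t' (p u)) =
  eta t u + (2^-1 * h (p u) (Lfield h t t' (p u)) (Lfield h t t' (p u))) *: l0.
Proof.
set l := Lfield h t t' (p u).
have E := An_part_decomp ZE tS' u (eta t u); rewrite -LfieldE -/l lbot_eta scale1r in E.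
set a := lprod _ _ in E; have tl : t' (p u) l = 0 by exact: (Lfield_section.2).
have a0 : a = - (2^-1 * h (p u) l l).
  have := eta_null t u; rewrite {1}E lprodC !lprodDr lprodZr -/a.
  rewrite [lprod _ l0]lprod_ell lbot_eta mulr1 {1}E lprodC !lprodDr lprodZr lprod_Phih_xi mulr0 add0r.
  rewrite -hE (Phih_eta ZE tS') tl addr0 => H; lra.
rewrite [in RHS]E a0 scaleNr [RHS]addrC; set k := _ *: l0.
by rewrite !addrA addrN add0r addrC.
Qed.

Lemma An_part_change u e :
  An_part Z t' u e = Pr Z t' (p u) (An_part Z t u e) + lbot e *: Lfield h t t' (p u).
Proof.
have lin := An_part_linear ZE tS'.
rewrite {1}(An_part_decomp ZE tS u e) !(linearP_add _ _ (lin u)) !(linearP_scale _ _ (lin u)).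
by rewrite (An_part_xi ZE tS') scaler0 add0r (An_part_Phih Z) LfieldE.
Qed.

Lemma lbot_nablaT W f (k : R) u : tractor_section f ->
  (forall u, lbot (f u) = k) -> lbot (nablaT W f u) = - lprod (f u) (Phih u (W (p u))).
Proof.
move=> tf fk; have FE u' : (fun _ : N => k : R^o) (p u') = lprod (f u') (xi u').
  by rewrite /xi lprod_ell fk.
have := dfun_lprod tf (tractor_xi C) W u FE; rewrite dfun_cst.
rewrite -/(Phi W u) PhiE lprod_ell => /esym/eqP.
by rewrite addr_eq0 => /eqP.
Qed.

(** Differentiate [Phi(P^{t'} X) = Phi X - t'(X) xi] and take [An(t')]-parts. The derivative of [xi]
    is [Phi W]; the term in [L] comes from the [eta t] component of the derivative of [Phi X], which
    is [- h(X, W)]. *)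
Lemma tractor_compat_nabla X W x : An_section t X -> smooth_field setT W ->
  tractor_nabla t' W (fun y => Pr Z t' y (X y)) x =
    Pr Z t' x (tractor_nabla t W X x - t' x (X x) *: W x) - h x (X x) (W x) *: Lfield h t t' x.
Proof.
move=> XA WC; have lin := An_part_linear ZE tS'.
have tX := tractor_Phi C XA.1.
pose k y : R^o := - t' y (X y).
have kC : smooth_fun setT k.
  apply: (smooth_fun_opp openT).
  exact: (form_field openT (one_form_on tS'.1) XA.1).
have PE : (fun u => Phih u (Pr Z t' (p u) (X (p u)))) =
    fun u => Phih u (X (p u)) + k (p u) *: xi u.
  by apply/funext => u; rewrite /Pr PhihB PhihZ ZE /k scaleNr.
rewrite /tractor_nabla /An_field PE (nablaT_add tX (tractor_scale (tractor_xi C) kC)).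
rewrite (nablaT_scale (tractor_xi C) W _ kC) -/(Phi W _) PhiE.
rewrite !(linearP_add _ _ (lin _)) !(linearP_scale _ _ (lin _)) (An_part_xi ZE tS') scaler0 add0r.
rewrite (An_part_Phih Z) An_part_change (@lbot_nablaT W _ 0 _ tX); last first.
  by move=> u; exact: lbot_Phih.
rewrite -hE !pointK (linearP_sub (An_part Z t _ _) _ (Pr_linear tS' x)).
rewrite (linearP_scale _ (W x) (Pr_linear tS' x)).
by rewrite /k !scaleNr addrAC.
Qed.

(** Differentiate [eta_change] and take [An(t')]-parts; the term [- t(W) L] comes from the [eta t]
    component of the derivative of [eta t]. *)
Lemma tractor_compat_D W x : smooth_field setT W ->
  tractor_D t' x (W x) =
    Pr Z t' x (tractor_D t x (W x) + (2^-1 * h x (Lfield h t t' x) (Lfield h t t' x)) *: W x)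
    - t x (W x) *: Lfield h t t' x - tractor_nabla t' W (Lfield h t t') x.
Proof.
move=> WC; have lin := An_part_linear ZE tS'.
have te := tractor_eta ZE tS; have te' := tractor_eta ZE tS'.
have LA := Lfield_section; have tL := tractor_Phi C LA.1.
pose k y : R^o := 2^-1 * h y (Lfield h t t' y) (Lfield h t t' y).
have kC : smooth_fun setT k.
  apply: (smooth_fun_mul openT (smooth_fun_cst (2^-1 : R^o) openT)).
  exact: (tensor_field tractor_sym_tensor openT LA.1 LA.1).
have EF : (fun u => eta t' u + Phih u (Lfield h t t' (p u))) =
    fun u => eta t u + k (p u) *: xi u.
  by apply/funext => u; exact: eta_change.
have := congr1 (fun F => An_part Z t' (point C x) (nablaT W F (point C x))) EF.
rewrite (nablaT_add te' tL) (nablaT_add te (tractor_scale (tractor_xi C) kC)).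
rewrite (nablaT_scale (tractor_xi C) W _ kC) -/(Phi W _) PhiE.
rewrite !(linearP_add _ _ (lin _)) !(linearP_scale _ _ (lin _)) (An_part_xi ZE tS') scaler0 add0r.
rewrite (An_part_Phih Z) (An_part_change _ (nablaT W (eta t) _)) (@lbot_nablaT W _ 1 _ te); last first.
  by move=> u; exact: lbot_eta.
rewrite lprodC (Phih_eta ZE tS) -(tractor_DE tS' _ WC) -(tractor_DE tS _ WC).
rewrite -(tractor_nablaE tS' _ WC LA) !pointK => E.
rewrite (linearP_add _ _ (Pr_linear tS' x)) (linearP_scale _ _ (Pr_linear tS' x)) -/(k x).
apply/eqP; rewrite eq_sym subr_eq E -scaleNr addrAC.
by [].
Qed.

End TwoForms.
End MetricAndRadical.

Definition tractor_h x v w : R := lprod (Phih (point C x) v) (Phih (point C x) w).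
Definition tractor_Z x : vec := Phinv (point C x) l0.

Lemma tractor_hE : tractor_metric C tractor_h.
Proof.
move=> u v w; rewrite /tractor_h; have [g Hg {3 4}->] := point_act u.
by rewrite !Phih_act// Hgroup_preserves//; exact: HgroupV.
Qed.

Lemma tractor_ZE : tractor_radical C tractor_Z.
Proof.
move=> u; rewrite /tractor_Z; have [g Hg {1}->] := point_act u.
rewrite Phih_act// PhinvK; last by rewrite ellE lbot_lvec.
by have /HgroupP[_ ->] := HgroupV Hg.
Qed.

Definition tractor_data : lightlike_data N := LightlikeData tractor_h tractor_Z
  (tractor_nabla tractor_Z) (tractor_D tractor_Z).

Theorem tractor_data_structure : lightlike_structure tractor_data.
Proof.
have [hE ZE] := (tractor_hE, tractor_ZE).
split; first exact: tractor_lightlike.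
split; first by move=> t tS; exact: (tractor_metric_connection hE ZE tS).
split; first by move=> t tS; have := tractor_bundle_morphism ZE tS.
move=> t t' tS tS'; split.
  by move=> X W XA WC x; exact: (tractor_compat_nabla hE ZE tS tS').
by move=> W WC x; exact: (tractor_compat_D hE ZE tS tS').
Qed.

Theorem tractor_data_induced : induces C tractor_data.
Proof.
apply/inducesP; have [hE ZE] := (tractor_hE, tractor_ZE).
split; [exact: hE|exact: ZE|] => t tS W WC; split=> [X XA u|u].
  exact: (tractor_nablaE ZE tS u WC XA).
exact: (tractor_DE ZE tS u WC).
Qed.

End InducedStructure.

(** * Geometries inducing the same structure are isomorphic *)

Section Stabiliser.
Context {R : realType} {m : nat}.
Local Notation mat := 'M[R]_(1 + (m + 1)).
Local Notation L := 'cV[R]_(1 + (m + 1)).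
Local Notation l0 := (@ell R m).
Implicit Types (a y : 'cV[R]_m) (B : 'M[R]_m).

(* the element of H acting on [ell^perp] by [(al, y) |-> (al + <a, y>, B y)] *)
Definition hmx a B : mat := block_mx 1%:M (row_mx a^T (- (2^-1 * dot a a))%:M) 0
  (block_mx B (- (B *m a)) 0 1%:M).

Lemma hmx_lvec a B al y be : hmx a B *m lvec al y be =
  lvec (al + dot a y - be * (2^-1 * dot a a)) (B *m y - be *: (B *m a)) be.
Proof.
rewrite /hmx /lvec mul_block_col mul1mx mul0mx add0r mul_row_col mul_block_col.
rewrite mul0mx add0r mul1mx mulNmx [B *m a *m _]mul_mx_scalar; congr col_mx.
rewrite [a^T *m y]mx11_scalar -/(dot a y) -scalar_mxM -!raddfD /=; congr (_%:M); ring.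
Qed.

Lemma hmx_Hgroup a B : B^T *m B = 1%:M -> Hgroup (hmx a B).
Proof.
move=> BB; apply/HgroupP; split; last first.
  by rewrite ellE hmx_lvec dot0r !mul0r subr0 addr0 mulmx0 scale0r subr0.
apply/lprod_isoP => v w; rewrite (lvecK v) (lvecK w) !hmx_lvec !lprod_lvec.
have dB y y' : dot (B *m y) (B *m y') = dot y y'.
  by rewrite /dot trmx_mul -mulmxA (mulmxA B^T) BB mul1mx.
rewrite -[- (lbot v *: (B *m a))]scaleNr -[- (lbot w *: (B *m a))]scaleNr !dotDl !dotDr !dotZl !dotZr !dB (dotC _ a) -/(dot _ _).
by rewrite [dot a (lmid v)]dotC; field.
Qed.

Lemma hmx_smooth n (M : manifold R n) (O : set M) (a : M -> 'cV[R]_m) (B : M -> 'M[R]_m) :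
  open O -> smooth_fun O a -> smooth_fun O B -> smooth_fun O (fun x => hmx (a x) (B x)).
Proof.
move=> oO aC BC; have aTC := smooth_fun_trmx oO aC.
have kC : smooth_fun O (fun x => (- (2^-1 * dot (a x) (a x)))%:M : 'M[R]_1).
  have dC : smooth_fun O (fun x => - (2^-1 * dot (a x) (a x)) : R^o).
    apply: (smooth_fun_opp oO); apply: (smooth_fun_mul oO (smooth_fun_cst (2^-1 : R^o) oO)).
    exact: (smooth_fun_entry 0 0 oO (smooth_fun_mulmx oO aTC aC)).
  apply: (smooth_fun_entries oO) => i j.
  by apply: (eq_smooth_fun oO _ dC) => x _; rewrite !ord1 mxE eqxx mulr1n.
apply: (smooth_fun_col_mx oO).
  apply: (smooth_fun_row_mx oO (smooth_fun_cst _ oO)).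
  exact: (smooth_fun_row_mx oO aTC kC).
apply: (smooth_fun_row_mx oO (smooth_fun_cst _ oO)).
apply: (smooth_fun_col_mx oO).
  exact: (smooth_fun_row_mx oO BC (smooth_fun_opp oO (smooth_fun_mulmx oO BC aC))).
exact: (smooth_fun_row_mx oO (smooth_fun_cst _ oO) (smooth_fun_cst _ oO)).
Qed.

Lemma ltop_linear : linear (@ltop R m : L -> R^o).
Proof. by move=> k e e'; rewrite /ltop linearP /= !mxE. Qed.

Lemma lmid_linear : linear (@lmid R m).
Proof. by move=> k e e'; rewrite /lmid !linearP. Qed.

Lemma lbot_linear : linear (@lbot R m : L -> R^o).
Proof. by move=> k e e'; rewrite lbotD lbotZ. Qed.

Lemma smooth_fun_lmid n (M : manifold R n) (O : set M) (f : M -> L) : open O ->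
  smooth_fun O f -> smooth_fun O (fun x => lmid (f x)).
Proof. exact: (smooth_fun_linear lmid_linear). Qed.

Lemma smooth_fun_ltop n (M : manifold R n) (O : set M) (f : M -> L) : open O ->
  smooth_fun O f -> smooth_fun O (fun x => ltop (f x) : R^o).
Proof.
move=> oO fC; have uC := smooth_fun_linear (fun k e e' => linearP (@usubmx R 1 (m + 1) 1) k e e') oO fC.
exact: (smooth_fun_entry 0 0 oO uC).
Qed.

Lemma mx_eq_apply (A A' : mat) : (forall e : L, A *m e = A' *m e) -> A = A'.
Proof.
move=> H; apply/matrixP => i j.
by have := congr1 (fun e : L => e i 0) (H (delta_mx j 0)); rewrite -!colE !mxE.
Qed.

(** Only the image of [enn] is in question. Its products with [ell] and with the fixed middle
    vectors are those of [enn], and it is null; this determines it. *)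
Lemma Hgroup_fix (g : mat) : Hgroup g -> (forall e : L, lbot e = 0 -> g *m e = e) -> g = 1%:M.
Proof.
move=> Hg gE; pose n' := g *m (enn : L).
have nb : lbot n' = 1 by rewrite /n' Hgroup_lbot// ennE lbot_lvec.
have nm : lmid n' = 0.
  apply/colP => i; rewrite [RHS]mxE; have e0 : lbot (lvec 0 (delta_mx i 0) 0 : L) = 0 by rewrite lbot_lvec.
  have := Hgroup_preserves (lvec 0 (delta_mx i 0) 0) (enn : L) Hg.
  rewrite gE// -/n' [n']lvecK ennE !lprod_lvec !mul0r !add0r !addr0 dot0r dotC dot_delta.
  by rewrite lmid_lvec.
have nt : ltop n' = 0.
  have := Hgroup_preserves (enn : L) (enn : L) Hg; rewrite -/n' !lprod_self nm nb ennE.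
  rewrite ltop_lvec lmid_lvec dot0r !mulr0 mul0r mulr1 !addr0 => /eqP.
  by rewrite mulf_eq0 pnatr_eq0 => /eqP.
apply: mx_eq_apply => e; rewrite mul1mx [e]lvecK.
rewrite -[lbot e]add0r -{1}[ltop e]addr0 -{1}[lmid e]addr0 -lvecD mulmxDr gE ?lbot_lvec//.
have -> : lvec 0 0 (lbot e) = lbot e *: (enn : L) by rewrite ennE lvecZ mulr0 scaler0 mulr1.
rewrite -scalemxAr -/n' [n']lvecK nm nb nt lvecZ lvecD !mulr0 scaler0 mulr1 !addr0 add0r.
by [].
Qed.

End Stabiliser.

Section Uniqueness.
Context {R : realType} {m : nat} {N : manifold R m.+1}.
Variable C : cartan_geometry N.
Local Notation p := (@cg_proj R m N C).

Lemma induced_unique (s s' : lightlike_data N) : induces C s -> induces C s' -> lightlike_eq s s'.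
Proof.
move=> /inducesP[hE ZE cE] /inducesP[hE' ZE' cE'].
have ZZ : ls_Z s = ls_Z s'.
  apply/funext => x; rewrite -(pointK C x); apply: (@Phih_inj R m N C (point C x)).
  by rewrite ZE ZE'.
split=> //.
  apply/funext => x; apply/funext => v; apply/funext => w.
  by rewrite -(pointK C x) hE hE'.
move=> t tS; have tS' : Sforms (ls_Z s') t by rewrite -ZZ.
split=> [W X WC XA|]; apply/funext => x; rewrite -(pointK C x).
  by rewrite (cE t tS W WC).1// (cE' t tS' W WC).1// ZZ.
apply/funext => v; have [W WC <-] := field_through (p (point C x)) v.
by rewrite (cE t tS W WC).2 (cE' t tS' W WC).2 ZZ.
Qed.

Lemma lightlike_eq_sym (s s' : lightlike_data N) : lightlike_eq s s' -> lightlike_eq s' s.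
Proof.
move=> [hh ZZ H]; split=> // t; rewrite -ZZ => tS; have [nE DE] := H t tS.
by split=> // W X WC XA; rewrite nE.
Qed.

Lemma lightlike_eq_induces (s s' : lightlike_data N) :
  lightlike_eq s s' -> induces C s -> induces C s'.
Proof.
move=> [hh ZZ H] /inducesP[hE ZE cE]; apply/inducesP; split.
- by rewrite -hh.
- by rewrite -ZZ.
- move=> t; rewrite -ZZ => tS W WC; have [nE DE] := H t tS; have [cn cD] := cE t tS W WC.
  split=> [X XA u|u]; last by rewrite -DE cD.
  by rewrite -nE// cn.
Qed.

End Uniqueness.

(** * Matching the points of two geometries *)

Section Transport.
Context {R : realType} {m : nat} {N : manifold R m.+1}.
Variables C C' : cartan_geometry N.
Local Notation P := (cg_tot C).
Local Notation P' := (cg_tot C').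
Local Notation p := (@cg_proj R m N C).
Local Notation p' := (@cg_proj R m N C').
Local Notation act := (@cg_act R m N C).
Local Notation act' := (@cg_act R m N C').
Local Notation L := 'cV[R]_(1 + (m + 1)).
Local Notation l0 := (@ell R m).
Local Notation vec := 'rV[R]_m.+1.

(* A matched point is unique, so the relation is the graph of the isomorphism
   [P -> P']; over local sections it is a change of frame in H. *)
Definition matched (u : P) (u' : P') : Prop := p u = p' u' /\ forall v, Phih u v = Phih u' v.

Lemma lprod_Phih (C0 : cartan_geometry N) (u : cg_tot C0) v w :
  lprod (Phih u v) (Phih u w) = dot (lmid (Phih u v)) (lmid (Phih u w)).
Proof. by rewrite {1}[Phih u v]lvecK {1}[Phih u w]lvecK lprod_lvec !lbot_Phih mulr0 mul0r add0r addr0. Qed.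

Lemma lprod_delta (i j : 'I_m) :
  lprod (lvec 0 (delta_mx i 0) 0 : L) (lvec 0 (delta_mx j 0) 0) = (i == j)%:R.
Proof. by rewrite lprod_lvec dot_delta mxE !mul0r add0r addr0 eqxx andbT eq_sym. Qed.

(** Both [eta] and [An_part] are built from [Phih] and the base point alone. *)
Lemma matched_eta Z t u u' : matched u u' ->
  eta t u = eta t u' /\ forall e : L, An_part Z t u e = An_part Z t u' e.
Proof.
move=> [pE PE]; have PI e : Phinv u e = Phinv u' e.
  by rewrite /Phinv; congr xget; apply/seteqP; split => v /=; rewrite PE.
have mE : eta_mid t u = eta_mid t u' by apply/colP => i; rewrite !mxE PI pE.
have eE : eta t u = eta t u' by rewrite /eta mE.
by split=> // e; rewrite /An_part eE PI pE.
Qed.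

Lemma matched_act u u' g : Hgroup g -> matched u u' -> matched (act u g) (act' u' g).
Proof.
move=> Hg [pE PE]; split; first by rewrite !proj_act.
by move=> v; rewrite !Phih_act// PE.
Qed.

(** Two matches differ by some [g] in [H] that fixes every value of [Phih]. These values fill the
    orthogonal of [ell], so [g] is the identity. *)
Lemma matched_unique u u1 u2 : matched u u1 -> matched u u2 -> u1 = u2.
Proof.
move=> [p1 P1] [p2 P2]; have [g Hg E] := fibre_ex (C := C') (etrans (esym p1) p2).
suff g1 : g = 1%:M by rewrite E g1 act1.
apply: Hgroup_fix => // e e0; have [v vE] := Phih_surj u1 e0.
have := P2 v; rewrite E Phih_act// P1 vE => gV.
by rewrite {1}gV mulmxA Hgroup_mulmxV// mul1mx.
Qed.

Section Sections.
Variables (h : N -> vec -> vec -> R) (Z : N -> vec).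
Hypotheses (hE : tractor_metric C h) (ZE : tractor_radical C Z).
Hypotheses (hE' : tractor_metric C' h) (ZE' : tractor_radical C' Z).

(** Start from any section [s'] of the second bundle and let [g] express [Phih (s y)] through
    [Phih (s' y)]. It is isometric because both metrics are [h] and fixes [ell] because both
    radicals are spanned by [Z], so it has the form [hmx a B], with [a] and [B] smooth; the section
    sought is [s' . g^-1]. *)
Lemma matched_section U (s : N -> P) x : local_section U s -> U x ->
  exists O (s' : N -> P'), [/\ local_section O s', O x, O `<=` U &
    forall y, O y -> matched (s y) (s' y)].
Proof.
move=> ls Ux; have [oU sC ps] := ls.
have [U' [s' [ls' Ux']]] := local_section_through C' x; have [oU' sC' ps'] := ls'.
pose O := U `&` U'; have oO : open O := openI oU oU'.
have [OU OU'] : O `<=` U /\ O `<=` U' by split => y [].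
pose E i y := Phinv (s' y) (lvec 0 (delta_mx i 0) 0).
have EE i y : Phih (s' y) (E i y) = lvec 0 (delta_mx i 0) 0 by rewrite PhinvK ?lbot_lvec.
have EC i : smooth_field O (E i).
  apply: (smooth_field_sub OU'); apply: (smooth_field_Phih ls').
  by apply: (eq_smooth_fun oU' _ (smooth_fun_cst (lvec 0 (delta_mx i 0) 0) oU')) => y _.
pose a y : 'cV[R]_m := \col_i ltop (Phih (s y) (E i y)).
pose B y : 'M[R]_m := \matrix_(j, i) lmid (Phih (s y) (E i y)) j 0.
have FC i : smooth_fun O (fun y => Phih (s y) (E i y)).
  exact: (form_field oO (form_on_sub OU (Phih_form ls)) (EC i)).
have aC : smooth_fun O a.
  apply: (smooth_fun_entries oO) => i j.
  by apply: (eq_smooth_fun oO _ (smooth_fun_ltop oO (FC i))) => y _; rewrite [RHS]mxE.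
have BC : smooth_fun O B.
  apply: (smooth_fun_entries oO) => j i.
  apply: (eq_smooth_fun oO _ (smooth_fun_entry j 0 oO (smooth_fun_lmid oO (FC i)))) => y _.
  by rewrite [RHS]mxE.
have BB y : O y -> (B y)^T *m B y = 1%:M.
  move=> [Uy Uy']; apply/matrixP => i j; rewrite mxE.
  have <- : dot (lmid (Phih (s y) (E i y))) (lmid (Phih (s y) (E j y))) = (1%:M : 'M[R]_m) i j.
    rewrite -lprod_Phih -hE ps// -[in h _](ps' y Uy') hE' !EE lprod_delta.
    by rewrite [RHS]mxE.
  by rewrite dotE; apply: eq_bigr => k _; rewrite !mxE.
pose g y := hmx (a y) (B y).
have Hg y : O y -> Hgroup (g y) by move=> Oy; exact/hmx_Hgroup/BB.
have gE y v : O y -> Phih (s y) v = g y *m Phih (s' y) v.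
  move=> [Uy Uy']; set e := Phih (s' y) v.
  have -> : v = ltop e *: Z y + \sum_i lmid e i 0 *: E i y.
    apply: (@Phih_inj R m N C' (s' y)); rewrite PhihD PhihZ (linearP_sum _ _ _ (Phih_linear _)).
    under eq_bigr do rewrite PhihZ EE.
    rewrite (Phih_radical ZE' (ps' y Uy')) lvec_sum ellE lvecZ lvecD -/e [LHS]lvecK lbot_Phih.
    by rewrite mulr1 mulr0 scaler0 !addr0 add0r.
  rewrite PhihD PhihZ (Phih_radical ZE (ps y Uy)) (linearP_sum _ _ _ (Phih_linear _)).
  have -> : e = lvec (ltop e) (lmid e) 0 by rewrite [LHS]lvecK lbot_Phih.
  rewrite hmx_lvec mul0r scale0r !subr0 ltop_lvec lmid_lvec.
  under eq_bigr do rewrite PhihZ.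
  have -> : \sum_i lmid e i 0 *: Phih (s y) (E i y) = lvec (dot (a y) (lmid e)) (B y *m lmid e) 0.
    rewrite [LHS]lvecK (linearP_sum _ _ _ ltop_linear) (linearP_sum _ _ _ lmid_linear).
    rewrite (linearP_sum _ _ _ lbot_linear); congr lvec.
    - rewrite dotE; apply: eq_bigr => i _.
      by rewrite [a y i 0]mxE (linearP_scale _ _ ltop_linear) scale_regE mulrC.
    - apply/colP => j; rewrite summxE mxE; apply: eq_bigr => i _.
      by rewrite (linearP_scale _ _ lmid_linear) mxE [B y j i]mxE mulrC.
    - by rewrite big1// => i _; rewrite lbotZ lbot_Phih mulr0.
  by rewrite ellE lvecZ lvecD mulr1 mulr0 scaler0 add0r addr0.
exists O, (fun y => act' (s' y) (invmx (g y))).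
have gC : smooth_fun O g := hmx_smooth oO aC BC.
have gVC := smooth_fun_invmx oO (fun y Oy => Hgroup_unit (Hg y Oy)) gC.
have gVH y : O y -> Hgroup (invmx (g y)) by move=> Oy; exact: (HgroupV (Hg y Oy)).
split; [split|by []|exact: OU|].
- exact: oO.
- exact: (act_map_smooth oO (smooth_map_sub OU' sC') gVC gVH).
- by move=> y Oy; rewrite proj_act ?ps'; [|exact: Oy.2|exact: gVH].
move=> y Oy; have [Uy Uy'] := Oy; split=> [|v].
  by rewrite proj_act ?ps ?ps'//; exact: gVH.
rewrite (gE y v Oy) Phih_act; last exact: gVH.
by rewrite invmxK.
Qed.

Lemma matched_ex u : exists u', matched u u'.
Proof.
have [U [s [ls Uu su]]] := local_section_at u.
by have [ O [s' [_ Ou _ /(_ _ Ou)]]] := matched_section ls Uu; rewrite su; exists (s' (p u)).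
Qed.

Definition match_map u : P' := xget (point C' (p u)) [set u' | matched u u'].

Lemma match_mapP u : matched u (match_map u).
Proof. by rewrite /match_map; case: xgetP => [u' _ //|H]; have [u' /H] := matched_ex u. Qed.

Lemma match_map_eq u u' : matched u u' -> match_map u = u'.
Proof. exact: (matched_unique (match_mapP u)). Qed.

(** Matching is equivariant and unique, so the function [g] that expresses points through [s] also
    expresses their images through the matched section [s']. *)
Lemma match_map_local u : exists O (s : N -> P) (s' : N -> P') g,
  [/\ local_section O s, local_section O s', O (p u) &
   [/\ forall y, O y -> matched (s y) (s' y), smooth_fun (p @^-1` O) g,
     forall u, O (p u) -> Hgroup (g u) /\ match_map u = act' (s' (p u)) (g u) &
     forall z, cg_om C u z =
       invmx (g u) *m theta s (p u) (tmap p u z) *m g u + invmx (g u) *m dfun g u z]].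
Proof.
have [U [s [ls Uu su]]] := local_section_at u.
have [ O [s' [ls' Ou OU sm]]] := matched_section ls Uu.
have lsO : local_section O s.
  have [oU sC ps] := ls; have [oO _ _] := ls'.
  by split; [exact: oO|exact: (smooth_map_sub OU sC)|move=> y /OU; exact: ps].
have [g gC [gE omE]] := om_section_vertical lsO Ou.
exists O, s, s', g; split; [exact: lsO|exact: ls'|exact: Ou|].
split; [exact: sm|exact: gC| |exact: omE].
move=> u1 Ou1; have [Hg E] := gE u1 Ou1; split; first exact: Hg.
by apply: match_map_eq; rewrite {1}E; exact: (matched_act Hg (sm _ Ou1)).
Qed.

Lemma match_map_smooth : smooth_map setT match_map.
Proof.
apply: smooth_map_local => u _.
have [ O [s [s' [g [_ [oO sC' ps'] Ou [_ gC mE _]]]]]] := match_map_local u.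
have opO := proj_preim_open C oO; exists (p @^-1` O); split; first exact: Ou.
have pC : smooth_map (p @^-1` O) p by exact: (smooth_map_sub (@subsetT _ _) (proj_smooth (C := C))).
have spC : smooth_map (p @^-1` O) (s' \o p) := smooth_map_comp opO oO (fun _ Uz => Uz) pC sC'.
apply: (eq_smooth_map opO _ (act_map_smooth opO spC gC (fun y Oy => (mE y Oy).1))) => y Oy.
by rewrite (mE y Oy).2.
Qed.

Lemma match_map_act u g : Hgroup g -> match_map (act u g) = act' (match_map u) g.
Proof. by move=> Hg; apply: match_map_eq; exact: (matched_act Hg (match_mapP u)). Qed.

Variable s : lightlike_data N.
Hypotheses (iC : induces C s) (iC' : induces C' s) (hs : ls_h s = h) (Zs : ls_Z s = Z).

Lemma nablaT_eta_lprod (C0 : cartan_geometry N) (hE0 : tractor_metric C0 h)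
    (ZE0 : tractor_radical C0 Z) t W (u : cg_tot C0) :
  Sforms Z t -> lprod (nablaT W (eta (C := C0) t) u) (eta t u) = 0.
Proof.
move=> tS; have te := tractor_eta ZE0 tS.
have := dfun_lprod te te (F := fun=> 0 : R^o) W u (fun u => esym (eta_null t u)).
rewrite dfun_cst [X in _ + X]lprodC -mulr2n => /esym/eqP.
by rewrite mulrn_eq0 => /eqP.
Qed.

Lemma nablaT_Phih_lprod (C0 : cartan_geometry N) (hE0 : tractor_metric C0 h)
    (ZE0 : tractor_radical C0 Z) t W X (u : cg_tot C0) :
  Sforms Z t -> An_section t X ->
  lprod (nablaT W (fun u => Phih u (X (@cg_proj R m N C0 u))) u) (eta t u) =
    - h (@cg_proj R m N C0 u) (An_part Z t u (nablaT W (eta t) u)) (X (@cg_proj R m N C0 u)).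
Proof.
move=> tS XA; have te := tractor_eta ZE0 tS; have tX := tractor_Phi C0 XA.1.
have FE u' : (0 : R) = lprod (Phih u' (X (@cg_proj R m N C0 u'))) (eta t u').
  by rewrite (Phih_eta ZE0 tS) XA.2.
have := dfun_lprod tX te (F := fun=> 0 : R^o) W u FE.
rewrite dfun_cst => /esym/eqP; rewrite addr_eq0 => /eqP ->.
by rewrite lprodC (lprod_An_part hE0 ZE0 tS)// XA.2.
Qed.

(** A matrix is determined by its action on [ell], on [Phi(An t)] and on [eta t]. On [ell] this is
    the matching itself. In the other two cases the [An(t)]-components of the covariant derivatives
    are the common [nabla] and [D], and their remaining components follow from metric
    compatibility. *)
Lemma theta_matched O (s0 : N -> P) (s' : N -> P') x w :
  local_section O s0 -> local_section O s' -> O x -> (forall y, O y -> matched (s0 y) (s' y)) ->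
  theta s0 x w = theta s' x w.
Proof.
move=> ls ls' Ox sm; have [oO sC ps] := ls; have [_ sC' ps'] := ls'.
have [_ _ cE] := (inducesP C s).1 iC; have [_ _ cE'] := (inducesP C' s).1 iC'.
have Zne : forall x, Z x != 0.
  by have [_ _ _ H] := tractor_lightlike hE ZE => y; have [] := H y.
have [t tS] := Sforms_nonempty (radical_smooth ZE) Zne.
have tSs : Sforms (ls_Z s) t by rewrite Zs.
have [W WC Wx] := field_through x w; rewrite Zs in cE cE'.
have [nE DE] := cE t tS W WC; have [nE' DE'] := cE' t tS W WC.
have te := tractor_eta ZE tS; have te' := tractor_eta ZE' tS.
have [eE AE] := matched_eta Z t (sm x Ox).
pose u := s0 x; pose u' := s' x.
have pu : p u = x by exact: ps.
have pu' : p' u' = x by exact: ps'.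
(* [theta] is the difference between the covariant derivative and the derivative along the section;
   the latter is the same for functions agreeing along matched sections. *)
have key (f : P -> L) (f' : P' -> L) : tractor_section f -> tractor_section f' ->
    (forall y, O y -> f (s0 y) = f' (s' y)) -> nablaT W f u = nablaT W f' u' ->
    theta s0 x w *m f u = theta s' x w *m f' u'.
  move=> tf tf' ff' E.
  have dE : dfun (f \o s0) x (W x) = dfun (f' \o s') x (W x).
    exact: (eq_dfun (W x) oO ff' (tractor_along tf ls) Ox).
  move: E; rewrite /u /u' (nablaTE W ls Ox tf) (nablaTE W ls' Ox tf') /nabla_along dE Wx.
  exact: addrI.
have decomp e e' : An_part Z t u e = An_part Z t u e' -> lprod e (eta t u) = lprod e' (eta t u) ->
    lbot e = lbot e' -> e = e' :> L.
  by move=> e1 e2 e3; rewrite (An_part_decomp ZE tS u e) e1 e2 e3 -(An_part_decomp ZE tS u e').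
have K1 : theta s0 x w *m l0 = theta s' x w *m l0.
  by rewrite -(Phih_section _ ls Ox) -(Phih_section _ ls' Ox) (sm x Ox).2.
have K2 v : t x v = 0 -> theta s0 x w *m Phih u v = theta s' x w *m Phih u v.
  move=> tv; have [X XA Xx] := An_through ZE tS tv.
  have tX := tractor_Phi C XA.1; have tX' := tractor_Phi C' XA.1.
  have := key _ _ tX tX'; rewrite /u /u' ps// ps'// Xx (sm x Ox).2; apply.
    by move=> y Oy; rewrite ps ?ps'// (sm y Oy).2.
  apply: decomp.
  - have := nE X XA u; rewrite pu => <-.
    by rewrite AE -/u'; have := nE' X XA u'; rewrite pu' => <-.
  - rewrite (nablaT_Phih_lprod hE ZE _ _ tS XA) -DE eE -/u' (nablaT_Phih_lprod hE' ZE' _ _ tS XA).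
    by rewrite -DE' pu pu'.
  - rewrite (lbot_nablaT W _ tX (k := 0)) => [|u1]; last exact: lbot_Phih.
    rewrite (lbot_nablaT W _ tX' (k := 0)) => [|u1]; last exact: lbot_Phih.
    by rewrite -hE -hE' pu pu'.
have K3 : theta s0 x w *m eta t u = theta s' x w *m eta t u.
  apply: (etrans (key _ _ te te' _ _)); last by rewrite {1}/u eE.
    by move=> y Oy; exact: (matched_eta Z t (sm y Oy)).1.
  apply: decomp.
  - by rewrite -DE pu AE -/u' -DE' pu'.
  - by rewrite nablaT_eta_lprod// eE -/u' nablaT_eta_lprod.
  - rewrite (lbot_nablaT W _ te (k := 1)) => [|u1]; last exact: lbot_eta.
    rewrite (lbot_nablaT W _ te' (k := 1)) => [|u1]; last exact: lbot_eta.
    by rewrite ![lprod (eta _ _) _]lprodC (Phih_eta ZE tS) (Phih_eta ZE' tS) pu pu'.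
apply: mx_eq_apply => e; rewrite (An_part_decomp ZE tS u e) !mulmxDr -!scalemxAr K1 K3.
by rewrite K2//; have := An_part_form tS u e; rewrite pu.
Qed.

(** Locally both connection forms are given by the same formula in [theta] and [g], and the two
    [theta] agree. *)
Lemma match_map_om u z : cg_om C' (match_map u) (tmap match_map u z) = cg_om C u z.
Proof.
have [ O [s0 [s' [g [ls ls' Ou [sm gC mE ->]]]]]] := match_map_local u.
have [oO sC' ps'] := ls'.
have opO := proj_preim_open C oO.
have pC : smooth_map (p @^-1` O) p by exact: (smooth_map_sub (@subsetT _ _) (proj_smooth (C := C))).
have spC : smooth_map (p @^-1` O) (s' \o p) := smooth_map_comp opO oO (fun _ Uz => Uz) pC sC'.
have := om_act_map opO spC gC (fun y Oy => (mE y Oy).1) z Ou.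
rewrite (tmap_comp z opO oO pC sC' Ou Ou) -/(theta s' (p u) _) -(theta_matched _ ls ls' Ou sm) => <-.
rewrite (mE u Ou).2 /=; apply: (congr1 (cg_om C' _)).
apply: (eq_tmap z opO _ (smooth_map_sub (@subsetT _ _) match_map_smooth) Ou) => y Oy.
exact: (mE y Oy).2.
Qed.

End Sections.
End Transport.

Section Isomorphism.
Context {R : realType} {m : nat} {N : manifold R m.+1}.
Implicit Types (C : cartan_geometry N).

Lemma matched_sym C C' (u : cg_tot C) (u' : cg_tot C') : matched u u' -> matched u' u.
Proof. by move=> [pE PE]; split=> [|v]; rewrite ?pE ?PE. Qed.

Lemma induced_iso C C' (s : lightlike_data N) : induces C s -> induces C' s -> cartan_iso C C'.
Proof.
move=> iC iC'; have [hE ZE _] := (inducesP C s).1 iC; have [hE' ZE' _] := (inducesP C' s).1 iC'.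
have mP := @match_mapP _ _ _ C C' _ _ hE ZE hE' ZE'.
have mP' := @match_mapP _ _ _ C' C _ _ hE' ZE' hE ZE.
exists (@match_map _ _ _ C C'), (@match_map _ _ _ C' C); split; split.
- exact: (match_map_smooth hE ZE hE' ZE').
- exact: (match_map_smooth hE' ZE' hE ZE).
- by move=> u; apply: (match_map_eq hE' ZE' hE ZE); exact: (matched_sym (mP u)).
- by move=> u; apply: (match_map_eq hE ZE hE' ZE'); exact: (matched_sym (mP' u)).
- by move=> u; rewrite -(mP u).1.
- by move=> u g; exact: (match_map_act hE ZE hE' ZE').
- by move=> u z; exact: (match_map_om hE ZE hE' ZE' iC iC').
Qed.

(** Composition with [F] pulls tractor sections back. It commutes with the connections, since
    [F \o s0] has the same [theta] as [s0], and it respects [Phih], hence also [eta] and the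
    components. *)
Lemma iso_induces C C' (s : lightlike_data N) : cartan_iso C C' -> induces C' s -> induces C s.
Proof.
move=> [F [_ [[FC _ _ _] [pF aF omF]]]] /inducesP[hE ZE cE].
have PF u v : Phih u v = Phih (F u) v.
  have [z zv] := proj_submersive u v; rewrite (PhihE zv) -omF; apply/esym/PhihE.
  rewrite -(tmap_comp z openT openT FC (proj_smooth (C := C')) I I) -zv.
  apply: (eq_tmap z openT _ _ I) => [y _|]; first exact: pF.
  exact: (smooth_map_comp openT openT (fun _ _ => I) FC (proj_smooth (C := C'))).
have mF u : matched u (F u) by split => [|v]; [rewrite pF|exact: PF].
have tF f : tractor_section f -> tractor_section (f \o F).
  move=> tf; split; first exact: (smooth_fun_comp openT openT (fun _ _ => I) FC tf.1).
  by move=> u g Hg; rewrite /= aF// (tractor_act _ tf Hg).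
have nF W f u : tractor_section f -> nablaT W (f \o F) u = nablaT W f (F u).
  move=> tf; have [U [s0 [ls Uu su]]] := local_section_at u; have [oU sC ps] := ls.
  have ls' : local_section U (F \o s0).
    split; [exact: oU|exact: (smooth_map_comp oU openT (fun _ _ => I) sC FC)|].
    by move=> x Ux; rewrite /= pF ps.
  rewrite -su (nablaTE W ls Uu (tF f tf)) -[F (s0 (_ u))]/((F \o s0) (cg_proj C u)).
  rewrite (nablaTE W ls' Uu tf) /nabla_along /theta.
  by rewrite (tmap_comp _ oU openT sC FC Uu I) omF.
apply/inducesP; split.
- by move=> u v w; rewrite -pF hE !PF.
- by move=> u; rewrite PF -pF ZE.
move=> t tS W WC; have [cn cD] := cE t tS W WC; split=> [X XA u|u].
  rewrite -pF cn// (matched_eta _ t (mF u)).2 -nF; last exact: (tractor_Phi C' XA.1).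
  apply: (congr1 (fun f => An_part (ls_Z s) t (F u) (nablaT W f u))); apply/funext => u1.
  by rewrite /= pF PF.
rewrite -pF cD (matched_eta _ t (mF u)).2 -nF; last exact: (tractor_eta ZE tS).
apply: (congr1 (fun f => An_part (ls_Z s) t (F u) (nablaT W f u))); apply/funext => u1.
by rewrite /= (matched_eta (ls_Z s) t (mF u1)).1.
Qed.

End Isomorphism.

(* Charts on a bare set, whose topology is still to be defined. *)
Record atlas (R : realType) (n : nat) := Atlas {
  at_pt : Type;
  at_dom : at_pt -> set at_pt;
  at_phi : at_pt -> at_pt -> 'rV[R]_n;
  at_psi : at_pt -> 'rV[R]_n -> at_pt;
  at_self : forall x, at_dom x x;
  at_open : forall x y, open (at_phi x @` (at_dom x `&` at_dom y));
  at_K : forall x y, at_dom x y -> at_psi x (at_phi x y) = y;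
  at_smooth : forall x y, Cinf_on (at_phi x @` (at_dom x `&` at_dom y)) (at_phi y \o at_psi x)
}.

(** * The manifold defined by an atlas on a bare set *)

Section AtlasTopology.
Context {R : realType} {n : nat} (a : atlas R n).
Local Notation T := (at_pt a).
Local Notation dom := (@at_dom R n a).
Local Notation phi := (@at_phi R n a).
Local Notation psi := (@at_psi R n a).
Implicit Types (x y : T) (A : set T).

(** Openness is tested in all charts, so that each chart becomes a homeomorphism onto its open
    image. Hausdorffness and second countability do not follow and remain hypotheses. *)
Definition atlas_open A : Prop := forall x, open (phi x @` (dom x `&` A)).

Lemma atlas_openT : atlas_open setT.
Proof.
move=> x; have -> : dom x `&` setT = dom x `&` dom x by rewrite setIT setIid.
exact: at_open.
Qed.

Lemma atlas_image_I x A B : phi x @` (dom x `&` (A `&` B)) =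
  (phi x @` (dom x `&` A)) `&` (phi x @` (dom x `&` B)).
Proof.
apply/seteqP; split=> [_ [y [dy [Ay By]] <-]|_ [[y [dy Ay] <-] [z [dz Bz] E]]].
  by split; exists y.
have zy : z = y by rewrite -(at_K dz) E at_K.
by exists y => //; split => //; split => //; rewrite -zy.
Qed.

Lemma atlas_openI : setI_closed atlas_open.
Proof. by move=> A B oA oB x; rewrite atlas_image_I; exact: openI. Qed.

Lemma atlas_open_bigU (I : Type) (f : I -> set T) :
  (forall i, atlas_open (f i)) -> atlas_open (\bigcup_i f i).
Proof.
move=> fo x; have -> : phi x @` (dom x `&` \bigcup_i f i) = \bigcup_i phi x @` (dom x `&` f i).
  apply/seteqP; split=> [_ [y [dy [i _ fy]] <-]|_ [i _ [y [dy fy] <-]]].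
    by exists i => //; exists y.
  by exists y => //; split => //; exists i.
by apply: bigcup_open => i _; exact: fo.
Qed.

HB.instance Definition _ := gen_eqMixin T.
HB.instance Definition _ := gen_choiceMixin T.
HB.instance Definition _ := isOpenTopological.Build T atlas_openT atlas_openI atlas_open_bigU.

Lemma atlas_openE A : open A = atlas_open A.
Proof. by []. Qed.

Lemma atlas_dom_open x : open (dom x).
Proof. by rewrite atlas_openE => y; exact: at_open. Qed.

Lemma atlas_phi_open x : open (phi x @` dom x).
Proof. by have := @at_open R n a x x; rewrite setIid. Qed.

Lemma atlas_preim_open x (B : set 'rV[R]_n) : open B -> open (dom x `&` phi x @^-1` B).
Proof.
move=> oB; rewrite atlas_openE => z; rewrite atlas_image_I.
have oD := @at_open R n a z x.
have := Cinf_preim_open oD (@at_smooth R n a z x) oB.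
suff -> : (phi z @` (dom z `&` dom x)) `&` (phi z @` (dom z `&` phi x @^-1` B)) =
    (phi z @` (dom z `&` dom x)) `&` (phi x \o psi z) @^-1` B by [].
apply/seteqP; split=> [w [[y [dzy dxy] <-] [y' [dzy' By'] E]]|_ [[y [dzy dxy] <-]]].
  split; first by exists y.
  have yy' : y' = y by rewrite -(at_K dzy') E at_K.
  by rewrite /= at_K// -yy'.
by rewrite /= at_K// => By; split; exists y.
Qed.

Lemma atlas_phi_continuous x y : dom x y -> {for y, continuous (phi x)}.
Proof.
move=> dy B; rewrite nbhsE => -[B' [oB' By'] BB'].
have : nbhs y (dom x `&` phi x @^-1` B').
  by apply: open_nbhs_nbhs; split => //; exact: atlas_preim_open.
by apply: filterS => z [_ Bz]; exact: BB'.
Qed.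

Lemma atlas_psi_continuous x y : dom x y -> {for phi x y, continuous (psi x)}.
Proof.
move=> dy A; rewrite /= at_K// nbhsE => -[A' [oA' Ay] AA'].
have oI : open (phi x @` (dom x `&` A')) by exact: (oA' x).
have : nbhs (phi x y) (phi x @` (dom x `&` A')).
  by apply: open_nbhs_nbhs; split => //; exists y.
by apply: filterS => _ [z [dz Az] <-]; apply: AA'; rewrite at_K.
Qed.

Hypotheses (haus : hausdorff_space T) (sc : @second_countable T).

Definition atlas_manifold : manifold R n :=
  Manifold haus sc (@at_self R n a) atlas_dom_open atlas_phi_open (@at_K R n a)
    atlas_phi_continuous atlas_psi_continuous (@at_smooth R n a).

End AtlasTopology.

(** * Adapted frames *)

Section Lightlike.
Context {R : realType} {m : nat} {N : manifold R m.+1}.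
Local Notation vec := 'rV[R]_m.+1.
Variables (h : N -> vec -> vec -> R) (Z : N -> vec) (t : N -> vec -> R).
Hypotheses (hL : lightlike h Z) (tS : Sforms Z t).
Implicit Types (x c : N) (v w : vec) (O U : set N).

Lemma lightlike_tensor : sym_tensor h.
Proof. by case: hL. Qed.
Local Notation hT := lightlike_tensor.

Lemma lightlike_radl x v : h x (Z x) v = 0.
Proof. by have [_ _ _ /(_ x) [_ /(_ (Z x))[_ ->]]] := hL => //; exists 1; rewrite scale1r. Qed.

Lemma lightlike_radr x v : h x v (Z x) = 0.
Proof. by rewrite (tensorC hT) lightlike_radl. Qed.

(** The Cauchy-Schwarz argument for a semidefinite form: if [b = h(v, w)] were nonzero, the given
    [k] would make [h(w + k v, w + k v) = h(w, w) + 2 k b] equal to [-1]. *)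
Lemma lightlike_null x v w : h x v v = 0 -> h x v w = 0.
Proof.
have [_ h0 _ _] := hL => vv; apply/eqP/negP => /negP b0.
pose b := h x v w; pose k := - (h x w w + 1) / (2 * b).
have := h0 x (w + k *: v).
rewrite (tensorDl hT) !(tensorDr hT) !(tensorZl hT) !(tensorZr hT) vv (tensorC hT x w v) -/b.
have -> : h x w w + k * b + (k * b + k * (k * 0)) = -1 by rewrite /k; field.
by rewrite lerNr oppr0 ler10.
Qed.

Lemma lightlike_definite x v : t x v = 0 -> v != 0 -> 0 < h x v v.
Proof.
move=> tv v0; have [_ h0 _ /(_ x)[_ H]] := hL; rewrite lt_neqAle h0 andbT eq_sym.
apply: contra v0 => /eqP vv; have [a E] : exists a : R, v = a *: Z x.
  by apply/H => w; exact: lightlike_null.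
by move: tv; rewrite E (formZ tS) (form_rad tS) mulr1 => ->; rewrite scale0r.
Qed.

(** These are [1 + k] linear conditions on a space of dimension [m.+1], and [1 + k < m.+1]. *)
Lemma orthogonal_ex x k (E : nat -> vec) : (k < m)%N ->
  exists v, [/\ v != 0, t x v = 0 & forall i, (i < k)%N -> h x v (E i) = 0].
Proof.
move=> km; pose f (v : vec) : 'rV[R]_(1 + k) := row_mx (t x v)%:M (\row_i h x v (E i)).
have fl : linear f.
  move=> a v w; rewrite /f (formD tS) (formZ tS) scale_row_mx add_row_mx; congr row_mx.
    by apply/rowP => i; rewrite !ord1 !mxE eqxx !mulr1n.
  by apply/rowP => i; rewrite !mxE (tensorDl hT) (tensorZl hT).
pose M := \matrix_(i < m.+1) f (delta_mx 0 i).
have fM v : v *m M = f v.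
  rewrite mulmx_sum_row [RHS](linear_sum_delta _ fl).
  by apply: eq_bigr => i _; rewrite rowK.
have K0 : kermx M != 0.
  rewrite -mxrank_eq0 mxrank_ker -lt0n subn_gt0.
  by apply: leq_ltn_trans (rank_leq_col M) _; rewrite add1n ltnS.
have /rowV0Pn[v /sub_kermxP vM v0] := K0; rewrite fM in vM.
exists v; split=> // [|i ik].
  have := congr1 (fun r : 'rV[R]_(1 + k) => lsubmx r 0 0) vM.
  by rewrite /f row_mxKl !mxE eqxx mulr1n.
have := congr1 (fun r : 'rV[R]_(1 + k) => rsubmx r 0 (Ordinal ik)) vM.
by rewrite /f row_mxKr !mxE.
Qed.

Lemma An_field_through x v : t x v = 0 -> exists2 X, An_section t X & X x = v.
Proof.
move=> tv; have [Y YC Yx] := field_through x v; have [_ _ ZC _] := hL.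
exists (fun y => Pr Z t y (Y y)); last by rewrite Yx (Pr_id _ tv).
split; last by move=> y; exact: (form_Pr tS).
apply: (smooth_field_subr openT YC); apply: (smooth_field_scale openT _ ZC).
exact: (form_field openT (one_form_on tS.1) YC).
Qed.

(** The new field is chosen so that its value at [c] is already orthogonal to the previous ones; the
    projection leaves that value unchanged, so the norm is positive at [c] and on a neighbourhood,
    to which [U] shrinks before normalising. Indices in [nat] let the family grow without changing
    its type. *)
Lemma gram_schmidt c k : (k <= m)%N -> exists U (E : nat -> N -> vec),
  [/\ open U, U c, forall i x, t x (E i x) = 0, forall i, smooth_field U (E i) &
      forall x i j, U x -> (i < k)%N -> (j < k)%N -> h x (E i x) (E j x) = (i == j)%:R].
Proof.
elim: k => [|k IH] km.
  exists setT, (fun _ _ => 0); split=> //; first exact: openT.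
    by move=> i x; exact: (form0 tS).
  by move=> i; exact: (smooth_field_cst0 openT).
have [U [E [oU Uc tE EC hE]]] := IH (ltnW km).
have [v [v0 tv hv]] := orthogonal_ex c (fun i => E i c) km.
have [Y YA Yc] := An_field_through tv; have YCU := smooth_field_sub (@subsetT _ U) YA.1.
pose Y' y := Y y - \sum_(i < k) h y (Y y) (E i y) *: E i y.
have Y'C : smooth_field U Y'.
  apply: (smooth_field_subr oU YCU); apply: (smooth_field_sum _ oU) => i.
  by apply: (smooth_field_scale oU _ (EC i)); exact: (tensor_field hT oU YCU (EC i)).
pose r y : R^o := h y (Y' y) (Y' y).
have rC : smooth_fun U r by exact: (tensor_field hT oU Y'C Y'C).
have hY' y j : U y -> (j < k)%N -> h y (Y' y) (E j y) = 0.
  move=> Uy jk; rewrite /Y' (tensorBl hT) (tensor_suml hT) (bigD1 (Ordinal jk))//= big1 => [|i ij].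
    by rewrite (tensorZl hT) hE// eqxx mulr1 addr0 subrr.
  rewrite (tensorZl hT) hE//; have -> : (i == j :> nat) = false; last by rewrite mulr0.
  by apply/negbTE; apply: contra ij => /eqP ij; apply/eqP/val_inj.
have tY' y : t y (Y' y) = 0.
  rewrite /Y' (formB tS) YA.2 (linearP_sum _ _ _ (form_linear tS y)) big1 ?subr0// => i _.
  by rewrite (formZ tS) tE mulr0.
pose U' := U `&` r @^-1` [set z | 0 < z].
have oU' : open U' by exact: (smooth_fun_preim_open oU rC (@open_gt R 0)).
have Y'c : Y' c = v.
  rewrite /Y' Yc big1 ?subr0// => i _.
  by rewrite hv ?scale0r// ltn_ord.
have rc : 0 < r c by rewrite /r Y'c; exact: lightlike_definite.
have sC : smooth_fun U' (fun y => (Num.sqrt (r y))^-1 : R^o).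
  apply: (smooth_fun_inv oU') => [y [_ ry]|]; first by rewrite gt_eqF// sqrtr_gt0.
  by apply: (smooth_fun_sqrt oU') => [y [_ ry] //|]; apply: (smooth_fun_sub _ rC) => y [].
have U'U : U' `<=` U by move=> y [].
pose F y := (Num.sqrt (r y))^-1 *: Y' y.
exists U', (fun i => if i == k then F else E i); split; first exact: oU'.
- by split.
- by move=> i y; case: eqP => _ //; rewrite /F (formZ tS) tY' mulr0.
- move=> i; case: eqP => _; last exact: (smooth_field_sub U'U (EC i)).
  exact: (smooth_field_scale oU' sC (smooth_field_sub U'U Y'C)).
move=> y i j [Uy ry]; rewrite !ltnS => ik jk.
have lt_k l : (l <= k)%N -> l <> k -> (l < k)%N.
  by move=> lk /eqP ne; rewrite ltn_neqAle ne lk.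
case: (i =P k) => [->|/(lt_k _ ik) ik0]; case: (j =P k) => [->|/(lt_k _ jk) jk0].
- rewrite eqxx /F (tensorZl hT) (tensorZr hT) -/(r y) mulrA -expr2 exprVn sqr_sqrtr ?(ltW ry)//.
  by rewrite mulVf// gt_eqF.
- by rewrite /F (tensorZl hT) hY'// mulr0 gtn_eqF.
- by rewrite /F (tensorZr hT) (tensorC hT) hY'// mulr0 ltn_eqF.
- exact: hE.
Qed.

(** [ls_nabla] is meaningful on global sections of [An(t)] only, so the local frame is multiplied by
    a bump function and remains orthonormal where that function is 1. *)
Lemma orthonormal_frame c : exists U (E : 'I_m -> N -> vec),
  [/\ open U, U c, forall i, An_section t (E i) &
      forall x, U x -> An_orthonormal h t x (fun i => E i x)].
Proof.
have [U [E [oU Uc tE EC hE]]] := gram_schmidt c (leqnn m).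
have [chi [ O1 [ O2 [chiC _ [oO1 O1x O1U chi1] [oO2 cO2 chi0]]]]] := bump_function oU Uc.
exists O1, (fun (i : 'I_m) y => (chi y : R) *: E i y); split; [exact: oO1|exact: O1x| |].
  move=> i; split; last by move=> y; rewrite (formZ tS) tE mulr0.
  exact: (smooth_field_extend oU oO2 cO2 chi0 chiC (EC i)).
move=> y O1y; split=> [i|i j]; first by rewrite (formZ tS) tE mulr0.
have k1 : (chi y : R) = 1 := chi1 y O1y.
by rewrite k1 !scale1r hE//; exact: O1U.
Qed.

End Lightlike.

(** * Operators linear over the smooth functions *)

Section Tensoriality.
Context {R : realType} {n : nat} {M : manifold R n}.
Local Notation vec := 'rV[R]_n.
Variable T : (M -> vec) -> M -> vec.
Hypothesis T_linear : forall W W' (f : M -> R^o),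
  smooth_field setT W -> smooth_field setT W' -> smooth_fun setT f ->
  T (fun y => (f y : R) *: W y + W' y) = fun x => (f x : R) *: T W x + T W' x.

Let T0 : T (fun=> 0) = fun=> 0.
Proof.
have C0 := smooth_field_cst0 (M := M) openT.
have := T_linear C0 C0 (smooth_fun_cst (1 : R^o) openT).
rewrite (_ : (fun y : M => (1 : R) *: (0 : vec) + 0) = fun=> 0); last first.
  by apply/funext => y; rewrite scaler0 addr0.
move=> E; apply/funext => x; apply/eqP.
have := congr1 (fun F => F x) E => /= /eqP; rewrite scale1r eq_sym -subr_eq0 addrK.
by [].
Qed.

Let T_sum (r : seq 'I_n) (f : 'I_n -> M -> R^o) (W : 'I_n -> M -> vec) W' x :
  (forall i, smooth_fun setT (f i)) -> (forall i, smooth_field setT (W i)) -> smooth_field setT W' ->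
  T (fun y => \sum_(i <- r) (f i y : R) *: W i y + W' y) x =
    \sum_(i <- r) (f i x : R) *: T (W i) x + T W' x.
Proof.
move=> fC WC; elim: r W' => [|i r IH] W' WC'.
  rewrite big_nil add0r; apply: (congr1 (fun F => T F x)); apply/funext => y.
  by rewrite big_nil add0r.
rewrite big_cons -addrA [_ + (_ + T W' x)]addrCA.
rewrite -[_ + T W' x](congr1 (fun F => F x) (T_linear (WC i) WC' (fC i))) -IH.
  apply: (congr1 (fun F => T F x)); apply/funext => y.
  by rewrite big_cons -addrA addrCA.
exact: (smooth_field_add openT (smooth_field_scale openT (fC i) (WC i)) WC').
Qed.

(* Near [x] a field vanishing at [x] is a combination of the coordinate fields
   with coefficients vanishing at [x]; a bump function makes this global. *)
Lemma tensorial W W' x : smooth_field setT W -> smooth_field setT W' -> W x = W' x ->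
  T W x = T W' x.
Proof.
move=> WC WC' Wx.
pose V y := (-1 : R) *: W' y + W y.
have VC : smooth_field setT V.
  exact: (smooth_field_add openT (smooth_field_scale openT (smooth_fun_cst (-1 : R^o) openT) WC') WC).
have Vx : V x = 0 by rewrite /V Wx scaleN1r addNr.
suff TV : T V x = 0.
  have := congr1 (fun F => F x) (T_linear WC' WC (smooth_fun_cst (-1 : R^o) openT)).
  by rewrite -/V TV scaleN1r => /esym/eqP; rewrite addrC subr_eq0 => /eqP.
have dx := @dom_self _ _ M x.
have [chi [ O1 [ O2 [chiC _ [oO1 O1x O1U chi1] [oO2 cO2 chi0]]]]] := bump_function (dom_open x) dx.
pose Wi i y := (chi y : R) *: tvec x y (delta_mx 0 i).
pose fi i y : R^o := (chi y : R) *: (tcoord x y (V y) 0 i : R^o).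
(* One factor [chi] goes into the coefficients and another into the coordinate fields, so that their
   combination is [chi^2 V]; the remainder [(1 - chi^2) V] has a coefficient vanishing at [x]. *)
pose g y : R^o := 1 - chi y * chi y.
have WiC i : smooth_field setT (Wi i).
  exact: (smooth_field_extend (dom_open x) oO2 cO2 chi0 chiC (smooth_field_chart (delta_mx 0 i))).
have fiC i : smooth_fun setT (fi i).
  apply: (smooth_fun_extend (dom_open x) oO2 cO2 chi0 chiC).
  apply: (smooth_fun_entry 0 i (dom_open x)); apply: (smooth_fun_tcoord (dom_open x)) => //.
  exact: (smooth_field_sub (@subsetT _ _) VC).
have gC : smooth_fun setT g.
  exact: (smooth_fun_subr openT (smooth_fun_cst (1 : R^o) openT) (smooth_fun_mul openT chiC chiC)).
have C0 := smooth_field_cst0 (M := M) openT.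
pose V0 y := (g y : R) *: V y + 0.
have V0C : smooth_field setT V0.
  exact: (smooth_field_add openT (smooth_field_scale openT gC VC) C0).
have VE : V = fun y => \sum_(i <- index_enum 'I_n) (fi i y : R) *: Wi i y + V0 y.
  apply/funext => y; rewrite /V0 addr0.
  have -> : \sum_(i <- index_enum 'I_n) (fi i y : R) *: Wi i y = ((chi y : R) * chi y) *: V y.
    have [dy|dy] := cO2 y.
      rewrite [V y in RHS](field_tvec_sum (V y) dy) scaler_sumr; apply: eq_bigr => i _.
      by rewrite /fi /Wi scale_regE !scalerA; congr (_ *: _); ring.
    have k0 : (chi y : R) = 0 := chi0 y dy.
    by rewrite k0 mul0r scale0r big1// => i _; rewrite /Wi k0 scale0r scaler0.
  by rewrite -scalerDl /g addrC subrK scale1r.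
have chix : (chi x : R) = 1 := chi1 x O1x.
rewrite VE (T_sum (index_enum 'I_n) x fiC WiC V0C).
have -> : T V0 x = 0.
  have := congr1 (fun F => F x) (T_linear VC C0 gC); rewrite -/V0 T0 => ->.
  by rewrite /g chix mulr1 subrr scale0r addr0.
rewrite addr0 big1// => i _.
by rewrite /fi Vx (linearP_0 (tcoord_linear x x)) mxE scale_regE mulr0 scale0r.
Qed.

End Tensoriality.

(** * The local connection form in an orthonormal frame *)

Section AdaptedForm.
Context {R : realType} {m : nat} {N : manifold R m.+1}.
Local Notation vec := 'rV[R]_m.+1.
Local Notation mat := 'M[R]_(1 + (m + 1)).
Local Notation l0 := (@ell R m).
Variables (s : lightlike_data N) (t : N -> vec -> R).
Hypotheses (sS : lightlike_structure s) (tS : Sforms (ls_Z s) t).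
Local Notation h := (ls_h s).
Local Notation Z := (ls_Z s).
Local Notation nb := (ls_nabla s t).
Local Notation D := (ls_D s t).
Implicit Types (x c : N) (v w : vec) (O U : set N) (E : 'I_m -> N -> vec).

Let hL : lightlike h Z := sS.1.
Let hT : sym_tensor h := lightlike_tensor hL.
Let nbC : metric_connection h t nb := sS.2.1 t tS.
Let DC : bundle_morphism t D := sS.2.2.1 t tS.

(** The connection evaluated on a single tangent vector, through any global field with that value;
    [tensorial] shows that the choice does not matter. *)
Definition nabla_at X x w : vec := nb (sval (cid2 (field_through x w))) X x.

Lemma nabla_atE X W x : An_section t X -> smooth_field setT W -> nabla_at X x (W x) = nb W X x.
Proof.
move=> XA WC; rewrite /nabla_at; case: cid2 => W' WC' W'x /=.
apply: (@tensorial _ _ _ (fun W => nb W X)) => // V V' f VC VC' fC.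
by have [_ -> _ _ _] := nbC VC VC' XA XA fC.
Qed.

Lemma nabla_at_linear X x : An_section t X -> linear (nabla_at X x).
Proof.
move=> XA k v w; have [V VC <-] := field_through x v; have [W WC <-] := field_through x w.
have kC := smooth_fun_cst (M := N) (k : R^o) openT.
have C := smooth_field_add openT (smooth_field_scale openT kC VC) WC.
rewrite (nabla_atE _ XA C) (nabla_atE _ XA VC) (nabla_atE _ XA WC).
by have [_ -> _ _ _] := nbC VC WC XA XA kC.
Qed.

Lemma nabla_at_form X x w : An_section t X -> t x (nabla_at X x w) = 0.
Proof.
move=> XA; have [W WC <-] := field_through x w; rewrite (nabla_atE _ XA WC).
by have [[_ ->]] := nbC WC WC XA XA (smooth_fun_cst (0 : R^o) openT).
Qed.

Lemma nabla_at_metric X Y x w : An_section t X -> An_section t Y ->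
  dfun ((fun y => h y (X y) (Y y)) : N -> R^o) x w =
    h x (nabla_at X x w) (Y x) + h x (X x) (nabla_at Y x w).
Proof.
move=> XA YA; have [W WC <-] := field_through x w.
rewrite (nabla_atE _ XA WC) (nabla_atE _ YA WC).
by have [_ _ _ _ ->] := nbC WC WC XA YA (smooth_fun_cst (0 : R^o) openT).
Qed.

Lemma nabla_at_smooth X c w : An_section t X ->
  smooth_field (dom N c) (fun x => nabla_at X x (tvec c x w)).
Proof.
move=> XA; apply: smooth_field_local => x cx.
have [chi [ O1 [ O2 [chiC _ [oO1 O1x O1c chi1] [oO2 cO2 chi0]]]]] := bump_function (dom_open c) cx.
pose W y := (chi y : R) *: tvec c y w.
have WC : smooth_field setT W.
  exact: (smooth_field_extend (dom_open c) oO2 cO2 chi0 chiC (smooth_field_chart w)).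
have [[nC _] _ _ _ _] := nbC WC WC XA XA (smooth_fun_cst (0 : R^o) openT).
exists O1; split; first exact: O1x.
apply: (eq_smooth_field oO1 _ (smooth_field_sub (@subsetT _ O1) nC)) => y O1y.
rewrite -(nabla_atE _ XA WC); apply: (congr1 (nabla_at X y)).
by apply: (etrans (congr1 (fun k : R => k *: tvec c y w) (chi1 y O1y))); exact: scale1r.
Qed.

Definition frame_mid E x v : 'cV[R]_m := \col_i h x v (E i x).

(* The local expression of [nabla^T] in the frame [(xi, Phi E_1, ..., Phi E_m, eta^t)]. *)
Definition adapted_form E x w : mat :=
  gmx (t x w) (frame_mid E x w) (- (frame_mid E x (D x w))^T)
    (\matrix_(i, j) h x (nabla_at (E j) x w) (E i x)).

Lemma frame_mid_linear E x : linear (frame_mid E x).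
Proof. by move=> k v w; apply/colP => i; rewrite !mxE (tensorDl hT) (tensorZl hT). Qed.

Lemma gmx_linear k a X z (A : 'M[R]_m) a' X' z' A' :
  gmx (k * a + a') (k *: X + X') (k *: z + z') (k *: A + A') = k *: gmx a X z A + gmx a' X' z' A'.
Proof.
apply: mx_eq_apply => e; rewrite mulmxDl -scalemxAl (lvecK e) !gmx_lvec lvecZ lvecD.
congr lvec.
- by rewrite mulmxDl -scalemxAl !mxE; ring.
- by apply/colP => i; rewrite !mulmxDl -!scalemxAl !mxE; ring.
- by rewrite dotDl dotZl; ring.
Qed.

Lemma adapted_form_linear E x : (forall i, An_section t (E i)) -> linear (adapted_form E x).
Proof.
move=> EA k v w; rewrite /adapted_form -gmx_linear.
have [Dl _ _] := DC; rewrite Dl !frame_mid_linear.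
congr gmx.
- by rewrite (formD tS) (formZ tS).
- by rewrite linearP /= opprD scalerN.
- by apply/matrixP => i j; rewrite !mxE (nabla_at_linear x (EA j)) (tensorDl hT) (tensorZl hT).
Qed.

Lemma smooth_frame_mid E O X : open O -> (forall i, An_section t (E i)) ->
  smooth_field O X -> smooth_fun O (fun x => frame_mid E x (X x)).
Proof.
move=> oO EA XC; apply: (smooth_fun_entries oO) => i j.
have EC : smooth_field O (E i) := smooth_field_sub (@subsetT _ O) (EA i).1.
by apply: (eq_smooth_fun oO _ (tensor_field hT oO XC EC)) => x _; rewrite mxE.
Qed.

Lemma smooth_gmx O (a : N -> R^o) (X : N -> 'cV[R]_m) z (A : N -> 'M[R]_m) : open O ->
  smooth_fun O a -> smooth_fun O X -> smooth_fun O z -> smooth_fun O A ->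
  smooth_fun O (fun x => gmx (a x) (X x) (z x) (A x)).
Proof.
move=> oO aC XC zC AC; have c0 p q := smooth_fun_cst (0 : 'M[R]_(p, q)) oO.
have asC (b : N -> R^o) : smooth_fun O b -> smooth_fun O (fun x => (b x)%:M : 'M[R]_1).
  move=> bC; apply: (smooth_fun_entries oO) => i j.
  by apply: (eq_smooth_fun oO _ bC) => x _; rewrite !ord1 mxE eqxx mulr1n.
apply: (smooth_fun_col_mx oO).
  apply: (smooth_fun_row_mx oO (asC _ aC)).
  exact: (smooth_fun_row_mx oO zC (c0 _ _)).
apply: (smooth_fun_row_mx oO).
  exact: (smooth_fun_col_mx oO XC (c0 _ _)).
apply: (smooth_fun_col_mx oO).
  exact: (smooth_fun_row_mx oO AC (smooth_fun_opp oO (smooth_fun_trmx oO zC))).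
exact: (smooth_fun_row_mx oO (smooth_fun_opp oO (smooth_fun_trmx oO XC))
  (smooth_fun_opp oO (asC _ aC))).
Qed.

Lemma adapted_form_form E : (forall i, An_section t (E i)) -> form_on setT (adapted_form E).
Proof.
move=> EA; split=> [x _|c w]; first exact: adapted_form_linear.
have oO := openId c (@openT N); set O := setT `&` dom N c in oO *.
have Od : O `<=` dom N c by move=> y [].
have wC := smooth_field_sub Od (smooth_field_chart (c := c) w).
have [_ _ Dsm] := DC; have DwC := smooth_field_sub Od (Dsm c w).
apply: (smooth_gmx oO).
- exact: (smooth_fun_sub Od (tS.1.2 c w)).
- exact: (smooth_frame_mid oO EA wC).
- exact: (smooth_fun_opp oO (smooth_fun_trmx oO (smooth_frame_mid oO EA DwC))).
- apply: (smooth_fun_entries oO) => i j.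
  have EC : smooth_field O (E i) := smooth_field_sub (@subsetT _ O) (EA i).1.
  have nC := smooth_field_sub Od (nabla_at_smooth w (EA j)).
  by apply: (eq_smooth_fun oO _ (tensor_field hT oO nC EC)) => x _; rewrite mxE.
Qed.

Definition frame_gram E E' x : 'M[R]_m := \matrix_(i, j) h x (E i x) (E' j x).
(* The frames [(xi, Phi E_i, eta^t)] and [(xi, Phi E'_i, eta^t)] share their null
   vectors, so the change of frame is in O(m). *)
Definition frame_change E E' x : mat := hmx 0 (frame_gram E E' x).

Lemma hmx0_lvec (B : 'M[R]_m) al y be : hmx 0 B *m lvec al y be = lvec al (B *m y) be.
Proof. by rewrite hmx_lvec !dot0l mulmx0 !mulr0 subr0 addr0 scaler0 subr0. Qed.

Lemma frame_dot E x v w : An_orthonormal h t x (fun i => E i x) ->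
  dot (frame_mid E x v) (frame_mid E x w) = h x v w.
Proof.
move=> Eo; have R0 := lightlike_radl hL.
rewrite [in RHS](orthonormal_expand hT tS R0 w Eo) (tensorDr hT) (tensorZr hT).
rewrite (lightlike_radr hL) mulr0 add0r (tensor_sumr hT) dotE.
by apply: eq_bigr => i _; rewrite !mxE (tensorZr hT) mulrC.
Qed.

Lemma frame_gramE E E' x y i : (frame_gram E E' x *m y) i 0 = dot (frame_mid E' x (E i x)) y.
Proof. by rewrite dotE mxE; apply: eq_bigr => j _; rewrite !mxE. Qed.

Lemma frame_gram_mid E E' x v : An_orthonormal h t x (fun i => E' i x) ->
  frame_gram E E' x *m frame_mid E' x v = frame_mid E x v.
Proof. by move=> Eo; apply/colP => i; rewrite frame_gramE frame_dot// mxE (tensorC hT). Qed.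

Lemma frame_gram_mul E E' E'' x : An_orthonormal h t x (fun i => E' i x) ->
  frame_gram E E' x *m frame_gram E' E'' x = frame_gram E E'' x.
Proof.
move=> Eo; apply/matrixP => i k; rewrite [RHS]mxE -(frame_dot _ _ Eo) dotE mxE.
by apply: eq_bigr => j _; rewrite !mxE (tensorC hT x (E' j x)).
Qed.

Lemma frame_gram1 E x : An_orthonormal h t x (fun i => E i x) -> frame_gram E E x = 1%:M.
Proof. by move=> [_ hE]; apply/matrixP => i j; rewrite !mxE hE. Qed.

Lemma frame_changeM E E' E'' x : An_orthonormal h t x (fun i => E' i x) ->
  frame_change E E' x *m frame_change E' E'' x = frame_change E E'' x.
Proof.
move=> Eo; apply: mx_eq_apply => e; rewrite -mulmxA [e]lvecK !hmx0_lvec mulmxA.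
by rewrite frame_gram_mul.
Qed.

Lemma frame_change1 E x : An_orthonormal h t x (fun i => E i x) -> frame_change E E x = 1%:M.
Proof.
move=> Eo; apply: mx_eq_apply => e; rewrite mul1mx {1}[e]lvecK hmx0_lvec frame_gram1//.
by rewrite mul1mx -lvecK.
Qed.

Lemma frame_change_Hgroup E E' x : An_orthonormal h t x (fun i => E i x) ->
  An_orthonormal h t x (fun i => E' i x) -> Hgroup (frame_change E E' x).
Proof.
move=> Eo Eo'; apply: hmx_Hgroup.
have -> : (frame_gram E E' x)^T = frame_gram E' E x.
  by apply/matrixP => i j; rewrite !mxE (tensorC hT).
by rewrite frame_gram_mul// frame_gram1.
Qed.

Lemma frame_gram_smooth E E' : (forall i, An_section t (E i)) -> (forall i, An_section t (E' i)) ->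
  smooth_fun setT (frame_gram E E').
Proof.
move=> EA EA'; apply: (smooth_fun_entries openT) => i j.
by apply: (eq_smooth_fun openT _ (tensor_field hT openT (EA i).1 (EA' j).1)) => x _; rewrite mxE.
Qed.

Lemma frame_change_smooth E E' : (forall i, An_section t (E i)) ->
  (forall i, An_section t (E' i)) -> smooth_fun setT (frame_change E E').
Proof.
move=> EA EA'.
exact: (hmx_smooth openT (smooth_fun_cst (0 : 'cV[R]_m) openT) (frame_gram_smooth EA EA')).
Qed.

Lemma dfun_linear_post O p q p' q' (l : 'M[R]_(p, q) -> 'M[R]_(p', q'))
    (f : N -> 'M[R]_(p, q)) x v : linear l -> open O -> smooth_fun O f -> O x ->
  dfun (fun y => l (f y)) x v = l (dfun f x v).
Proof.
move=> ll oO fC Ox; apply: (diff_linear v ll).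
exact: (smooth_fun_differentiable oO fC Ox (@dom_self _ _ N x)).
Qed.

Lemma lvec_mid_linear : linear (fun y : 'cV[R]_m => lvec 0 y 0).
Proof. by move=> k y y'; rewrite lvecZ lvecD !mulr0 !addr0. Qed.

(** Only the middle block of [frame_change] varies with the point, so its derivative kills the two
    null directions. *)
Lemma dfun_frame_change E E' x w al y be : (forall i, An_section t (E i)) ->
  (forall i, An_section t (E' i)) ->
  dfun (frame_change E E') x w *m lvec al y be = lvec 0 (dfun (frame_gram E E') x w *m y) 0.
Proof.
move=> EA EA'; have gC := frame_gram_smooth EA EA'; have cC := frame_change_smooth EA EA'.
have eC := smooth_fun_cst (M := N) (lvec al y be) openT.
have yC := smooth_fun_cst (M := N) y openT.
have gyC := smooth_fun_mulmx openT gC yC.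
have E1 := dfun_mulmx w openT cC eC (I : setT x); rewrite dfun_cst mulmx0 addr0 in E1.
have E2 := dfun_mulmx w openT gC yC (I : setT x); rewrite dfun_cst mulmx0 addr0 in E2.
rewrite -E1 -E2 -(dfun_linear_post w lvec_mid_linear openT gyC (I : setT x)).
have aC : smooth_fun setT (fun _ : N => lvec al (0 : 'cV[R]_m) be) := smooth_fun_cst _ openT.
have lC := smooth_fun_linear lvec_mid_linear openT gyC.
have E3 : dfun (fun z => lvec al (0 : 'cV[R]_m) be + lvec 0 (frame_gram E E' z *m y) 0) x w =
    dfun (fun z => lvec 0 (frame_gram E E' z *m y) 0) x w.
  by rewrite (dfun_add w openT aC lC (I : setT x)) dfun_cst add0r.
rewrite -E3; apply: dfun_ext => z.
by rewrite hmx0_lvec lvecD addr0 add0r addr0.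
Qed.

Section Frames.
Variables (E : 'I_m -> N -> vec) (U : set N).
Hypotheses (oU : open U) (EA : forall i, An_section t (E i)).
Hypothesis Eo : forall x, U x -> An_orthonormal h t x (fun i => E i x).

(** Metric compatibility applied to the locally constant functions [h(E i, E j)]. *)
Lemma nabla_frame_skew x w i j : U x ->
  h x (nabla_at (E i) x w) (E j x) = - h x (nabla_at (E j) x w) (E i x).
Proof.
move=> Ux; have := nabla_at_metric x w (EA i) (EA j).
have C : smooth_fun setT (fun y => h y (E i y) (E j y) : R^o).
  exact: (tensor_field hT openT (EA i).1 (EA j).1).
rewrite (eq_dfun (g := fun=> (i == j)%:R : R^o) w oU _ (smooth_fun_sub (@subsetT _ U) C) Ux); last first.
  by move=> y Uy; rewrite (Eo Uy).2.
rewrite dfun_cst (tensorC hT x (E i x)) => /esym/eqP.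
by rewrite addr_eq0 => /eqP.
Qed.

Lemma adapted_form_galg x w : U x -> galg (adapted_form E x w).
Proof.
move=> Ux; apply: galg_gmx; apply/matrixP => i j; rewrite !mxE.
exact: nabla_frame_skew.
Qed.

Lemma adapted_form_ell x w : adapted_form E x w *m l0 = lvec (t x w) (frame_mid E x w) 0.
Proof. by rewrite ellE gmx_lvec !mulmx0 dot0r !mulr1 scale1r scale0r !mxE !mulr0 !subr0 !addr0 oppr0. Qed.

Lemma adapted_form_inj x w : U x -> adapted_form E x w *m l0 = 0 -> w = 0.
Proof.
move=> Ux; rewrite adapted_form_ell => w0; have R0 := lightlike_radl hL.
have t0 : t x w = 0 by have := congr1 (@ltop R m) w0; rewrite ltop_lvec /ltop !mxE.
have m0 : frame_mid E x w = 0 by have := congr1 (@lmid R m) w0; rewrite lmid_lvec /lmid !linear0.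
rewrite [LHS](orthonormal_expand hT tS R0 w (Eo Ux)) t0 scale0r add0r big1// => i _.
by have := congr1 (fun y : 'cV[R]_m => y i 0) m0; rewrite !mxE => ->; rewrite scale0r.
Qed.

Lemma adapted_form_surj x (e : 'cV[R]_(1 + (m + 1))) : U x -> lbot e = 0 ->
  exists w, adapted_form E x w *m l0 = e.
Proof.
move=> Ux e0; exists (ltop e *: Z x + \sum_i lmid e i 0 *: E i x).
rewrite adapted_form_ell [RHS]lvecK e0; have [tE hE] := Eo Ux; congr lvec.
  rewrite (formD tS) (formZ tS) (form_rad tS) mulr1 (linearP_sum _ _ _ (form_linear tS x)).
  by rewrite big1 ?addr0// => i _; rewrite (formZ tS) tE mulr0.
apply/colP => j; rewrite mxE (tensorDl hT) (tensorZl hT) (lightlike_radl hL) mulr0 add0r.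
rewrite (tensor_suml hT) (bigD1 j)//= big1 => [|i ij]; rewrite (tensorZl hT) hE.
  by rewrite eqxx mulr1 addr0.
by rewrite (negbTE ij) mulr0.
Qed.

(** The gauge transformation law. The entries built from [t], [h] and [D] are components of one and
    the same tensor in the two frames and merely rotate; the derivative of the change of frame
    appears only in the block of [nabla]. *)
Lemma adapted_form_change E' U' x w : (forall i, An_section t (E' i)) ->
  (forall x, U' x -> An_orthonormal h t x (fun i => E' i x)) -> U x -> U' x ->
  frame_change E E' x *m adapted_form E' x w =
    adapted_form E x w *m frame_change E E' x + dfun (frame_change E E') x w.
Proof.
move=> EA' Eo' Ux Ux'; apply: mx_eq_apply => e; rewrite [e]lvecK.
move: (ltop e) (lmid e) (lbot e) => al y be {e}.
rewrite mulmxDl -!mulmxA dfun_frame_change// hmx0_lvec !gmx_lvec hmx0_lvec lvecD.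
set B := frame_gram E E' x; pose A F := \matrix_(i, j) h x (nabla_at (F j) x w) (F i x) : 'M[R]_m.
rewrite -/(A E) -/(A E').
have midE v : B *m frame_mid E' x v = frame_mid E x v by exact: (frame_gram_mid E v (Eo' x Ux')).
have tmid v : (frame_mid E x v)^T *m B = (frame_mid E' x v)^T.
  have BT : B = (frame_gram E' E x)^T by apply/matrixP => i j; rewrite !mxE (tensorC hT).
  by rewrite BT -trmx_mul (frame_gram_mid E' v (Eo Ux)).
(* Metric compatibility splits the derivative of [h(E i, E' k)] into two terms: the one with
   [nabla E' k] is the entry of [B *m A E'], the one with [nabla E i] is minus the entry of
   [A E *m B] by skewness. *)
have BA : B *m A E' = A E *m B + dfun (frame_gram E E') x w.
  apply/matrixP => i k; rewrite mxE [RHS]mxE.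
  have gC := frame_gram_smooth EA EA'.
  rewrite (dfun_entry w i k openT gC (I : setT x)).
  rewrite (dfun_ext (g := fun z => h z (E i z) (E' k z) : R^o)); last by move=> z; rewrite mxE.
  rewrite (nabla_at_metric x w (EA i) (EA' k)).
  have -> : \sum_j B i j * A E' j k = h x (E i x) (nabla_at (E' k) x w).
    rewrite -(frame_dot _ _ (Eo' x Ux')) dotE; apply: eq_bigr => j _; rewrite !mxE.
    by rewrite (tensorC hT x (nabla_at _ _ _)).
  have -> : (A E *m B) i k = - h x (nabla_at (E i) x w) (E' k x).
    rewrite -(frame_dot _ _ (Eo Ux)) dotE mxE -sumrN; apply: eq_bigr => j _; rewrite !mxE.
    by rewrite nabla_frame_skew// mulNr (tensorC hT x (E j x)).
  by rewrite addrA addNr add0r.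
congr lvec.
- rewrite addr0 !mulNmx -tmid -mulmxA !mxE.
  by [].
- have tN (z : 'cV[R]_m) : (- z^T)^T = - z by rewrite linearN /= trmxK.
  rewrite !tN !scalerN !opprK !mulmxDr -!scalemxAr !midE !mulmxA BA mulmxDl.
  by rewrite addrA [RHS]addrAC.
- by rewrite addr0 /dot mulmxA tmid.
Qed.

End Frames.
End AdaptedForm.

(** * Gluing local Cartan connections *)

Section Gluing.
Context {R : realType} {m : nat} {N : manifold R m.+1}.
Local Notation q := (1 + (m + 1))%N.
Local Notation mat := 'M[R]_(1 + (m + 1)).
Local Notation L := 'cV[R]_(1 + (m + 1)).
Local Notation l0 := (@ell R m).
Local Notation vec := 'rV[R]_m.+1.
Local Notation dh := (@halg_dim R m).
Variables (U : N -> set N) (gh : N -> N -> N -> mat).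
Hypotheses (oU : forall c, open (U c)) (Uc : forall c, U c c) (Udom : forall c, U c `<=` dom N c).
Hypothesis ghC : forall c d, smooth_fun setT (gh c d).
Hypothesis ghH : forall c d x, U c x -> U d x -> Hgroup (gh c d x).
Hypothesis ghM : forall c d e x, U c x -> U d x -> U e x -> gh c d x *m gh d e x = gh c e x.
Hypothesis gh1 : forall c x, U c x -> gh c c x = 1%:M.

(* The point [(x, h)] stands for [sg_x(x) . h], where [sg_c] is the local
   section over [U c]; its coordinate in the trivialisation over [U c] is
   [glue_coord c (x, h)]. *)
Definition glue_pt : Type := (N * {h : mat | Hgroup h})%type.
Implicit Types (u v : glue_pt) (c d x : N) (g : mat).

Definition glue_proj u : N := u.1.
Definition glue_coord c u : mat := gh c (glue_proj u) (glue_proj u) *m sval u.2.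

(** Defined for every matrix, with the identity as a default outside [H], so that charts and action
    are total functions of a matrix. *)
Definition glue_mk x g : glue_pt :=
  (x, if pselect (Hgroup g) is left Hg then exist _ g Hg else exist _ 1%:M (@Hgroup1 R m)).
Definition glue_sec c x g : glue_pt := glue_mk x (gh x c x *m g).

Lemma Hgroup_invmxM (h k : mat) : Hgroup h -> Hgroup k -> invmx (h *m k) = invmx k *m invmx h.
Proof.
move=> Hh Hk; have Hhk := HgroupM Hh Hk.
have E : invmx k *m invmx h *m (h *m k) = 1%:M.
  by rewrite mulmxA -(mulmxA _ (invmx h)) Hgroup_mulVmx// mulmx1 Hgroup_mulVmx.
by rewrite -[LHS]mul1mx -E -mulmxA Hgroup_mulmxV// mulmx1.
Qed.

Lemma glue_mkE x g : Hgroup g -> sval (glue_mk x g).2 = g.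
Proof. by rewrite /glue_mk; case: pselect. Qed.

Lemma glue_coord_self u : glue_coord (glue_proj u) u = sval u.2.
Proof. by rewrite /glue_coord gh1// mul1mx. Qed.

Lemma glue_coord_change c d u : U c (glue_proj u) -> U d (glue_proj u) ->
  glue_coord c u = gh c d (glue_proj u) *m glue_coord d u.
Proof. by move=> Ucu Udu; rewrite /glue_coord mulmxA ghM. Qed.

Lemma glue_coord_Hgroup c u : U c (glue_proj u) -> Hgroup (glue_coord c u).
Proof. by move=> Ucu; apply: HgroupM; [exact: ghH|exact: (svalP u.2)]. Qed.

Lemma glue_secK c x g : U c x -> Hgroup g -> glue_coord c (glue_sec c x g) = g.
Proof.
move=> Ucx Hg; rewrite /glue_coord glue_mkE; last by apply: HgroupM => //; exact: ghH.
by rewrite mulmxA ghM// gh1// mul1mx.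
Qed.

Lemma glue_ptP u v : glue_proj u = glue_proj v -> sval u.2 = sval v.2 -> u = v.
Proof.
case: u v => [x [h Hh]] [y [k Hk]]; rewrite /glue_proj /= => xy hk.
by subst; congr (_, exist _ _ _); exact: Prop_irrelevance.
Qed.

Lemma glue_ptE c u v : U c (glue_proj u) -> glue_proj u = glue_proj v ->
  glue_coord c u = glue_coord c v -> u = v.
Proof.
move=> Ucu uv E; apply: glue_ptP => //; rewrite -!glue_coord_self -uv.
by rewrite (@glue_coord_change _ c u)// (@glue_coord_change _ c v) -?uv// E.
Qed.

(* The chart at [v = (x, h)] is [(phi_x, cayV (h^-1 g))], with [g] the coordinate
   in the trivialisation over [U x]. *)
Definition glue_chart_set v : set 'rV[R]_(m.+1 + dh) :=
  [set y | (phi N (glue_proj v) @` (U (glue_proj v) `&` dom N (glue_proj v))) (lsubmx y) /\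
           1%:M - 2^-1 *: iota (rsubmx y) \in unitmx].

Definition glue_dom v : set glue_pt :=
  [set u | U (glue_proj v) (glue_proj u) /\
           invmx (sval v.2) *m glue_coord (glue_proj v) u + 1%:M \in unitmx].

Definition glue_phi v u : 'rV[R]_(m.+1 + dh) :=
  row_mx (phi N (glue_proj v) (glue_proj u))
    (iotaV (cayV (invmx (sval v.2) *m glue_coord (glue_proj v) u))).

Definition glue_psi v (y : 'rV[R]_(m.+1 + dh)) : glue_pt :=
  glue_sec (glue_proj v) (psi N (glue_proj v) (lsubmx y)) (sval v.2 *m cay (iota (rsubmx y))).

Lemma glue_psiP v y : glue_chart_set v y ->
  [/\ U (glue_proj v) (glue_proj (glue_psi v y)),
      glue_proj (glue_psi v y) = psi N (glue_proj v) (lsubmx y),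
      glue_coord (glue_proj v) (glue_psi v y) = sval v.2 *m cay (iota (rsubmx y)) &
      glue_dom v (glue_psi v y) /\ glue_phi v (glue_psi v y) = y].
Proof.
move=> [/chart_imageP[Ux dx xE] yu]; have Hv := svalP v.2.
have Hg : Hgroup (sval v.2 *m cay (iota (rsubmx y))).
  by apply: HgroupM => //; apply: cay_Hgroup => //; exact: iota_halg.
have E : glue_coord (glue_proj v) (glue_psi v y) = sval v.2 *m cay (iota (rsubmx y)).
  exact: glue_secK.
have E' : invmx (sval v.2) *m glue_coord (glue_proj v) (glue_psi v y) = cay (iota (rsubmx y)).
  by rewrite E mulmxA Hgroup_mulVmx// mul1mx.
split=> //; split; first by split => //; rewrite E'; exact: cay_unit.
by rewrite /glue_phi E' cayK// iotaK /glue_proj /= xE hsubmxK.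
Qed.

Lemma glue_phiP v u : glue_dom v u -> glue_chart_set v (glue_phi v u) /\ glue_psi v (glue_phi v u) = u.
Proof.
move=> [Uu uu]; have Hv := svalP v.2; have Hu := glue_coord_Hgroup Uu.
have Hc : halg (cayV (invmx (sval v.2) *m glue_coord (glue_proj v) u)).
  by apply: cayV_halg => //; apply: HgroupM => //; exact: HgroupV.
have C : glue_chart_set v (glue_phi v u).
  split; first by rewrite /glue_phi row_mxKl; apply: phi_image => //; exact: Udom.
  by rewrite /glue_phi row_mxKr iotaVK//; exact: cayV_unit.
split=> //; have [U' pE gE _] := glue_psiP C.
have pE' : glue_proj (glue_psi v (glue_phi v u)) = glue_proj u.
  by rewrite pE /glue_phi row_mxKl phiK//; exact: Udom.
apply: (glue_ptE U' pE'); rewrite gE /glue_phi row_mxKr iotaVK// cayVK//.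
by rewrite mulmxA Hgroup_mulmxV// mul1mx.
Qed.

Lemma glue_image v (S : set glue_pt) :
  glue_phi v @` (glue_dom v `&` S) = glue_chart_set v `&` glue_psi v @^-1` S.
Proof.
apply/seteqP; split=> [_ [u [du Su] <-]|y [Cy Sy]].
  by have [C E] := glue_phiP du; split => //=; rewrite E.
by have [_ _ _ [dy E]] := glue_psiP Cy; exists (glue_psi v y).
Qed.

(** Smoothness tested on the base point and on the matrix coordinates over all [U c]. It needs no
    topology on the total set, hence can be applied to the inverse charts before the manifold
    exists. *)
Definition glue_plot k (V : set 'rV[R]_k) (a : 'rV[R]_k -> glue_pt) : Prop :=
  smooth_plot V (glue_proj \o a) /\
  forall c, Cinf_on (V `&` (glue_proj \o a) @^-1` U c) (glue_coord c \o a).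

Section Plots.
Context {k : nat} (V : set 'rV[R]_k) (a : 'rV[R]_k -> glue_pt).
Hypotheses (oV : open V) (aP : glue_plot V a).

Lemma glue_plot_open0 O : open O -> open (V `&` (glue_proj \o a) @^-1` O).
Proof. by move=> oO; apply: (plot_preim_open oV) => // y Vy; exact: (aP.1.1 y Vy). Qed.

Lemma glue_plot_open c O (Q : set mat) : open O -> open Q ->
  open (V `&` a @^-1` [set u | [/\ O (glue_proj u), U c (glue_proj u) & Q (glue_coord c u)]]).
Proof.
move=> oO oQ; have oO1 := glue_plot_open0 (oU c); have oO2 := glue_plot_open0 oO.
have := openI oO2 (Cinf_preim_open oO1 (aP.2 c) oQ).
suff -> : (V `&` (glue_proj \o a) @^-1` O) `&`
    ((V `&` (glue_proj \o a) @^-1` U c) `&` (glue_coord c \o a) @^-1` Q) =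
    V `&` a @^-1` [set u | [/\ O (glue_proj u), U c (glue_proj u) & Q (glue_coord c u)]] by [].
by apply/seteqP; split=> y /=; [move=> [[Vy Oy] [[_ Uy] Qy]]|move=> [Vy [Oy Uy Qy]]].
Qed.

Let O1 v := V `&` (glue_proj \o a) @^-1` U (glue_proj v).

Let gC v : Cinf_on (O1 v) (fun y => invmx (sval v.2) *m glue_coord (glue_proj v) (a y)).
Proof.
have oO1 : open (O1 v) := glue_plot_open0 (oU _).
exact: (Cinf_mulmx oO1 (Cinf_cst _ oO1) (aP.2 (glue_proj v))).
Qed.

Lemma glue_plot_dom_open v : open (V `&` a @^-1` glue_dom v).
Proof.
have oO1 : open (O1 v) := glue_plot_open0 (oU _).
have := Cinf_unit_open oO1 (Cinf_add oO1 (@gC v) (Cinf_cst 1%:M oO1)).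
by rewrite /O1 -setIA.
Qed.

Lemma glue_plot_phi v : Cinf_on (V `&` a @^-1` glue_dom v) (glue_phi v \o a).
Proof.
have oD := @glue_plot_dom_open v; set D := V `&` _ in oD *.
have DO1 : D `<=` O1 v by move=> y [Vy [Uy _]].
apply: (Cinf_row_mx oD).
  apply: (Cinf_sub _ (aP.1.2 (glue_proj v))) => y [Vy [Uy _]].
  by split => //; exact: Udom.
apply: (Cinf_linear (@iotaV_linear R m) oD); apply: (Cinf_cayV oD).
  by move=> y [_ [_ uy]].
exact: (Cinf_sub DO1 (@gC v)).
Qed.

End Plots.

Lemma glue_chart_set_open v : open (glue_chart_set v).
Proof.
have lC := Cinf_lsub openT (Cinf_id (@openT 'rV[R]_(m.+1 + dh))).
have rC := Cinf_rsub openT (Cinf_id (@openT 'rV[R]_(m.+1 + dh))).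
have oI : open (phi N (glue_proj v) @` (U (glue_proj v) `&` dom N (glue_proj v))).
  exact: (chart_image_open _ (oU _)).
have o1 := Cinf_preim_open openT lC oI.
have iC : Cinf_on setT (fun y : 'rV[R]_(m.+1 + dh) => 1%:M - 2^-1 *: iota (rsubmx y)).
  apply: (Cinf_sub_fun openT (Cinf_cst _ openT)).
  apply: (Cinf_scale openT (Cinf_cst (2^-1 : R^o) openT)).
  exact: (Cinf_linear (@iota_linear R m) openT rC).
have o2 := Cinf_unit_open openT iC.
by have := openI o1 o2; rewrite !setTI.
Qed.

Lemma glue_psi_plot v : glue_plot (glue_chart_set v) (glue_psi v).
Proof.
have oS := @glue_chart_set_open v; set S := glue_chart_set v in oS *.
have lC := Cinf_lsub oS (Cinf_id oS); have rC := Cinf_rsub oS (Cinf_id oS).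
have P1 : smooth_plot S (glue_proj \o glue_psi v).
  apply: (eq_smooth_plot (a := psi N (glue_proj v) \o (fun y => lsubmx y)) oS).
    by move=> y Sy; have [_ E _ _] := glue_psiP Sy; exact: (esym E).
  have oI : open (phi N (glue_proj v) @` (setT `&` dom N (glue_proj v))).
    exact: (chart_image_open _ openT).
  apply: (smooth_plot_comp oI oS lC _ (smooth_plot_psi (glue_proj v))).
  by move=> y [/chart_imageP[_ dx E] _]; rewrite -E; exact: phi_image.
split=> // c; set S' := S `&` _.
have oS' : open S' by apply: (plot_preim_open oS _ (oU c)) => y Sy; exact: (P1.1 y Sy).
have S'S : S' `<=` S by move=> y [].
apply: (eq_Cinf (f := fun y => gh c (glue_proj v) (glue_proj (glue_psi v y)) *m
    (sval v.2 *m cay (iota (rsubmx y)))) oS').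
  move=> y [Sy Uy]; have [U' _ gE _] := glue_psiP Sy.
  by rewrite /= (glue_coord_change Uy U') gE.
apply: (Cinf_mulmx oS').
  exact: (plot_fun oS' openT (smooth_plot_sub S'S P1) (fun _ _ => I) (ghC c (glue_proj v))).
apply: (Cinf_mulmx oS' (Cinf_cst _ oS')); apply: (Cinf_cay oS').
  by move=> y [[_ uy] _].
exact: (Cinf_linear (@iota_linear R m) oS' (Cinf_sub S'S rC)).
Qed.

Lemma glue_self v : glue_dom v v.
Proof.
split; first exact: Uc.
rewrite glue_coord_self Hgroup_mulVmx; last exact: (svalP v.2).
exact: unit2.
Qed.

(** Openness of overlaps and smoothness of transitions both come from the inverse charts being
    plots. The definition is transparent so that the fields of the record reduce to [glue_dom],
    [glue_phi] and [glue_psi]. *)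
Definition glue_atlas : atlas R (m.+1 + dh).
Proof.
apply: (@Atlas R (m.+1 + dh) glue_pt glue_dom glue_phi glue_psi glue_self).
- move=> v w; rewrite glue_image.
  exact: (@glue_plot_dom_open _ _ _ (@glue_chart_set_open v) (glue_psi_plot v) w).
- by move=> v u /glue_phiP[].
- move=> v w; rewrite glue_image.
  exact: (@glue_plot_phi _ _ _ (@glue_chart_set_open v) (glue_psi_plot v) w).
Defined.

(** * Topology of the glued total space *)

Local Notation T := (at_pt glue_atlas).

Lemma glue_open_set c O (Q : set mat) : open O -> open Q ->
  open ([set u | [/\ O (glue_proj u), U c (glue_proj u) & Q (glue_coord c u)]] : set T).
Proof.
move=> oO oQ; rewrite atlas_openE => v; rewrite [X in open X]glue_image.
exact: (@glue_plot_open _ _ _ (@glue_chart_set_open v) (glue_psi_plot v) c O Q oO oQ).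
Qed.

Lemma glue_proj_open O : open O -> open (glue_proj @^-1` O : set T).
Proof.
move=> oO; rewrite atlas_openE => v; rewrite [X in open X]glue_image.
exact: (@glue_plot_open0 _ _ _ (@glue_chart_set_open v) (glue_psi_plot v) O oO).
Qed.

(** Points over different base points are separated in [N]; points of the same fibre have different
    matrix coordinates over a common [U c] and are separated there. *)
Lemma glue_hausdorff : hausdorff_space T.
Proof.
rewrite open_hausdorff => u v /eqP uv.
have [puv|/eqP puv] := pselect (glue_proj u = glue_proj v); last first.
  have := @manifold_hausdorff _ _ N; rewrite open_hausdorff => /(_ (glue_proj u) (glue_proj v) puv).
  move=> [[A B] [/= ]]; rewrite !inE => Au Bv [oA oB]; rewrite /= => AB0.
  have {}AB0 : A `&` B = set0 by first [exact: AB0 | exact/eqP].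
  exists (glue_proj @^-1` A, glue_proj @^-1` B); first by rewrite !inE.
  split; [exact: glue_proj_open|exact: glue_proj_open|apply/eqP/seteqP; split=> //].
  by move=> w [Aw Bw]; have : (A `&` B) (glue_proj w) by []; rewrite AB0.
pose c := glue_proj u; have Uu : U c (glue_proj u) := Uc _.
have guv : glue_coord c u != glue_coord c v by apply/eqP => E; apply: uv; exact: (glue_ptE Uu puv E).
have := @norm_hausdorff _ mat; rewrite open_hausdorff => /(_ _ _ guv).
move=> [[A B] [/= ]]; rewrite !inE => Au Bv [oA oB]; rewrite /= => AB0.
  have {}AB0 : A `&` B = set0 by first [exact: AB0 | exact/eqP].
exists ([set w | [/\ setT (glue_proj w), U c (glue_proj w) & A (glue_coord c w)]],
  [set w | [/\ setT (glue_proj w), U c (glue_proj w) & B (glue_coord c w)]]).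
  by rewrite !inE; split; split => //; rewrite -puv.
split; [by apply: glue_open_set => //; exact: openT|by apply: glue_open_set => //; exact: openT|].
apply/eqP/seteqP; split=> // w [[_ _ Aw] [_ _ Bw]].
by have : (A `&` B) (glue_coord c w) by []; rewrite AB0.
Qed.

Lemma nbhs_mxvec k l (g : 'M[R]_(k, l)) (B : set 'rV[R]_(k * l)) :
  nbhs (mxvec g) B -> nbhs g (mxvec @^-1` B).
Proof. by move=> nB; exact: (@linear_mx_continuous _ _ _ _ (@mxvec R k l) g B nB). Qed.

Lemma ball_row_mx k l (y y' : 'rV[R]_k) (z z' : 'rV[R]_l) e :
  ball y e y' -> ball z e z' -> ball (row_mx y z) e (row_mx y' z').
Proof.
by move=> [e0 yb] [_ zb]; split=> // i j; rewrite !mxE; case: splitP => o _.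
Qed.

(** Conditions on the base point and on the matrix coordinate suffice to describe neighbourhoods: in
    a suitable chart both components depend continuously on these data, the second one on an open
    set of all matrices and not only on [H]. *)
Lemma glue_nbhs c u (A : set T) : open A -> A u -> U c (glue_proj u) ->
  exists O (Q : set mat), [/\ open O /\ O (glue_proj u), open Q /\ Q (glue_coord c u) &
    forall u', O (glue_proj u') -> U c (glue_proj u') -> Q (glue_coord c u') -> A u'].
Proof.
move=> oA Au Ucu; pose k := glue_coord c u; have Hk : Hgroup k := glue_coord_Hgroup Ucu.
(* Chosen so that the chart at [v] uses the coordinate over [U c] and places [u] at Cayley
   coordinate 0. *)
pose v := glue_mk c k; have vk : sval v.2 = k := glue_mkE c Hk.
have kk : invmx k *m k = 1%:M by exact: Hgroup_mulVmx.
have du : glue_dom v u.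
  split => //; have -> : glue_coord (glue_proj v) u = k by [].
  by rewrite vk kk; exact: unit2.
pose W := glue_phi v @` (glue_dom v `&` A); have oW : open W := oA v.
have Wu : W (glue_phi v u) by exists u.
have /nbhs_ballP[e e0 eW] : nbhs (glue_phi v u) W by exact: open_nbhs_nbhs.
pose S := [set y : 'rV[R]_(q * q) | invmx k *m vec_mx y + 1%:M \in unitmx].
have vC (B : set 'rV[R]_(q * q)) : open B -> Cinf_on B (fun y => invmx k *m (vec_mx y : mat)).
  move=> oB; apply: (Cinf_mulmx oB (Cinf_cst _ oB)).
  apply: (@Cinf_linear _ _ _ _ _ _ _ (@vec_mx R q q) _ _ oB (Cinf_id oB)).
  by move=> r y z; rewrite linearP.
have oS : open S.
  have := Cinf_unit_open openT (Cinf_add openT (vC _ openT) (Cinf_cst 1%:M openT)).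
  by rewrite setTI.
pose F (y : 'rV[R]_(q * q)) : 'rV[R]_dh := iotaV (cayV (invmx k *m vec_mx y)).
have FC : Cinf_on S F.
  by apply: (Cinf_linear (@iotaV_linear R m) oS); apply: (Cinf_cayV oS _ (vC _ oS)).
have Sk : S (mxvec k) by rewrite /S /= mxvecK kk; exact: unit2.
have nS : nbhs (mxvec k) S by exact: (open_nbhs_nbhs (conj oS Sk)).
have nF : nbhs (mxvec k) (F @^-1` ball (F (mxvec k)) e).
  by apply: (Cinf_continuous FC Sk); exact: nbhsx_ballx.
have nQ : nbhs k (mxvec @^-1` (S `&` F @^-1` ball (F (mxvec k)) e)) by exact: (nbhs_mxvec (filterI nS nF)).
have nO : nbhs (glue_proj u) (phi N c @^-1` ball (phi N c (glue_proj u)) e).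
  by apply: (phi_continuous (Udom Ucu)); exact: nbhsx_ballx.
move: nQ nO; rewrite /= !nbhsE => -[Q [oQ Qk] QS] [ O [oO Ou] OS].
exists O, Q; split=> // u' Ou' Uu' Qu'.
have [Su' Fu'] := QS _ Qu'; rewrite /S /= mxvecK in Su'.
have du' : glue_dom v u' by split => //; rewrite vk.
have [u'' [du'' Au''] E] : W (glue_phi v u').
  apply: eW; rewrite /glue_phi vk; apply: ball_row_mx; first exact: (OS _ Ou').
  by move: Fu'; rewrite /F /= !mxvecK.
by rewrite -(glue_phiP du').2 -E (glue_phiP du'').2.
Qed.

Definition rat_box (ab : 'M[rat]_q * 'M[rat]_q) : set mat :=
  [set g | forall i j, ratr (ab.1 i j) < g i j < ratr (ab.2 i j)].

Lemma rat_box_open ab : open (rat_box ab).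
Proof.
rewrite openE => g Hg.
have H i j : nbhs g [set g' : mat | ratr (ab.1 i j) < g' i j < ratr (ab.2 i j)].
  have /andP[h1 h2] := Hg i j.
  have cg : {for g, continuous (fun g' : mat => g' i j)} by exact: coord_continuous.
  apply: (cg [set r | ratr (ab.1 i j) < r < ratr (ab.2 i j)]).
  by near=> r; apply/andP; split; near: r; [exact: lt_nbhsr|exact: lt_nbhsl].
have H2 (FF : Filter (nbhs g)) i := filter_forall FF (H i).
have H3 (FF : Filter (nbhs g)) := filter_forall FF (H2 FF).
exact: H3.
Unshelve. all: by end_near. Qed.

Lemma rat_box_basis (g : mat) Q : open Q -> Q g -> exists2 ab, rat_box ab g & rat_box ab `<=` Q.
Proof.
move=> oQ Qg; have /nbhs_ballP[e e0 eQ] : nbhs g Q by exact: open_nbhs_nbhs.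
have lo i j : exists r : rat, g i j - e < ratr r < g i j.
  have : g i j - e < g i j by rewrite ltrBlDr ltrDl.
  by move=> /rat_in_itvoo[r]; rewrite inE /= => /itvP h; exists r; rewrite !h.
have hi i j : exists r : rat, g i j < ratr r < g i j + e.
  have : g i j < g i j + e by rewrite ltrDl.
  by move=> /rat_in_itvoo[r]; rewrite inE /= => /itvP h; exists r; rewrite !h.
pose ra i j := sval (cid (lo i j)); pose rb i j := sval (cid (hi i j)).
exists (\matrix_(i, j) ra i j, \matrix_(i, j) rb i j) => [i j|g' Hg'].
  rewrite !mxE; have /andP[_ ->] := svalP (cid (lo i j)).
  by have /andP[-> _] := svalP (cid (hi i j)).
apply: eQ; split=> // i j; have := Hg' i j; rewrite !mxE => /andP[h1 h2].
have /andP[h3 _] := svalP (cid (lo i j)); have /andP[_ h4] := svalP (cid (hi i j)).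
rewrite /ball /= /ball_ /= ltr_norml; rewrite -/(ra i j) in h3; rewrite -/(rb i j) in h4.
by apply/andP; split; lra.
Qed.

(** A countable basis is indexed by basic sets of [N], a countable subfamily of the [U c] covering
    [N], and boxes of matrices with rational bounds. *)
Lemma glue_second_countable : @second_countable T.
Proof.
have [x0|x0] := pselect (exists x0 : N, True); last first.
  exists set0; first exact: countable0.
  by split=> [A //|u]; case: x0; exists (glue_proj u).
have {x0} [x0 _] := x0.
have [cc ccP] := second_countable_subcover x0 oU Uc.
have [B Bc [Bo Bb]] := @manifold_second_countable _ _ N.
pose D : set (set N * (nat * ('M[rat]_q * 'M[rat]_q))) := B `*` setT.
pose G (b : set N * (nat * ('M[rat]_q * 'M[rat]_q))) : set T :=
  [set u | [/\ b.1 (glue_proj u), U (cc b.2.1) (glue_proj u) &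
               rat_box b.2.2 (glue_coord (cc b.2.1) u)]].
exists (G @` D).
  apply: (sub_countable (card_image_le _ _)); apply: (countableX Bc); exact: countableP.
split=> [_ [b [Bb1 _] <-]|u A].
  by apply: glue_open_set; [exact: Bo|exact: rat_box_open].
rewrite nbhsE => -[A' [oA' A'u] A'A]; have [i Uu] := ccP (glue_proj u).
have [ O [ Q [[oO Ou] [oQ Qu] H]]] := glue_nbhs oA' A'u Uu.
have [ab abu abQ] := rat_box_basis oQ Qu.
have /(_ O) [] := Bb (glue_proj u); first exact: open_nbhs_nbhs.
move=> b [Bb1 bu] bO; exists (G (b, (i, ab))).
  by split; [exists (b, (i, ab))|].
by move=> u' [/= bu' Uu' abu']; apply/A'A/H => //; [exact: bO|exact: abQ].
Qed.

Definition glue_total : manifold R (m.+1 + dh) := atlas_manifold glue_hausdorff glue_second_countable.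

Local Notation P := glue_total.

Lemma glue_proj_smooth : smooth_map (M := P) (M' := N) setT glue_proj.
Proof.
move=> v; apply: (smooth_plot_sub _ (glue_psi_plot v).1).
by move=> _ [u [_ du] <-]; exact: (glue_phiP du).1.
Qed.

Lemma glue_coord_smooth c : smooth_fun (M := P) (glue_proj @^-1` U c) (glue_coord c).
Proof.
move=> v; apply: (Cinf_sub _ ((glue_psi_plot v).2 c)).
move=> _ [u [Uu du] <-]; have [Cu E] := glue_phiP du; split; first exact: Cu.
have UE : U c (glue_proj (glue_psi v (glue_phi v u))) by rewrite E.
exact: UE.
Qed.

(** With its converse [smooth_glue_plot], this reduces smoothness into the total space to
    coordinates over the sets [U c]. *)
Lemma glue_plot_smooth k (V : set 'rV[R]_k) (a : 'rV[R]_k -> P) : open V ->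
  glue_plot V a -> smooth_plot V a.
Proof.
move=> oV aP; apply: (smooth_plotI oV) => y Vy.
exists (a y), (V `&` a @^-1` glue_dom (a y)); split.
- exact: (@glue_plot_dom_open _ _ _ oV aP (a y)).
- by split; [exact: Vy|exact: glue_self].
- by move=> z [].
- exact: (@glue_plot_phi _ _ _ oV aP (a y)).
Qed.

Lemma smooth_glue_plot k (V : set 'rV[R]_k) (a : 'rV[R]_k -> P) : open V ->
  smooth_plot V a -> glue_plot V a.
Proof.
move=> oV aP.
have P1 : smooth_plot V (glue_proj \o a).
  exact: (plot_map oV openT aP (fun _ _ => I) glue_proj_smooth).
split=> // c; have oVc : open (V `&` (glue_proj \o a) @^-1` U c).
  by apply: (plot_preim_open oV _ (oU c)) => y Vy; exact: (P1.1 y Vy).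
have aPc : smooth_plot (V `&` (glue_proj \o a) @^-1` U c) a.
  by apply: (smooth_plot_sub _ aP) => y [].
have oO : open (glue_proj @^-1` U c : set P) by exact: glue_proj_open.
have aV y : (V `&` (glue_proj \o a) @^-1` U c) y -> (glue_proj @^-1` U c : set P) (a y) by case.
exact: (plot_fun oVc oO aPc aV (@glue_coord_smooth c)).
Qed.

Definition glue_act (u : P) g : P := glue_mk (glue_proj u) (sval u.2 *m g).

Lemma glue_act_coord c (u : P) g : Hgroup g -> glue_coord c (glue_act u g) = glue_coord c u *m g.
Proof.
move=> Hg; rewrite /glue_coord glue_mkE ?mulmxA//.
by apply: HgroupM => //; exact: (svalP u.2).
Qed.

Lemma glue_act_val (u : P) g : Hgroup g -> sval (glue_act u g).2 = sval u.2 *m g.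
Proof. by move=> Hg; rewrite glue_mkE//; apply: HgroupM => //; exact: (svalP u.2). Qed.

Definition glue_section c x : P := glue_sec c x 1%:M.

Lemma glue_section_smooth c : smooth_map (M := N) (M' := P) (U c) (glue_section c).
Proof.
move=> c'; have oV := chart_image_open c' (oU c); set V := phi N c' @` _ in oV *.
have VP : forall y, V y -> U c (psi N c' y) by move=> y /chart_imageP[].
have P1 : smooth_plot V (psi N c') by exact: smooth_plot_psi_sub.
apply: (glue_plot_smooth oV); split; first exact: P1.
move=> d; have oV' : open (V `&` (glue_proj \o (glue_section c \o psi N c')) @^-1` U d).
  by apply: (plot_preim_open oV _ (oU d)) => y Vy; exact: (P1.1 y Vy).
set V' := V `&` _ in oV' *.
have P1' : smooth_plot V' (psi N c') by apply: (smooth_plot_sub _ P1) => y [].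
apply: (eq_Cinf (f := gh d c \o psi N c') oV').
  move=> y [Vy Udy]; rewrite /= (@glue_coord_change d c)//; last exact: VP.
  by rewrite glue_secK ?mulmx1//; [exact: VP|exact: Hgroup1].
exact: (plot_fun oV' openT P1' (fun _ _ => I) (@ghC d c)).
Qed.

Lemma glue_principal : principal_bundle (m := m) (P := P) glue_proj glue_act.
Proof.
split.
- exact: glue_proj_smooth.
- by move=> u; apply: glue_ptP => //; rewrite glue_act_val ?mulmx1//; exact: Hgroup1.
- move=> u g g' Hg Hg'; apply: glue_ptP => //.
  by rewrite !glue_act_val ?mulmxA//; exact: HgroupM.
- by [].
- move=> d V a b oV aP bC bH; have [P1 P2] := smooth_glue_plot oV aP.
  apply: (glue_plot_smooth oV); split; first exact: P1.
  move=> c; set V' := V `&` _; have V'V : V' `<=` V by move=> y [].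
  have oV' : open V'.
    by apply: (plot_preim_open oV _ (oU c)) => y Vy; exact: (P1.1 y Vy).
  apply: (eq_Cinf (f := fun y => glue_coord c (a y) *m b y) oV').
    by move=> y [Vy _]; rewrite /= glue_act_coord//; exact: bH.
  exact: (Cinf_mulmx oV' (P2 c) (Cinf_sub V'V bC)).
- move=> c; exists (U c), (glue_section c), (glue_coord c); split.
  + exact: oU.
  + exact: Uc.
  + exact: glue_section_smooth.
  + exact: glue_coord_smooth.
  split=> [x _|u Uu|x g Ux Hg]; first by [].
    have Hu := glue_coord_Hgroup Uu; split; first exact: Hu.
    apply: (@glue_ptE c) => //; rewrite glue_act_coord// glue_secK ?mul1mx//.
    exact: Hgroup1.
  by rewrite glue_act_coord// glue_secK ?mul1mx//; exact: Hgroup1.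
Qed.

(** * The glued Cartan connection *)

Variable th : N -> N -> vec -> mat.
Hypothesis thF : forall c, one_form (th c).
Hypothesis thG : forall c x w, U c x -> galg (th c x w).
Hypothesis th_inj : forall c x w, U c x -> th c x w *m l0 = 0 -> w = 0.
Hypothesis th_surj : forall c x (e : L), U c x -> lbot e = 0 -> exists w, th c x w *m l0 = e.
Hypothesis th_change : forall c d x w, U c x -> U d x ->
  gh c d x *m th d x w = th c x w *m gh c d x + dfun (gh c d) x w.

Definition glue_form c (u : P) (z : 'rV[R]_(m.+1 + dh)) : mat :=
  invmx (glue_coord c u) *m th c (glue_proj u) (tmap (M := P) (M' := N) glue_proj u z) *m
    glue_coord c u + invmx (glue_coord c u) *m dfun (M := P) (glue_coord c) u z.
Definition glue_om (u : P) z : mat := glue_form (glue_proj u) u z.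

(** The coordinates satisfy [g_d = gh d c . g_c], and the term in the derivative of [gh d c] is
    exactly what [th_change] supplies. So the formula written over [U (glue_proj u)], a set varying
    with [u], is smooth. *)
Lemma glue_omE c (u : P) z : U c (glue_proj u) -> glue_om u z = glue_form c u z.
Proof.
move=> Ucu; rewrite /glue_om; set d := glue_proj u; have Udu : U d (glue_proj u) := Uc _.
pose O : set P := glue_proj @^-1` U c `&` glue_proj @^-1` U d.
have oO : open O by apply: openI; exact: glue_proj_open.
have Ou : O u by [].
have gdC : smooth_fun (M := P) O (glue_coord d) by apply: (smooth_fun_sub _ (@glue_coord_smooth d)) => w [].
have gcC : smooth_fun (M := P) O (glue_coord c) by apply: (smooth_fun_sub _ (@glue_coord_smooth c)) => w [].
have pC : smooth_map (M := P) (M' := N) O glue_proj by exact: (smooth_map_sub (@subsetT _ _) glue_proj_smooth).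
have ghO : smooth_fun (M := P) O (gh d c \o glue_proj).
  exact: (smooth_fun_comp oO openT (fun _ _ => I) pC (ghC d c)).
have E : dfun (M := P) (glue_coord d) u z =
    dfun (gh d c) (glue_proj u) (tmap (M := P) (M' := N) glue_proj u z) *m glue_coord c u +
    gh d c (glue_proj u) *m dfun (M := P) (glue_coord c) u z.
  rewrite -(dfun_comp z oO openT pC (ghC d c) Ou I).
  apply: (etrans _ (dfun_mulmx z oO ghO gcC Ou)).
  by apply: (eq_dfun z oO _ gdC Ou) => w [Ucw Udw]; exact: glue_coord_change.
set w := tmap _ u z in E *.
have Hc := glue_coord_Hgroup Ucu; have Hd := ghH Udu Ucu.
have gE : glue_coord d u = gh d c (glue_proj u) *m glue_coord c u by exact: glue_coord_change.
have {gE} gVE : invmx (glue_coord d u) = invmx (glue_coord c u) *m invmx (gh d c (glue_proj u)).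
  by rewrite gE Hgroup_invmxM.
rewrite /glue_form -/w E gVE {1}(@glue_coord_change d c)//.
have := th_change w Udu Ucu; set g := gh d c (glue_proj u); set k := glue_coord c u.
have HV : invmx g *m g = 1%:M by exact: Hgroup_mulVmx.
set T := th d _ w; set T' := th c _ w; set dg := dfun (gh d c) _ w; set dk := dfun (M := P) (glue_coord c) u z.
move=> H; transitivity (invmx k *m invmx g *m (T *m g + dg) *m k + invmx k *m (invmx g *m g) *m dk).
  by rewrite !(mulmxDl, mulmxDr) !mulmxA addrA.
by rewrite HV mulmx1 -H !mulmxA -(mulmxA _ _ g) HV mulmx1.
Qed.

Lemma glue_form_smooth c : form_on (M := P) (glue_proj @^-1` U c) (glue_form c).
Proof.
have oO : open (glue_proj @^-1` U c : set P) by exact: glue_proj_open.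
have pC : smooth_map (M := P) (M' := N) (glue_proj @^-1` U c) glue_proj.
  exact: (smooth_map_sub (@subsetT _ _) glue_proj_smooth).
have F1 : form_on (M := P) (glue_proj @^-1` U c)
    (fun u z => th c (glue_proj u) (tmap (M := P) (M' := N) glue_proj u z)).
  exact: (pullback_form oO pC (thF c)).
have F2 : form_on (M := P) (glue_proj @^-1` U c) (dfun (M := P) (glue_coord c)).
  exact: (dfun_form oO (@glue_coord_smooth c)).
split=> [u Ucu k z z'|v w].
  rewrite /glue_form (F1.1 u Ucu) (F2.1 u Ucu).
  by rewrite !(mulmxDr, mulmxDl) -!(scalemxAr, scalemxAl) scalerDr addrACA.
have oO' : open ((glue_proj @^-1` U c : set P) `&` dom P v) by exact: openId.
have kC : smooth_fun (M := P) ((glue_proj @^-1` U c : set P) `&` dom P v) (glue_coord c).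
  by apply: (smooth_fun_sub _ (@glue_coord_smooth c)) => u [].
have kVC : smooth_fun (M := P) ((glue_proj @^-1` U c : set P) `&` dom P v) (fun u => invmx (glue_coord c u)).
  apply: (smooth_fun_invmx oO' _ kC) => u [Ucu _]; exact: (Hgroup_unit (glue_coord_Hgroup Ucu)).
apply: (smooth_fun_add oO' _ (smooth_fun_mulmx oO' kVC (F2.2 v w))).
exact: (smooth_fun_mulmx oO' (smooth_fun_mulmx oO' kVC (F1.2 v w)) kC).
Qed.

Lemma glue_om_form : one_form (M := P) glue_om.
Proof.
split=> [u|v w]; first exact: (glue_form_smooth _).1.
apply: smooth_fun_local => u vu; pose c := glue_proj u.
have oO : open (glue_proj @^-1` U c : set P) by exact: glue_proj_open.
exists ((glue_proj @^-1` U c : set P) `&` dom P v); split; first by split; [exact: Uc|].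
apply: (eq_smooth_fun (openId v oO) _ ((glue_form_smooth c).2 v w)) => u' [Ucu' _].
by rewrite (@glue_omE c).
Qed.

(** A tangent vector at [u] is read in the chart centred at [u], whose second component is the
    inverse Cayley transform of [k^-1 g]. At the identity this transform has the identity as
    derivative, so the two blocks of [z] are its projection and [k^-1 dg(z)]. *)
Lemma glue_tangent (u : P) z :
  lsubmx z = tmap (M := P) (M' := N) glue_proj u z /\
  iota (rsubmx z) = invmx (sval u.2) *m dfun (M := P) (glue_coord (glue_proj u)) u z.
Proof.
set c := glue_proj u; set k := sval u.2; have Hk : Hgroup k := svalP u.2.
have oS := @glue_chart_set_open u; set S := glue_chart_set u in oS.
have du := glue_self u; have [Sy uE] := glue_phiP du; set y0 := glue_phi u u in Sy uE.
have [P1 P2] := glue_psi_plot u.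
have SU y : S y -> U c (glue_proj (glue_psi u y)) by move=> Sy'; have [] := glue_psiP Sy'.
have P1C : Cinf_on S (phi N c \o (glue_proj \o glue_psi u)).
  by apply: (Cinf_sub _ (P1.2 c)) => y Sy'; split=> //; apply: Udom; exact: SU.
have kC : Cinf_on S (glue_coord c \o glue_psi u).
  by apply: (Cinf_sub _ (P2 c)) => y Sy'; split=> //; exact: SU.
pose b y := invmx k *m glue_coord c (glue_psi u y).
have bC : Cinf_on S b := Cinf_mulmx oS (Cinf_cst _ oS) kC.
have b0 : b y0 = 1%:M by rewrite /b uE /c glue_coord_self Hgroup_mulVmx.
have bu y : S y -> b y + 1%:M \in unitmx.
  move=> Sy'; have [_ _ E _] := glue_psiP Sy'; rewrite /b E mulmxA Hgroup_mulVmx// mul1mx.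
  by apply: cay_unit; exact: Sy'.2.
have bH y : S y -> Hgroup (b y).
  by move=> Sy'; apply: HgroupM; [exact: HgroupV|apply: glue_coord_Hgroup; exact: SU].
have bD : 'd b y0 z = invmx k *m dfun (M := P) (glue_coord c) u z.
  apply: (etrans (diff_mulmx z oS Sy (Cinf_cst _ oS) kC)).
  rewrite -[RHS]add0r -[in X in _ = X + _](mul0mx _ ((glue_coord c \o glue_psi u) y0)).
  exact: (congr2 (fun X Y => X *m _ + Y) (diff_cstE _ _ _) erefl).
have cC : Cinf_on S (cayV \o b) := Cinf_cayV oS bu bC.
have iC : Cinf_on S (fun y => iotaV (cayV (b y))) := Cinf_linear (@iotaV_linear R m) oS cC.
have E : z = row_mx (tmap (M := P) (M' := N) glue_proj u z) (iotaV ('d b y0 z)).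
  apply: (etrans (esym (tvec_self (M := P) u z))).
  apply: (etrans (diff_row_mx z oS Sy P1C iC)); apply: congr1.
  apply: (etrans (diff_linear z (@iotaV_linear R m) (Cinf_differentiable oS cC Sy))).
  exact: (congr1 iotaV (diff_cayV z oS Sy bu bC b0)).
rewrite -bD {1 3}E row_mxKl row_mxKr iotaVK//.
exact: (diff_Hgroup1_halg oS bC bH Sy b0).
Qed.

Lemma glue_om_self (u : P) z : glue_om u z =
  invmx (sval u.2) *m th (glue_proj u) (glue_proj u) (lsubmx z) *m sval u.2 + iota (rsubmx z).
Proof. by have [-> ->] := glue_tangent u z; rewrite /glue_om /glue_form glue_coord_self. Qed.

(** The blocks of [z] make [omega] triangular: its action on [ell] determines the first block
    through [th], which is injective and onto the orthogonal of [ell] there; what is left kills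
    [ell], hence lies in [halg], and is the second block. *)
Lemma glue_om_iso u : set_bij [set: 'rV[R]_(m.+1 + dh)] galg (glue_om u).
Proof.
have Hk : Hgroup (sval u.2) := svalP u.2; set k := sval u.2 in Hk.
have Uu : U (glue_proj u) (glue_proj u) by exact: Uc.
have omE z : glue_om u z *m l0 = invmx k *m (th (glue_proj u) (glue_proj u) (lsubmx z) *m l0).
  have /halgP[_ i0] := iota_halg (rsubmx z); have /HgroupP[_ k0] := Hk.
  by rewrite glue_om_self mulmxDl i0 addr0 -!mulmxA k0.
have ul := (glue_om_form).1 u.
split.
- move=> z _; rewrite glue_om_self; apply: galgD; last exact/halg_galg/iota_halg.
  by apply: galg_Ad => //; exact: thG.
- move=> z z' _ _ zz'; apply/eqP; rewrite -subr_eq0; apply/eqP.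
  have z0 : glue_om u (z - z') = 0.
    by rewrite -[z - z']addrC -scaleN1r ul scaleN1r zz' addNr.
  set y := z - z' in z0 *.
  have ly : lsubmx y = 0.
    apply: (th_inj Uu); move: (omE y); rewrite z0 mul0mx => /esym/(congr1 (mulmx k)).
    by rewrite mulmx0 !mulmxA Hgroup_mulmxV// mul1mx.
  have := glue_om_self u y; rewrite z0 ly (linearP_0 ((thF _).1 _)) mulmx0 mul0mx add0r => /esym iy.
  by rewrite -[y]hsubmxK ly -[rsubmx y]iotaK iy (linearP_0 (@iotaV_linear R m)) row_mx0.
- move=> X gX.
  have [w wE] : exists w, th (glue_proj u) (glue_proj u) w *m l0 = k *m (X *m l0).
    apply: th_surj => //; rewrite Hgroup_lbot// galg_ell// lbot_lvec//.
  have hY : halg (X - invmx k *m th (glue_proj u) (glue_proj u) w *m k).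
    apply: galg_halg; first by apply: (galgB gX); apply: galg_Ad => //; exact: thG.
    have /HgroupP[_ k0] := Hk.
    by rewrite mulmxBl -!mulmxA k0 wE !mulmxA Hgroup_mulVmx// mul1mx subrr.
  exists (row_mx w (iotaV (X - invmx k *m th (glue_proj u) (glue_proj u) w *m k))) => //.
  by rewrite glue_om_self row_mxKl row_mxKr iotaVK// addrC subrK.
Qed.

Lemma glue_act_smooth g : Hgroup g -> smooth_map (M := P) (M' := P) setT (glue_act^~ g).
Proof.
move=> Hg c; have oi : open (phi P c @` (setT `&` dom P c)) by exact: (chart_image_open _ openT).
apply: (pb_act_smooth glue_principal oi (smooth_plot_psi c) (Cinf_cst g oi)).
by move=> y _.
Qed.

Lemma glue_om_act g : Hgroup g -> forall u z,
  glue_om (glue_act u g) (tmap (M := P) (M' := P) (glue_act^~ g) u z) = invmx g *m glue_om u z *m g.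
Proof.
move=> Hg u z; set c := glue_proj u; have Ucu : U c (glue_proj u) := Uc _.
have Hk : Hgroup (glue_coord c u) by exact: glue_coord_Hgroup.
have aC := glue_act_smooth Hg.
pose O : set P := glue_proj @^-1` U c; have oO : open O by exact: glue_proj_open.
have kC : smooth_fun (M := P) O (glue_coord c) by exact: glue_coord_smooth.
have aCO : smooth_map (M := P) (M' := P) O (glue_act^~ g) by exact: (smooth_map_sub (@subsetT _ _) aC).
have T1 : tmap (M := P) (M' := N) glue_proj (glue_act u g) (tmap (M := P) (M' := P) (glue_act^~ g) u z) =
    tmap (M := P) (M' := N) glue_proj u z.
  have pC : smooth_map (M := P) (M' := N) setT glue_proj by exact: glue_proj_smooth.
  have := tmap_comp (M := P) (M' := P) (M'' := N) (x := u) z openT openT aC pC I I.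
  by move=> <-.
have gC : smooth_fun (M := P) O (fun=> g) by exact: (smooth_fun_cst g oO).
have T2 : dfun (M := P) (glue_coord c) (glue_act u g) (tmap (M := P) (M' := P) (glue_act^~ g) u z) =
    dfun (M := P) (glue_coord c) u z *m g.
  have T : dfun (M := P) (glue_coord c \o glue_act^~ g) u z =
      dfun (M := P) (glue_coord c) (glue_act u g) (tmap (M := P) (M' := P) (glue_act^~ g) u z).
    exact: (@dfun_comp _ _ P _ P _ _ O O _ _ u z oO oO aCO kC Ucu Ucu).
  rewrite -T.
  have E : glue_coord c \o (glue_act^~ g) = fun u' => glue_coord c u' *m g.
    by apply/funext => u'; exact: glue_act_coord.
  apply: (etrans (congr1 (fun f : P -> mat => dfun f u z) E)).
  apply: (etrans (dfun_mulmx z oO kC gC Ucu)).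
  have -> : dfun (M := P) (fun=> g) u z = 0 by exact: diff_cstE.
  by rewrite mulmx0 addr0.
have -> : glue_om (glue_act u g) (tmap (M := P) (M' := P) (glue_act^~ g) u z) =
  glue_form c (glue_act u g) (tmap (M := P) (M' := P) (glue_act^~ g) u z) by [].
rewrite /glue_form T1 T2 glue_act_coord// Hgroup_invmxM// /glue_om /glue_form -/c.
by rewrite !(mulmxDl, mulmxDr) !mulmxA.
Qed.

(** In the chart at [u] the curve [u . exp(tX)] has constant first component and second component
    [iotaV (cayV (exp(tX)))], whose derivative at 0 is [iotaV X]. *)
Lemma glue_om_fundamental X : halg X -> forall u,
  glue_om u (derive1 (fun t : R => phi P u (glue_act u (expmx (t *: X)))) 0) = X.
Proof.
move=> HX u; have Hk : Hgroup (sval u.2) := svalP u.2.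
have EH y : Hgroup (exp_line X y) by exact: expmx_Hgroup.
have e0 : exp_line X 0 = 1%:M by rewrite /exp_line mxE expmx0.
pose g (y : 'rV[R]_1) := phi P u (glue_act u (exp_line X y)).
have gE y : g y = row_mx (phi N (glue_proj u) (glue_proj u)) (iotaV (cayV (exp_line X y))).
  rewrite /g /= /glue_phi glue_act_coord// glue_coord_self mulmxA Hgroup_mulVmx// mul1mx //.
have EC := @exp_line_smooth R m X.
pose B := setT `&` [set y | exp_line X y + 1%:M \in unitmx].
have oB : open B by exact: (Cinf_unit_open openT (Cinf_add openT EC (Cinf_cst _ openT))).
have B0 : B 0 by split=> //=; rewrite e0; exact: unit2.
have ECB : Cinf_on B (exp_line X) by exact: (Cinf_sub (@subsetT _ _) EC).
have cC : Cinf_on B (fun y => cayV (exp_line X y)) := Cinf_cayV oB (fun y By => By.2) ECB.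
have iC : Cinf_on B (fun y => iotaV (cayV (exp_line X y))) := Cinf_linear (@iotaV_linear R m) oB cC.
have gC : Cinf_on B g.
  apply: (eq_Cinf oB _ (Cinf_row_mx oB (Cinf_cst (phi N (glue_proj u) (glue_proj u)) oB) iC)) => y _.
  by rewrite gE.
pose e : 'rV[R]_1 := delta_mx 0 0.
have gd : differentiable g 0 by exact: (Cinf_differentiable oB gC B0).
have gD : 'd g 0 e = row_mx 0 (iotaV X).
  rewrite (funext gE); apply: (etrans (diff_row_mx e oB B0 (Cinf_cst _ oB) iC)).
  apply: congr2; first exact: diff_cstE.
  apply: (etrans (diff_linear e (@iotaV_linear R m) (Cinf_differentiable oB cC B0))).
  apply: congr1; apply: (etrans (diff_cayV e oB B0 (fun y By => By.2) ECB e0)).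
  by rewrite diff_exp_line e0 mulmx1 mxE !eqxx scale1r.
have e00 : (0 : 'rV[R]_1) + (0 : R) *: e = 0 by rewrite scale0r addr0.
have gd' : derivable g ((0 : 'rV[R]_1) + (0 : R) *: e) e.
  by rewrite e00; exact: diff_derivable.
have -> : derive1 (fun t : R => phi P u (glue_act u (expmx (t *: X)))) 0 = row_mx 0 (iotaV X).
  rewrite -gD -(deriveE e gd) derive1E.
  have -> : (fun t : R => phi P u (glue_act u (expmx (t *: X)))) =
      fun s : R => g ((0 : 'rV[R]_1) + s *: e).
    by apply/funext => t; rewrite /g /exp_line /e !mxE add0r !eqxx mulr1.
  by have [_ ->] := is_derive_line gd'; rewrite e00.
rewrite glue_om_self row_mxKl row_mxKr (linearP_0 ((thF _).1 _)) mulmx0 mul0mx add0r.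
exact: iotaVK.
Qed.

Definition glue_geometry : cartan_geometry N :=
  CartanGeometry glue_principal
    (CartanConnection glue_om_form glue_om_iso glue_om_act glue_om_fundamental).

(** Along its own section the matrix coordinate is constantly 1, so the pullback of the glued form
    is the prescribed [th c]. Only this property of the construction is used later. *)
Lemma cartan_gluing : exists (C : cartan_geometry N) (sg : N -> N -> cg_tot C), forall c,
  local_section (U c) (sg c) /\ forall x w, U c x -> theta (sg c) x w = th c x w.
Proof.
exists glue_geometry, glue_section => c; split.
  split; [exact: oU|exact: glue_section_smooth|by []].
move=> x w Ux; have Ux' : U c (glue_proj (glue_section c x)) by exact: Ux.
have k1 : glue_coord c (glue_section c x) = 1%:M by apply: glue_secK => //; exact: Hgroup1.
have sC := @glue_section_smooth c.
have pC : smooth_map (M := P) (M' := N) setT glue_proj by exact: glue_proj_smooth.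
have oO : open (glue_proj @^-1` U c : set P) by exact: glue_proj_open.
have T1 : tmap (M := P) (M' := N) glue_proj (glue_section c x)
    (tmap (M := N) (M' := P) (glue_section c) x w) = w.
  have := tmap_comp (M := N) (M' := P) (M'' := N) (x := x) w (oU c) openT sC pC Ux I.
  by move=> <-; exact: tvec_self.
have T2 : dfun (M := P) (glue_coord c) (glue_section c x)
    (tmap (M := N) (M' := P) (glue_section c) x w) = 0.
  have T : dfun (glue_coord c \o glue_section c) x w = dfun (M := P) (glue_coord c) (glue_section c x)
      (tmap (M := N) (M' := P) (glue_section c) x w).
    by apply: (@dfun_comp _ _ N _ P _ _ (U c) (glue_proj @^-1` U c) _ _ x w (oU c) oO sC _ Ux Ux');
      exact: glue_coord_smooth.
  rewrite -T; apply: (etrans _ (dfun_cst (M := N) (1%:M : mat) x w)).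
  have E y : U c y -> 1%:M = (glue_coord c \o glue_section c) y.
    by move=> Uy; apply/esym/glue_secK => //; exact: Hgroup1.
  by apply/esym; apply: (eq_dfun w (oU c) E _ Ux); exact: (smooth_fun_cst (M := N) (1%:M : mat) (oU c)).
transitivity (glue_form c (glue_section c x) (tmap (M := N) (M' := P) (glue_section c) x w)).
  exact: glue_omE.
by rewrite /glue_form T1 T2 k1 invmx1 mul1mx mulmx1 mulmx0 addr0.
Qed.

End Gluing.

(** * Geometries inducing a given structure *)

Section Comparison.
Context {R : realType} {m : nat} {N : manifold R m.+1}.
Local Notation vec := 'rV[R]_m.+1.

Lemma Pr_section (Z : N -> vec) t X : Sforms Z t -> smooth_field setT Z -> smooth_field setT X ->
  An_section t (fun y => Pr Z t y (X y)).
Proof.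
move=> tS ZC XC; split=> [|x]; last exact: form_Pr.
have tC : smooth_fun setT (fun y => t y (X y) : R^o).
  exact: (form_field openT (one_form_on tS.1) XC).
exact: (smooth_field_subr openT XC (smooth_field_scale openT tC ZC)).
Qed.

(* The transformation rules determine [nabla] and [D] from their values at a single one-form. *)
Lemma compatible_determined (C : cartan_geometry N) (s s' : lightlike_data N) t0 :
  lightlike_structure s -> lightlike_structure s' ->
  tractor_metric C (ls_h s) -> tractor_radical C (ls_Z s) ->
  ls_h s = ls_h s' -> ls_Z s = ls_Z s' -> Sforms (ls_Z s) t0 ->
  (forall W X, smooth_field setT W -> An_section t0 X -> ls_nabla s t0 W X = ls_nabla s' t0 W X) ->
  (forall x v, ls_D s t0 x v = ls_D s' t0 x v) -> lightlike_eq s s'.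
Proof.
case: s s' => h Z nb D [h' Z' nb' D'] /= [hL [_ [_ cs]]] [_ [_ [_ cs']]] hE ZE hh ZZ t0S nE DE.
rewrite /= in hL cs cs'; subst h' Z'; split=> // t tS.
have [_ _ ZC _] := hL; have [csn csD] := cs t0 t t0S tS; have [csn' csD'] := cs' t0 t t0S tS.
have nE' W X : smooth_field setT W -> An_section t X -> nb t W X = nb' t W X.
  move=> WC XA; have YA := Pr_section t0S ZC XA.1.
  (* [P^t] and [P^{t0}] are inverse isomorphisms between [An(t0)] and [An(t)], so every section of
     [An(t)] is of the form to which the transformation rule applies. *)
  have XE : X = fun y => Pr Z t y (Pr Z t0 y (X y)).
    apply/funext => y; rewrite /Pr (formB tS) (formZ tS) (form_rad tS) XA.2.
    by rewrite sub0r mulr1 scaleNr opprK subrK.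
  apply/funext => x; have := csn _ W YA WC x; rewrite -XE => ->.
  by have := csn' _ W YA WC x; rewrite -XE nE// => ->.
split=> //; apply/funext => x; apply/funext => v.
have [W WC <-] := field_through x v; apply: (etrans (csD W WC x)); apply: (etrans _ (esym (csD' W WC x))).
have nL : nb t W (Lfield h t0 t) x = nb' t W (Lfield h t0 t) x.
  by rewrite (nE' W _ WC (Lfield_section hE ZE t0S tS)).
have DL : D t0 x (W x) = D' t0 x (W x) := DE x (W x).
exact: (congr2 (fun a b => Pr Z t x (a + _) - _ - b) DL nL).
Qed.

End Comparison.

(** * Sections whose pulled back connection form is an adapted form *)

Section AdaptedSections.
Context {R : realType} {m : nat} {N : manifold R m.+1}.
Local Notation vec := 'rV[R]_m.+1.
Local Notation l0 := (@ell R m).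
Local Notation L := 'cV[R]_(1 + (m + 1)).
Variables (s : lightlike_data N) (t : N -> vec -> R) (C : cartan_geometry N).
Hypotheses (sS : lightlike_structure s) (tS : Sforms (ls_Z s) t).
Local Notation h := (ls_h s).
Local Notation Z := (ls_Z s).
Variables (U : set N) (sg : N -> cg_tot C) (E : 'I_m -> N -> vec).
Hypotheses (sgL : local_section U sg) (EA : forall i, An_section t (E i)).
Hypothesis Eo : forall x, U x -> An_orthonormal h t x (fun i => E i x).
Hypothesis thE : forall x w, U x -> theta sg x w = adapted_form s t E x w.

Let hL : lightlike h Z := sS.1.
Let hT : sym_tensor h := lightlike_tensor hL.
Let oU : open U. Proof. by have [] := sgL. Qed.

Lemma adapted_Phih x v : U x -> Phih (sg x) v = lvec (t x v) (frame_mid s E x v) 0.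
Proof. by move=> Ux; rewrite (Phih_section _ sgL Ux) thE// adapted_form_ell. Qed.

Lemma adapted_metric x v w : U x -> lprod (Phih (sg x) v) (Phih (sg x) w) = h x v w.
Proof.
move=> Ux; rewrite !adapted_Phih// lprod_lvec mulr0 mul0r add0r addr0.
exact: (frame_dot sS tS _ _ (Eo Ux)).
Qed.

Lemma adapted_radical x : U x -> Phih (sg x) (Z x) = l0.
Proof.
move=> Ux; rewrite adapted_Phih// (form_rad tS) ellE; congr lvec.
by apply/colP => i; rewrite !mxE (lightlike_radl hL).
Qed.

Lemma adapted_eta x : U x -> tractor_radical C Z -> eta t (sg x) = enn.
Proof.
move=> Ux ZE; have [_ _ pE] := sgL; apply: esym; apply: eta_unique.
- by rewrite ennE lprod_lvec dot0l !mulr0 !mul0r !addr0.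
- by rewrite ennE lbot_lvec.
- by move=> v; rewrite lprod_enn adapted_Phih// ltop_lvec pE.
Qed.

(** Along the section [eta t] is the constant [enn], so its covariant derivative is the last column
    of the adapted form; the sign of the [z] block there makes its middle part the components of
    [D(W)]. *)
Lemma adapted_D W x : U x -> tractor_radical C Z ->
  An_part Z t (sg x) (nablaT W (eta t) (sg x)) = ls_D s t x (W x).
Proof.
move=> Ux ZE; have [_ _ pE] := sgL; have eT := tractor_eta ZE tS.
have [Dl Dt _] := sS.2.2.1 t tS.
rewrite (nablaTE W sgL Ux eT) /nabla_along.
have -> : dfun (eta t \o sg) x (W x) = 0.
  rewrite (eq_dfun (g := fun=> enn) (W x) oU _ (tractor_along eT sgL) Ux); first exact: dfun_cst.
  by move=> y Uy; exact: adapted_eta.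
rewrite add0r adapted_eta// thE//.
apply/esym; apply: (An_part_unique ZE tS (a := 0) (b := - t x (W x))); first by rewrite pE.
rewrite adapted_eta// scale0r add0r adapted_Phih// Dt ennE gmx_lvec lvecZ lvecD.
rewrite mulmx0 dot0r !mulr0 !scale0r !mulr1 scale1r.
have tN (y : 'cV[R]_m) : (- y^T)^T = - y by rewrite linearN /= trmxK.
rewrite tN opprK; congr lvec; first by rewrite mxE.
  by rewrite mulmx0 add0r add0r scaler0 addr0.
by rewrite oppr0.
Qed.

(** The middle part is the derivative of the components [h(V, E i)] plus the [nabla] block applied
    to them. Metric compatibility turns the derivative into [h(nabla V, E i) + h(V, nabla E i)], and
    skewness of the block cancels the second term. *)
Lemma adapted_nabla W V x : U x -> tractor_radical C Z -> smooth_field setT W -> An_section t V ->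
  An_part Z t (sg x) (nablaT W (fun u => Phih u (V (cg_proj C u))) (sg x)) = ls_nabla s t W V x.
Proof.
move=> Ux ZE WC VA; have [_ _ pE] := sgL; have fT := @tractor_Phi _ _ _ C _ VA.1.
rewrite (nablaTE W sgL Ux fT) /nabla_along.
have fE y : U y -> Phih (sg y) (V (cg_proj C (sg y))) = lvec 0 (frame_mid s E y (V y)) 0.
  by move=> Uy; rewrite pE// adapted_Phih// VA.2.
have mC : smooth_fun U (fun y => frame_mid s E y (V y)).
  exact: (smooth_frame_mid sS oU EA (smooth_field_sub (@subsetT _ U) VA.1)).
rewrite (eq_dfun (g := fun y => lvec 0 (frame_mid s E y (V y)) 0) (W x) oU fE (tractor_along fT sgL) Ux).
rewrite (dfun_linear_post (W x) lvec_mid_linear oU mC Ux) fE// thE// gmx_lvec lvecD.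
rewrite -(nabla_atE sS tS x VA WC).
have nt : t x (nabla_at s t V x (W x)) = 0 by exact: (nabla_at_form sS tS).
set e := lvec _ _ _; have Em : lmid e = frame_mid s E x (nabla_at s t V x (W x)).
  rewrite /e lmid_lvec scale0r add0r scale0r subr0; apply/colP => i; rewrite mxE.
  rewrite (dfun_entry (W x) i 0 oU mC Ux).
  rewrite (eq_dfun (g := fun y => h y (V y) (E i y) : R^o) (W x) oU _ (smooth_fun_entry i 0 oU mC) Ux); last first.
    by move=> y Uy; rewrite mxE.
  rewrite (nabla_at_metric sS tS x (W x) VA (EA i)) [RHS]mxE -addrA -[RHS]addr0; congr (_ + _).
  rewrite -(frame_dot sS tS _ _ (Eo Ux)) dotE [X in _ + X]mxE -big_split big1// => j _ /=.
  rewrite !mxE (nabla_frame_skew sS tS oU EA Eo (W x) i j Ux).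
  by ring.
apply/esym; apply: (An_part_unique ZE tS (a := ltop e) (b := lbot e)); first by rewrite pE.
rewrite adapted_eta// adapted_Phih// nt -Em {1}[e]lvecK ellE ennE !lvecZ !lvecD.
by rewrite !mulr0 !mulr1 !scaler0 !addr0 !add0r.
Qed.

End AdaptedSections.

Section Realization.
Context {R : realType} {m : nat} {N : manifold R m.+1}.

Theorem structure_induced (s : lightlike_data N) : lightlike_structure s ->
  exists C : cartan_geometry N, induces C s.
Proof.
move=> sS; have hL := sS.1; have [_ _ ZC Zr] := hL.
have [t tS] := Sforms_nonempty ZC (fun x => (Zr x).1).
have FE c : exists UE : set N * ('I_m -> N -> 'rV[R]_m.+1),
    [/\ open UE.1, UE.1 c, forall i, An_section t (UE.2 i) &
        forall x, UE.1 x -> An_orthonormal (ls_h s) t x (fun i => UE.2 i x)].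
  by have [U [E H]] := orthonormal_frame hL tS c; exists (U, E).
have [F FP] := choice FE.
pose U c : set N := (F c).1 `&` dom N c; pose E c := (F c).2.
have oU c : open (U c) by apply: openI; [have [? ? _ _] := FP c|exact: dom_open].
have Uc c : U c c by split; [have [? ? _ _] := FP c|exact: dom_self].
have Ud c : U c `<=` dom N c by move=> x [].
have EA c i : An_section t (E c i) by have [_ _ EE _] := FP c; exact: EE.
have Eo c x : U c x -> An_orthonormal (ls_h s) t x (fun i => E c i x).
  by move=> [Ux _]; have [_ _ _] := FP c; apply.
have [C [sg sgP]] : exists (C : cartan_geometry N) (sg : N -> N -> cg_tot C), forall c,
    local_section (U c) (sg c) /\
    forall x w, U c x -> theta (sg c) x w = adapted_form s t (E c) x w.
  apply: (@cartan_gluing _ _ _ U (fun c d => frame_change s (E c) (E d))) => //.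
  - by move=> c d; exact: (frame_change_smooth sS (EA c) (EA d)).
  - by move=> c d x Ux Ux'; exact: (frame_change_Hgroup sS tS (Eo c x Ux) (Eo d x Ux')).
  - by move=> c d e x _ Ux _; exact: (frame_changeM sS tS (E c) (E e) (Eo d x Ux)).
  - by move=> c x Ux; exact: (frame_change1 (Eo c x Ux)).
  - move=> c; have [l lC] := adapted_form_form sS tS (EA c); split=> [x|d w]; first exact: l.
    by have := lC d w; rewrite setTI.
  - by move=> c x w Ux; exact: (adapted_form_galg sS tS (oU c) (EA c) (Eo c) w Ux).
  - by move=> c x w Ux; exact: (adapted_form_inj sS tS (Eo c) Ux).
  - by move=> c x e Ux; exact: (adapted_form_surj sS tS (Eo c) Ux).
  - move=> c d x w Ux Ux'.
    exact: (adapted_form_change sS tS (oU c) (EA c) (Eo c) w (EA d) (Eo d) Ux Ux').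
have sE c x : U c x -> cg_proj C (sg c x) = x by have [[_ _ +] _] := sgP c; apply.
have hE : tractor_metric C (ls_h s).
  move=> u v w; set x := cg_proj C u; have Ux := Uc x.
  have [g Hg ->] := fibre_ex (sE x x Ux : _ = cg_proj C u).
  have [ls th] := sgP x; have Hg' := HgroupV Hg.
  by rewrite !Phih_act// Hgroup_preserves// (adapted_metric sS tS ls (Eo x) th).
have ZE : tractor_radical C (ls_Z s).
  move=> u; set x := cg_proj C u; have Ux := Uc x.
  have [g Hg ->] := fibre_ex (sE x x Ux : _ = cg_proj C u).
  have [ls th] := sgP x; have /HgroupP[_ g0] := HgroupV Hg.
  by rewrite Phih_act// (adapted_radical sS tS ls th).
(* The glued geometry induces some structure [s']; it remains to compare [s'] with [s], and
   agreement at the single form [t] used for gluing suffices by [compatible_determined]. *)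
have [s' [sS' iC]] : exists s', lightlike_structure s' /\ induces C s'.
  by exists (tractor_data C); split; [exact: tractor_data_structure|exact: tractor_data_induced].
exists C; apply: (lightlike_eq_induces _ iC); have /inducesP[hE' ZE' cE'] := iC.
have hh : ls_h s' = ls_h s.
  apply/funext => x; apply/funext => v; apply/funext => w.
  by rewrite -[x](pointK C) hE' hE.
have ZZ : ls_Z s' = ls_Z s.
  apply/funext => x; have := ZE' (point C x); rewrite -(ZE (point C x)) pointK.
  exact: Phih_inj.
rewrite ZZ in cE'.
apply: (compatible_determined (t0 := t) sS' sS hE' ZE' hh ZZ); first by rewrite ZZ.
- move=> W X WC XA; apply/funext => x; have Ux := Uc x; have [ls th] := sgP x.
  have [nE _] := cE' t tS W WC.
  apply: etrans (adapted_nabla sS tS ls (EA x) (Eo x) th Ux ZE WC XA).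
  exact: (etrans (congr1 (ls_nabla s' t W X) (esym (sE x x Ux))) (nE X XA (sg x x))).
- move=> x v; have [W WC <-] := field_through x v; have Ux := Uc x; have [ls th] := sgP x.
  have [_ DE] := cE' t tS W WC; apply: etrans (adapted_D sS tS ls th W Ux ZE).
  exact: (etrans (congr1 (fun y => ls_D s' t y (W y)) (esym (sE x x Ux))) (DE (sg x x))).
Qed.

End Realization.

(** [induces] is a relation, so bijectivity on classes takes the form of three clauses: every
    geometry induces a structure, two geometries are isomorphic exactly when their structures agree,
    and every structure is reached. *)
Theorem theorem6p17 (R : realType) (m : nat) (m_ge2 : (2 <= m)%N)
    (N : manifold R m.+1) (N_connected : connected [set: N]) :
  [/\ forall C : cartan_geometry N,
        exists s : lightlike_data N, lightlike_structure s /\ induces C s,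
      forall (C C' : cartan_geometry N) (s s' : lightlike_data N),
        lightlike_structure s -> lightlike_structure s' ->
        induces C s -> induces C' s' ->
        (cartan_iso C C' <-> lightlike_eq s s') &
      forall s : lightlike_data N, lightlike_structure s ->
        exists C : cartan_geometry N, induces C s].
Proof.
split=> [C|C C' s s' sS _ Cs Cs'|s].
- by exists (tractor_data C); split; [exact: tractor_data_structure|exact: tractor_data_induced].
- split=> [iso|ss']; first exact: (induced_unique Cs (iso_induces iso Cs')).
  exact: (induced_iso Cs (lightlike_eq_induces (lightlike_eq_sym ss') Cs')).
- exact: structure_induced.
Qed.
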